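(* Let $n\in\mathbb{Z}_{\ge0}$, let $u$ be a solution of $\triangle u+e^u=4\pi(2n+1)\,\delta_0$ on $E=\mathbb{C}/\Lambda$, and let $f$ be a normalized type I developing map of $u$. Let $\Lambda'=\mathbb{Z}\omega_1'+\mathbb{Z}\omega_2'$ with $\omega_1'=\omega_1$, $\omega_2'=2\omega_2$, $\omega_3'=-\omega_1'-\omega_2'$, and let $e_i=\wp(\tfrac12\omega_i';\Lambda')$ for $i=1,2,3$. (1) The solution $u$ is even and the developing map $f$ is even: $u(-z)=u(z)$ for all $z\in E$ and $f(-z)=f(z)$ for all $z\in\mathbb{C}$. (2) There exist $p_1,\dots,p_n\in\mathbb{C}$ such that: $2p_i\notin\Lambda'$ for $i=1,\dots,n$; $p_i\pm p_j\notin\Lambda'$ for all $i\ne j$, $1\le i,j\le n$; $f$ has simple zeros at $\tfrac12\omega_1$ and at $\pm p_i$ for $i=1,\dots,n$; $f$ has simple poles at $\tfrac12\omega_1+\omega_2$ and at $\pm p_i+\omega_2$ for $i=1,\dots,n$; and every zero or pole of $f$ is congruent modulo $\Lambda'$ to one of the zeros or poles just listed. The unordered set $\{p_i \bmod \Lambda'\}\subset E'=\mathbb{C}/\Lambda'$ is uniquely determined by the normalized developing map $f$. (3) Let $q_i=p_i+\omega_2$, $z_i=\wp(p_i;\Lambda')-e_2$ and $\tilde z_i=\wp(q_i;\Lambda')-e_2$ for $i=1,\dots,n$. There exist constants $\mu$ and $C_1,\dots,C_n$, which depend only on $e_1,e_3,g_2(\Lambda'),g_3(\Lambda')$, such that $$\sum_{i=1}^n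 z_i^j-\sum_{i=1}^n\tilde z_i^{\,j}=C_j\quad\text{and}\quad z_j\tilde z_j=\mu\qquad\text{for all } j=1,\dots,n.$$ (4) Conversely, let $\mu,C_1,\dots,C_n$ be the constants in (3), and suppose that $(z_1,\dots,z_n;\tilde z_1,\dots,\tilde z_n)\in\mathbb{C}^{2n}$ is a solution of the system of polynomial equations in (3). Then there exist an even type I developing map $f$ (of a solution of $\triangle u+e^u=4\pi(2n+1)\delta_0$ on $E$) and $p_1,\dots,p_n\in\mathbb{C}$ such that: $f$ has simple zeros at $\tfrac12\omega_1$ and $\pm p_i$ for $i=1,\dots,n$; $f$ has simple poles at $\tfrac12\omega_1+\omega_2$ and $\pm p_i+\omega_2$ for $i=1,\dots,n$; and $z_i=\wp(p_i;\Lambda')-e_2$, $\tilde z_i=\wp(p_i+\omega_2;\Lambda')-e_2$ for $i=1,\dots,n$.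
   Context: $\Lambda=\mathbb{Z}\omega_1+\mathbb{Z}\omega_2\subset\mathbb{C}$ is a lattice with $\mathrm{Im}(\omega_2/\omega_1)>0$; $\wp(z;\Lambda')$ is the Weierstrass function of $\Lambda'$, and $\wp'^2=4\wp^3-g_2(\Lambda')\wp-g_3(\Lambda')$. $\triangle=\partial_x^2+\partial_y^2$ and $\delta_0$ is the Dirac measure at $0\in E$; the equation $\triangle u+e^u=\rho\delta_0$ means $\int_E(u\,\triangle h+e^u h)\,dx\,dy=\rho\,h(0)$ for all $h\in C^\infty(E)$, where $u$ is real-valued. A developing map of a solution $u$ is a meromorphic function $f$ on $\mathbb{C}$ such that $u(z)=\log\frac{8|f'(z)|^2}{(1+|f(z)|^2)^2}$ on $\mathbb{C}\smallsetminus\Lambda$. For every $\omega\in\Lambda$ there is a unique $T_\omega\in\mathrm{PSU}(2)$ with $f(z+\omega)=T_\omega f(z)$ (linear fractional action); $f$ is of type I if the group $\{T_\omega:\omega\in\Lambda\}$ is isomorphic to $(\mathbb{Z}/2\mathbb{Z})^2$. It is a normalized type I developing map if $f(z+\omega_1)=-f(z)$ and $f(z+\omega_2)=1/f(z)$ for all $z\in\mathbb{C}$.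
   Formalization: Parts (2) and (3) are stated for f if f has a zero at ω1/2 and for 1/f if f has a pole there (1/f is also a normalized developing map of u, so (2) fails for one of the two); {p_i mod Λ'} is unique only up to replacing p_i by -p_i. *)

(* Defs.v *)
(* The complex numbers are [R[i]], for an arbitrary [R : realType]. *)
From mathcomp Require Import all_boot all_order all_algebra all_fingroup.
From mathcomp Require Import all_classical all_reals all_analysis.
From mathcomp Require Import complex.
From mathcomp.analysis.showcase Require summability.

Set Implicit Arguments.
Unset Strict Implicit.
Unset Printing Implicit Defensive.

Import Order.TTheory GRing.Theory Num.Theory.
Import numFieldNormedType.Exports.

Local Open Scope classical_set_scope.
Local Open Scope ring_scope.
Local Open Scope complex_scope.

Section Lattices.
Variable R : realType.
Local Notation C := R[i].

Definition lattice (w1 w2 : C) : set C :=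
  [set z | exists m n : int, z = m%:~R * w1 + n%:~R * w2].

(* [summability.sum] is the limit of the finite partial sums along the
   directed set of all finite sets of indices, i.e. the unconditional sum. *)
Definition lattice_sum (L : set C) (F : C -> C) : C :=
  summability.sum (fun w : C => (if w \in L `\ 0 then F w else 0) : C^o).

(* The value of [wp L] on [L], where the Weierstrass function has its poles,
   is meaningless. *)
Definition wp (L : set C) (z : C) : C :=
  z ^- 2 + lattice_sum L (fun w => (z - w) ^- 2 - w ^- 2).

(* The invariants in the equation wp'^2 = 4 wp^3 - g2 wp - g3. *)
Definition g2 (L : set C) : C := 60 * lattice_sum L (fun w => w ^- 4).
Definition g3 (L : set C) : C := 140 * lattice_sum L (fun w => w ^- 6).

End Lattices.

Section Plane.
Variable R : realType.
Local Notation C := R[i].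

Definition cplx (p : R * R) : C := p.1 +i* p.2.

Definition dx (h : R * R -> R) (p : R * R) : R := 'D_(1, 0) h p.
Definition dy (h : R * R -> R) (p : R * R) : R := 'D_(0, 1) h p.

Fixpoint class_C (k : nat) (h : R * R -> R) : Prop :=
  continuous h /\
  if k is k'.+1 then
    [/\ forall p, derivable h p (1, 0), forall p, derivable h p (0, 1),
        class_C k' (dx h) & class_C k' (dy h)]
  else True.

Definition smooth (h : R * R -> R) : Prop := forall k, class_C k h.

Definition laplacian (h : R * R -> R) (p : R * R) : R :=
  dx (dx h) p + dy (dy h) p.

Definition lebesgue2 := (@lebesgue_measure R \x @lebesgue_measure R)%E.

Definition fundamental_parallelogram (w1 w2 : C) : set (R * R) :=
  [set p | exists s t : R,
     [/\ 0 <= s < 1, 0 <= t < 1 & cplx p = s%:C * w1 + t%:C * w2]].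

(* Functions on E = C/L, where L = [lattice w1 w2], are L-periodic functions
   on C; the integral over E is the Lebesgue integral over a fundamental
   parallelogram. *)
Definition periodic (T : Type) (L : set C) (F : C -> T) : Prop :=
  forall z w, L w -> F (z + w) = F z.

(* Real solutions of (laplacian u) + exp u = rho * delta_0 on C/L.  The
   integrability of u and exp u is what gives a meaning to the integrals
   against all test functions.  The value of u at the points of L is
   irrelevant. *)
Definition solution (w1 w2 : C) (rho : R) (u : C -> R) : Prop :=
  let P := fundamental_parallelogram w1 w2 in
  [/\ periodic (lattice w1 w2) u,
      lebesgue2.-integrable P (fun p => (u (cplx p))%:E),
      lebesgue2.-integrable P (fun p => (expR (u (cplx p)))%:E) &
      forall h : C -> R, periodic (lattice w1 w2) h -> smooth (h \o cplx) ->
        (\int[lebesgue2]_(p in P)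
           (u (cplx p) * laplacian (h \o cplx) p
            + expR (u (cplx p)) * h (cplx p))%:E)%E = (rho * h 0)%:E].

End Plane.

Section Developing.
Variable R : realType.
Local Notation C := R[i].
Local Notation normc := ComplexField.Normc.normc.

(* The Riemann sphere, [None] being the point at infinity. *)
Definition sphere : Type := option C.
Implicit Types (f : C -> sphere) (s : sphere).

Definition sph_opp s : sphere := omap (fun w => - w) s.

Definition sph_inv s : sphere :=
  if s is Some w then (if w == 0 then None else Some w^-1) else Some 0.

Definition mobius (A : 'M[C]_2) (s : sphere) : sphere :=
  if s is Some w then
    if A 1 0 * w + A 1 1 == 0 then None
    else Some ((A 0 0 * w + A 0 1) / (A 1 0 * w + A 1 1))
  else if A 1 0 == 0 then None else Some (A 0 0 / A 1 0).

Definition SU2 : set 'M[C]_2 :=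
  [set A | A *m (map_mx Num.conj A)^T = 1%:M /\ \det A = 1].

(* PSU(2) acts faithfully on the sphere: its elements are identified with the
   corresponding linear fractional transformations. *)
Definition PSU2 : set (sphere -> sphere) := mobius @` SU2.

Definition fin f : C^o -> C^o := fun z => odflt 0 (f z).

Definition holomorphic_at f (z : C) : Prop :=
  \forall w \near (z : C^o), f w <> None /\ derivable (fin f) w 1.

(* Holomorphic maps to the sphere, the constant infinity being excluded. *)
Definition meromorphic f : Prop :=
  (forall z, holomorphic_at f z \/ holomorphic_at (sph_inv \o f) z) /\
  (exists z, f z <> None).

Definition simple_zero f (a : C) : Prop :=
  [/\ holomorphic_at f a, f a = Some 0 & (fin f)^`()%classic a != 0].

Definition simple_pole f (a : C) : Prop := simple_zero (sph_inv \o f) a.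

(* 8|f'|^2 / (1 + |f|^2)^2, which is invariant under f |-> 1/f and is therefore
   extended to the poles of f by the same expression for 1/f. *)
Definition density f (z : C) : R :=
  if f z is Some w then
    8 * normc ((fin f)^`()%classic z) ^+ 2 / (1 + normc w ^+ 2) ^+ 2
  else 8 * normc ((fin (sph_inv \o f))^`()%classic z) ^+ 2.

(* The positivity of the density is implicit in u being its logarithm ([ln] is
   a total function). *)
Definition developing_map (L : set C) (u : C -> R) f : Prop :=
  meromorphic f /\
  forall z, ~ L z -> 0 < density f z /\ u z = ln (density f z).

Definition monodromy (L : set C) f : set (sphere -> sphere) :=
  [set T | PSU2 T /\ exists2 w, L w & forall z, f (z + w) = T (f z)].

(* [phi] is an isomorphism from (Z/2)^2 onto the monodromy group. *)
Definition type_I (L : set C) f : Prop :=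
  exists phi : 'Z_2 * 'Z_2 -> (sphere -> sphere),
    [/\ injective phi, range phi = monodromy L f &
        forall a b, phi (a + b) = phi a \o phi b].

Definition normalized (w1 w2 : C) f : Prop :=
  (forall z, f (z + w1) = sph_opp (f z)) /\
  (forall z, f (z + w2) = sph_inv (f z)).

Definition even_map (T : Type) (F : C -> T) : Prop := forall z, F (- z) = F z.

(* If f is a normalized developing map of u then so is 1/f, and exactly one of
   the two has a zero at w1/2 (the other one has a pole there).  This is the
   one with the zero. *)
Definition zero_at_half_period (w1 : C) f : C -> sphere :=
  if f (w1 / 2) is None then sph_inv \o f else f.

Definition simple_zeros_poles (n : nat) (w1 w2 : C) f (p : 'I_n -> C) : Prop :=
  [/\ simple_zero f (w1 / 2),
      forall i, simple_zero f (p i) /\ simple_zero f (- p i),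
      simple_pole f (w1 / 2 + w2) &
      forall i, simple_pole f (p i + w2) /\ simple_pole f (- p i + w2)].

Definition listed (n : nat) (w1 w2 : C) (p : 'I_n -> C) : set C :=
  [set a | a = w1 / 2 \/ a = w1 / 2 + w2 \/
     exists i, a = p i \/ a = - p i \/ a = p i + w2 \/ a = - p i + w2].

Definition divisor_data (n : nat) (w1 w2 : C) f (p : 'I_n -> C) : Prop :=
  let L' := lattice w1 (2 * w2) in
  [/\ forall i, ~ L' (2 * p i),
      forall i j, i != j -> ~ L' (p i + p j) /\ ~ L' (p i - p j),
      simple_zeros_poles w1 w2 f p &
      forall z, f z = Some 0 \/ f z = None ->
        exists2 a, listed w1 w2 p a & L' (z - a)].

Definition polynomial_system (n : nat) (mu : C) (c z zt : 'I_n -> C) : Prop :=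
  forall j : 'I_n,
    \sum_(i < n) z i ^+ j.+1 - \sum_(i < n) zt i ^+ j.+1 = c j /\
    z j * zt j = mu.

End Developing.

(* Main.v *)
(* Put X = wp(.; L') - e2; then X(z) X(z + w2) = X(w1/2) X(w1/2 + w2).
   Integrating the equation against 1 shows that f' vanishes to order 2n + 1 at 0.
   Then (f(z) - f(-z))^2 / (f'(z) f'(-z)) is L-periodic, without poles, and zero
   at 0, so f is even; and (f / f') X' X^n is a polynomial D(X) of degree 2n + 2
   whose simple roots x are the values of X at the zeros and poles of f.  There
   x^n / D'(x) is 1 or -1, or half of this at the half periods; by Lagrange
   interpolation the correspondingly weighted power sums of order <= n vanish.
   Conversely they force f = lam S prod (X - z_i) / (X - zt_i), where
   S^2 = const (X - X(w1/2)) / (X - X(w1/2 + w2)), to satisfy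
   f'/f = const X' X^n / D(X); and the logarithm of its density solves the
   equation by Green's formula, after subtraction of a cut-off logarithm. *)
Require Import Defs.
From mathcomp Require Import all_boot all_order all_algebra all_fingroup all_classical all_reals all_analysis complex ring lra zify finmap measurable_realfun.
From mathcomp.analysis.showcase Require summability.
Set Implicit Arguments.
Unset Strict Implicit.
Unset Printing Implicit Defensive.
Import Order.TTheory GRing.Theory Num.Theory.
Import numFieldNormedType.Exports.
Local Open Scope classical_set_scope.
Local Open Scope ring_scope.
Local Open Scope complex_scope.

(** Zeros and poles of elliptic functions are never counted. Each global fact (the differential
    equation of wp, X being two-to-one, evenness of f) comes from an elliptic expression whose local
    orders are all nonnegative, to which Liouville's theorem applies. Local orders are thus the
    basic notion; as division and poles carry default values, they are defined on punctured
    neighbourhoods, and point values are recovered by continuity. X - X(w1/2) and X - X(w1/2 + w2)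
    have double zeros: hence the half weights, and the square root S in the formula for f. S is not
    elliptic for L'; it is built from the Weierstrass function of the sublattice generated by 2 w1
    and 2 w2, in a coordinate where translation by w1 becomes S -> -S. The scale lam is then fixed
    by f(z + w2) = 1/f(z). The Dirac mass is computed only once, for a regularized periodic
    logarithm whose Laplacian splits into a bounded part and an approximate identity of mass 4 pi.
    Its integrability also comes from the equation, tested on an explicit bump. *)

Section Plane.
Variable R : realType.
Local Notation C := R[i].
Local Notation nm := (@ComplexField.Normc.normc R).
Local Notation Re := (@complex.Re R).
Local Notation Im := (@complex.Im R).
Local Notation RR := (measurableTypeR R * measurableTypeR R)%type.
Local Notation mu2 := (@lebesgue2 R).
Local Notation leb := (@lebesgue_measure R).
Local Notation meas2 := (measurable_fun [set: RR]).
Implicit Types (H K : C -> C).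

Lemma half_pos (e : R) : 0 < e -> 0 < e / 2. Proof. by move=> e0; rewrite divr_gt0. Qed.

(** * The topology of C in terms of real radii *)

Section ComplexTopology.
Implicit Types (x y z w : C) (r : R).

Lemma nmE z : `|z| = (nm z)%:C. Proof. by []. Qed.
Lemma nm_ge0 z : 0 <= nm z. Proof. by case: z => a b; rewrite sqrtr_ge0. Qed.
Lemma nm0 : nm 0 = 0. Proof. exact: ComplexField.Normc.normc0. Qed.
Lemma nm1 : nm 1 = 1. Proof. exact: ComplexField.Normc.normc1. Qed.
Lemma nmM x y : nm (x * y) = nm x * nm y. Proof. exact: ComplexField.Normc.normcM. Qed.
Lemma nmV x : nm x^-1 = (nm x)^-1. Proof. exact: ComplexField.Normc.normcV. Qed.
Lemma nmN x : nm (- x) = nm x. Proof. exact: normcN. Qed.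
Lemma nmB x y : nm (x - y) = nm (y - x). Proof. by rewrite -nmN opprB. Qed.
Lemma nm_leD x y : nm (x + y) <= nm x + nm y. Proof. exact: le_normcD. Qed.
Lemma nm_distD y x z : nm (x - z) <= nm (x - y) + nm (y - z).
Proof. by have := nm_leD (x - y) (y - z); rewrite addrA subrK. Qed.
Lemma nm_dist x y : `|nm x - nm y| <= nm (x - y).
Proof.
have := nm_leD (x - y) y; have := nm_leD (y - x) x.
rewrite !subrK (nmB y) => h1 h2; rewrite ler_norml; lra.
Qed.
Lemma nm_eq0 x : (nm x == 0) = (x == 0).
Proof.
by apply/eqP/eqP => [/ComplexField.Normc.eq0_normc//|->]; rewrite nm0.
Qed.
Lemma nm_gt0 x : (0 < nm x) = (x != 0).
Proof. by rewrite lt_neqAle nm_ge0 andbT eq_sym nm_eq0. Qed.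
Lemma nmX x n : nm (x ^+ n) = nm x ^+ n.
Proof. by elim: n => [|n ih]; rewrite ?nm1// !exprS nmM ih. Qed.
Lemma nm_real r : nm r%:C = `|r|.
Proof. by rewrite /= expr0n/= addr0 sqrtr_sqr. Qed.
Lemma nm_sqr z : nm z ^+ 2 = complex.Re z ^+ 2 + complex.Im z ^+ 2.
Proof. by case: z => a b /=; rewrite sqr_sqrtr// addr_ge0 ?sqr_ge0. Qed.
Lemma Re_le_nm z : `|complex.Re z| <= nm z.
Proof.
by case: z => a b; rewrite -sqrtr_sqr ler_wsqrtr//= lerDl sqr_ge0.
Qed.
Lemma Im_le_nm z : `|complex.Im z| <= nm z.
Proof.
by case: z => a b; rewrite -sqrtr_sqr ler_wsqrtr//= lerDr sqr_ge0.
Qed.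
Lemma nm_le_ReIm z : nm z <= `|complex.Re z| + `|complex.Im z|.
Proof.
rewrite -(@ler_pXn2r _ 2)// ?nnegrE ?nm_ge0 ?addr_ge0//.
rewrite nm_sqr sqrrD !real_normK ?num_real// lerD2r lerDl.
by rewrite mulrn_wge0.
Qed.

(** Balls of [C^o] have complex radii; a positive complex number has zero imaginary part, so its
    real part serves as radius. *)
Lemma nbhs_nmP z (P : set C) :
 nbhs (z : C^o) P <-> exists2 r, 0 < r & forall w, nm (w - z) < r -> P w.
Proof.
split.
 move=> /nbhs_ballP[e /= e0 eP]. have [er eI] : 0 < complex.Re e /\ complex.Im e = 0.
  by move: e0; case: (e) => a b; rewrite ltcE/= => /andP[/eqP -> ->].
 exists (complex.Re e) => // w wz; apply: eP; rewrite /ball/= distrC nmE. move: eI wz; case: (e) => a b /= -> wz.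
 by rewrite ltcE/= eqxx.
case=> r r0 rP; apply/nbhs_ballP; exists r%:C => /=; first by rewrite ltcR.
by move=> w; rewrite /ball/= distrC nmE ltcR => /rP.
Qed.

Definition nearc z (P : C -> Prop) := exists2 r : R, 0 < r & forall w, nm (w - z) < r -> P w.

Lemma nearcP z (P : C -> Prop) : (\forall w \near (z : C^o), P w) <-> nearc z P.
Proof. exact: nbhs_nmP. Qed.
Lemma nearcT z (P : C -> Prop) : (forall w, P w) -> nearc z P.
Proof. by move=> h; exists 1. Qed.
Lemma nearc_at z (P : C -> Prop) : nearc z P -> P z.
Proof. by case=> r r0; apply; rewrite subrr nm0. Qed.
Lemma nearcS z (P Q : C -> Prop) : (forall w, P w -> Q w) -> nearc z P -> nearc z Q.
Proof. by move=> h [r r0 H]; exists r => // w /H /h. Qed.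
Lemma nearcS2 z (P Q S : C -> Prop) : (forall w, P w -> Q w -> S w) ->
 nearc z P -> nearc z Q -> nearc z S.
Proof.
move=> h [r r0 H] [t t0 K]; exists (Num.min r t); first by rewrite lt_min r0.
by move=> w; rewrite lt_min => /andP[/H + /K]; exact: h.
Qed.
Lemma nearc_open z (P : C -> Prop) : nearc z P -> nearc z (fun w => nearc w P).
Proof.
case=> r r0 H; exists r => // w wr; exists (r - nm (w - z)); first by rewrite subr_gt0.
move=> v vw; apply: H; have := nm_leD (v - w) (w - z).
by rewrite addrA subrK; lra.
Qed.

Lemma cvg_nmP (T : Type) (F : set_system T) {FF : Filter F}
  (f : T -> C) z :
 (f @ F --> (z : C^o)) <->
 forall e : R, 0 < e -> \forall t \near F, nm (f t - z) < e.
Proof.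
split=> [fz e e0|fz].
 have /fz : nbhs (z : C^o) [set w | nm (w - z) < e] by apply/nbhs_nmP; exists e. by [].
move=> A /nbhs_nmP[r r0 rA].
have := fz _ r0; apply: (@filterS _ F) => t; exact: rA.
Qed.

Definition ccts (H : C -> C) z := forall e : R, 0 < e ->
  exists2 d : R, 0 < d & forall w, nm (w - z) < d -> nm (H w - H z) < e.
End ComplexTopology.

(** * Complex differentiability, and curves of a real variable *)

Section ComplexDerivative.
Implicit Types (x z w d : C) (r t s : R).

(** A division-free derivative: the weak inequality is trivial at w = z, so no punctured
    neighbourhood enters products, compositions and mean value estimates. *)
Definition cdiff H z d := forall e : R, 0 < e -> exists2 del : R, 0 < del &
 forall w, nm (w - z) < del -> nm (H w - H z - d * (w - z)) <= e * nm (w - z).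

Lemma cdiffP H z d : cdiff H z d <-> is_derive (z : C^o) 1 (H : C^o -> C^o) d.
Proof.
have key : cdiff H z d <->
  (h^-1 *: ((H : C^o -> C^o) (h *: (1 : C^o) + z) - H z) @[h --> (0 : C^o)^'] --> (d : C^o)).
 have P := @cvg_nmP _ ((0 : C^o)^') _
   (fun h => h^-1 *: ((H : C^o -> C^o) (h *: (1 : C^o) + z) - H z)) d.
 split=> [h|/P h e e0].
  apply/P => e e0; have e2 := half_pos e0.
  have [del del0 Hd] := h _ e2; apply/(@nbhs_nmP); exists del => //= k. rewrite subr0 => kd k0.
  have := Hd (k + z); rewrite addrK => /(_ kd) hk. rewrite -(ltr_pM2l (x := nm k)) ?nm_gt0// -nmM.
  have -> : k * (k^-1 *: (H (k *: (1 : C^o) + z) - H z) - d) = H (k + z) - H z - d * k.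
   by rewrite /GRing.scale/= mulr1; field.
  by rewrite (le_lt_trans hk)// mulrC ltr_pM2l ?nm_gt0//; lra.
 have /(@nbhs_nmP)[del del0 Hd] := h _ e0; exists del => // w wz.
 have [->|k0] := eqVneq w z; first by rewrite !subrr mulr0 subrr nm0 mulr0. have k1 : w - z != 0 by rewrite subr_eq0.
 have := Hd (w - z); rewrite subr0 => /(_ wz k1)/ltW.
 rewrite -(ler_pM2l (x := nm (w - z))) ?nm_gt0// -nmM mulrC [leRHS]mulrC.
 by rewrite /GRing.scale/= mulr1 subrK mulrBl mulrAC mulVf// mul1r.
split=> [/key h|[h1 h2]]; last by apply/key; rewrite -h2.
by split; [apply/cvg_ex; exists d|apply/cvg_lim].
Qed.

Definition holo H z := nearc z (fun w => exists d, cdiff H w d).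
Definition cderiv H z := (H : C^o -> C^o)^`()%classic z.

Lemma cdiff_cderiv H z d : cdiff H z d -> cderiv H z = d.
Proof. by move=> /cdiffP h; rewrite /cderiv derive1E derive_val. Qed.

Lemma cdiff_derivable H z : (exists d, cdiff H z d) <-> derivable (H : C^o -> C^o) (z : C^o) 1.
Proof.
split=> [[d /cdiffP[]]//|h]; exists ('D_1 (H : C^o -> C^o) (z : C^o)).
by apply/cdiffP; apply: derivableP.
Qed.
Lemma cdiff_ex H z : (exists d, cdiff H z d) -> cdiff H z (cderiv H z).
Proof. by case=> d h; rewrite (cdiff_cderiv h). Qed.

Lemma cdiff_cts H z d : cdiff H z d -> ccts H z.
Proof.
move=> h e e0; have [del del0 Hd] := h _ ltr01.
have k0 : 0 < 1 + nm d by rewrite ltr_wpDr ?nm_ge0.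
exists (Num.min del (e / (1 + nm d))); first by rewrite lt_min del0 divr_gt0.
move=> w; rewrite lt_min ltr_pdivlMr// => /andP[/Hd h1 h2].
have := nm_leD (H w - H z - d * (w - z)) (d * (w - z)).
by rewrite subrK nmM => h3; lra.
Qed.

Lemma cdiff_ext H K z d : nearc z (fun w => H w = K w) -> cdiff H z d -> cdiff K z d.
Proof.
move=> [r r0 HK] h e e0; have [del del0 Hd] := h _ e0.
exists (Num.min del r); first by rewrite lt_min del0.
move=> w; rewrite lt_min => /andP[/Hd h1 /HK <-].
by rewrite -(HK z)// subrr nm0.
Qed.

(* Caratheodory's form of differentiability. *)
Lemma cdiff_slope H z d : cdiff H z d <->
 exists g, [/\ ccts g z, g z = d & forall w, H w = H z + (w - z) * g w].
Proof.
split=> [h|[g [gc gz Hg]] e e0].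
 pose g w := if w == z then d else (H w - H z) / (w - z). exists g; split.
 - move=> e e0; have e2 := half_pos e0.
  have [del del0 Hd] := h _ e2; exists del => // w wz.
  rewrite /g eqxx; case: eqP => [_|/eqP wz']; first by rewrite subrr nm0. have k1 : w - z != 0 by rewrite subr_eq0.
  have := Hd _ wz; rewrite -{1}[w - z in leLHS]mulr1 => hw. rewrite -(ltr_pM2l (x := nm (w - z))) ?nm_gt0// -nmM.
  have -> : (w - z) * ((H w - H z) / (w - z) - d) = H w - H z - d * (w - z) by field.
  have := Hd _ wz; move/le_lt_trans; apply. by rewrite mulrC ltr_pM2l ?nm_gt0//; lra.
 - by rewrite /g eqxx. move=> w; rewrite /g; case: eqP => [->|/eqP wz]; first by rewrite subrr mul0r addr0.
 by rewrite mulrCA divff ?subr_eq0// mulr1 addrC subrK.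
have [del del0 Hd] := gc _ e0; exists del => // w /Hd /ltW.
rewrite gz => h; rewrite Hg.
have -> : H z + (w - z) * g w - H z - d * (w - z) = (g w - d) * (w - z) by ring.
by rewrite nmM ler_wpM2r ?nm_ge0.
Qed.
Lemma ccts_cst c z : ccts (fun=> c) z.
Proof. by move=> e e0; exists 1 => // w _; rewrite subrr nm0. Qed.
Lemma ccts_id z : ccts id z. Proof. by move=> e e0; exists e. Qed.
Lemma ccts_comp H K z : ccts K z -> ccts H (K z) -> ccts (fun w => H (K w)) z.
Proof.
by move=> k h e /h[d d0 hd]; have [r r0 kr] := k _ d0; exists r => // w /kr /hd.
Qed.
Lemma cctsD H K z : ccts H z -> ccts K z -> ccts (fun w => H w + K w) z.
Proof.
move=> h k e e0; have e2 := half_pos e0.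
have [d d0 hd] := h _ e2; have [r r0 kr] := k _ e2.
exists (Num.min d r); first by rewrite lt_min d0.
move=> w; rewrite lt_min => /andP[/hd {}hd /kr {}kr].
have -> : H w + K w - (H z + K z) = (H w - H z) + (K w - K z) by ring.
apply: le_lt_trans (nm_leD _ _) _; lra.
Qed.
Lemma cctsM H K z : ccts H z -> ccts K z -> ccts (fun w => H w * K w) z.
Proof.
move=> h k e e0; pose M := 1 + nm (H z) + nm (K z).
have [H0 K0] : 0 <= nm (H z) /\ 0 <= nm (K z) by rewrite !nm_ge0.
have M0 : 0 < 2 * M by rewrite /M; lra.
have e2 : 0 < Num.min 1 (e / (2 * M)) by rewrite lt_min ltr01 divr_gt0.
have [d d0 hd] := h _ e2; have [r r0 kr] := k _ e2.
exists (Num.min d r); first by rewrite lt_min d0.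
move=> w; rewrite lt_min => /andP[/hd {}hd /kr {}kr].
move: hd kr; rewrite !lt_min !ltr_pdivlMr// => /andP[h1 h2] /andP[k1 k2].
have -> : H w * K w - H z * K z = (H w - H z) * K z + (H w - H z) * (K w - K z) + H z * (K w - K z) by ring.
apply: le_lt_trans (nm_leD _ _) _; rewrite nmM.
have := nm_leD ((H w - H z) * K z) ((H w - H z) * (K w - K z)); rewrite !nmM.
move: H0 K0 h1 h2 k1 k2; rewrite /M; have := nm_ge0 (H w - H z); have := nm_ge0 (K w - K z).
set a := nm (H w - H z); set b := nm (K w - K z); set c := nm (H z); set f := nm (K z).
move=> b0 a0 c0 f0 a1 a2 b1 b2 tri.
have A : a * b <= a by rewrite ler_piMr// ltW.
have fb := mulr_ge0 f0 b0.
have ac := mulr_ge0 a0 c0.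
lra.
Qed.
Lemma cctsN H z : ccts H z -> ccts (fun w => - H w) z.
Proof. by move=> h e /h[d d0 hd]; exists d => // w /hd; rewrite -opprD nmN. Qed.
Lemma cctsV H z : H z != 0 -> ccts H z -> ccts (fun w => (H w)^-1) z.
Proof.
move=> H0 h e e0; have a0 : 0 < nm (H z) by rewrite nm_gt0.
have m0 : 0 < Num.min (nm (H z) / 2) (e * (nm (H z) ^+ 2 / 2)).
 by rewrite lt_min !(divr_gt0, mulr_gt0, exprn_gt0).
have [d d0 hd] := h _ m0; exists d => // w /hd; rewrite lt_min => /andP[h1 h2].
have := nm_leD (H z - H w) (H w); rewrite subrK nmB => h3.
have h4 : nm (H z) / 2 < nm (H w) by lra.
have Hw : H w != 0 by rewrite -nm_gt0; lra.
have -> : (H w)^-1 - (H z)^-1 = - ((H w - H z) / (H w * H z)) by field; rewrite Hw H0.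
rewrite nmN nmM nmV nmM ltr_pdivrMr ?mulr_gt0 ?nm_gt0//.
move: h2 h4 a0; set a := nm (H w - H z); set b := nm (H z); set c := nm (H w) => h2 h4 a0.
apply: (lt_le_trans h2); rewrite ler_pM2l//.
by have := ltW h4; rewrite -(ler_pM2r a0) => h5; lra.
Qed.
Lemma cdiff_cst c z : cdiff (fun=> c) z 0.
Proof. by move=> e e0; exists 1 => // w _; rewrite mul0r !subrr nm0 mulr_ge0 ?nm_ge0// ltW. Qed.
Lemma cdiff_id z : cdiff id z 1.
Proof. by move=> e e0; exists 1 => // w _; rewrite mul1r subrr nm0 mulr_ge0 ?nm_ge0// ltW. Qed.

Lemma cdiffD H K z d c : cdiff H z d -> cdiff K z c -> cdiff (fun w => H w + K w) z (d + c).
Proof.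
move=> /cdiff_slope[g [gc <- Hg]] /cdiff_slope[k [kc <- Kk]].
apply/cdiff_slope; exists (fun w => g w + k w); split=> //; first exact: cctsD.
by move=> w; rewrite Hg Kk; ring.
Qed.
Lemma cdiffM H K z d c : cdiff H z d -> cdiff K z c ->
 cdiff (fun w => H w * K w) z (d * K z + H z * c).
Proof.
move=> Hd; have Hc := cdiff_cts Hd; move: Hd.
move=> /cdiff_slope[g [gc <- Hg]] /cdiff_slope[k [kc <- Kk]].
apply/cdiff_slope; exists (fun w => g w * K z + H w * k w); split=> //.
 by apply: cctsD; apply: cctsM => //; apply: ccts_cst.
by move=> w; rewrite [K w]Kk [in LHS]mulrDr [H w]Hg; ring.
Qed.
Lemma cdiffN H z d : cdiff H z d -> cdiff (fun w => - H w) z (- d).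
Proof.
move=> h; have := cdiffM (cdiff_cst (-1) z) h; rewrite mul0r add0r mulN1r.
by apply: cdiff_ext; apply: nearcT => w; rewrite mulN1r.
Qed.
Lemma cdiffB H K z d c : cdiff H z d -> cdiff K z c -> cdiff (fun w => H w - K w) z (d - c).
Proof. by move=> h /cdiffN; apply: cdiffD. Qed.
Lemma cdiffV H z d : H z != 0 -> cdiff H z d ->
 cdiff (fun w => (H w)^-1) z (- d / H z ^+ 2).
Proof.
move=> H0 Hd; have Hc := cdiff_cts Hd; have := Hc (nm (H z)).
rewrite nm_gt0 => /(_ H0)[r r0 Hr].
have Hn : nearc z (fun w => H w != 0).
 exists r => // w /Hr; apply: contraTneq => ->. by rewrite sub0r nmN ltxx.
move/cdiff_slope : Hd => [g [gc <- Hg]].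
pose k w := - g w / (H w * H z).
have kd : cdiff (fun w => (H z)^-1 + (w - z) * k w) z (- g z / H z ^+ 2).
 apply/cdiff_slope; exists k; split => //.
 - apply: cctsM; first exact: cctsN.
  by apply: cctsV; rewrite ?mulf_neq0//; apply: cctsM => //; apply: ccts_cst.
 by move=> w; rewrite subrr mul0r addr0.
apply: cdiff_ext kd; apply: nearcS Hn => w Hw0.
rewrite /k.
have -> : (w - z) * (- g w / (H w * H z)) = (H z - H w) / (H w * H z).
 have Hgw : (w - z) * g w = H w - H z by rewrite [H w]Hg; ring. by rewrite mulrA mulrN Hgw opprB.
by field; rewrite Hw0 H0.
Qed.
Lemma cdiff_comp H K z d c : cdiff K z c -> cdiff H (K z) d -> cdiff (fun w => H (K w)) z (d * c).
Proof.
move=> Kd; have Kc := cdiff_cts Kd; move: Kd.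
move=> /cdiff_slope[k [kc <- Kk]] /cdiff_slope[g [gc <- Hg]].
apply/cdiff_slope; exists (fun w => g (K w) * k w); split=> //.
 by apply: cctsM => //; apply: ccts_comp.
move=> w; rewrite [LHS]Hg; congr (_ + _); rewrite mulrA [RHS]mulrAC; congr (_ * _).
by rewrite [K w]Kk; ring.
Qed.
Lemma cdiffX H z d n : cdiff H z d -> cdiff (fun w => H w ^+ n) z (n%:R * H z ^+ n.-1 * d).
Proof.
move=> h; elim: n => [|n ih].
 by rewrite !mul0r; apply: cdiff_ext (cdiff_cst 1 z); apply: nearcT => w; rewrite expr0.
have := cdiffM h ih; rewrite /=.
have -> : d * H z ^+ n + H z * (n%:R * H z ^+ n.-1 * d) = n.+1%:R * H z ^+ n * d.
 case: n {ih} => [|n] /=; first by rewrite expr0; ring. by rewrite exprS [n.+2%:R]mulrS; ring.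
by apply: cdiff_ext; apply: nearcT => w; rewrite exprS.
Qed.
Lemma cdiff_shift H z a d : cdiff H (z + a) d -> cdiff (fun w => H (w + a)) z d.
Proof.
move=> h; have := @cdiff_comp H (fun w => w + a) z d 1 _ h; rewrite mulr1; apply.
by rewrite -[1]addr0; apply: cdiffD (cdiff_id z) (cdiff_cst a z).
Qed.
Lemma cdiff_opp_arg H z d : cdiff H (- z) d -> cdiff (fun w => H (- w)) z (- d).
Proof.
move=> h; have := @cdiff_comp H (fun w => - w) z d (- 1) _ h; rewrite mulrN1; apply.
exact: cdiffN (cdiff_id z).
Qed.
Lemma cdiff_horner (p : {poly C}) H z d : cdiff H z d ->
 cdiff (fun w => p.[H w]) z (p^`().[H z] * d).
Proof.
move=> h; elim/poly_ind: p => [|p c ih].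
 by rewrite deriv0 horner0 mul0r; apply: cdiff_ext (cdiff_cst 0 z); apply: nearcT => w; rewrite horner0.
have -> : (p * 'X + c%:P)^`().[H z] * d = p^`().[H z] * d * H z + p.[H z] * d + 0.
 by rewrite derivD derivM derivX derivC !hornerE; ring.
apply: cdiff_ext (cdiffD (cdiffM ih h) (cdiff_cst c z)).
by apply: nearcT => w; rewrite !hornerE.
Qed.

Lemma holoW H z : holo H z -> exists d, cdiff H z d.
Proof. exact: nearc_at. Qed.
Lemma holo_near H z : holo H z -> nearc z (fun w => holo H w).
Proof. exact: nearc_open. Qed.
Lemma holo_cts H z : holo H z -> ccts H z.
Proof. by move=> /holoW[d]; apply: cdiff_cts. Qed.
Lemma holo_ext H K z : nearc z (fun w => H w = K w) -> holo H z -> holo K z.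
Proof.
move=> /nearc_open HK; apply: nearcS2 HK => w HK [d h]; exists d.
by apply: cdiff_ext h.
Qed.
Lemma holo_cst c z : holo (fun=> c) z.
Proof. by apply: nearcT => w; exists 0; exact: cdiff_cst. Qed.
Lemma holo_id z : holo id z.
Proof. by apply: nearcT => w; exists 1; exact: cdiff_id. Qed.
Lemma holoD H K z : holo H z -> holo K z -> holo (fun w => H w + K w) z.
Proof. by apply: nearcS2 => w [d h] [c k]; exists (d + c); apply: cdiffD. Qed.
Lemma holoM H K z : holo H z -> holo K z -> holo (fun w => H w * K w) z.
Proof. by apply: nearcS2 => w [d h] [c k]; eexists; apply: cdiffM h k. Qed.
Lemma holoN H z : holo H z -> holo (fun w => - H w) z.
Proof. by apply: nearcS => w [d h]; eexists; apply: cdiffN h. Qed.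
Lemma holoB H K z : holo H z -> holo K z -> holo (fun w => H w - K w) z.
Proof. by move=> h /holoN; apply: holoD. Qed.
Lemma holoX H z n : holo H z -> holo (fun w => H w ^+ n) z.
Proof. by apply: nearcS => w [d h]; eexists; apply: cdiffX h. Qed.
Lemma nearc_ccts H z (P : C -> Prop) : ccts H z -> nearc (H z) P -> nearc z (fun w => P (H w)).
Proof. by move=> h [r r0 Hr]; have [d d0 hd] := h _ r0; exists d => // w /hd /Hr. Qed.
Lemma ccts_neq0 H z : ccts H z -> H z != 0 -> nearc z (fun w => H w != 0).
Proof.
move=> /(_ (nm (H z))); rewrite nm_gt0 => Hr /Hr[r r0 {}Hr].
exists r => // w /Hr; apply: contraTneq => ->.
by rewrite sub0r nmN ltxx.
Qed.
Lemma holoV H z : holo H z -> H z != 0 -> holo (fun w => (H w)^-1) z.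
Proof.
move=> h H0; have := ccts_neq0 (holo_cts h) H0; apply: nearcS2 h.
by move=> w [d h] Hw; eexists; apply: cdiffV h.
Qed.
Lemma holo_horner (p : {poly C}) H z : holo H z -> holo (fun w => p.[H w]) z.
Proof. by apply: nearcS => w [d h]; eexists; apply: cdiff_horner h. Qed.
Lemma holo_comp H K z : holo K z -> holo H (K z) -> holo (fun w => H (K w)) z.
Proof.
move=> hK hH; have := nearc_ccts (holo_cts hK) hH; apply: nearcS2 hK.
by move=> w [d h] [c k]; eexists; apply: cdiff_comp h k.
Qed.
Lemma holo_shift H z a : holo H (z + a) -> holo (fun w => H (w + a)) z.
Proof.
by move=> h; apply: (@holo_comp H (fun w => w + a)) => //; apply: holoD (holo_id z) (holo_cst a z).
Qed.
Lemma holo_opp_arg H z : holo H (- z) -> holo (fun w => H (- w)) z.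
Proof.
by move=> h; apply: (@holo_comp H (fun w => - w)) => //; apply: holoN (holo_id z).
Qed.

Definition rdiff (G : R -> C) t d := forall e : R, 0 < e -> exists2 del : R, 0 < del &
 forall s, `|s - t| < del -> nm (G s - G t - d * (s - t)%:C) <= e * `|s - t|.

Lemma is_derive_eps (f : R -> R) (t : R) (d : R) : is_derive t 1 f d <->
 forall e : R, 0 < e -> exists2 del : R, 0 < del &
 forall s, `|s - t| < del -> `|f s - f t - d * (s - t)| <= e * `|s - t|.
Proof.
have key : (forall e : R, 0 < e -> exists2 del : R, 0 < del &
 forall s, `|s - t| < del -> `|f s - f t - d * (s - t)| <= e * `|s - t|) <->
  (h^-1 *: (f (h *: (1 : R) + t) - f t) @[h --> (0 : R)^'] --> (d : R)).
 split=> [h|/cvgrPdist_lt h e e0].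
  apply/cvgrPdist_lt => e e0; have e2 := half_pos e0.
  have [del del0 Hd] := h _ e2; exists del => //= k kd k0; have {}kd : `|k| < del by move: kd; rewrite /= (distrC 0) subr0.
  have := Hd (k + t); rewrite addrK => /(_ kd) hk. rewrite distrC -(ltr_pM2l (x := `|k|)) ?normr_gt0// -normrM.
  have -> : k * (k^-1 *: (f (k *: (1 : R) + t) - f t) - d) = f (k + t) - f t - d * k.
   by rewrite /GRing.scale/= mulr1; field.
  by rewrite (le_lt_trans hk)// mulrC ltr_pM2l ?normr_gt0//; lra.
 have [del /= del0 Hd] := h _ e0; exists del => // w wz.
 have [->|k0] := eqVneq w t; first by rewrite !subrr mulr0 subrr normr0 mulr0.
 have k1 : w - t != 0 by rewrite subr_eq0. have := Hd (w - t); rewrite /= (distrC 0) subr0 => /(_ wz k1)/ltW.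
 rewrite distrC -(ler_pM2l (x := `|w - t|)) ?normr_gt0// -normrM mulrC [leRHS]mulrC.
 by rewrite /GRing.scale/= mulr1 subrK mulrBl mulrAC mulVf// mul1r.
split=> [[h1 h2]|/key h]; first by apply/key; rewrite -h2.
by split; [apply/cvg_ex; exists d|apply/cvg_lim].
Qed.

Lemma rdiffP (G : R -> C) t d : rdiff G t d <->
 is_derive t 1 (Re \o G) (Re d) /\ is_derive t 1 (Im \o G) (Im d).
Proof.
have E s : Re (G s - G t - d * (s - t)%:C) = Re (G s) - Re (G t) - Re d * (s - t) /\
      Im (G s - G t - d * (s - t)%:C) = Im (G s) - Im (G t) - Im d * (s - t).
 by case: (G s) (G t) d => a b [a' b'] [a'' b'']; split=> /=; ring.
split=> [h|[/is_derive_eps h1 /is_derive_eps h2] e e0].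
 by split; apply/is_derive_eps => e /h[del del0 Hd]; exists del => // s /Hd;
  apply: le_trans; [rewrite -(E s).1 Re_le_nm|rewrite -(E s).2 Im_le_nm].
have e2 := half_pos e0.
have [d1 d10 H1] := h1 _ e2; have [d2 d20 H2] := h2 _ e2.
exists (Num.min d1 d2); first by rewrite lt_min d10.
move=> s; rewrite lt_min => /andP[/H1 {}h1 /H2 {}h2].
apply: le_trans (nm_le_ReIm _) _; rewrite (E s).1 (E s).2.
by move: h1 h2 => /=; set a := `|_ - _ - _|; set b := `|_ - _ - _|; lra.
Qed.
Lemma half_div (e M : R) : 0 < M -> e / (2 * M) * M = e / 2.
Proof. by move=> M0; field; rewrite gt_eqF. Qed.

Lemma rdiff_comp H (G : R -> C) t d c : rdiff G t c -> cdiff H (G t) d ->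
 rdiff (fun s => H (G s)) t (d * c).
Proof.
move=> h k e e0.
pose M := 1 + nm c + nm d; have M0 : 0 < M by rewrite /M ltr_wpDr ?nm_ge0// ltr_wpDr ?nm_ge0.
have e2 : 0 < e / (2 * M) by rewrite divr_gt0// mulr_gt0.
have eM : e / (2 * M) * M = e / 2.
 exact: half_div.
have [d1 d10 H1] := k _ e2.
have m1 : 0 < Num.min 1 (e / (2 * M)) by rewrite lt_min ltr01.
have [d2 d20 H2] := h _ m1.
exists (Num.min d2 (d1 / M)); first by rewrite lt_min d20 divr_gt0.
move=> s; rewrite lt_min ltr_pdivlMr// => /andP[/H2 h2 h3].
have [h2a h2b] : nm (G s - G t - c * (s - t)%:C) <= `|s - t| /\
         nm (G s - G t - c * (s - t)%:C) <= e / (2 * M) * `|s - t|.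
 split; last by apply: le_trans h2 _; rewrite ler_wpM2r// ge_min lexx orbT.
 by apply: le_trans h2 _; rewrite -[leRHS]mul1r ler_wpM2r// ge_min lexx.
have GG : nm (G s - G t) <= M * `|s - t|.
 have := nm_leD (G s - G t - c * (s - t)%:C) (c * (s - t)%:C). rewrite subrK nmM nm_real => /le_trans; apply.
 rewrite /M !mulrDl mul1r -(addrA `|s - t|); apply: lerD => //. by rewrite lerDl mulr_ge0 ?nm_ge0.
have := H1 (G s); have -> : nm (G s - G t) < d1 by rewrite (le_lt_trans GG)// mulrC.
move=> /(_ isT) h1.
have -> : H (G s) - H (G t) - d * c * (s - t)%:C =
 (H (G s) - H (G t) - d * (G s - G t)) + d * (G s - G t - c * (s - t)%:C) by ring.
apply: le_trans (nm_leD _ _) _; rewrite nmM.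
rewrite [e]splitr mulrDl; apply: lerD.
 apply: le_trans h1 _; apply: (@le_trans _ _ (e / (2 * M) * (M * `|s - t|))).
  by rewrite ler_wpM2l// ltW.
 by rewrite mulrA eM.
apply: (@le_trans _ _ (M * (e / (2 * M) * `|s - t|))); last by rewrite mulrA [M * _]mulrC eM.
apply: ler_pM => //; [exact: nm_ge0|exact: nm_ge0|].
by rewrite /M lerDr addr_ge0 ?nm_ge0.
Qed.

Lemma rdiff_cst c t : rdiff (fun=> c) t 0.
Proof.
move=> e e0; exists 1; first exact: ltr01.
move=> s _.
rewrite mul0r.
rewrite subrr.
rewrite subr0.
rewrite nm0.
by rewrite mulr_ge0 ?normr_ge0 ?ltW.
Qed.
Lemma rdiffD (F G : R -> C) t d c : rdiff F t d -> rdiff G t c ->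
 rdiff (fun s => F s + G s) t (d + c).
Proof.
move=> /rdiffP[f1 f2] /rdiffP[g1 g2]; apply/rdiffP; split.
 rewrite raddfD/= (_ : _ \o _ = (Re \o F) + (Re \o G)); last by apply/funext => s /=; rewrite raddfD.
 exact: is_deriveD.
rewrite raddfD/= (_ : _ \o _ = (Im \o F) + (Im \o G)); last by apply/funext => s /=; rewrite raddfD.
exact: is_deriveD.
Qed.
Lemma rdiff_scale (G : R -> C) t d c : rdiff G t d -> rdiff (fun s => c * G s) t (c * d).
Proof.
move=> h; apply: (@rdiff_comp (fun z => c * z)) => //.
by have := cdiffM (cdiff_cst c (G t)) (cdiff_id (G t)); rewrite mul0r add0r mulr1.
Qed.
Lemma rdiff_line a b t : rdiff (fun s => a + s%:C * b) t b.
Proof.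
move=> e e0; exists 1 => // s _.
have -> : a + s%:C * b - (a + t%:C * b) - b * (s - t)%:C = 0 by rewrite rmorphB; ring.
by rewrite nm0 mulr_ge0// ltW.
Qed.
Definition rcts (G : R -> C) t := forall e : R, 0 < e ->
 exists2 d : R, 0 < d & forall s, `|s - t| < d -> nm (G s - G t) < e.

Lemma rctsP (G : R -> C) t : rcts G t <->
 {for t, continuous (Re \o G)} /\ {for t, continuous (Im \o G)}.
Proof.
split=> [h|[/cvgrPdist_lt h1 /cvgrPdist_lt h2] e e0].
 split; apply/cvgrPdist_lt => e /h[d d0 hd]; exists d => //= s sd;
  have {}sd : `|s - t| < d by rewrite distrC. by rewrite distrC (le_lt_trans _ (hd _ sd))// -raddfB Re_le_nm.
 by rewrite distrC (le_lt_trans _ (hd _ sd))// -raddfB Im_le_nm.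
have e2 := half_pos e0.
have [d1 /= d10 H1] := h1 _ e2; have [d2 /= d20 H2] := h2 _ e2.
exists (Num.min d1 d2); first by rewrite lt_min d10.
move=> s; rewrite distrC lt_min => /andP[/H1 {}h1 /H2 {}h2].
apply: le_lt_trans (nm_le_ReIm _) _; rewrite [e]splitr !raddfB/=.
by apply: ltrD; rewrite distrC.
Qed.

Lemma rdiff_cts (G : R -> C) t d : rdiff G t d -> rcts G t.
Proof.
move=> /rdiffP[[f1 _] [g1 _]]; apply/rctsP; split;
 exact: (differentiable_continuous ((derivable1_diffP _ _).1 _)).
Qed.

Lemma rcts_comp H (G : R -> C) t : rcts G t -> ccts H (G t) -> rcts (fun s => H (G s)) t.
Proof.
move=> g h e /h[d d0 hd]; have [r r0 hr] := g _ d0.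
by exists r => // s /hr /hd.
Qed.

Lemma rdiff_affine (G : R -> C) (p q : R) t d : rdiff G (p + q * t) d ->
 rdiff (fun s => G (p + q * s)) t (d * q%:C).
Proof.
move=> h e e0; have [->|q0] := eqVneq q 0.
 by exists 1 => // s _; rewrite !mul0r mulr0 mul0r !subrr nm0 mulr_ge0// ltW.
have q1 : 0 < `|q| by rewrite normr_gt0.
have e2 : 0 < e / `|q| by rewrite divr_gt0.
have [del del0 Hd] := h _ e2; exists (del / `|q|); first by rewrite divr_gt0.
move=> s; rewrite ltr_pdivlMr// => st; have := Hd (p + q * s).
have -> : p + q * s - (p + q * t) = q * (s - t) by ring.
rewrite mulrC in st; rewrite normrM => /(_ st).
by rewrite mulrA divfK ?gt_eqF// rmorphM/= mulrA.
Qed.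

Lemma rdiffN (G : R -> C) t d : rdiff G t d -> rdiff (fun s => - G s) t (- d).
Proof.
move=> h e /h[del del0 Hd]; exists del => // s /Hd.
by rewrite -(nmN (_ - _)); congr (nm _ <= _); ring.
Qed.
Lemma rdiffB (F G : R -> C) t d c : rdiff F t d -> rdiff G t c ->
 rdiff (fun s => F s - G s) t (d - c).
Proof. by move=> f /rdiffN; apply: rdiffD. Qed.
End ComplexDerivative.

(** * Integrals of complex functions over real intervals and segments *)

Section ComplexIntegral.
Implicit Types (x z : C) (t s : R).

Lemma Re_nmV u v : Re ((u^*)%C * v) <= nm u * nm v.
Proof.
apply: le_trans (ler_norm _) _; apply: le_trans (Re_le_nm _) _.
by rewrite nmM; case: u => a b /=; rewrite sqrrN.
Qed.

(** With u = G b - G a, the real function Re (conj u G t) increases by |u|^2 over [a, b]; the real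
    mean value theorem applied to it gives the estimate. *)
Lemma cmean_value (G g : R -> C) (M a b : R) : a <= b ->
 (forall t, a <= t <= b -> rdiff G t (g t)) ->
 (forall t, a <= t <= b -> nm (g t) <= M) -> nm (G b - G a) <= M * (b - a).
Proof.
move=> ab Gg gM; have [->|ltab] := eqVneq a b; first by rewrite !subrr nm0 mulr0.
have {}ltab : a < b by rewrite lt_neqAle ltab.
pose u := G b - G a; rewrite -/u; have [u0|u0] := eqVneq u 0.
 rewrite u0 nm0 mulr_ge0 ?subr_ge0//. by apply: le_trans (nm_ge0 (g a)) _; apply: gM; rewrite lexx.
pose k t := Re ((u^*)%C * G t).
have kd t : a <= t <= b -> is_derive t 1 k (Re ((u^*)%C * g t)).
 by move=> /Gg/(rdiff_scale (u^*)%C)/rdiffP[].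
have kc : {within `[a, b], continuous k}.
 apply: derivable_within_continuous => t; rewrite in_itv/= => /kd h. exact: ex_derive.
have kd' t : t \in `]a, b[ -> is_derive t 1 k (Re ((u^*)%C * g t)).
 by rewrite in_itv/= => /andP[at_ tb]; apply: kd; rewrite !ltW.
have [t] := MVT ltab kd' kc; rewrite in_itv/= => /andP[at_ tb].
rewrite /k -raddfB -mulrBr -/u => ku.
have : Re ((u^*)%C * u) = nm u ^+ 2 by rewrite nm_sqr; case: (u) => p q /=; ring.
rewrite ku expr2 => kuu; rewrite -(ler_pM2l (x := nm u)) ?nm_gt0// -kuu mulrA.
rewrite ler_wpM2r ?subr_ge0//; apply: le_trans (Re_nmV _ _) _.
by rewrite ler_wpM2l ?nm_ge0// gM// !ltW.
Qed.

(** Integrating from a - 1, inside an interval ending at b + 1, makes every point of [a, b]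
    interior, so the derivative is two-sided at the end points as well. *)
Lemma antider_real (f : R -> R) (a b : R) : continuous f ->
 exists F, forall t, a <= t <= b -> is_derive t 1 F (f t).
Proof.
move=> fc; pose F (x : R) := (\int[lebesgue_measure]_(t in [set` `[(a - 1)%R, x]]) f t)%R.
exists F => t /andP[at_ tb].
have tb1 : t < b + 1 by rewrite ltr_pwDr.
have int : lebesgue_measure.-integrable `[(a - 1)%R, (b + 1)%R] (EFin \o f).
 apply: continuous_compact_integrable; first exact: segment_compact. by apply: continuous_subspaceT => x; exact: fc.
have at1 : ((BLeft (a - 1)%R : itv_bound R) < BRight t)%E.
 by rewrite lte_fin ltrBlDr (le_lt_trans at_)// ltrDl.
have [h1 h2] := @continuous_FTC1 R f (BLeft (a - 1)) t (b + 1) tb1 int at1 (fc t).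
have h3 : 'D_1 F t = f t by rewrite -derive1E.
exact: DeriveDef h1 h3.
Qed.

Lemma antider (f : R -> C) (a b : R) : (forall t, rcts f t) ->
 exists F, forall t, a <= t <= b -> rdiff F t (f t).
Proof.
move=> fc.
have [F hF] : exists F, forall t, a <= t <= b -> is_derive t 1 F (Re (f t)).
 by apply: (@antider_real (Re \o f)) => t; case/rctsP: (fc t).
have [G hG] : exists F, forall t, a <= t <= b -> is_derive t 1 F (Im (f t)).
 by apply: (@antider_real (Im \o f)) => t; case/rctsP: (fc t).
exists (fun t => F t +i* G t) => t ht; apply/rdiffP; split; [exact: hF|exact: hG].
Qed.

(** Encoded as the increment of a chosen antiderivative: for continuous f one exists, and by
    [cmean_value] the increment does not depend on the choice. *)
Definition cint (f : R -> C) (a b : R) : C :=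
 let F := xget (fun=> 0) [set F | forall t, a <= t <= b -> rdiff F t (f t)] in F b - F a.

Lemma cintE (f F : R -> C) (a b : R) : a <= b ->
 (forall t, a <= t <= b -> rdiff F t (f t)) -> cint f a b = F b - F a.
Proof.
move=> ab hF; rewrite /cint; set G := xget _ _.
have hG : forall t, a <= t <= b -> rdiff G t (f t).
 by have := @xgetPex _ (fun=> 0) [set F | forall t, a <= t <= b -> rdiff F t (f t)]; apply; exists F.
have := @cmean_value (fun s => G s - F s) (fun t => f t - f t) 0 a b ab.
rewrite mul0r => h; have /h : forall t, a <= t <= b -> rdiff (fun s => G s - F s) t (f t - f t).
 by move=> t ht; apply: rdiffB; [exact: hG|exact: hF].
have h0 : forall t, a <= t <= b -> nm (f t - f t) <= 0 by move=> t _; rewrite subrr nm0.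
move=> /(_ h0) {}h; apply/eqP; rewrite -subr_eq0 -nm_eq0 eq_le nm_ge0 andbT.
by rewrite (le_trans _ h)// le_eqVlt; apply/orP; left; apply/eqP; congr nm; ring.
Qed.

Lemma cint_antider (f : R -> C) (a b : R) : (forall t, rcts f t) -> a <= b ->
 exists2 F, (forall t, a <= t <= b -> rdiff F t (f t)) & cint f a b = F b - F a.
Proof. by move=> fc ab; have [F hF] := antider a b fc; exists F => //; apply: cintE. Qed.

Lemma cint_le (f : R -> C) (a b M : R) : (forall t, rcts f t) -> a <= b ->
 (forall t, a <= t <= b -> nm (f t) <= M) -> nm (cint f a b) <= M * (b - a).
Proof.
by move=> fc ab fM; have [F hF ->] := cint_antider fc ab; apply: cmean_value hF fM.
Qed.

Lemma cintD (f g : R -> C) (a b : R) : (forall t, rcts f t) -> (forall t, rcts g t) -> a <= b ->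
 cint (fun t => f t + g t) a b = cint f a b + cint g a b.
Proof.
move=> fc gc ab; have [F hF ->] := cint_antider fc ab; have [G hG ->] := cint_antider gc ab.
rewrite (@cintE _ (fun t => F t + G t))//; first by ring.
by move=> t ht; apply: rdiffD; [exact: hF|exact: hG].
Qed.

Lemma cintZ (f : R -> C) c (a b : R) : (forall t, rcts f t) -> a <= b ->
 cint (fun t => c * f t) a b = c * cint f a b.
Proof.
move=> fc ab; have [F hF ->] := cint_antider fc ab.
rewrite (@cintE _ (fun t => c * F t))//; first by ring.
by move=> t ht; apply: rdiff_scale; exact: hF.
Qed.

Lemma rctsD (f g : R -> C) t : rcts f t -> rcts g t -> rcts (fun s => f s + g s) t.
Proof.
move=> /rctsP[f1 f2] /rctsP[g1 g2]; apply/rctsP; split.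
 rewrite (_ : _ \o _ = (Re \o f) \+ (Re \o g)); first exact: continuousD. by apply/funext => s /=; rewrite raddfD.
rewrite (_ : _ \o _ = (Im \o f) \+ (Im \o g)); first exact: continuousD.
by apply/funext => s /=; rewrite raddfD.
Qed.
Lemma rctsM (f g : R -> C) t : rcts f t -> rcts g t -> rcts (fun s => f s * g s) t.
Proof.
move=> /rctsP[f1 f2] /rctsP[g1 g2]; apply/rctsP; split.
 rewrite (_ : _ \o _ = (Re \o f) \* (Re \o g) \- (Im \o f) \* (Im \o g)); last first.
  by apply/funext => s /=; case: (f s) (g s) => ? ? [].
 by apply: continuousB; apply: continuousM.
rewrite (_ : _ \o _ = (Re \o f) \* (Im \o g) \+ (Im \o f) \* (Re \o g)); last first.
 by apply/funext => s /=; case: (f s) (g s) => ? ? [].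
by apply: continuousD; apply: continuousM.
Qed.
Lemma rcts_cst c t : rcts (fun=> c) t.
Proof. by move=> e e0; exists 1 => // s _; rewrite subrr nm0. Qed.
Lemma rcts_real (f : R -> R) t : {for t, continuous f} -> rcts (fun s => (f s)%:C) t.
Proof. by move=> h; apply/rctsP; split => //; apply: cst_continuous. Qed.
Lemma rctsV (f : R -> C) t : f t != 0 -> rcts f t -> rcts (fun s => (f s)^-1) t.
Proof.
move=> f0 fc; apply: (@rcts_comp (fun z => z^-1)) => //.
by apply: (@cctsV id) => //; apply: ccts_id.
Qed.

(** Composition with [clamp] extends an integrand from [0, 1] to a continuous function on all of R,
    the form which [antider] takes. *)
Definition clamp (t : R) : R := Num.max 0 (Num.min 1 t).
Lemma clamp01 t : 0 <= clamp t <= 1.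
Proof. by rewrite /clamp le_max lexx ge_max ler01 ge_min lexx. Qed.
Lemma clampE t : 0 <= t <= 1 -> clamp t = t.
Proof. by move=> /andP[t0 t1]; rewrite /clamp min_r// max_r. Qed.
Lemma clamp_cont : continuous clamp.
Proof.
move=> t; apply: continuous_max; first exact: cst_continuous.
by apply: continuous_min => //; exact: cst_continuous.
Qed.

Definition lpt a b t : C := a + t%:C * (b - a).
Lemma lpt1 a b : lpt a b 1 = b. Proof. by rewrite /lpt mul1r addrC subrK. Qed.
Lemma lpt0 a b : lpt a b 0 = a. Proof. by rewrite /lpt mul0r addr0. Qed.
Definition seg H a b : C := (b - a) * cint (fun t => H (lpt a b (clamp t))) 0 1.

Definition cts_seg H a b := forall t, 0 <= t <= 1 -> ccts H (lpt a b t).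

Lemma seg_rcts H a b : cts_seg H a b -> forall t, rcts (fun t => H (lpt a b (clamp t))) t.
Proof.
move=> h t; apply: (@rcts_comp H (fun t => lpt a b (clamp t))); last exact/h/clamp01.
apply: rctsD; first exact: rcts_cst.
apply: rctsM; last exact: rcts_cst.
by apply: rcts_real; apply: clamp_cont.
Qed.

Lemma seg_antider H a b : cts_seg H a b -> exists2 G,
 (forall t, 0 <= t <= 1 -> rdiff G t (H (lpt a b t))) & seg H a b = (b - a) * (G 1 - G 0).
Proof.
move=> /seg_rcts h; have [G hG E] := cint_antider h (@ler01 R).
exists G; last by rewrite /seg E.
by move=> t ht; have := hG t ht; rewrite clampE.
Qed.

Lemma segE H a b G : (forall t, 0 <= t <= 1 -> rdiff G t (H (lpt a b t))) ->
 seg H a b = (b - a) * (G 1 - G 0).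
Proof.
by move=> hG; congr (_ * _); apply: cintE => // t ht; rewrite clampE//; exact: hG.
Qed.

Lemma seg_prim H K a b : (forall t, 0 <= t <= 1 -> cdiff K (lpt a b t) (H (lpt a b t))) ->
 seg H a b = K b - K a.
Proof.
move=> h; have [->|ab] := eqVneq b a; first by rewrite /seg !subrr mul0r.
have ab0 : b - a != 0 by rewrite subr_eq0.
rewrite (@segE _ _ _ (fun t => (b - a)^-1 * K (lpt a b t))).
 by rewrite lpt1 lpt0; field.
move=> t ht; have := rdiff_scale (b - a)^-1 (rdiff_comp (rdiff_line a (b - a) t) (h t ht)).
by rewrite mulrC -mulrA divff// mulr1.
Qed.

Lemma seg_le H a b (M : R) : cts_seg H a b ->
 (forall t, 0 <= t <= 1 -> nm (H (lpt a b t)) <= M) -> nm (seg H a b) <= nm (b - a) * M.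
Proof.
move=> h hM; rewrite nmM ler_wpM2l ?nm_ge0//.
have := cint_le (seg_rcts h) (@ler01 R); rewrite -[M in leRHS]mulr1 -[in leRHS](subr0 1); apply.
by move=> t _; apply: hM; exact: clamp01.
Qed.

Lemma segD H K a b : cts_seg H a b -> cts_seg K a b ->
 seg (fun z => H z + K z) a b = seg H a b + seg K a b.
Proof. by move=> h k; rewrite /seg cintD ?mulrDr//; exact: seg_rcts. Qed.

Lemma seg_rev H a b : cts_seg H a b -> seg H b a = - seg H a b.
Proof.
move=> h; have [G hG ->] := seg_antider h.
rewrite (@segE _ _ _ (fun t => - G (1 + (-1) * t))).
 by rewrite mulr0 addr0 mulr1 subrr; ring.
move=> t /andP[t0 t1]; have ht : 0 <= 1 + (-1) * t <= 1 by apply/andP; split; lra.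
have := rdiffN (rdiff_affine (hG _ ht)).
rewrite rmorphN rmorph1 mulrN1 opprK; congr (rdiff _ _ (H _)).
by rewrite /lpt rmorphD rmorphM rmorphN rmorph1; ring.
Qed.

Definition mid a b : C := (a + b) / 2%:R.

Lemma seg_mid H a b : cts_seg H a b -> seg H a b = seg H a (mid a b) + seg H (mid a b) b.
Proof.
move=> h; have [G hG ->] := seg_antider h.
have half : ((2^-1 : R)%:C : C) = 2^-1 by rewrite fmorphV rmorph_nat.
rewrite (@segE _ a _ (fun t => 2 * G (0 + 2^-1 * t))); last first.
 move=> t /andP[t0 t1]; have ht : 0 <= 0 + 2^-1 * t <= 1 by apply/andP; split; lra.
 have := rdiff_scale 2 (rdiff_affine (hG _ ht)); rewrite half mulrCA divff// mulr1.
 by congr (rdiff _ _ (H _)); rewrite /lpt add0r rmorphM/= half /mid; field.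
rewrite (@segE _ _ b (fun t => 2 * G (2^-1 + 2^-1 * t))); last first.
 move=> t /andP[t0 t1]; have ht : 0 <= 2^-1 + 2^-1 * t <= 1 by apply/andP; split; lra.
 have := rdiff_scale 2 (rdiff_affine (hG _ ht)); rewrite half mulrCA divff// mulr1.
 by congr (rdiff _ _ (H _)); rewrite /lpt rmorphD rmorphM/= half /mid; field.
rewrite !mulr1 !mulr0 !addr0 add0r (_ : 2^-1 + 2^-1 = 1 :> R); last by field.
by rewrite /mid; field.
Qed.
End ComplexIntegral.

(** * Goursat's lemma and primitives on a disc *)

Section Goursat.
Implicit Types (x y z w a b c d : C) (r t s : R).

Lemma half_pow_small (B e : R) : 0 < e -> exists n, B / 2 ^+ n < e.
Proof.
move=> e0; exists (Num.bound (`|B| / e)); set m := Num.bound _.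
have h1 : `|B| / e < m%:R by apply: archi_boundP; rewrite divr_ge0// ltW.
rewrite ltr_pdivrMr ?exprn_gt0//; apply: le_lt_trans (ler_norm _) _.
rewrite mulrC -ltr_pdivrMr//; apply: lt_trans h1 _.
by rewrite -natrX ltr_nat ltn_expl.
Qed.

Lemma nm_lpt a b z t : 0 <= t <= 1 ->
 nm (lpt a b t - z) <= (1 - t) * nm (a - z) + t * nm (b - z).
Proof.
move=> /andP[t0 t1]; have -> : lpt a b t - z = (1 - t)%:C * (a - z) + t%:C * (b - z).
 by rewrite /lpt rmorphB rmorph1; ring.
apply: le_trans (nm_leD _ _) _; rewrite !nmM !nm_real !ger0_norm//.
by rewrite subr_ge0.
Qed.

Lemma nm_lpt_le a b z t r : 0 <= t <= 1 -> nm (a - z) <= r -> nm (b - z) <= r ->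
 nm (lpt a b t - z) <= r.
Proof.
move=> t01 ha hb; apply: le_trans (nm_lpt a b z t01) _; move/andP : t01 => [t0 t1].
have -> : r = (1 - t) * r + t * r by ring.
by apply: lerD; rewrite ler_wpM2l// subr_ge0.
Qed.

Lemma nm_lpt_lt a b z t r : 0 <= t <= 1 -> nm (a - z) < r -> nm (b - z) < r ->
 nm (lpt a b t - z) < r.
Proof.
move=> t01 ha hb; apply: le_lt_trans (@nm_lpt_le a b z t (Num.max (nm (a - z)) (nm (b - z))) t01 _ _) _.
- by rewrite le_max lexx.
- by rewrite le_max lexx orbT.
by rewrite gt_max ha hb.
Qed.

(** The intervals of radius 2K/2^n about x n are nested, so the supremum of their left ends is a
    limit with an explicit rate. *)
Lemma geometric_limit_real (x : nat -> R) (K : R) :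
 (forall n, `|x n.+1 - x n| <= K / 2 ^+ n) ->
 exists X, forall n, `|x n - X| <= 2 * K / 2 ^+ n.
Proof.
move=> hx; pose lo n := x n - 2 * K / 2 ^+ n; pose up n := x n + 2 * K / 2 ^+ n.
have two n : (2 : R) ^+ n != 0 by rewrite expf_neq0.
have K2 n : 2 * K / 2 ^+ n.+1 = K / 2 ^+ n by rewrite exprS; field; rewrite two.
have K0 n : 0 <= K / 2 ^+ n by apply: le_trans (hx n).
have K20 n : 2 * K / 2 ^+ n = K / 2 ^+ n + K / 2 ^+ n by field; rewrite two.
have los n : lo n <= lo n.+1.
 by rewrite /lo K2 K20; have := hx n; rewrite ler_norml => /andP[]; lra.
have ups n : up n.+1 <= up n.
 by rewrite /up K2 K20; have := hx n; rewrite ler_norml => /andP[]; lra.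
have lom n m : (n <= m)%N -> lo n <= lo m by move/nondecreasing_seqP : los; exact.
have upm n m : (n <= m)%N -> up m <= up n by move/nonincreasing_seqP : ups; exact.
have lu n m : lo n <= up m.
 apply: le_trans (lom _ _ (leq_maxl n m)) _; apply: le_trans (upm _ _ (leq_maxr n m)).
 by rewrite /lo /up; have := K20 (maxn n m); have := K0 (maxn n m); lra.
pose X := sup (range lo).
have hs : has_sup (range lo).
 by split; [exists (lo 0%N); exists 0%N|exists (up 0%N) => _ [n _ <-]].
exists X => n.
have h1 : lo n <= X by apply: ub_le_sup; [case: hs|exists n].
have h2 : X <= up n by apply: ge_sup; [case: hs|move=> _ [m _ <-]].
by move: h1 h2; rewrite /lo /up => h1 h2; rewrite ler_norml; apply/andP; split; lra.
Qed.

Lemma geometric_limit (x : nat -> C) (K : R) :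
 (forall n, nm (x n.+1 - x n) <= K / 2 ^+ n) ->
 exists X, forall n, nm (x n - X) <= 4 * K / 2 ^+ n.
Proof.
move=> hx.
have [X1 h1] : exists X, forall n, `|Re (x n) - X| <= 2 * K / 2 ^+ n.
 by apply: geometric_limit_real => n; rewrite -raddfB; apply: le_trans (Re_le_nm _) (hx n).
have [X2 h2] : exists X, forall n, `|Im (x n) - X| <= 2 * K / 2 ^+ n.
 by apply: geometric_limit_real => n; rewrite -raddfB; apply: le_trans (Im_le_nm _) (hx n).
exists (X1 +i* X2) => n; apply: le_trans (nm_le_ReIm _) _; rewrite !raddfB/=.
by have := lerD (h1 n) (h2 n); rewrite -!mulrA; lra.
Qed.

Variables (Q : C -> C) (c0 : C) (rho : R).
Hypothesis Qd : forall z, nm (z - c0) < rho -> exists d, cdiff Q z d.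
Let inD z := nm (z - c0) < rho.

Let Qc a b : inD a -> inD b -> cts_seg Q a b.
Proof.
by move=> ha hb t t01; have [d hd] := Qd (nm_lpt_lt t01 ha hb); exact: cdiff_cts hd.
Qed.

Definition tri_int (p : C * C * C) : C :=
 seg Q p.1.1 p.1.2 + seg Q p.1.2 p.2 + seg Q p.2 p.1.1.
Definition tri_per (p : C * C * C) : R :=
 nm (p.1.2 - p.1.1) + nm (p.2 - p.1.2) + nm (p.1.1 - p.2).
(** The last entry is the middle triangle, oriented so that the inner edges cancel in the sum of the
    four boundary integrals. *)
Definition tri_sub (p : C * C * C) : seq (C * C * C) :=
 let: (a, b, c) := p in
 [:: (a, mid a b, mid c a); (mid a b, b, mid b c); (mid c a, mid b c, c); (mid b c, mid c a, mid a b)].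
Definition tri_in (r : R) (p : C * C * C) : Prop :=
 [/\ nm (p.1.1 - c0) <= r, nm (p.1.2 - c0) <= r & nm (p.2 - c0) <= r].

Let mid_in r a b : nm (a - c0) <= r -> nm (b - c0) <= r -> nm (mid a b - c0) <= r.
Proof.
move=> ha hb; have -> : mid a b = lpt a b 2^-1.
 by rewrite /lpt /mid fmorphV rmorph_nat; field.
by apply: nm_lpt_le => //; apply/andP; split; lra.
Qed.

Lemma tri_sub_in r p q : tri_in r p -> q \in tri_sub p -> tri_in r q.
Proof.
case: p => [[a b] c] [/= ha hb hc]; rewrite !inE => /or4P[] /eqP ->; split => //=;
 exact: mid_in.
Qed.
Let nm_half x : nm (x / 2) = nm x / 2.
Proof. by rewrite nmM nmV -[2]/(2%:R) -(rmorph_nat (real_complex R)) nm_real ger0_norm. Qed.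

Lemma tri_sub_per p q : q \in tri_sub p ->
 tri_per q = tri_per p / 2 /\ nm (q.1.1 - p.1.1) <= tri_per p.
Proof.
case: p => [[a b] c]; rewrite /tri_per !inE /=.
have e1 : nm (a - mid a b) = nm (b - a) / 2 by rewrite nmB -nm_half; congr nm; rewrite /mid; field.
have e2 : nm (mid a b - a) = nm (b - a) / 2 by rewrite nmB.
have e3 : nm (mid c a - a) = nm (a - c) / 2 by rewrite nmB -nm_half; congr nm; rewrite /mid; field.
have e4 : nm (a - mid c a) = nm (a - c) / 2 by rewrite nmB.
have e5 : nm (b - mid a b) = nm (b - a) / 2 by rewrite -nm_half; congr nm; rewrite /mid; field.
have e6 : nm (mid b c - b) = nm (c - b) / 2 by rewrite -nm_half; congr nm; rewrite /mid; field.
have e7 : nm (c - mid b c) = nm (c - b) / 2 by rewrite -nm_half; congr nm; rewrite /mid; field.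
have e8 : nm (mid c a - c) = nm (a - c) / 2 by rewrite -nm_half; congr nm; rewrite /mid; field.
have f1 : nm (mid c a - mid a b) = nm (c - b) / 2 by rewrite -nm_half; congr nm; rewrite /mid; field.
have f2 : nm (mid a b - mid b c) = nm (a - c) / 2 by rewrite -nm_half; congr nm; rewrite /mid; field.
have f3 : nm (mid b c - mid c a) = nm (b - a) / 2 by rewrite -nm_half; congr nm; rewrite /mid; field.
have f4 : nm (mid b c - a) <= nm (b - a) / 2 + nm (a - c) / 2.
 rewrite [X in _ + X / 2]nmB -!nm_half; apply: le_trans (nm_leD _ _).
 by rewrite le_eqVlt; apply/orP; left; apply/eqP; congr nm; rewrite /mid; field.
have := nm_ge0 (b - a); have := nm_ge0 (c - b); have := nm_ge0 (a - c) => g1 g2 g3.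
case/or4P => /eqP -> /=.
- by rewrite e2 e4 f1 subrr nm0; split; lra.
- by rewrite e5 e6 f2 e2; split; lra.
- by rewrite f3 e7 e8 e3; split; lra.
by rewrite (nmB (mid c a)) f3 (nmB (mid a b) (mid c a)) f1 (nmB (mid b c) (mid a b)) f2; split; lra.
Qed.

Lemma tri_split r p : r < rho -> tri_in r p ->
 exists2 q, q \in tri_sub p & nm (tri_int p) <= 4 * nm (tri_int q).
Proof.
move=> r_rho; case: p => [[a b] c] [/= ha hb hc].
have hab := mid_in ha hb; have hbc := mid_in hb hc; have hca := mid_in hc ha.
have D x : nm (x - c0) <= r -> inD x by move=> h; exact: le_lt_trans h r_rho.
have E : tri_int (a, b, c) = tri_int (a, mid a b, mid c a) + tri_int (mid a b, b, mid b c)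
  + tri_int (mid c a, mid b c, c) + tri_int (mid b c, mid c a, mid a b).
 rewrite /tri_int /= (seg_mid (Qc (D _ ha) (D _ hb))) (seg_mid (Qc (D _ hb) (D _ hc)))
  (seg_mid (Qc (D _ hc) (D _ ha))).
 rewrite (seg_rev (Qc (D _ hab) (D _ hca))) (seg_rev (Qc (D _ hbc) (D _ hab))) (seg_rev (Qc (D _ hca) (D _ hbc))).
 by ring.
apply: contrapT => h.
have hq q : q \in tri_sub (a, b, c) -> 4 * nm (tri_int q) < nm (tri_int (a, b, c)).
 by move=> qs; rewrite ltNge; apply/negP => hq; apply: h; exists q.
have := hq (a, mid a b, mid c a); have := hq (mid a b, b, mid b c).
have := hq (mid c a, mid b c, c); have := hq (mid b c, mid c a, mid a b).
rewrite /tri_sub !inE !eqxx !orbT /= => /(_ isT) h1 /(_ isT) h2 /(_ isT) h3 /(_ isT) h4.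
have := nm_leD (tri_int (a, mid a b, mid c a) + tri_int (mid a b, b, mid b c)
  + tri_int (mid c a, mid b c, c)) (tri_int (mid b c, mid c a, mid a b)).
have := nm_leD (tri_int (a, mid a b, mid c a) + tri_int (mid a b, b, mid b c))
  (tri_int (mid c a, mid b c, c)).
have := nm_leD (tri_int (a, mid a b, mid c a)) (tri_int (mid a b, b, mid b c)).
by rewrite -E; lra.
Qed.

(** The affine approximation of Q at z has an explicit primitive, and only the error remains to be
    integrated. The explicit terms are increments, hence cancel around a closed triangle. *)
Let seg_affine_bound z d a b (e M : R) : inD a -> inD b ->
 (forall w, nm (w - z) <= M -> nm (Q w - Q z - d * (w - z)) <= e) ->
 nm (a - z) <= M -> nm (b - z) <= M ->
 nm (seg Q a b - (Q z * (b - a) + d / 2 * ((b - z) ^+ 2 - (a - z) ^+ 2))) <= nm (b - a) * e.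
Proof.
move=> ha hb he ka kb.
pose A w := Q z + d * (w - z); pose N w := - A w.
have Ad w : cdiff A w d.
 have := cdiffD (cdiff_cst (Q z) w) (cdiffM (cdiff_cst d w) (cdiffB (cdiff_id w) (cdiff_cst z w))).
 by rewrite subr0 mul0r !add0r mulr1.
have Nc : cts_seg N a b by move=> t _; apply: cctsN; exact: cdiff_cts (Ad _).
have Ep : seg N a b = - (Q z * (b - a) + d / 2 * ((b - z) ^+ 2 - (a - z) ^+ 2)).
 rewrite (@seg_prim N (fun w => - (Q z * (w - z) + d / 2 * (w - z) ^+ 2))); first by ring.
 move=> t _; rewrite /N; apply: cdiffN; set w := lpt a b t. have wz : cdiff (fun w => w - z) w 1.
  by have := cdiffB (cdiff_id w) (cdiff_cst z w); rewrite subr0.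
 have := cdiffD (cdiffM (cdiff_cst (Q z) w) wz) (cdiffM (cdiff_cst (d / 2) w) (cdiffX 2 wz)).
 have -> : 0 * (w - z) + Q z * 1 + (0 * (w - z) ^+ 2 + d / 2 * (2%:R * (w - z) ^+ 2.-1 * 1)) = A w.
  by rewrite /A /=; field.
 by [].
rewrite -Ep -segD//; last exact: Qc.
apply: seg_le; first by move=> t t01; apply: cctsD; [exact: Qc|exact: Nc].
move=> t t01; rewrite /N /A.
have -> : Q (lpt a b t) + - (Q z + d * (lpt a b t - z)) = Q (lpt a b t) - Q z - d * (lpt a b t - z) by ring.
by apply: he; exact: nm_lpt_le.
Qed.

Lemma tri_bisect r p0 : r < rho -> tri_in r p0 ->
 exists P : nat -> C * C * C, forall n, [/\ tri_in r (P n), tri_per (P n) = tri_per p0 / 2 ^+ n,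
  nm (tri_int p0) <= 4 ^+ n * nm (tri_int (P n)) &
  nm ((P n.+1).1.1 - (P n).1.1) <= tri_per p0 / 2 ^+ n].
Proof.
move=> r_rho hp0.
pose S p q := q \in tri_sub p /\ nm (tri_int p) <= 4 * nm (tri_int q).
have [P P0 PS] : exists2 P : nat -> C * C * C, P 0%N = p0 &
  forall n, tri_in r (P n) /\ S (P n) (P n.+1).
 have stepP p : tri_in r p -> S p (xget p (S p)).
  move=> hp; have [q q1 q2] := tri_split r_rho hp. exact: (@xgetPex _ p (S p) (ex_intro _ q (conj q1 q2))).
 exists (fun n => iter n (fun p => xget p (S p)) p0); first by [].
 elim=> [|n [h1 [h2 h3]]]; first by split; [exact: hp0|exact: stepP].
 by have h4 := tri_sub_in h1 h2; split; [exact: h4|exact: (stepP _ h4)].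
exists P.
have per n : tri_per (P n) = tri_per p0 / 2 ^+ n.
 elim: n => [|n ih]; first by rewrite expr0 divr1 P0.
 by have [_ [/tri_sub_per[-> _] _]] := PS n; rewrite ih exprS invfM mulrA mulrAC.
move=> n; split; [by case: (PS n)|exact: per| |]; last first.
 by rewrite -per; have [_ [/tri_sub_per[_ ->] _]] := PS n.
elim: n => [|n ih]; first by rewrite expr0 mul1r P0.
have [_ [_ h]] := PS n; apply: le_trans ih _; rewrite exprSr -mulrA.
by rewrite ler_wpM2l.
Qed.

(** The affine parts telescope around the triangle, leaving perimeter times error. All vertices lie
    within 5s of z because the first lies within 4s and the perimeter is s. *)
Lemma tri_int_le z d p (s e : R) : inD p.1.1 -> inD p.1.2 -> inD p.2 ->
 tri_per p = s -> nm (p.1.1 - z) <= 4 * s ->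
 (forall w, nm (w - z) <= 5 * s -> nm (Q w - Q z - d * (w - z)) <= e) ->
 nm (tri_int p) <= s * e.
Proof.
case: p => [[a b] c] /= ha hb hc; rewrite /tri_per /tri_int /= => hs az he.
have [g1 g2 g3] : [/\ 0 <= nm (b - a), 0 <= nm (c - b) & 0 <= nm (a - c)] by rewrite !nm_ge0.
have k1 : nm (a - z) <= 5 * s.
 by move: az hs g1 g2 g3; set x := nm (a - z); set u := nm _; set v := nm _; set w := nm _; lra.
have k2 : nm (b - z) <= 5 * s.
 have := nm_distD a b z; move: az hs g1 g2 g3.
 by set x := nm (a - z); set y := nm (b - z); set u := nm _; set v := nm _; set w := nm _; lra.
have k3 : nm (c - z) <= 5 * s.
 have := nm_distD a c z; rewrite (nmB c a); move: az hs g1 g2 g3.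
 by set x := nm (a - z); set y := nm (c - z); set u := nm _; set v := nm _; set w := nm _; lra.
have b1 := seg_affine_bound ha hb he k1 k2.
have b2 := seg_affine_bound hb hc he k2 k3.
have b3 := seg_affine_bound hc ha he k3 k1.
move: b1 b2 b3; set S1 := seg Q a b; set S2 := seg Q b c; set S3 := seg Q c a => b1 b2 b3.
set A1 := (X in S1 - X) in b1; set A2 := (X in S2 - X) in b2; set A3 := (X in S3 - X) in b3.
have -> : S1 + S2 + S3 = (S1 - A1) + (S2 - A2) + (S3 - A3) by rewrite /A1 /A2 /A3; ring.
rewrite -hs !mulrDl.
apply: le_trans (nm_leD _ _) _; apply: lerD => //.
by apply: le_trans (nm_leD _ _) _; apply: lerD.
Qed.

Lemma goursat a b c : inD a -> inD b -> inD c -> seg Q a b + seg Q b c + seg Q c a = 0.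
Proof.
move=> ha hb hc; rewrite -[LHS]/(tri_int (a, b, c)).
have [r [r_rho hp0]] : exists r, r < rho /\ tri_in r (a, b, c).
 exists (Num.max (nm (a - c0)) (Num.max (nm (b - c0)) (nm (c - c0)))). split; first by rewrite !gt_max; apply/and3P.
 by split=> /=; rewrite !le_max lexx ?orbT.
have s00 : 0 <= tri_per (a, b, c) by rewrite !addr_ge0 ?nm_ge0.
move: hp0 s00; move: (a, b, c) => p0 hp0 s00 {a b c ha hb hc}.
have [P hP] := tri_bisect r_rho hp0.
have [z hz] : exists z, forall n, nm ((P n).1.1 - z) <= 4 * tri_per p0 / 2 ^+ n.
 by apply: geometric_limit => n; case: (hP n).
have zD : inD z.
 have e0 : 0 < rho - r by rewrite subr_gt0. have [n hn] := half_pow_small (4 * tri_per p0) e0.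
 have [[h _ _] _ _ _] := hP n; have h1 := nm_leD (z - (P n).1.1) ((P n).1.1 - c0).
 rewrite addrA subrK (nmB z) in h1; apply: le_lt_trans h1 _.
 have := ler_ltD h (le_lt_trans (hz n) hn); rewrite addrC => /lt_le_trans; apply. by rewrite subrKC.
have [d hd] := Qd zD.
apply/eqP; rewrite -nm_eq0 eq_le nm_ge0 andbT; apply/ler_addgt0Pl => e e0; rewrite addr0.
move: s00 hP hz; set s0 := tri_per p0 => s00 hP hz.
(* The error on the n-th triangle is at most e/(5(s0^2 + 1)) times 5 s0/2^n. Multiplied by the
   perimeter s0/2^n and by 4^n, it becomes e s0^2/(s0^2 + 1), which is at most e for every n. *)
have B0 : 0 < 5 * (s0 ^+ 2 + 1) by rewrite mulr_gt0// ltr_wpDl ?sqr_ge0.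
have [del del0 Hd] := hd _ (divr_gt0 e0 B0).
have [n hn] := half_pow_small (5 * s0) del0.
have [[h1 h2 h3] hper hbig _] := hP n; apply: le_trans hbig _.
have D x : nm (x - c0) <= r -> inD x by move=> h; exact: le_lt_trans h r_rho.
have he w : nm (w - z) <= 5 * (s0 / 2 ^+ n) ->
  nm (Q w - Q z - d * (w - z)) <= e / (5 * (s0 ^+ 2 + 1)) * (5 * (s0 / 2 ^+ n)).
 move=> h; apply: le_trans (Hd _ _) _; first by rewrite (le_lt_trans h)// mulrA.
 by rewrite ler_wpM2l// ltW// divr_gt0.
have hzn : nm ((P n).1.1 - z) <= 4 * (s0 / 2 ^+ n) by rewrite mulrA.
have tot := tri_int_le (D _ h1) (D _ h2) (D _ h3) hper hzn he.
have e2 : 0 <= 4 ^+ n :> R by rewrite exprn_ge0.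
apply: le_trans (ler_wpM2l e2 tot) _.
have two : (2 : R) ^+ n != 0 by rewrite expf_neq0.
have s1 : s0 ^+ 2 + 1 != 0 by rewrite gt_eqF// ltr_wpDl ?sqr_ge0.
have -> : 4 ^+ n = 2 ^+ n * 2 ^+ n :> R by rewrite -exprMn; congr (_ ^+ _); ring.
have -> : 2 ^+ n * 2 ^+ n * (s0 / 2 ^+ n * (e / (5 * (s0 ^+ 2 + 1)) * (5 * (s0 / 2 ^+ n)))) =
 e * (s0 ^+ 2 / (s0 ^+ 2 + 1)) by field; rewrite s1 two.
by rewrite ler_piMr ?ltW// ltr_pdivrMr ?ltr_wpDl ?sqr_ge0// mul1r ltrDl.
Qed.

(** Goursat on the triangle c0, z, w turns the increment of the integral from c0 into the integral
    over [z, w], where continuity of Q suffices. *)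
Lemma holo_primitive z : inD z -> cdiff (fun w => seg Q c0 w) z (Q z).
Proof.
move=> hz e e0; have c0D : inD c0.
 by rewrite /inD subrr nm0; apply: le_lt_trans hz; exact: nm_ge0.
have [d hd] := Qd hz; have [del del0 Hd] := cdiff_cts hd e0.
have rz : 0 < rho - nm (z - c0) by rewrite subr_gt0.
exists (Num.min del (rho - nm (z - c0))); first by rewrite lt_min del0.
move=> w; rewrite lt_min => /andP[w1 w2].
have wD : inD w.
 by have := nm_leD (w - z) (z - c0); rewrite addrA subrK /inD; lra.
have := goursat c0D hz wD; rewrite (seg_rev (Qc c0D wD)) => E.
have -> : seg Q c0 w - seg Q c0 z - Q z * (w - z) = seg Q z w + seg (fun=> - Q z) z w.
 rewrite (@seg_prim (fun=> - Q z) (fun w => - Q z * w)).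
  by move/eqP: E; rewrite subr_eq0 => /eqP <-; ring.
 move=> t _; have := cdiffM (cdiff_cst (- Q z) (lpt z w t)) (cdiff_id (lpt z w t)). by rewrite mul0r add0r mulr1.
rewrite -segD; first last.
- by move=> t _; exact: ccts_cst.
- exact: Qc.
rewrite mulrC; apply: seg_le.
 by move=> t t01; apply: cctsD; [exact: Qc|exact: ccts_cst].
move=> t t01; apply/ltW/Hd; apply: nm_lpt_lt => //; by rewrite subrr nm0.
Qed.
End Goursat.

(** * Circles and Cauchy kernels *)

Section CauchyFormula.
Implicit Types (x y z w a b c d : C) (r t s : R).

Lemma real_ctsP (f : R -> R) (t : R) : {for t, continuous f} <-> forall e : R, 0 < e ->
 exists2 d : R, 0 < d & forall s, `|s - t| < d -> `|f s - f t| < e.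
Proof.
split=> [/cvgrPdist_lt h e /h[d /= d0 hd]|h].
 by exists d => // s st; rewrite distrC; apply: hd; rewrite /= distrC.
by apply/cvgrPdist_lt => e /h[d d0 hd]; exists d => //= s st; rewrite distrC hd// distrC.
Qed.
Lemma nm_nat n : nm n%:R = n%:R.
Proof. by rewrite -(rmorph_nat (real_complex R)) nm_real normr_nat. Qed.

Definition cis (t : R) : C := cos t +i* sin t.
Lemma nm_cis t : nm (cis t) = 1. Proof. by rewrite /= cos2Dsin2 sqrtr1. Qed.
Lemma rdiff_cis t : rdiff cis t ('i * cis t).
Proof.
apply/rdiffP; split.
 rewrite (_ : _ \o _ = cos) // (_ : Re _ = - sin t); first exact: is_derive_cos. by rewrite /= mul0r mul1r sub0r.
rewrite (_ : _ \o _ = sin) // (_ : Im _ = cos t); first exact: is_derive_sin.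
by rewrite /= mul0r mul1r add0r.
Qed.
Definition circ c r (t : R) : C := c + r%:C * cis t.
Lemma circB c r t : circ c r t - c = r%:C * cis t. Proof. by rewrite /circ addrC addKr. Qed.
Lemma nm_circ c r t : 0 <= r -> nm (circ c r t - c) = r.
Proof. by move=> r0; rewrite circB nmM nm_cis mulr1 nm_real ger0_norm. Qed.
Lemma rdiff_circ c r t : rdiff (circ c r) t ('i * (circ c r t - c)).
Proof.
have := rdiffD (rdiff_cst c t) (rdiff_scale r%:C (rdiff_cis t)).
by rewrite circB add0r mulrCA.
Qed.
Lemma rcts_circ c r t : rcts (circ c r) t.
Proof. exact: rdiff_cts (rdiff_circ c r t). Qed.
Lemma circ_2pi c r : circ c r (2 * pi) = circ c r 0.
Proof. by rewrite /circ /cis -[2 * pi]add0r mulr_natl cosD2pi sinD2pi. Qed.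
Lemma pi2_ge0 : 0 <= 2 * pi :> R. Proof. by rewrite mulr_ge0// pi_ge0. Qed.

Local Notation oi f := (cint f 0 (2 * pi)).

Lemma oint_prim c r H K : (forall t, rcts (fun t => H (circ c r t) * ('i * (circ c r t - c))) t) ->
 (forall t, cdiff K (circ c r t) (H (circ c r t))) ->
 oi (fun t => H (circ c r t) * ('i * (circ c r t - c))) = 0.
Proof.
move=> Hc HK; rewrite (@cintE _ (fun t => K (circ c r t))) ?pi2_ge0//.
 by rewrite circ_2pi subrr.
by move=> t _; apply: rdiff_comp (rdiff_circ c r t) (HK t).
Qed.

Lemma rcts_bounded (f : R -> C) (a b : R) : a <= b -> (forall t, rcts f t) ->
 exists2 M : R, 0 < M & forall t, a <= t <= b -> nm (f t) <= M.
Proof.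
move=> ab fc; pose g t := nm (f t).
have gc : continuous g.
 move=> t; apply/real_ctsP => e e0; have [d d0 hd] := fc t _ e0.
 by exists d => // s /hd; apply: le_lt_trans; exact: nm_dist.
have [c _ hc] := EVT_max ab (continuous_subspaceT gc).
exists (1 + g c); first by rewrite ltr_wpDr// nm_ge0.
by move=> t ht; apply: le_trans (hc t _) _; rewrite ?in_itv// lerDr.
Qed.

Lemma deriv_under_cint (f : R -> R -> C) (g : R -> C) (a b l0 : R) : a <= b ->
 (forall t, rcts g t) ->
 (forall e : R, 0 < e -> exists2 del : R, 0 < del & forall l, `|l - l0| < del ->
  (forall t, rcts (f l) t) /\
  forall t, a <= t <= b -> nm (f l t - f l0 t - g t * (l - l0)%:C) <= e * `|l - l0|) ->
 rdiff (fun l => cint (f l) a b) l0 (cint g a b).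
Proof.
move=> ab gc h e e0.
have ba0 : 0 < b - a + 1 by rewrite ltr_wpDl// subr_ge0.
have [del del0 hd] := h _ (divr_gt0 e0 ba0); exists del => // l /[dup] hl /hd[fc hf].
have f0c : forall t, rcts (f l0) t by have [] := hd l0 _; rewrite ?subrr ?normr0.
have dc : forall t, rcts (fun t => f l t + (- 1) * f l0 t) t.
 by move=> t; apply: rctsD => //; apply: rctsM => //; exact: rcts_cst.
have ec : forall t, rcts (fun t => (f l t + (- 1) * f l0 t) + (- (l - l0)%:C) * g t) t.
 by move=> t; apply: rctsD => //; apply: rctsM => //; exact: rcts_cst.
have -> : cint (f l) a b - cint (f l0) a b - cint g a b * (l - l0)%:C =
  cint (fun t => (f l t + (- 1) * f l0 t) + (- (l - l0)%:C) * g t) a b.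
 rewrite cintD//; last by move=> t; apply: rctsM => //; exact: rcts_cst.
 rewrite cintD//; last by move=> t; apply: rctsM => //; exact: rcts_cst. by rewrite !cintZ//; ring.
apply: le_trans (cint_le (M := e / (b - a + 1) * `|l - l0|) ec ab _) _.
 move=> t /hf; congr (nm _ <= _); ring.
rewrite mulrAC ler_wpM2r// -mulrA ger_pMr// mulrC ler_pdivrMr// mul1r lerDl.
exact: ler01.
Qed.

Section Kernel.
Variables (c : C) (r : R) (phi : R -> C).
Hypotheses (r0 : 0 < r) (phic : forall t, rcts phi t).

(** With phi from [cphi] this is Cauchy's integral with denominator (z - a)^k. An arbitrary phi
    keeps the class stable under difference quotients at the centre, which only divide phi by z -
    c. *)
Definition ker (k : nat) a : C := oi (fun t => phi t / (circ c r t - a) ^+ k).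

Lemma circ_far a t : nm (a - c) < r -> r - nm (a - c) <= nm (circ c r t - a).
Proof.
move=> ar; have := nm_distD a (circ c r t) c; rewrite (nm_circ _ _ (ltW r0)).
by rewrite lerBlDr.
Qed.
Lemma circ_neq a t : nm (a - c) < r -> circ c r t - a != 0.
Proof.
move=> ar; rewrite -nm_gt0; apply: lt_le_trans (circ_far t ar); by rewrite subr_gt0.
Qed.
Lemma ker_rcts k a : nm (a - c) < r -> forall t, rcts (fun t => phi t / (circ c r t - a) ^+ k) t.
Proof.
move=> ar t; apply: rctsM => //; apply: rctsV; first by rewrite expf_neq0// circ_neq.
apply: (@rcts_comp (fun z => (z - a) ^+ k)); first exact: rcts_circ.
have h : cdiff (fun z => z - a) (circ c r t) 1.
 by have := cdiffB (cdiff_id (circ c r t)) (cdiff_cst a (circ c r t)); rewrite subr0.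
exact: cdiff_cts (cdiffX k h).
Qed.

Lemma kerB k a b j : nm (a - c) < r -> nm (b - c) < r ->
 (forall t, (circ c r t - a) ^- k - (circ c r t - b) ^- k =
   (a - b) * ((circ c r t - b) ^- j * (circ c r t - a) ^- k)) ->
 ker k a - ker k b = (a - b) * oi (fun t => phi t / (circ c r t - b) ^+ j / (circ c r t - a) ^+ k).
Proof.
move=> ar br E; have ac := ker_rcts k ar; have bc := ker_rcts k br.
have jc : forall t, rcts (fun t => phi t / (circ c r t - b) ^+ j / (circ c r t - a) ^+ k) t.
 move=> t; rewrite [X in rcts X](_ : _ = fun t => (phi t / (circ c r t - b) ^+ j) * (1 / (circ c r t - a) ^+ k)).
  apply: rctsM; first exact: ker_rcts.
  rewrite [X in rcts X](_ : _ = fun t => ((circ c r t - a) ^+ k)^-1); last by apply/funext => u; rewrite div1r.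
  apply: rctsV; first by rewrite expf_neq0// circ_neq.
  apply: (@rcts_comp (fun z => (z - a) ^+ k)); first exact: rcts_circ.
  have h : cdiff (fun z => z - a) (circ c r t) 1.
   by have := cdiffB (cdiff_id (circ c r t)) (cdiff_cst a (circ c r t)); rewrite subr0.
  exact: cdiff_cts (cdiffX k h).
 by apply/funext => u; rewrite div1r.
have -> : ker k a - ker k b = oi (fun t => phi t / (circ c r t - a) ^+ k + (- 1) * (phi t / (circ c r t - b) ^+ k)).
 rewrite cintD ?pi2_ge0//; last by move=> t; apply: rctsM => //; exact: rcts_cst. by rewrite cintZ ?pi2_ge0// mulN1r.
rewrite -cintZ ?pi2_ge0//; congr (cint _ _ _); apply/funext => t.
have -> : phi t / (circ c r t - a) ^+ k + -1 * (phi t / (circ c r t - b) ^+ k) =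
 phi t * ((circ c r t - a) ^- k - (circ c r t - b) ^- k) by ring.
by rewrite E; ring.
Qed.

(** Meant for u = 1/(z - b), v = 1/(z - a), d = b - a. The relation u - v = d u v yields, by
    induction on k, a second-order remainder with a bound uniform along the circle. *)
Lemma inv_pow_taylor (M : R) k : 0 <= M -> exists2 K : R, 0 <= K & forall u v d : C, nm u <= M -> nm v <= M ->
 u - v = d * (u * v) -> nm (u ^+ k - v ^+ k - k%:R * d * v ^+ k.+1) <= K * nm d ^+ 2.
Proof.
move=> M0; elim: k => [|k [K K0 ih]].
 by exists 0 => // u v d _ _ _; rewrite !expr0 subrr !mul0r subrr nm0.
exists (M * K + k.+1%:R * M ^+ k.+3); first by apply: addr_ge0; rewrite mulr_ge0 ?exprn_ge0 ?ler0n.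
move=> u v d hu hv E.
have -> : u ^+ k.+1 - v ^+ k.+1 - k.+1%:R * d * v ^+ k.+2 =
  u * (u ^+ k - v ^+ k - k%:R * d * v ^+ k.+1) + k.+1%:R * d ^+ 2 * (u * v ^+ k.+2).
 apply/eqP; rewrite -subr_eq0; apply/eqP.
 transitivity ((u - v - d * (u * v)) * (v ^+ k + k.+1%:R * d * v ^+ k.+1)); last by rewrite E subrr mul0r.
 by rewrite !exprS -natr1; ring.
apply: le_trans (nm_leD _ _) _; rewrite mulrDl; apply: lerD.
 by rewrite nmM -[leRHS]mulrA; apply: ler_pM; rewrite ?nm_ge0 ?ih.
rewrite nmM (nmM k.+1%:R) nm_nat (nmX d) (nmM u) [leRHS]mulrAC ler_wpM2l ?mulr_ge0 ?exprn_ge0 ?nm_ge0// nmX [M ^+ _]exprS.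
by apply: ler_pM; rewrite ?exprn_ge0 ?nm_ge0// lerXn2r ?nnegrE ?nm_ge0.
Qed.

Lemma ker_cdiff k a : nm (a - c) < r -> cdiff (ker k) a (k%:R * ker k.+1 a).
Proof.
move=> ar.
have [M M0 hM] := rcts_bounded pi2_ge0 phic.
(* Half the distance from a to the circle: for |b - a| < m both a and b stay at distance at least m
   from it. *)
pose m := (r - nm (a - c)) / 2; have m0 : 0 < m by rewrite divr_gt0// subr_gt0.
have mi0 : 0 <= m^-1 by rewrite invr_ge0 ltW.
have [K K0 hK] := inv_pow_taylor k mi0; pose B := (2 * pi) * (M * K) : R.
have B0 : 0 <= B by rewrite mulr_ge0 ?pi2_ge0// mulr_ge0// ltW.
move=> e e0; have B1 : 0 < B + 1 by rewrite ltr_wpDl.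
exists (Num.min m (e / (B + 1))); first by rewrite lt_min m0 divr_gt0.
move=> b; rewrite lt_min => /andP[b1 b2].
have br : nm (b - c) < r.
 have := nm_distD a b c; move=> /le_lt_trans; apply.
 have -> : r = 2 * m + nm (a - c) by rewrite /m; field.
 by rewrite ltrD2r; apply: lt_trans b1 _; rewrite ltr_pMl// ltr1n.
have farA t : m <= nm (circ c r t - a).
 by apply: le_trans (circ_far t ar); rewrite /m ler_pdivrMr// ler_peMr// ?ler1n// subr_ge0 ltW.
have farB t : m <= nm (circ c r t - b).
 have := nm_distD b (circ c r t) a; move=> h.
 have h2 := circ_far t ar; have E : r - nm (a - c) = m + m by rewrite /m; field.
 by move: h h2 b1; rewrite E; set u := nm _; set v := nm (_ - b); set w := nm (b - a); lra.
have ac := ker_rcts k ar; have bc := ker_rcts k br; have dc := ker_rcts k.+1 ar.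
have cc x : forall t, rcts (fun=> x) t by move=> t; exact: rcts_cst.
pose rem t := phi t / (circ c r t - b) ^+ k + (- 1) * (phi t / (circ c r t - a) ^+ k)
  + (- (k%:R * (b - a))) * (phi t / (circ c r t - a) ^+ k.+1).
have rc1 t : rcts (fun t => phi t / (circ c r t - b) ^+ k + (- 1) * (phi t / (circ c r t - a) ^+ k)) t.
 by apply: rctsD => //; apply: rctsM.
have rc t : rcts rem t by apply: rctsD => //; apply: rctsM.
have -> : ker k b - ker k a - k%:R * ker k.+1 a * (b - a) = oi rem.
 rewrite /rem cintD ?pi2_ge0//; last by move=> t; apply: rctsM.
 rewrite cintD ?pi2_ge0//; last by move=> t; apply: rctsM.
 rewrite !cintZ ?pi2_ge0//; rewrite -/(ker k b) -/(ker k a) -/(ker k.+1 a).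
 by move: (ker k b) (ker k a) (ker k.+1 a) => x y z; ring.
have bound : forall t, 0 <= t <= 2 * pi -> nm (rem t) <= M * K * nm (b - a) ^+ 2.
 move=> t ht; pose u := (circ c r t - b)^-1; pose v := (circ c r t - a)^-1.
 have hu : nm u <= m^-1 by rewrite nmV lef_pV2 ?posrE ?nm_gt0 ?circ_neq.
 have hv : nm v <= m^-1 by rewrite nmV lef_pV2 ?posrE ?nm_gt0 ?circ_neq. have uv : u - v = (b - a) * (u * v).
  by rewrite /u /v; field; rewrite !circ_neq.
 have -> : rem t = phi t * (u ^+ k - v ^+ k - k%:R * (b - a) * v ^+ k.+1) by rewrite /rem /u /v !exprVn; ring.
 rewrite nmM -[leRHS]mulrA; apply: ler_pM; [exact: nm_ge0|exact: nm_ge0|exact: hM|exact: hK hu hv uv].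
apply: le_trans (cint_le rc pi2_ge0 bound) _; rewrite subr0.
have -> : M * K * nm (b - a) ^+ 2 * (2 * pi) = B * nm (b - a) * nm (b - a) by rewrite /B; ring.
rewrite ler_wpM2r ?nm_ge0//; move: b2; rewrite ltr_pdivlMr// mulrC => /ltW; apply: le_trans.
by rewrite ler_wpM2r ?nm_ge0// lerDl.
Qed.
End Kernel.
End CauchyFormula.

(** * Cauchy's formula and Taylor expansions *)

Section CauchyFormula2.
Implicit Types (x y z w a b c d : C) (r t s : R).
Local Notation oi f := (cint f 0 (2 * pi)).

Lemma compact_uniform (P : R -> R -> Prop) (a b : R) :
 (forall t, a <= t <= b -> exists2 d : R, 0 < d & forall s x : R, a <= s <= b -> `|s - t| < d -> `|x| < d -> P s x) ->
 exists2 d : R, 0 < d & forall s x : R, a <= s <= b -> `|x| < d -> P s x.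
Proof.
move=> h.
have /compact_near_coveringP/(_ R (nbhs (0 : R)) (fun (x s : R) => a <= s <= b -> P s x) _) := @segment_compact R a b.
case.
 move=> t; rewrite /= in_itv/= => /h[d d0 hd]. exists ([set s | `|s - t| < d], [set x : R | `|x| < d]); last first.
  by move=> [s x] [/= h1 h2] h3; exact: hd.
 split; first by exists d => // s; rewrite /= distrC. by exists d => // s; rewrite /= sub0r normrN.
move=> d /= d0 hd; exists d => // s x sab xd; apply: (hd x) => //=; first by rewrite sub0r normrN.
Qed.

Lemma C1_estimate F H z0 (del e : R) :
 (forall w, nm (w - z0) < del -> cdiff F w (H w) /\ nm (H w - H z0) <= e) ->
 forall p q, nm (p - z0) < del -> nm (q - z0) < del ->
 nm (F q - F p - (q - p) * H p) <= 2 * e * nm (q - p).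
Proof.
move=> h p q hp hq.
pose G t := F (p + t%:C * (q - p)) + (- H p) * (0 + t%:C * (q - p)).
have ball t : 0 <= t <= 1 -> nm (p + t%:C * (q - p) - z0) < del by move=> ht; exact: nm_lpt_lt.
have := @cmean_value G (fun t => H (p + t%:C * (q - p)) * (q - p) + (- H p) * (q - p)) (2 * e * nm (q - p)) 0 1 ler01.
rewrite subr0 mulr1.
have -> : G 1 - G 0 = F q - F p - (q - p) * H p.
 by rewrite /G !mul1r !mul0r addr0 subrKC; ring.
apply.
 move=> t ht; apply: rdiffD; last by apply: rdiff_scale; exact: rdiff_line.
 by apply: (rdiff_comp (rdiff_line _ _ _)); case: (h _ (ball _ ht)).
move=> t ht; rewrite -mulrDl nmM ler_wpM2r ?nm_ge0//.
have -> : H (p + t%:C * (q - p)) - H p = (H (p + t%:C * (q - p)) - H z0) - (H p - H z0) by ring.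
apply: le_trans (nm_leD _ _) _; rewrite nmN mulr_natl mulr2n; apply: lerD.
 by case: (h _ (ball _ ht)).
by case: (h _ hp).
Qed.

Section C1.
Variables (F H : C -> C) (c : C) (r rho : R).
Hypotheses (r0 : 0 < r) (r_rho : r < rho) (FH : forall z, nm (z - c) < rho -> cdiff F z (H z) /\ ccts H z).
Variable a : C.
Hypothesis ar : nm (a - c) < r.

Let zt t := circ c r t.
Let dz t := 'i * (zt t - c).

(** The circle contracted towards a: l = 1 is the circle itself, l = 0 the point a. *)
Let zl (l t : R) := a + l%:C * (zt t - a).

Let nm_za t : nm (zt t - a) < 2 * r.
Proof.
have := nm_distD c (zt t) a; rewrite (nm_circ _ _ (ltW r0)) => /le_lt_trans; apply.
by rewrite (nmB c) mulr_natl mulr2n ltrD2l.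
Qed.

Let zl_in l t : 0 <= l <= 1 -> nm (zl l t - c) <= r.
Proof.
move=> l01; apply: nm_lpt_le => //; first exact: ltW.
by rewrite (nm_circ _ _ (ltW r0)).
Qed.

Let dz_rcts t : rcts dz t.
Proof.
apply: rctsM; first exact: rcts_cst.
by apply: rctsD; [exact: rcts_circ|exact: rcts_cst].
Qed.

Let zl_rcts l t : rcts (zl l) t.
Proof.
apply: rctsD; first exact: rcts_cst.
apply: rctsM; first exact: rcts_cst.
by apply: rctsD; [exact: rcts_circ|exact: rcts_cst].
Qed.

Let inv_rcts t : rcts (fun t => (zt t - a)^-1) t.
Proof.
apply: rctsV; first exact: circ_neq.
by apply: rctsD; [exact: rcts_circ|exact: rcts_cst].
Qed.

Let unif l0 : 0 <= l0 <= 1 -> forall e : R, 0 < e -> exists2 del : R, 0 < del &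
 forall t x : R, 0 <= t <= 2 * pi -> `|x| < del ->
 nm (F (zl (l0 + x) t) - F (zl l0 t) - (zl (l0 + x) t - zl l0 t) * H (zl l0 t)) <=
 2 * e * nm (zl (l0 + x) t - zl l0 t).
Proof.
move=> l01 e e0; apply: compact_uniform => t _.
have h0 : nm (zl l0 t - c) < rho by apply: le_lt_trans r_rho; exact: zl_in.
have [_ Hc] := FH h0; have [d1 d10 hd1] := Hc _ e0.
pose d2 := Num.min d1 (rho - nm (zl l0 t - c)).
have d20 : 0 < d2 by rewrite lt_min d10 subr_gt0.
have hd2 w : nm (w - zl l0 t) < d2 -> cdiff F w (H w) /\ nm (H w - H (zl l0 t)) <= e.
 rewrite lt_min => /andP[/hd1/ltW h1 h2]; split => //.
 have := nm_distD (zl l0 t) w c; move=> h3.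
 by have [] := FH (le_lt_trans h3 _) => //; rewrite -ltrBrDr.
have d22 : 0 < d2 / 2 by rewrite divr_gt0.
have [d3 d30 hd3] := zl_rcts l0 t d22.
exists (Num.min d3 (d2 / 2 / (2 * r))); first by rewrite lt_min d30 divr_gt0// mulr_gt0.
move=> s x _; rewrite lt_min => /andP[/hd3 {}hd3 _]; rewrite lt_min => /andP[_ hx].
have p1 : nm (zl l0 s - zl l0 t) < d2 by apply: lt_trans hd3 _; rewrite ltr_pdivrMr// ltr_pMr// ltr1n.
apply: (C1_estimate hd2) => //.
have := nm_distD (zl l0 s) (zl (l0 + x) s) (zl l0 t).
move=> /le_lt_trans; apply; rewrite [d2]splitr; apply: ltrD => //.
have -> : zl (l0 + x) s - zl l0 s = x%:C * (zt s - a) by rewrite /zl rmorphD; ring.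
rewrite nmM nm_real; move: hx; rewrite ltr_pdivlMr ?mulr_gt0//; apply: le_lt_trans.
by rewrite ler_wpM2l// ltW.
Qed.

Let J l := oi (fun t => F (zl l t) * dz t / (zt t - a)).

Let J_deriv l0 : 0 <= l0 <= 1 -> rdiff J l0 (oi (fun t => H (zl l0 t) * dz t)).
Proof.
move=> l01; apply: deriv_under_cint; first exact: pi2_ge0.
 move=> t; apply: rctsM => //; apply: rcts_comp => //. by have [] := FH (le_lt_trans (zl_in t l01) r_rho).
move=> e e0.
have e1 : 0 < e / (2 * r) by rewrite divr_gt0// mulr_gt0.
have [d1 d10 hd1] := unif l01 e1.
have rr : 0 < rho - r by rewrite subr_gt0.
exists (Num.min d1 ((rho - r) / (2 * r))); first by rewrite lt_min d10 divr_gt0// mulr_gt0.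
move=> l; rewrite lt_min => /andP[l1 l2]; split.
 move=> t; apply: rctsM => //; apply: rctsM => //; apply: rcts_comp => //.
 suff /FH[+ _] : nm (zl l t - c) < rho by exact: cdiff_cts.
 have -> : zl l t - c = (l - l0)%:C * (zt t - a) + (zl l0 t - c) by rewrite /zl rmorphB; ring.
 apply: le_lt_trans (nm_leD _ _) _; rewrite nmM nm_real.
 have := ltr_leD _ (zl_in t l01) => /(_ (`|l - l0| * nm (zt t - a)) (rho - r)); rewrite subrK; apply.
 move: l2; rewrite ltr_pdivlMr ?mulr_gt0//; apply: le_lt_trans; rewrite ler_wpM2l//. exact/ltW/nm_za.
move=> t ht; have := hd1 t (l - l0) ht l1; rewrite subrKC.
have zE : zl l t - zl l0 t = (l - l0)%:C * (zt t - a) by rewrite /zl rmorphB; ring.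
have z0 : zt t - a != 0 by exact: circ_neq.
set X := F (zl l t); set Y := F (zl l0 t); set Z := H (zl l0 t); rewrite zE => hX.
have -> : X * dz t / (zt t - a) - Y * dz t / (zt t - a) - Z * dz t * (l - l0)%:C =
 (dz t / (zt t - a)) * (X - Y - (l - l0)%:C * (zt t - a) * Z) by field.
have dr : nm (dz t) = r by rewrite nmM (nm_circ _ _ (ltW r0)) /= expr0n expr1n add0r sqrtr1 mul1r.
rewrite nmM nmM dr nmV; apply: le_trans (ler_wpM2l _ hX) _.
 by rewrite divr_ge0 ?nm_ge0// ltW.
rewrite nmM nm_real; have n0 : nm (zt t - a) != 0 by rewrite nm_eq0.
have -> : r / nm (zt t - a) * (2 * (e / (2 * r)) * (`|l - l0| * nm (zt t - a))) = e * `|l - l0|.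
 by field; rewrite n0 gt_eqF.
exact: lexx.
Qed.

(** For l0 nonzero the integrand H(a + l0 (z - a)) has the primitive F(a + l0 (z - a))/l0 on the
    circle; for l0 = 0 it is the constant H(a). *)
Let J_deriv0 l0 : 0 <= l0 <= 1 -> oi (fun t => H (zl l0 t) * dz t) = 0.
Proof.
move=> l01; have [l00|l00] := eqVneq l0 0.
 have -> : (fun t => H (zl l0 t) * dz t) = (fun t => (fun=> H a) (circ c r t) * ('i * (circ c r t - c))).
  by apply/funext => t; rewrite /zl l00 mul0r addr0.
 apply: (@oint_prim c r (fun=> H a) (fun w => H a * w)).
  by move=> t; apply: rctsM; [exact: rcts_cst|exact: dz_rcts].
 by move=> t; have := cdiffM (cdiff_cst (H a) (circ c r t)) (cdiff_id (circ c r t)); rewrite mul0r add0r mulr1.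
have lC : l0%:C != 0 :> C by rewrite fmorph_eq0.
pose H1 z := H (a + l0%:C * (z - a)); pose K z := l0%:C^-1 * F (a + l0%:C * (z - a)).
apply: (@oint_prim c r H1 K) => t.
 apply: rctsM; last exact: dz_rcts.
 by apply: (@rcts_comp H (zl l0)) => //; have [] := FH (le_lt_trans (zl_in t l01) r_rho).
have [h1 _] := FH (le_lt_trans (zl_in t l01) r_rho).
have ad : cdiff (fun z => a + l0%:C * (z - a)) (circ c r t) l0%:C.
 have := cdiffD (cdiff_cst a (circ c r t)) (cdiffM (cdiff_cst l0%:C (circ c r t)) (cdiffB (cdiff_id (circ c r t)) (cdiff_cst a (circ c r t)))).
 by rewrite subr0 mul0r !add0r mulr1.
have := cdiffM (cdiff_cst l0%:C^-1 (circ c r t)) (@cdiff_comp F _ _ _ _ ad h1).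
by rewrite mul0r add0r mulrCA mulVf// mulr1.
Qed.

(** The integral [J l] of F over the contracted circle has zero derivative in l by [J_deriv0]; its
    values at l = 1 and l = 0 are the two sides. Continuity of H serves to differentiate under the
    integral sign. *)
Lemma cauchy_C1 : oi (fun t => F (circ c r t) * ('i * (circ c r t - c)) / (circ c r t - a)) =
  F a * oi (fun t => 'i * (circ c r t - c) / (circ c r t - a)).
Proof.
have : nm (J 1 - J 0) <= 0 * (1 - 0).
 apply: (@cmean_value J (fun=> 0)) => //; last by move=> t _; rewrite nm0.
 by move=> l l01; rewrite -(J_deriv0 l01); exact: J_deriv.
rewrite mul0r => h; have /eqP : nm (J 1 - J 0) = 0 by apply/eqP; rewrite eq_le nm_ge0 h.
rewrite nm_eq0 subr_eq0 => /eqP JJ.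
have <- : J 1 = oi (fun t => F (circ c r t) * ('i * (circ c r t - c)) / (circ c r t - a)).
 by congr (cint _ _ _); apply/funext => t; rewrite /zl mul1r subrKC.
rewrite JJ -cintZ ?pi2_ge0//; last by move=> t; apply: rctsM.
by congr (cint _ _ _); apply/funext => t; rewrite /zl mul0r addr0 [RHS]mulrA.
Qed.
End C1.

Lemma cint_cst x : oi (fun=> x) = (2 * pi)%:C * x.
Proof.
rewrite (@cintE _ (fun t : R => 0 + t%:C * x)) ?pi2_ge0//; last by move=> t _; exact: rdiff_line.
by rewrite mul0r !add0r subr0.
Qed.

(** The derivative in a is the integral of dz/(z - a)^2, which is exact, so the integral is constant
    on the disc; at the centre the integrand is the constant i. *)
Lemma winding c r a : 0 < r -> nm (a - c) < r ->
 oi (fun t => 'i * (circ c r t - c) / (circ c r t - a)) = (2 * pi)%:C * 'i.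
Proof.
move=> r0 ar; pose phi t := 'i * (circ c r t - c).
have phic t : rcts phi t.
 apply: rctsM; first exact: rcts_cst. by apply: rctsD; [exact: rcts_circ|exact: rcts_cst].
have E b : oi (fun t => 'i * (circ c r t - c) / (circ c r t - b)) = ker c r phi 1 b.
 by congr (cint _ _ _); apply/funext => t; rewrite expr1.
have W0 b : nm (b - c) < r -> cdiff (ker c r phi 1) b 0.
 move=> br; have := ker_cdiff r0 phic 1 br; rewrite mul1r. suff -> : ker c r phi 2 b = 0 by [].
 have -> : ker c r phi 2 b = oi (fun t => (fun z => (z - b) ^- 2) (circ c r t) * ('i * (circ c r t - c))).
  by congr (cint _ _ _); apply/funext => t; rewrite mulrC.
 apply: (@oint_prim c r (fun z => (z - b) ^- 2) (fun z => - (z - b)^-1)) => t.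
  by have := ker_rcts r0 phic 2 br t; congr (rcts _ _); apply/funext => s; rewrite mulrC.
 have h1 : cdiff (fun z => z - b) (circ c r t) 1.
  by have := cdiffB (cdiff_id (circ c r t)) (cdiff_cst b (circ c r t)); rewrite subr0.
 have := cdiffN (@cdiffV (fun z => z - b) _ _ (circ_neq r0 t br) h1); congr (cdiff _ _ _).
 by rewrite mulNr opprK div1r.
have : nm (ker c r phi 1 (c + (1 : R)%:C * (a - c)) - ker c r phi 1 (c + (0 : R)%:C * (a - c))) <= 0 * (1 - 0).
 apply: (@cmean_value (fun t => ker c r phi 1 (c + t%:C * (a - c))) (fun=> 0)) => //.
  move=> t t01; have := rdiff_comp (rdiff_line c (a - c) t) (W0 (c + t%:C * (a - c)) _); rewrite mul0r; apply.
  by apply: nm_lpt_lt => //; rewrite subrr nm0.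
 by move=> t _; rewrite nm0.
rewrite !mul0r mul1r addr0 subrKC => h.
have /eqP : nm (ker c r phi 1 a - ker c r phi 1 c) = 0 by apply/eqP; rewrite eq_le nm_ge0 h.
rewrite nm_eq0 subr_eq0 E => /eqP ->; rewrite -E -cint_cst.
congr (cint _ _ _); apply/funext => t; rewrite mulfK//.
by apply: circ_neq => //; rewrite subrr nm0.
Qed.

Definition cphi c r H (t : R) : C := H (circ c r t) * ('i * (circ c r t - c)) / ((2 * pi)%:C * 'i).

Lemma twopii_neq0 : (2 * pi)%:C * 'i != 0 :> C.
Proof.
apply: mulf_neq0; last exact: neq0Ci.
by rewrite fmorph_eq0 gt_eqF// mulr_gt0 ?pi_gt0.
Qed.

Lemma cphi_rcts c r H : 0 <= r -> (forall z, nm (z - c) <= r -> ccts H z) -> forall t, rcts (cphi c r H) t.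
Proof.
move=> r0 Hc t; apply: rctsM; last exact: rcts_cst.
apply: rctsM; first by apply: rcts_comp; [exact: rcts_circ|apply: Hc; rewrite nm_circ].
apply: rctsM; first exact: rcts_cst.
by apply: rctsD; [exact: rcts_circ|exact: rcts_cst].
Qed.

Lemma cauchy_formula_C1 F H c r rho a : 0 < r -> r < rho ->
 (forall z, nm (z - c) < rho -> cdiff F z (H z) /\ ccts H z) -> nm (a - c) < r ->
 F a = ker c r (cphi c r F) 1 a.
Proof.
move=> r0 rr FH ar; have := cauchy_C1 r0 rr FH ar; rewrite winding// => E.
have -> : ker c r (cphi c r F) 1 a = ((2 * pi)%:C * 'i)^-1 *
  oi (fun t => F (circ c r t) * ('i * (circ c r t - c)) / (circ c r t - a)).
 rewrite -cintZ ?pi2_ge0//.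
  by congr (cint _ _ _); apply/funext => t; rewrite expr1 /cphi [RHS]mulrC mulrAC.
 move=> t; have h w : nm (w - c) <= r -> ccts F w.
  by move=> /le_lt_trans/(_ rr)/FH[/cdiff_cts].
 apply: rctsM; last first.
  apply: rctsV; first exact: circ_neq. by apply: rctsD; [exact: rcts_circ|exact: rcts_cst].
 apply: rctsM; first by apply: rcts_comp; [exact: rcts_circ|apply: h; rewrite nm_circ// ltW].
 apply: rctsM; first exact: rcts_cst. by apply: rctsD; [exact: rcts_circ|exact: rcts_cst].
by rewrite E mulrC mulfK// twopii_neq0.
Qed.
Lemma cdiff_uniq H z d1 d2 : cdiff H z d1 -> cdiff H z d2 -> d1 = d2.
Proof. by move=> /cdiff_cderiv <- /cdiff_cderiv <-. Qed.

Lemma nearc_lt z c r : nm (z - c) < r -> nearc z (fun w => nm (w - c) < r).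
Proof.
move=> zr; exists (r - nm (z - c)); first by rewrite subr_gt0.
move=> w wz; have := nm_distD z w c; move=> /le_lt_trans; apply.
by rewrite -ltrBrDr.
Qed.

(** Here H is only differentiable. Goursat supplies a primitive F, which is C^1 and hence a Cauchy
    integral on the intermediate disc of radius r1. So H = F' is a kernel of order 2, therefore C^1,
    and the C^1 formula applies to H itself. *)
Lemma cauchy_formula H c r rho a : 0 < r -> r < rho ->
 (forall z, nm (z - c) < rho -> exists d, cdiff H z d) -> nm (a - c) < r ->
 H a = ker c r (cphi c r H) 1 a.
Proof.
move=> r0 rr Hd ar.
pose r1 := (r + rho) / 2; have [rr1 r1r] : r < r1 /\ r1 < rho.
 by split; rewrite /r1; lra.
have r10 : 0 < r1 by apply: lt_trans rr1.
pose F := seg H c.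
have FH z : nm (z - c) < rho -> cdiff F z (H z) /\ ccts H z.
 by move=> zr; split; [exact: holo_primitive zr|have [d /cdiff_cts] := Hd _ zr].
have phic := @cphi_rcts c r1 F (ltW r10) (fun z zr => cdiff_cts (FH z (le_lt_trans zr r1r)).1).
have FE b : nm (b - c) < r1 -> cdiff F b (ker c r1 (cphi c r1 F) 2 b).
 move=> br; have := ker_cdiff r10 phic 1 br; rewrite mul1r.
 apply: cdiff_ext; apply: nearcS (nearc_lt br) => w wr; symmetry. exact: (cauchy_formula_C1 r10 r1r FH wr).
have HE b : nm (b - c) < r1 -> H b = ker c r1 (cphi c r1 F) 2 b.
 by move=> br; apply: cdiff_uniq (FE b br); have [] := FH b (lt_trans br r1r).
apply: (@cauchy_formula_C1 H (fun b => 2%:R * ker c r1 (cphi c r1 F) 3 b) c r r1) => // z zr; split.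
 have := ker_cdiff r10 phic 2 zr; apply: cdiff_ext. by apply: nearcS (nearc_lt zr) => w /HE ->.
apply: cctsM; first exact: ccts_cst.
exact: cdiff_cts (ker_cdiff r10 phic 3 zr).
Qed.

Lemma holo_ker H z : holo H z -> exists r phi, [/\ 0 < r, (forall t, rcts phi t) &
 forall a, nm (a - z) < r -> H a = ker z r phi 1 a].
Proof.
case=> rho rho0 Hd; have r0 : 0 < rho / 2 by rewrite divr_gt0.
have rr : rho / 2 < rho by rewrite ltr_pdivrMr// ltr_pMr// ltr1n.
exists (rho / 2), (cphi z (rho / 2) H); split=> //.
 apply: cphi_rcts; first exact: ltW. by move=> w wr; have [d /cdiff_cts] := Hd w (le_lt_trans wr rr).
by move=> a ar; apply: cauchy_formula Hd ar.
Qed.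

Lemma ker_holo c r phi k a : 0 < r -> (forall t, rcts phi t) -> nm (a - c) < r ->
 holo (ker c r phi k) a.
Proof.
by move=> r0 pc ar; apply: nearcS (nearc_lt ar) => w wr; eexists; apply: ker_cdiff.
Qed.

Lemma holo_deriv H z : holo H z -> holo (cderiv H) z.
Proof.
move=> /holo_ker[r [phi [r0 pc E]]]; have zr : nm (z - z) < r by rewrite subrr nm0.
apply: holo_ext (ker_holo 2 r0 pc zr).
apply: nearcS (nearc_lt zr) => w wr; symmetry; apply: cdiff_cderiv.
have := ker_cdiff r0 pc 1 wr; rewrite mul1r; apply: cdiff_ext.
by apply: nearcS (nearc_lt wr) => v /E.
Qed.

Lemma ker_phi_rcts c r phi : 0 < r -> (forall t, rcts phi t) ->
 forall j t, rcts (fun t => phi t / (circ c r t - c) ^+ j) t.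
Proof. by move=> r0 pc j t; apply: ker_rcts => //; rewrite subrr nm0. Qed.

Lemma ker_step c r phi a : 0 < r -> (forall t, rcts phi t) -> nm (a - c) < r ->
 ker c r phi 1 a = ker c r phi 1 c + (a - c) * ker c r (fun t => phi t / (circ c r t - c) ^+ 1) 1 a.
Proof.
move=> r0 pc ar; have cr : nm (c - c) < r by rewrite subrr nm0.
rewrite [RHS]addrC -[LHS](subrK (ker c r phi 1 c)); congr (_ + _).
apply: (@kerB c r phi r0 pc 1 a c 1 ar cr) => t.
by rewrite !expr1; field; rewrite !(circ_neq r0 t).
Qed.

Lemma holo_factor H z : holo H z -> exists2 g, holo g z &
 nearc z (fun w => H w = H z + (w - z) * g w).
Proof.
move=> /holo_ker[r [phi [r0 pc E]]]; have zr : nm (z - z) < r by rewrite subrr nm0.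
exists (ker z r (fun t => phi t / (circ z r t - z) ^+ 1) 1).
 by apply: ker_holo => //; exact: ker_phi_rcts.
apply: nearcS (nearc_lt zr) => w wr; rewrite !E//; exact: ker_step.
Qed.
Lemma div_exprS x y k : x / y ^+ k / y ^+ 1 = x / y ^+ k.+1.
Proof. by rewrite expr1 exprSr invfM mulrA mulrAC. Qed.

(** The Taylor coefficients are the values at z of the kernels with density [phk k]. If all of them
    vanish, the remainder on half the radius is at most B/2^(k+1) for every k, so H is constant near
    z. Otherwise the first nonzero coefficient is the value at z of the cofactor g. *)
Lemma holo_order H z : holo H z -> nearc z (fun w => H w = H z) \/
 exists k g, [/\ holo g z, g z != 0 & nearc z (fun w => H w = H z + (w - z) ^+ k.+1 * g w)].
Proof.
move=> /holo_ker[r [phi [r0 pc E]]]; have zr : nm (z - z) < r by rewrite subrr nm0.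
pose phk k t := phi t / (circ z r t - z) ^+ k.
have phkc k t : rcts (phk k) t by exact: ker_phi_rcts.
have expand k w : nm (w - z) < r -> (forall j, (0 < j < k)%N -> ker z r (phk j) 1 z = 0) ->
  (0 < k)%N -> H w = H z + (w - z) ^+ k * ker z r (phk k) 1 w.
 move=> wr; elim: k => // -[_ _ _|k ih hj _].
  by rewrite !E// (ker_step r0 pc wr) expr1.
 rewrite ih//; last by move=> j /andP[j0 jk]; apply: hj; rewrite j0 ltnW.
 rewrite (ker_step r0 (phkc k.+1) wr) hj ?ltnSn// add0r mulrA -exprSr; congr (_ + _ * _).
 have E2 : (fun t => phk k.+1 t / (circ z r t - z) ^+ 1) = phk k.+2.
  by apply/funext => t; exact: div_exprS.
 by rewrite E2.
have [h|h] := pselect (exists k, ker z r (phk k.+1) 1 z != 0); last first.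
 left; have h0 j : (0 < j)%N -> ker z r (phk j) 1 z = 0.
  by case: j => // j _; apply/eqP/negP => /negP hj; apply: h; exists j.
 have [M M0 hM] := rcts_bounded (@pi2_ge0) pc. exists (r / 2); first by rewrite divr_gt0.
 move=> w wr2; have wr : nm (w - z) < r by apply: lt_trans wr2 _; rewrite ltr_pdivrMr// ltr_pMr// ltr1n.
 apply/eqP; rewrite -subr_eq0 -nm_eq0 eq_le nm_ge0 andbT; apply/ler_addgt0Pl => e e0; rewrite addr0.
 pose B := M / (r - nm (w - z)) * (2 * pi). have [k hk] := half_pow_small B e0. have k0 : B / 2 ^+ k.+1 <= e.
  apply: le_trans (ltW hk); rewrite ler_pM2l.
   by rewrite lef_pV2 ?posrE ?exprn_gt0// exprS ler_peMl ?exprn_ge0// ler1n.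
  by rewrite !mulr_gt0 ?invr_gt0 ?subr_gt0 ?pi_gt0.
 have Ew : H w = H z + (w - z) ^+ k.+1 * ker z r (phk k.+1) 1 w.
  by apply: expand => // j /andP[/h0].
 have r1 : 0 < r ^+ k.+1 by rewrite exprn_gt0.
 have : nm (ker z r (phk k.+1) 1 w) <= M / r ^+ k.+1 / (r - nm (w - z)) * (2 * pi - 0).
  apply: cint_le; [exact: ker_rcts|exact: pi2_ge0|].
  move=> t ht; rewrite /phk !nmM !nmV expr1 nmX (nm_circ _ _ (ltW r0)).
  apply: ler_pM; rewrite ?invr_ge0 ?mulr_ge0 ?nm_ge0 ?invr_ge0 ?(ltW r1)//.
   by rewrite ler_wpM2r ?invr_ge0 ?(ltW r1)// hM.
  rewrite lef_pV2 ?posrE ?subr_gt0 ?nm_gt0 ?(circ_neq r0)//; exact: circ_far.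
 rewrite subr0; move: Ew; set X := ker z r (phk k.+1) 1 w; clearbody X => -> hk2.
 rewrite addrAC subrr add0r nmM nmX; apply: le_trans k0. have w2 : nm (w - z) ^+ k.+1 <= (r / 2) ^+ k.+1.
  by rewrite lerXn2r ?nnegrE ?nm_ge0 ?divr_ge0 ?(ltW r0)// ltW.
 apply: le_trans (ler_pM _ _ w2 hk2) _; rewrite ?exprn_ge0 ?nm_ge0//.
 have -> : (r / 2) ^+ k.+1 * (M / r ^+ k.+1 / (r - nm (w - z)) * (2 * pi)) = B / 2 ^+ k.+1.
  rewrite expr_div_n /B; field. by rewrite !expf_neq0 ?gt_eqF// subr_gt0.
 exact: lexx.
right; have [k hk hmin] := ex_minnP h; exists k, (ker z r (phk k.+1) 1); split => //.
 by apply: ker_holo.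
apply: nearcS (nearc_lt zr) => w wr; apply: expand => // -[//|j] /andP[_ jk].
by apply/eqP/negP => /negP hj; have := hmin _ hj; rewrite leqNgt -ltnS jk.
Qed.
End CauchyFormula2.

(** * Orders of zeros and poles, the identity theorem and the maximum principle *)

Section LocalBehaviour.
Implicit Types (x y z w a c d : C) (r t s : R) (k l : int).

(* Functions are considered up to their values at isolated points. *)
Definition nearp z (P : C -> Prop) := nearc z (fun w => w != z -> P w).
Definition reg H z := exists2 g, holo g z & nearp z (fun w => H w = g w).
Definition ord H z k :=
 exists g, [/\ holo g z, g z != 0 & nearp z (fun w => H w = (w - z) ^ k * g w)].

Lemma nearpS z (P Q : C -> Prop) : (forall w, P w -> Q w) -> nearp z P -> nearp z Q.
Proof. by move=> h; apply: nearcS => w + wz => /(_ wz) /h. Qed.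
Lemma nearpS2 z (P Q S : C -> Prop) : (forall w, P w -> Q w -> S w) ->
 nearp z P -> nearp z Q -> nearp z S.
Proof. by move=> h; apply: nearcS2 => w + + wz => /(_ wz) p /(_ wz); exact: h. Qed.
Lemma nearpS3 z (P Q S T : C -> Prop) : (forall w, P w -> Q w -> S w -> T w) ->
 nearp z P -> nearp z Q -> nearp z S -> nearp z T.
Proof. by move=> h p q s; have := nearpS2 h p q; apply: nearpS2 s => w sw; apply. Qed.
Lemma nearc_p z (P : C -> Prop) : nearc z P -> nearp z P.
Proof. by apply: nearcS. Qed.
Lemma nearpT z (P : C -> Prop) : (forall w, P w) -> nearp z P.
Proof. by move=> h; apply: nearcT. Qed.
Lemma nearp_neq z : nearp z (fun w => w - z != 0).
Proof. by apply: nearcT => w; rewrite subr_eq0. Qed.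
Lemma nearp_open z (P : C -> Prop) : nearp z P -> nearp z (fun w => nearc w P).
Proof.
move=> /nearc_open; apply: nearcS => w h wz.
have d0 : 0 < nm (w - z) by rewrite nm_gt0 subr_eq0.
have : nearc w (fun v => v != z).
 exists (nm (w - z)) => // v; apply: contraTneq => ->; by rewrite nmB ltxx.
by apply: nearcS2 h => v; apply.
Qed.
Lemma nearp_ex z (P : C -> Prop) : nearp z P -> exists2 w, w != z & P w.
Proof.
case=> r r0 h; exists (z + (r / 2)%:C).
 by rewrite -subr_eq0 addrAC subrr add0r fmorph_eq0 gt_eqF// divr_gt0.
apply: h; first by rewrite addrAC subrr add0r nm_real gtr0_norm ?divr_gt0// ltr_pdivrMr// ltr_pMr// ltr1n.
by rewrite -subr_eq0 addrAC subrr add0r fmorph_eq0 gt_eqF// divr_gt0.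
Qed.

(** The device by which an identity known off isolated points is evaluated at one of them. *)
Lemma ccts_eq_at H K z : ccts H z -> ccts K z -> nearp z (fun w => H w = K w) -> H z = K z.
Proof.
move=> h k [r r0 hk]; apply/eqP; rewrite -subr_eq0 -nm_eq0 eq_le nm_ge0 andbT.
apply/ler_addgt0Pl => e e0; rewrite addr0; have e2 := half_pos e0.
have [d d0 hd] := h _ e2; have [d' d'0 hd'] := k _ e2.
have m0 : 0 < Num.min r (Num.min d d') by rewrite !lt_min r0 d0.
have [w wz] : exists2 w, w != z & nm (w - z) < Num.min r (Num.min d d').
 by apply: nearp_ex; exists (Num.min r (Num.min d d')).
rewrite !lt_min => /and3P[w1 w2 w3].
have E := hk _ w1 wz; have := hd _ w2; have := hd' _ w3.
have := nm_leD (H z - H w) (K w - K z).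
have -> : H z - H w + (K w - K z) = H z - K z by rewrite E; ring.
by rewrite (nmB (H z) (H w)) => h1 h2 h3; apply/ltW/(le_lt_trans h1); rewrite [e]splitr ltrD.
Qed.
Lemma reg_ext H K z : nearp z (fun w => H w = K w) -> reg H z -> reg K z.
Proof. by move=> hk [g hg E]; exists g => //; apply: nearpS2 hk E => w ->. Qed.
Lemma holo_reg H z : holo H z -> reg H z.
Proof. by move=> h; exists H => //; exact: nearpT. Qed.
Lemma reg_cst c z : reg (fun=> c) z.
Proof. exact/holo_reg/holo_cst. Qed.
Lemma regD H K z : reg H z -> reg K z -> reg (fun w => H w + K w) z.
Proof.
move=> [g hg E] [h hh F]; exists (fun w => g w + h w); first exact: holoD.
by apply: nearpS2 E F => w -> ->.
Qed.
Lemma regM H K z : reg H z -> reg K z -> reg (fun w => H w * K w) z.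
Proof.
move=> [g hg E] [h hh F]; exists (fun w => g w * h w); first exact: holoM.
by apply: nearpS2 E F => w -> ->.
Qed.
Lemma regN H z : reg H z -> reg (fun w => - H w) z.
Proof.
move=> [g hg E]; exists (fun w => - g w); first exact: holoN.
by apply: nearpS E => w ->.
Qed.
Lemma regB H K z : reg H z -> reg K z -> reg (fun w => H w - K w) z.
Proof. by move=> h /regN; exact: regD. Qed.
Lemma regX H z n : reg H z -> reg (fun w => H w ^+ n) z.
Proof.
move=> [g hg E]; exists (fun w => g w ^+ n); first exact: holoX.
by apply: nearpS E => w ->.
Qed.
Lemma ord_ext H K z k : nearp z (fun w => H w = K w) -> ord H z k -> ord K z k.
Proof.
by move=> hk [g [hg g0 E]]; exists g; split=> //; apply: nearpS2 hk E => w ->.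
Qed.
Lemma ord_neq0 H z k : ord H z k -> nearp z (fun w => H w != 0).
Proof.
move=> [g [hg g0 E]]; have gn := nearc_p (ccts_neq0 (holo_cts hg) g0).
apply: nearpS3 E gn (nearp_neq z) => w -> gw wz.
by rewrite mulf_neq0// expfz_neq0.
Qed.
Lemma ordM H K z k l : ord H z k -> ord K z l -> ord (fun w => H w * K w) z (k + l).
Proof.
move=> [g [hg g0 E]] [h [hh h0 F]]; exists (fun w => g w * h w); split.
- exact: holoM.
- by rewrite mulf_neq0.
by apply: nearpS3 E F (nearp_neq z) => w -> -> wz; rewrite expfzDr//; ring.
Qed.
Lemma ordV H z k : ord H z k -> ord (fun w => (H w)^-1) z (- k).
Proof.
move=> [g [hg g0 E]]; exists (fun w => (g w)^-1); split.
- exact: holoV.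
- by rewrite invr_eq0.
by apply: nearpS E => w ->; rewrite invfM invr_expz.
Qed.
Lemma holo_ord H z : holo H z -> H z != 0 -> ord H z 0.
Proof.
by move=> h h0; exists H; split => //; apply: nearpT => w; rewrite expr0z mul1r.
Qed.
Lemma ordX H z k n : ord H z k -> ord (fun w => H w ^+ n) z (k * n%:Z).
Proof.
move=> h; elim: n => [|n ih].
 rewrite mulr0; apply: ord_ext (holo_ord (holo_cst 1 z) (oner_neq0 _)). by apply: nearpT => w; rewrite expr0.
have -> : k * n.+1%:Z = k + k * n%:Z by rewrite intS mulrDr mulr1.
by apply: ord_ext (ordM h ih); apply: nearpT => w; rewrite exprS.
Qed.
Lemma ord_reg H z k : 0 <= k -> ord H z k -> reg H z.
Proof.
case: k => // n _ [g [hg g0 E]]; exists (fun w => (w - z) ^+ n * g w) => //.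
apply: holoM => //; apply: holoX; apply: holoB (holo_id z) (holo_cst z z).
Qed.
Lemma holo_dich H z : holo H z -> nearc z (fun w => H w = 0) \/ exists n : nat, ord H z n%:Z.
Proof.
move=> h; have [h0|h0] := eqVneq (H z) 0; last first.
 by right; exists 0%N; exact: holo_ord.
have [hz|[n [g [hg g0 E]]]] := holo_order h.
 by left; apply: nearcS hz => w ->.
right; exists n.+1, g; split => //; apply: nearc_p; apply: nearcS E => w.
by rewrite h0 add0r.
Qed.
Lemma ord_uniq_le H z k l : ord H z k -> ord H z l -> k <= l.
Proof.
move=> [g [hg g0 E]] [h [hh h0 F]]; rewrite leNgt; apply/negP => lk.
have [n hn] : exists n : nat, k - l = n.+1%:Z.
 case: (k - l) (subr_gt0 l k) => [[|n]|n]; rewrite lk //; by exists n.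
have Q : nearp z (fun w => h w = (w - z) ^+ n.+1 * g w).
 apply: nearpS3 E F (nearp_neq z) => w -> Ew wz. have wl : (w - z) ^ l != 0 by rewrite expfz_neq0.
 apply: (mulfI wl); rewrite -Ew mulrA; congr (_ * _). by rewrite exprnP -expfzDr// -hn subrKC.
have wc : ccts (fun w => (w - z) ^+ n.+1 * g w) z.
 by apply: holo_cts; apply: holoM => //; apply: holoX; apply: holoB (holo_id z) (holo_cst z z).
have := ccts_eq_at (holo_cts hh) wc Q; rewrite subrr expr0n mul0r => hz0.
by rewrite hz0 eqxx in h0.
Qed.
Lemma ord_uniq H z k l : ord H z k -> ord H z l -> k = l.
Proof. by move=> h h'; apply/eqP; rewrite eq_le (ord_uniq_le h h') (ord_uniq_le h' h). Qed.

Lemma cdiff_exprz w z k : w - z != 0 -> cdiff (fun v => (v - z) ^ k) w (k%:~R * (w - z) ^ (k - 1)).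
Proof.
move=> wz; have d1 : cdiff (fun v => v - z) w 1.
 by have := cdiffB (cdiff_id w) (cdiff_cst z w); rewrite subr0.
case: k => n.
 have := cdiffX n d1; rewrite mulr1 => h. have -> : (n%:~R : C) * (w - z) ^ (Posz n - 1) = n%:R * (w - z) ^+ n.-1.
  case: n {h} => [|n]; first by rewrite !mul0r. by have -> : n.+1%:Z - 1 = n%:Z by rewrite intS addrAC subrr add0r.
 exact: h.
have := @cdiffV (fun v => (v - z) ^+ n.+1) _ _ (expf_neq0 n.+1 wz) (cdiffX n.+1 d1); rewrite mulr1.
congr (cdiff _ _ _); rewrite NegzE -opprD -exprnN mulrNz.
rewrite addn1 mulNr mulNr; congr (- _).
rewrite /= !exprS; field; by rewrite wz expf_neq0.
Qed.

(** The order of H is the residue of its logarithmic derivative; orders of derivatives and the later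
    residue comparison rest on this form. *)
Lemma logderiv H z k : ord H z k ->
 exists2 h, holo h z & nearp z (fun w => cderiv H w / H w = k%:~R / (w - z) + h w).
Proof.
move=> [g [hg g0 E]]; exists (fun w => cderiv g w / g w).
 by apply: holoM; [exact: holo_deriv|exact: holoV].
have gn := nearc_p (ccts_neq0 (holo_cts hg) g0).
apply: nearpS3 (nearp_open (nearpS2 (fun w p q => conj p q) E (nearp_neq z))) (nearc_p hg) gn => w Ew gw gw0.
have [EE wz] := nearc_at Ew.
have hd : cdiff H w (k%:~R * (w - z) ^ (k - 1) * g w + (w - z) ^ k * cderiv g w).
 have := cdiffM (cdiff_exprz k wz) (cdiff_ex gw); apply: cdiff_ext. by apply: nearcS Ew => v [-> _].
rewrite (cdiff_cderiv hd) EE expfzDr// exprN1; field.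
by rewrite gw0 wz expfz_neq0.
Qed.

Lemma ord_deriv H z k : ord H z k -> k != 0 -> ord (cderiv H) z (k - 1).
Proof.
move=> Hk k0; have [h hh E] := logderiv Hk.
have L : ord (fun w => cderiv H w / H w) z (-1).
 exists (fun w => k%:~R + (w - z) * h w); split.
 - apply: holoD (holo_cst _ _) _; apply: holoM => //; exact: holoB (holo_id z) (holo_cst z z).
 - by rewrite subrr mul0r addr0 intr_eq0. by apply: nearpS2 E (nearp_neq z) => w -> wz; rewrite exprN1; field.
have := ordM L Hk; rewrite addrC; apply: ord_ext.
by apply: nearpS (ord_neq0 Hk) => w Hw; rewrite divfK.
Qed.

Lemma nearc_shift z a (P : C -> Prop) : nearc (z + a) P -> nearc z (fun w => P (w + a)).
Proof.
move=> [r r0 h]; exists r => // w wr; apply: h.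
by have -> : w + a - (z + a) = w - z by ring.
Qed.
Lemma nearc_opp z (P : C -> Prop) : nearc (- z) P -> nearc z (fun w => P (- w)).
Proof.
move=> [r r0 h]; exists r => // w wr; apply: h.
by rewrite -opprD nmN.
Qed.
Lemma nearp_shift z a (P : C -> Prop) : nearp (z + a) P -> nearp z (fun w => P (w + a)).
Proof. by move=> /nearc_shift; apply: nearcS => w + wz; apply; rewrite (inj_eq (addIr a)). Qed.
Lemma nearp_opp z (P : C -> Prop) : nearp (- z) P -> nearp z (fun w => P (- w)).
Proof. by move=> /nearc_opp; apply: nearcS => w + wz; apply; rewrite eqr_opp. Qed.
Lemma reg_shift H z a : reg H (z + a) -> reg (fun w => H (w + a)) z.
Proof.
move=> [g hg /nearp_shift E]; exists (fun w => g (w + a)) => //; exact: holo_shift.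
Qed.
Lemma ord_shift H z a k : ord H (z + a) k -> ord (fun w => H (w + a)) z k.
Proof.
move=> [g [hg g0 /nearp_shift E]]; exists (fun w => g (w + a)); split => //.
 exact: holo_shift.
apply: nearpS E => w ->.
by have -> : w + a - (z + a) = w - z by ring.
Qed.
Lemma ord_opp_arg H z k : ord H (- z) k -> ord (fun w => H (- w)) z k.
Proof.
move=> [g [hg g0 /nearp_opp E]]; exists (fun w => (- 1) ^ k * g (- w)); split => //.
- by apply: holoM (holo_cst _ _) _; exact: holo_opp_arg.
- by rewrite mulf_neq0// expfz_neq0// oppr_eq0 oner_eq0.
apply: nearpS E => w ->; have -> : - w - - z = (- 1) * (w - z) by ring.
by rewrite expfzMl mulrCA mulrA.
Qed.
(** True even where H is not differentiable: the two difference quotients are then the same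
    function, so the default values agree. *)
Lemma cderiv_shift H z a : cderiv (fun w => H (w + a)) z = cderiv H (z + a).
Proof.
have [h|h] := pselect (exists d, cdiff H (z + a) d).
 by rewrite (cdiff_cderiv (cdiff_shift (cdiff_ex h))).
rewrite /cderiv /derive1.
have -> : (fun h : C^o => h^-1 *: ((H (h + z + a) : C^o) - H (z + a))) =
 (fun h : C^o => h^-1 *: ((H (h + (z + a)) : C^o) - H (z + a))). by apply/funext => e; rewrite addrA.
by [].
Qed.

(** Identity theorem. Along the segment from z0 to z, the indicator of H vanishing near the point is
    locally constant, so it has derivative 0 and is constant. *)
Lemma zero_or_nonzero H : (forall z, nearp z (fun w => H w = 0) \/ nearp z (fun w => H w != 0)) ->
 forall z0, nearp z0 (fun w => H w = 0) -> forall z, nearp z (fun w => H w = 0).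
Proof.
move=> dich z0 hz0 z.
pose chi (t : R) : R := if `[< nearp (z0 + t%:C * (z - z0)) (fun w => H w = 0) >] then 1 else 0.
have loc v : nearc v (fun w => nearp w (fun u => H u = 0) <-> nearp v (fun u => H u = 0)).
 have [h|h] := dich v.
  have := nearp_open h; apply: nearcS => w; have [->//|wv] := eqVneq w v.
  by move=> /(_ isT) hw; split=> // _; exact: nearc_p.
 have nh : ~ nearp v (fun u => H u = 0).
  by move=> h'; have [w _ [/eqP]] := nearp_ex (nearpS2 (fun w p q => conj p q) h h').
 have := nearp_open h; apply: nearcS => w; have [->//|wv] := eqVneq w v. move=> /(_ isT) hw; split=> // hw'.
 by have [u _ [/eqP]] := nearp_ex (nearpS2 (fun w p q => conj p q) (nearc_p hw) hw').
have chid t : is_derive t 1 chi 0.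
 apply/is_derive_eps => e e0; have [r r0 hr] := loc (z0 + t%:C * (z - z0)).
 have [d d0 hd] := rdiff_cts (rdiff_line z0 (z - z0) t) r0. exists d => // s /hd /hr h; rewrite mul0r subr0.
 have -> : chi s = chi t by rewrite /chi; congr (if _ then _ else _); exact: asbool_equiv_eq.
 by rewrite subrr normr0 mulr_ge0// ltW.
have := is_derive_0_is_cst 0 1 chid; rewrite /chi mul0r addr0 mul1r subrKC.
by rewrite asboolT//; case: asboolP => // _ /eqP; rewrite oner_eq0.
Qed.

(* A nonconstant holomorphic function takes values of larger modulus in every
  direction where the first nonconstant Taylor term is aligned with the constant one. *)
Lemma local_max_const H z : holo H z -> nearc z (fun w => nm (H w) <= nm (H z)) ->
 nearc z (fun w => H w = H z).
Proof.
move=> hH hmax; have [//|[k [g [hg g0 E]]]] := holo_order hH; exfalso.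
have gn := ccts_neq0 (holo_cts hg) g0.
have [Hz|Hz] := eqVneq (H z) 0.
 have [w wz [[e1 e2] e3]] := nearp_ex (nearc_p (nearcS2 (fun w p q => conj p q) (nearcS2 (fun w p q => conj p q) E hmax) gn)) .
 move: e2; rewrite Hz nm0 le_eqVlt ltNge nm_ge0 orbF nm_eq0 e1 Hz add0r mulf_eq0 (negPf e3) orbF.
 by rewrite expf_eq0/= subr_eq0 (negPf wz).
pose v := k.+1.-root (H z / g z).
have vk : v ^+ k.+1 = H z / g z by rewrite rootCK.
have v0 : v != 0.
 have : v ^+ k.+1 != 0 by rewrite vk mulf_neq0// invr_eq0. by rewrite expf_eq0.
have gz : 0 < nm (g z) / 2 by rewrite divr_gt0// nm_gt0.
have [r [r0 hr]] : exists r, 0 < r /\ forall w, nm (w - z) < r ->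
  [/\ H w = H z + (w - z) ^+ k.+1 * g w, nm (H w) <= nm (H z) & nm (g w - g z) < nm (g z) / 2].
 have [r1 r10 h1] := E; have [r2 r20 h2] := hmax; have [r3 r30 h3] := holo_cts hg gz.
 exists (Num.min r1 (Num.min r2 r3)); split; first by rewrite !lt_min r10 r20.
 by move=> w; rewrite !lt_min => /and3P[/h1 ? /h2 ? /h3].
have nv : 0 < nm v by rewrite nm_gt0.
pose e := Num.min 1 (r / 2 / nm v).
have e0 : 0 < e by rewrite lt_min ltr01 !divr_gt0.
have er : nm (z + e%:C * v - z) < r.
 rewrite addrAC subrr add0r nmM nm_real gtr0_norm//.
 apply: (@le_lt_trans _ _ (r / 2)); last by rewrite ltr_pdivrMr// ltr_pMr// ltr1n.
 by rewrite -ler_pdivlMr// ge_min lexx orbT.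
have [h1 h2 h3] := hr _ er.
pose q := (g (z + e%:C * v) - g z) / g z.
have q2 : nm q <= 1 / 2.
 by rewrite nmM nmV ler_pdivrMr ?nm_gt0// mul1r [leRHS]mulrC; exact: ltW.
have Hw : H (z + e%:C * v) = H z * ((1 + (e ^+ k.+1)%:C) + (e ^+ k.+1)%:C * q).
 rewrite h1 (_ : z + e%:C * v - z = e%:C * v); last by ring. by rewrite exprMn vk rmorphXn /q; field.
have ek : 0 < e ^+ k.+1 by rewrite exprn_gt0.
have : 1 < nm ((1 + (e ^+ k.+1)%:C) + (e ^+ k.+1)%:C * q).
 have := nm_leD ((1 + (e ^+ k.+1)%:C) + (e ^+ k.+1)%:C * q) (- ((e ^+ k.+1)%:C * q)).
 rewrite addrK nmN nmM nm_real gtr0_norm//.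
 have -> : 1 + (e ^+ k.+1)%:C = (1 + e ^+ k.+1)%:C :> C by rewrite rmorphD rmorph1.
 rewrite nm_real gtr0_norm; last by rewrite addr_gt0.
 have := ler_wpM2l (ltW ek) q2; move: ek; set y := e ^+ k.+1; set x := nm _; set u := nm q. move=> *; lra.
by move: h2; rewrite Hw nmM -[leRHS]mulr1 ler_pM2l ?nm_gt0// leNgt => /negbTE ->.
Qed.
End LocalBehaviour.

(** * The lattice and Liouville's theorem *)

Section Lattice.
Implicit Types (x y z w a b c d : C) (t s : R).

Lemma cont2P (f : R * R -> R) p : {for p, continuous f} <-> forall e : R, 0 < e ->
 exists2 d : R, 0 < d & forall q, `|q.1 - p.1| < d -> `|q.2 - p.2| < d -> `|f q - f p| < e.
Proof.
split=> [/cvgrPdist_lt h e /h /nbhs_ballP[d /= d0 hd]|h].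
 exists d => // q q1 q2; rewrite distrC; apply: hd; split => /=;
  by rewrite /ball/= distrC.
apply/cvgrPdist_lt => e /h[d d0 hd].
apply: (@filterS _ (nbhs p) _ (ball p d)) (nbhsx_ballx p d d0) => q [q1 q2].
by rewrite distrC; apply: hd; rewrite distrC; [exact: q1|exact: q2].
Qed.

Variables (w1 w2 : C) (tau : 0 < Im (w2 / w1)).
Local Notation L := (lattice w1 w2).

Lemma w1_neq0 : w1 != 0.
Proof. by apply: contraTneq tau => ->; rewrite invr0 mulr0 ltxx. Qed.
Lemma lat0 : L 0. Proof. by exists 0, 0; rewrite !mul0r addr0. Qed.
Lemma latD x y : L x -> L y -> L (x + y).
Proof. by move=> [m [n ->]] [p [q ->]]; exists (m + p), (n + q); rewrite !rmorphD/=; ring. Qed.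
Lemma latN x : L x -> L (- x).
Proof. by move=> [m [n ->]]; exists (- m), (- n); rewrite !rmorphN/=; ring. Qed.
Lemma latB x y : L x -> L y -> L (x - y).
Proof. by move=> hx /latN; exact: latD. Qed.
Lemma lat_w1 : L w1. Proof. by exists 1, 0; rewrite mul1r mul0r addr0. Qed.
Lemma lat_w2 : L w2. Proof. by exists 0, 1; rewrite mul1r mul0r add0r. Qed.
Lemma latNE x : L (- x) <-> L x.
Proof. by split=> /latN; rewrite ?opprK. Qed.
Lemma latDr x y : L y -> L (x + y) <-> L x.
Proof. by move=> hy; split=> [/latB/(_ hy)|/latD]; rewrite ?addrK//; apply. Qed.

Definition rpt (s t : R) : C := s%:C * w1 + t%:C * w2.

Lemma coords z : exists s t, z = rpt s t.
Proof.
have w10 := w1_neq0; pose t := Im (z / w1) / Im (w2 / w1).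
pose s := Re (z / w1) - t * Re (w2 / w1).
exists s, t; rewrite /rpt.
have -> : z = (z / w1) * w1 by rewrite divfK.
have -> : t%:C * w2 = (t%:C * (w2 / w1)) * w1 by rewrite mulrA divfK.
rewrite -mulrDl; congr (_ * _); rewrite /s.
have E : Im (z / w1) = t * Im (w2 / w1) by rewrite divfK// gt_eqF.
move: E; case: (z / w1) => p q; case: (w2 / w1) => u v /= ->.
by apply/eqP; rewrite eq_complex/=; apply/andP; split; apply/eqP; ring.
Qed.

(** Equivalence of norms on the plane. Uniqueness of coordinates, discreteness of the lattice,
    convergence of the lattice sums and the radius of the cut-off all come from this constant. *)
Lemma coord_bound : exists2 K : R, 0 < K & forall s t, `|s| + `|t| <= K * nm (rpt s t).
Proof.
have w10 := w1_neq0; have n0 : 0 < nm w1 by rewrite nm_gt0.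
pose tu := w2 / w1; pose v := Im tu; have v0 : 0 < v by [].
exists ((1 + (nm tu + 1) / v) / nm w1).
 by rewrite divr_gt0// addr_gt0// divr_gt0// ltr_wpDl ?nm_ge0.
move=> s t; pose u := s%:C + t%:C * tu.
have -> : rpt s t = u * w1 by rewrite /rpt /u mulrDl -mulrA divfK.
rewrite nmM [nm u * _]mulrC mulrA divfK ?gt_eqF//.
have Et : t * v = Im u by rewrite /u /v; case: (tu) => a b /=; ring.
have ht : `|t| <= nm u / v.
 by rewrite ler_pdivlMr// -[v in leLHS](gtr0_norm v0) -normrM Et Im_le_nm.
have hs : `|s| <= nm u + `|t| * nm tu.
 have := nm_leD u (- (t%:C * tu)); rewrite /u addrK nmN nmM !nm_real; exact.
have := ler_wpM2r (nm_ge0 tu) ht; move: hs ht.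
have -> : (1 + (nm tu + 1) / v) * nm u = nm u + nm u / v * nm tu + nm u / v by field; rewrite gt_eqF.
by move: (`|s|) (`|t|) (nm u / v) (nm u) (nm tu) => a b c d e *; lra.
Qed.

Lemma rpt_inj s t s' t' : rpt s t = rpt s' t' -> s = s' /\ t = t'.
Proof.
move=> E; have [K K0 /(_ (s - s') (t - t'))] := coord_bound.
have -> : rpt (s - s') (t - t') = 0.
 by move/eqP: E; rewrite -subr_eq0 => /eqP <-; rewrite /rpt !rmorphB/=; ring.
rewrite nm0 mulr0 => h; have := normr_ge0 (s - s'); have := normr_ge0 (t - t') => h1 h2.
have e1 : `|s - s'| = 0 by lra.
have e2 : `|t - t'| = 0 by lra.
by move/eqP: e1; move/eqP: e2; rewrite !normr_eq0 !subr_eq0 => /eqP -> /eqP ->.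
Qed.
Lemma rpt_int (m n : int) : rpt m%:~R n%:~R = m%:~R * w1 + n%:~R * w2.
Proof. by rewrite /rpt !rmorph_int. Qed.

Lemma lat_discrete : exists2 d : R, 0 < d & forall x, L x -> x != 0 -> d <= nm x.
Proof.
have [K K0 hK] := coord_bound; exists K^-1; first by rewrite invr_gt0.
move=> x [m [n ->]] x0; rewrite -(ler_pM2l K0) divff ?gt_eqF// -rpt_int.
apply: le_trans (hK _ _); rewrite -!intr_norm -intrD (ler_int _ 1).
have : (m != 0) || (n != 0).
 by rewrite -negb_and; apply: contra x0 => /andP[/eqP -> /eqP ->]; rewrite !mul0r addr0.
case/orP; rewrite -normr_gt0 gtz0_ge1 => h; apply: le_trans h _; first by rewrite lerDl.
by rewrite lerDr.
Qed.

Lemma lat_reduce z : exists l s t, [/\ L l, 0 <= s < 1, 0 <= t < 1 & z = rpt s t + l].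
Proof.
have [s [t ->]] := coords z.
exists (rpt (Num.floor s)%:~R (Num.floor t)%:~R), (s - (Num.floor s)%:~R), (t - (Num.floor t)%:~R).
split.
- by rewrite rpt_int; exists (Num.floor s), (Num.floor t).
- by rewrite subr_ge0 ge_floor ltrBlDl -intrD1 lt_succ_floor.
- by rewrite subr_ge0 ge_floor ltrBlDl -intrD1 lt_succ_floor.
by rewrite /rpt !rmorphB/=; ring.
Qed.

Lemma lat_near z : nearp z (fun w => ~ L w).
Proof.
have [d d0 hd] := lat_discrete.
have uniq v w : nm (v - z) < d / 2 -> nm (w - z) < d / 2 -> L v -> L w -> w = v.
 move=> vz wz Lv Lw; apply/eqP; rewrite -subr_eq0; apply: contraT => n0.
 have := hd _ (latB Lw Lv) n0; have := nm_leD (w - z) (z - v). by rewrite addrA subrK (nmB z); lra.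
have d2 : 0 < d / 2 by rewrite divr_gt0.
have [[v [vd vz Lv]]|h] := pselect (exists v, [/\ nm (v - z) < d / 2, v != z & L v]); last first.
 by exists (d / 2) => // w wr wz Lw; apply: h; exists w.
exists (nm (v - z)); first by rewrite nm_gt0 subr_eq0.
move=> w wr wz Lw; have E := uniq v w vd (lt_trans wr vd) Lv Lw.
by rewrite E ltxx in wr.
Qed.

Lemma per_lat (T : Type) (F : C -> T) : (forall z, F (z + w1) = F z) -> (forall z, F (z + w2) = F z) ->
 forall z l, L l -> F (z + l) = F z.
Proof.
have mult (v : C) : (forall z, F (z + v) = F z) -> forall (m : int) z, F (z + m%:~R * v) = F z.
 move=> hv; have pos (n : nat) z : F (z + n%:R * v) = F z.
  elim: n => [|n ih]; first by rewrite mul0r addr0. by rewrite -natr1 mulrDl mul1r addrA hv ih.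
 case=> n z; first exact: pos. rewrite NegzE -[LHS](pos n.+1). by congr F; rewrite mulrNz; ring.
move=> h1 h2 z l [m [n ->]]; rewrite addrA mult// mult//.
Qed.

(** The holomorphic representative of H attains its maximal modulus on the compact parallelogram, so
    it is constant near that point by [local_max_const], and then everywhere by the identity
    theorem. *)
Lemma liouville H : (forall z, reg H z) -> (forall z, H (z + w1) = H z) -> (forall z, H (z + w2) = H z) ->
 exists c, forall z, nearp z (fun w => H w = c).
Proof.
move=> hreg p1 p2.
have /choice[g hg] : forall z, exists f, holo f z /\ nearp z (fun w => H w = f w).
 by move=> z; have [f hf E] := hreg z; exists f.
(* Each local representative is evaluated at its own centre; [Kg] shows that any other
   representative gives the same value there, so the glued K is holomorphic and periodic. *)
pose K z := g z z.
have Kg z f : holo f z -> nearp z (fun w => H w = f w) -> K z = f z.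
 move=> hf E; have [h1 h2] := hg z; apply: ccts_eq_at (holo_cts h1) (holo_cts hf) _.
 by apply: nearpS2 h2 E => w -> ->.
have HK z : nearp z (fun w => H w = K w).
 have [h1 h2] := hg z. apply: nearpS3 (nearp_open h2) (nearc_p (holo_near h1)) h2 => w E hw ->.
 by symmetry; apply: Kg => //; exact: nearc_p.
have Kh z : holo K z.
 have [h1 h2] := hg z; apply: holo_ext h1.
 have := nearpS2 (fun w p q => etrans (esym p) q) h2 (HK z); apply: nearcS => w h. by have [->|/h] := eqVneq w z.
have per v : (forall z, H (z + v) = H z) -> forall z, K (z + v) = K z.
 move=> pv z; symmetry; have [h1 h2] := hg (z + v).
 rewrite (Kg z (fun w => g (z + v) (w + v)))//; first exact: holo_shift.
 by apply: nearpS (nearp_shift h2) => w; rewrite pv.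
have Kper := per_lat (per _ p1) (per _ p2).
pose phi (p : R * R) := nm (K (rpt p.1 p.2)).
have phic : continuous phi.
 move=> p; apply/cont2P => e e0; have [d d0 hd] := holo_cts (Kh (rpt p.1 p.2)) e0.
 have M0 : 0 < nm w1 + nm w2 + 1 by rewrite ltr_wpDl// addr_ge0 ?nm_ge0.
 exists (d / (nm w1 + nm w2 + 1)); first by rewrite divr_gt0.
 move=> q q1 q2; apply: le_lt_trans (nm_dist _ _) _; apply: hd.
 have -> : rpt q.1 q.2 - rpt p.1 p.2 = (q.1 - p.1)%:C * w1 + (q.2 - p.2)%:C * w2.
  by rewrite /rpt !rmorphB; ring.
 apply: le_lt_trans (nm_leD _ _) _; rewrite !nmM !nm_real.
 have h1 := ler_wpM2r (nm_ge0 w1) (ltW q1); have h2 := ler_wpM2r (nm_ge0 w2) (ltW q2).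
 apply: le_lt_trans (lerD h1 h2) _; rewrite -mulrDr mulrAC ltr_pdivrMr//. by rewrite ltr_pM2l// ltrDl.
have [[s0 t0] _ hmax] : exists2 p, p \in (`[0, 1] `*` `[0, 1])%classic & forall q, q \in (`[0, 1] `*` `[0, 1])%classic -> phi q <= phi p.
 apply: compact_EVT_max.
 - by exists (0, 0); split; rewrite /= in_itv/= lexx ler01.
 - by apply: compact_setX; exact: segment_compact. exact: continuous_subspaceT.
pose z0 := rpt s0 t0.
have gmax z : nm (K z) <= nm (K z0).
 have [l [s [t [Ll /andP[s0' s1] /andP[t0' t1] ->]]]] := lat_reduce z; rewrite Kper//.
 by apply: (hmax (s, t)); apply/mem_set; split; rewrite /= in_itv/= ?s0' ?t0' ltW.
have lc := local_max_const (Kh z0) (nearcT z0 gmax).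
exists (K z0) => z.
have := @zero_or_nonzero (fun w => K w - K z0) _ z0 _ z => h.
have Z : nearp z (fun w => K w - K z0 = 0).
 apply: h.
  move=> w; have [hw|[n hw]] := holo_dich (holoB (Kh w) (holo_cst (K z0) w)).
   by left; exact: nearc_p.
  by right; exact: ord_neq0 hw.
 by apply: nearc_p; apply: nearcS lc => w ->; rewrite subrr.
by apply: nearpS2 (HK z) Z => w -> /eqP; rewrite subr_eq0 => /eqP.
Qed.

(* Meromorphic on C, as a function known up to isolated points. *)
Definition mero H := forall z, nearp z (fun w => H w = 0) \/ exists k, ord H z k.

Lemma mero_zero H z0 : mero H -> nearp z0 (fun w => H w = 0) -> forall z, nearp z (fun w => H w = 0).
Proof.
move=> hm; apply: zero_or_nonzero => z; have [h|[k h]] := hm z; first by left.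
by right; exact: ord_neq0 h.
Qed.
End Lattice.

(** * Unconditional sums of complex families *)

Section UnconditionalSums.
Implicit Types (u v a b c s t : C) (x y : C -> C) (A B : {fset C}).

(** A relation instead of the total function [summability.sum], so that convergence travels along
    with the value. *)
Definition has_sum x s := forall e : R, 0 < e -> exists A0, forall A, (A0 `<=` A)%fset ->
 nm (\sum_(i <- A) x i - s) < e.

Lemma has_sum_sum x s : has_sum x s -> summability.sum (x : C -> C^o) = s.
Proof.
move=> h; apply: cvg_lim; [exact: norm_hausdorff|exact: summability.totally_filter|].
have FF : Filter (@summability.totally C) by exact: summability.totally_filter.
have P := @cvg_nmP _ summability.totally FF (summability.partial_sum (x : C -> C^o)) s.
apply/P => e /h[A0 hA]; exists A0 => // A /= /hA.
by rewrite /summability.partial_sum (big_seq_fsetE _ _ xpredT).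
Qed.

Lemma has_sum_uniq x s t : has_sum x s -> has_sum x t -> s = t.
Proof.
move=> h k; apply/eqP; rewrite -subr_eq0 -nm_eq0 eq_le nm_ge0 andbT.
apply/ler_addgt0Pl => e e0; rewrite addr0; have e2 := half_pos e0.
have [A hA] := h _ e2; have [B hB] := k _ e2.
have := hA _ (fsubsetUl A B); have := hB _ (fsubsetUr A B).
set S := \sum_(_ <- _) _; have := nm_distD S s t; rewrite (nmB s S).
by move=> h1 h2 h3; apply/ltW/(le_lt_trans h1); rewrite [e]splitr ltrD.
Qed.

Lemma has_sumD x y s t : has_sum x s -> has_sum y t -> has_sum (fun i => x i + y i) (s + t).
Proof.
move=> h k e e0; have e2 := half_pos e0.
have [A hA] := h _ e2; have [B hB] := k _ e2; exists (A `|` B)%fset => D; rewrite fsubUset => /andP[/hA h1 /hB h2].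
rewrite big_split/= opprD addrACA; apply: le_lt_trans (nm_leD _ _) _.
by rewrite [e]splitr ltrD.
Qed.

Lemma has_sumZ x s c : has_sum x s -> has_sum (fun i => c * x i) (c * s).
Proof.
move=> h e e0; have c0 : 0 < nm c + 1 by rewrite ltr_wpDl ?nm_ge0.
have [A hA] := h _ (divr_gt0 e0 c0); exists A => B /hA; rewrite -mulr_sumr -mulrBr nmM ltr_pdivlMr//.
by apply: le_lt_trans; rewrite mulrC ler_wpM2l ?nm_ge0// lerDl.
Qed.

Lemma has_sum_single a c : has_sum (fun i => if i == a then c else 0) c.
Proof.
move=> e e0; exists [fset a]%fset => A; rewrite fsub1set => aA.
rewrite (big_fsetD1 a)//= eqxx big1_seq ?addr0 ?subrr ?nm0// => i /andP[_].
by rewrite !inE => /andP[/negPf ->].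
Qed.

Lemma has_sum_le x s (M : R) : has_sum x s -> (forall A, \sum_(i <- A) nm (x i) <= M) -> nm s <= M.
Proof.
move=> h hM; apply/ler_addgt0Pl => e e0; have [A hA] := h _ e0.
have := hA A (fsubset_refl A); set S := \sum_(_ <- _) _ => h1.
have h2 : nm S <= M.
 apply: le_trans (hM A); rewrite /S; elim/big_ind2 : _ => [|u a v b h3 h4|//]; first by rewrite nm0.
 by apply: le_trans (nm_leD _ _) _; exact: lerD.
have := nm_leD (s - S) S; rewrite subrK (nmB s) => /le_trans; apply.
by rewrite lerD// ltW.
Qed.

Lemma has_sum_reindex x s (f g : C -> C) : cancel f g -> cancel g f -> has_sum x s -> has_sum (fun i => x (f i)) s.
Proof.
move=> fg gf h e e0; have [A hA] := h _ e0; exists [fset g i | i in A]%fset => B hB.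
have := hA [fset f i | i in B]%fset; have -> : (A `<=` [fset f i | i in B])%fset.
 apply/fsubsetP => i iA; apply/imfsetP; exists (g i); rewrite ?gf//=.
 by apply: (fsubsetP hB); apply/imfsetP; exists i.
move=> /(_ isT); rewrite big_imfset//= => i j _ _ /(congr1 g); by rewrite !fg.
Qed.

Lemma has_sum_ge0 (x : C -> R) (M : R) : (forall i, 0 <= x i) -> (forall A, \sum_(i <- A) x i <= M) ->
 exists s : R, has_sum (fun i => (x i)%:C) s%:C.
Proof.
move=> x0 hM; pose S := [set \sum_(i <- (A : {fset C})) x i | A in [set: {fset C}]].
have hs : has_sup S.
 by split; [exists (\sum_(i <- (fset0 : {fset C})) x i), fset0|exists M => _ [A _ <-]].
exists (sup S) => e e0; have [_ [A _ <-] hA] := sup_adherent e0 hs.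
exists A => B AB; rewrite -rmorph_sum -rmorphB nm_real distrC ger0_norm.
 rewrite ltrBlDr -ltrBlDl; apply: lt_le_trans hA _.
 rewrite [leRHS](bigID (mem A))/= -[leLHS]addr0; apply: lerD; last exact: sumr_ge0.
 rewrite le_eqVlt; apply/orP; left; apply/eqP; rewrite -[RHS]big_filter; apply: perm_big.
 apply: uniq_perm; rewrite ?filter_uniq ?fset_uniq// => i; rewrite mem_filter.
 by have := fsubsetP AB i; case: (i \in A) => //= ->.
by rewrite subr_ge0; apply: ub_le_sup; [case: hs|exists B].
Qed.

(** Real and imaginary parts are treated separately; a real term y is (|y| + y) - |y|, a difference
    of two nonnegative families with bounded sums. *)
Lemma has_sum_abs x (M : R) : (forall A, \sum_(i <- A) nm (x i) <= M) -> exists s, has_sum x s.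
Proof.
move=> hM.
have real (y : C -> R) : (forall i, `|y i| <= nm (x i)) -> exists s : R, has_sum (fun i => (y i)%:C) s%:C.
 move=> hy. have [p hp] : exists s : R, has_sum (fun i => (`|y i| + y i)%:C) s%:C.
  apply: (@has_sum_ge0 _ (M + M)) => [i|A]; first by rewrite -lerBlDr sub0r ler_normr lexx orbT.
  rewrite big_split/=; apply: lerD; apply: le_trans (hM A); apply: ler_sum => i _ //.
  exact: le_trans (ler_norm _) (hy i).
 have [q hq] : exists s : R, has_sum (fun i => (`|y i|)%:C) s%:C.
  by apply: (@has_sum_ge0 _ M) => // A; apply: le_trans (hM A); apply: ler_sum.
 exists (p - q); have := has_sumD hp (has_sumZ (- 1) hq); rewrite mulN1r -rmorphB.
 congr (has_sum _ _); apply/funext => i; rewrite rmorphD/=; ring.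
have [p hp] := real (Re \o x) (fun i => Re_le_nm (x i)).
have [q hq] := real (Im \o x) (fun i => Im_le_nm (x i)).
exists (p%:C + 'i * q%:C); have := has_sumD hp (has_sumZ 'i hq).
by congr (has_sum _ _); apply/funext => i /=; rewrite [in RHS](complexE (x i)).
Qed.

Lemma uniq_sum_le (I J : eqType) (s : seq I) (t : seq J) (h : I -> J) (F : J -> R) :
 (forall j, 0 <= F j) -> uniq s -> uniq t -> {in s &, injective h} -> {subset map h s <= t} ->
 \sum_(i <- s) F (h i) <= \sum_(j <- t) F j.
Proof.
move=> F0 us ut hi st; have um : uniq (map h s) by rewrite map_inj_in_uniq.
rewrite -(big_map h xpredT F) [leRHS](bigID (mem (map h s)))/= -[leLHS]addr0.
apply: lerD; last exact: sumr_ge0.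
rewrite le_eqVlt; apply/orP; left; apply/eqP; rewrite -[RHS]big_filter; apply: perm_big.
apply: uniq_perm; rewrite ?filter_uniq// => j; rewrite mem_filter.
by have := st j; case: (j \in map h s) => //= ->.
Qed.

(** The number (k+1)^(-3/2). A product of two such terms, one for each lattice coordinate, majorizes
    the inverse cube of the modulus. *)
Definition g32 (k : nat) : R := (k.+1%:R * Num.sqrt k.+1%:R)^-1.

(** The right side is 1 plus the integral of x^(-3/2) from 1 to N + 1; this sharper form closes the
    induction, while the bound 3 alone would not. *)
Lemma sum_g32 N : \sum_(k <- iota 0 N.+1) g32 k <= 3 - 2 / Num.sqrt N.+1%:R.
Proof.
elim: N => [|N ih]; first by rewrite big_seq1 /g32 sqrtr1 mulr1 invr1; lra.
rewrite -[N.+2]addn1 iotaD big_cat big_seq1 add0n.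
apply: le_trans (lerD ih (lexx _)) _; rewrite /g32 addn1.
set r := Num.sqrt N.+1%:R; set s := Num.sqrt N.+2%:R.
have r0 : 0 < r by rewrite sqrtr_gt0 ltr0n.
have s0 : 0 < s by rewrite sqrtr_gt0 ltr0n.
have rr : r ^+ 2 = N.+1%:R by rewrite sqr_sqrtr// ler0n.
have ss : s ^+ 2 = r ^+ 2 + 1 by rewrite rr sqr_sqrtr -natr1.
have -> : N.+2%:R = s ^+ 2 by rewrite sqr_sqrtr.
have E : 3 - 2 / s - (3 - 2 / r + (s ^+ 2 * s)^-1) = (2 * s ^+ 2 * (s - r) - r) / (r * s ^+ 3).
 by field; rewrite !gt_eqF.
rewrite -subr_ge0 E; apply: divr_ge0; last by rewrite mulr_ge0 ?exprn_ge0// ltW.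
have sr : (s - r) * (s + r) = 1 by rewrite -subr_sqr ss; ring.
rewrite -(pmulr_lge0 _ (_ : 0 < s + r)); last exact: addr_gt0.
have -> : (2 * s ^+ 2 * (s - r) - r) * (s + r) = 2 * s ^+ 2 * ((s - r) * (s + r)) - r * (s + r) by ring.
rewrite sr mulr1; nra.
Qed.

Lemma sum_g32_le3 N : \sum_(k <- iota 0 N) g32 k <= 3.
Proof.
case: N => [|N]; first by rewrite big_nil.
by apply: le_trans (sum_g32 N) _; rewrite lerBlDr lerDl divr_ge0// sqrtr_ge0.
Qed.
End UnconditionalSums.

(** * A summable majorant on the lattice *)

Section LatticeWeights.
Variables (w1 w2 : C) (tau : 0 < Im (w2 / w1)).
Local Notation L := (lattice w1 w2).

Definition weight (w : C) : R := if w \in L then ((1 + nm w) ^+ 3)^-1 else 0.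

Lemma weight_ge0 w : 0 <= weight w.
Proof. by rewrite /weight; case: ifP => // _; rewrite invr_ge0 exprn_ge0// addr_ge0// nm_ge0. Qed.

(** If w has coordinates m and n, then (|m|+1)^(3/2) (|n|+1)^(3/2) is at most a constant times (1 +
    |w|)^3, so the sum is dominated by a product of two single sums. A coordinate is coded by its
    absolute value and a sign bit, which doubles each single sum: hence the factors 2 * 3. *)
Lemma weight_sum : exists2 M : R, 0 <= M & forall A : {fset C}, \sum_(w <- A) weight w <= M.
Proof.
have [K K0 hK] := coord_bound tau.
have /choice[co hco] : forall w : C, exists mn : int * int, L w -> w = mn.1%:~R * w1 + mn.2%:~R * w2.
 move=> w; have [[m [n ->]]|h] := pselect (L w); first by exists (m, n). by exists (0, 0).
pose h w := ((`|(co w).1|%N, 0 <= (co w).1), (`|(co w).2|%N, 0 <= (co w).2)).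
pose F (p : (nat * bool) * (nat * bool)) : R := (1 + K) ^+ 3 * (g32 p.1.1 * g32 p.2.1).
have g0 k : 0 <= g32 k by rewrite invr_ge0 mulr_ge0.
have K1 : 0 <= 1 + K by rewrite addr_ge0// ltW.
have F0 p : 0 <= F p by rewrite !mulr_ge0.
have wF w : L w -> weight w <= F (h w).
 move=> Lw; rewrite /weight mem_set// /F /h /=; have := hK (co w).1%:~R (co w).2%:~R.
 rewrite rpt_int -(hco _ Lw) -!intr_norm -!natr_absz; set m := `|_|%N; set n := `|_|%N => hmn.
 have N0 := nm_ge0 w; set X := 1 + nm w; have X0 : 0 < X by rewrite /X; lra.
 have a1 : m.+1%:R <= (1 + K) * X by rewrite -natr1 /X; have := ler0n R n; nra.
 have a2 : n.+1%:R <= (1 + K) * X by rewrite -natr1 /X; have := ler0n R m; nra.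
 rewrite /g32; set p := m.+1%:R; set q := n.+1%:R. have p0 : 0 < p by rewrite ltr0n.
 have q0 : 0 < q by rewrite ltr0n. have sp : Num.sqrt p * Num.sqrt q <= (1 + K) * X.
  rewrite -(@ler_pXn2r _ 2)// ?nnegrE ?mulr_ge0 ?(ltW X0)// exprMn !sqr_sqrtr ?(ltW p0) ?(ltW q0)//.
  by rewrite expr2; apply: ler_pM; rewrite ?(ltW p0) ?(ltW q0).
 have P0 : 0 < p * Num.sqrt p * (q * Num.sqrt q) by rewrite !mulr_gt0// sqrtr_gt0.
 have PX : p * Num.sqrt p * (q * Num.sqrt q) <= (1 + K) ^+ 3 * X ^+ 3.
  rewrite -exprMn (_ : p * _ * _ = p * q * (Num.sqrt p * Num.sqrt q)); last by ring.
  rewrite exprSr; apply: ler_pM; rewrite ?mulr_ge0 ?(ltW p0) ?(ltW q0)//.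
  by rewrite expr2; apply: ler_pM; rewrite ?(ltW p0) ?(ltW q0).
 rewrite -invfM ler_pdivlMr// mulrC ler_pdivrMr ?exprn_gt0//.
pose B := (1 + K) ^+ 3 * ((2 * 3) * (2 * 3)).
exists B; first by rewrite !mulr_ge0.
move=> A; pose s := [seq w <- A | w \in L].
have -> : \sum_(w <- A) weight w = \sum_(w <- s) weight w.
 by rewrite big_filter [RHS]big_mkcond; apply: eq_bigr => w _; rewrite /weight; case: (w \in L).
have sL w : w \in s -> L w by rewrite mem_filter => /andP[/set_mem].
apply: (@le_trans _ _ (\sum_(w <- s) F (h w))).
 by rewrite big_seq [leRHS]big_seq; apply: ler_sum => w /sL; exact: wF.
have [N hN] : exists N, forall w, w \in s -> (maxn `|(co w).1| `|(co w).2| < N)%N.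
 exists (\max_(w <- s) maxn `|(co w).1| `|(co w).2|).+1%N => w ws.
 by rewrite ltnS; apply: (@leq_bigmax_seq _ s xpredT (fun w => maxn `|(co w).1| `|(co w).2|) w).
pose P := [seq (k, e) | k <- iota 0 N, e <- [:: true; false]].
have SP : \sum_(p <- P) g32 p.1 <= 2 * 3.
 rewrite big_allpairs_dep/=; under eq_bigr do rewrite big_cons big_seq1/=.
 by rewrite big_split/= mulr_natl mulr2n; apply: lerD; exact: sum_g32_le3.
have SP0 : 0 <= \sum_(p <- P) g32 p.1 by exact: sumr_ge0.
apply: (@le_trans _ _ (\sum_(p <- [seq (a, b) | a <- P, b <- P]) F p)); last first.
 rewrite big_allpairs_dep/= /F /=; under eq_bigr do rewrite -mulr_sumr -mulr_sumr.
 rewrite -mulr_sumr -mulr_suml ler_wpM2l ?exprn_ge0//; exact: ler_pM.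
have uP : uniq P by apply: allpairs_uniq; rewrite ?iota_uniq// => -[? ?] [? ?] _ _ [-> ->].
apply: uniq_sum_le => //.
- by rewrite filter_uniq// fset_uniq.
- by apply: allpairs_uniq => // -[? ?] [? ?] _ _ [-> ->].
- move=> u v /sL Lu /sL Lv [] e1 e2 e3 e4; rewrite (hco _ Lu) (hco _ Lv).
 have abs (p q : int) : `|p|%N = `|q|%N -> (0 <= p) = (0 <= q) -> p = q.
  by move=> h1 h2; case: p q h1 h2 => [p|p] [q|q] //= => [->|[->]].
 by rewrite (abs _ _ e1 e2) (abs _ _ e3 e4).
move=> _ /mapP[w ws ->]; apply/allpairsP; exists ((h w).1, (h w).2); split=> //=.
 apply/allpairsP; exists (h w).1; split=> //=; last by rewrite !inE; case: (0 <= _).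
 by rewrite mem_iota/= add0n; apply: leq_ltn_trans (hN _ ws); exact: leq_maxl.
apply/allpairsP; exists (h w).2; split=> //=; last by rewrite !inE; case: (0 <= _).
by rewrite mem_iota/= add0n; apply: leq_ltn_trans (hN _ ws); exact: leq_maxr.
Qed.

Lemma weight_dom (x : C -> C) (M : R) : (forall w, nm (x w) <= M * weight w) -> exists s, has_sum x s.
Proof.
move=> hx; have [B B0 hB] := weight_sum.
apply: (@has_sum_abs x (`|M| * B)) => A.
apply: (@le_trans _ _ (\sum_(w <- A) `|M| * weight w)).
 apply: ler_sum => w _; apply: le_trans (hx w) _; by rewrite ler_wpM2r ?weight_ge0// ler_norm.
by rewrite -mulr_sumr ler_wpM2l.
Qed.

Lemma weight_dom_le : exists2 B : R, 0 <= B & forall (x : C -> C) (M : R) s, 0 <= M ->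
 (forall w, nm (x w) <= M * weight w) -> has_sum x s -> nm s <= M * B.
Proof.
have [B B0 hB] := weight_sum; exists B => // x M s M0 hx hs; apply: has_sum_le hs _ => A.
apply: (@le_trans _ _ (\sum_(w <- A) M * weight w)); first by apply: ler_sum => w _; exact: hx.
by rewrite -mulr_sumr ler_wpM2l.
Qed.
End LatticeWeights.

(** * The Weierstrass function: convergence, periodicity, holomorphy *)

Section WeierstrassP.
Implicit Types (x y z w v l : C).
Variables (w1 w2 : C) (tau : 0 < Im (w2 / w1)).
Local Notation L := (lattice w1 w2).
Local Notation P := (wp L).

(** Lattice points with 1 + |w| < M are kept away by the isolation of z0, the others by the triangle
    inequality. The final halving of c absorbs the motion of z around z0. *)
Lemma lat_far z0 : exists2 c : R, 0 < c & forall w, L w -> w != z0 -> forall z, nm (z - z0) < c ->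
 c * (1 + nm w) <= nm (z - w).
Proof.
have [r r0 hr] := lat_near tau z0.
have nz := nm_ge0 z0; pose M := 2 * nm z0 + 2; have M0 : 0 < M by rewrite /M; lra.
pose c := Num.min (1 / 2) (r / M); have c0 : 0 < c by rewrite lt_min divr_gt0 ?divr_gt0.
have far w : L w -> w != z0 -> c * (1 + nm w) <= nm (z0 - w).
 move=> Lw wz; have nw := nm_ge0 w. have rw : r <= nm (z0 - w).
  by rewrite nmB leNgt; apply/negP => h; exact: (hr w h wz).
 have [h|h] := lerP M (1 + nm w).
  have : c * (1 + nm w) <= (1 / 2) * (1 + nm w) by rewrite ler_wpM2r ?ge_min ?lexx// addr_ge0.
  have := nm_leD (w - z0) z0; rewrite subrK (nmB w); move: h; rewrite /M => *; lra.
 apply: le_trans rw; apply: (@le_trans _ _ (r / M * M)); last by rewrite divfK ?gt_eqF.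
 by apply: ler_pM; rewrite ?(ltW c0) ?addr_ge0 ?(ltW h)// ge_min lexx orbT.
exists (c / 2); first by rewrite divr_gt0.
move=> w Lw wz z hz; have := far w Lw wz; have := nm_leD (z0 - z) (z - w).
rewrite addrA subrK (nmB z0 z) => h1 h2; have nw := nm_ge0 w; have cw := mulr_ge0 (ltW c0) nw.
have -> : c / 2 * (1 + nm w) = (c + c * nm w) / 2 by ring.
lra.
Qed.

(** The index w = 0 is included: since 0^-1 = 0, its term is z^-2, so the leading term of wp becomes
    part of one sum over the whole lattice. *)
Definition wpterm z w : C := if w \in L then (z - w) ^- 2 - w ^- 2 else 0.

Lemma weightE w : L w -> weight w1 w2 w = ((1 + nm w) ^+ 3)^-1.
Proof. by move=> Lw; rewrite /weight mem_set. Qed.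

Lemma nm_wpterm_le z : exists2 M : R, 0 <= M & forall w, w != 0 -> w != z ->
 nm (wpterm z w) <= M * weight w1 w2 w.
Proof.
have [c c0 hc] := lat_far z; have [d d0 hd] := lat_discrete tau.
(* This d' turns the lower bound d <= |w| into d' (1 + |w|) <= |w|. *)
have nz := nm_ge0 z; pose d' := d / (1 + d).
have d1 : 0 < 1 + d by lra.
have d'0 : 0 < d' by rewrite divr_gt0.
exists (nm z * (2 + nm z) / (d' ^+ 2 * c ^+ 2)).
 apply: divr_ge0; first by apply: mulr_ge0 => //; lra. by rewrite mulr_ge0 ?sqr_ge0.
move=> w w0 wz; rewrite /wpterm /weight; case: ifP => [/set_mem Lw|_]; last by rewrite nm0 mulr0.
have zw : z - w != 0 by rewrite subr_eq0 eq_sym.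
have -> : (z - w) ^- 2 - w ^- 2 = z * (2 * w - z) / (w ^+ 2 * (z - w) ^+ 2).
 by field; rewrite w0 zw.
rewrite nmM nmV [nm (z * _)]nmM [nm (w ^+ 2 * _)]nmM !nmX; set N := 1 + nm w.
have nw : 0 < nm w by rewrite nm_gt0.
have N0 : 0 < N by rewrite /N; lra.
have a1 : d' * N <= nm w.
 rewrite /d' mulrAC ler_pdivrMr// /N; have := hd _ Lw w0; nra.
have a2 : c * N <= nm (z - w) by apply: hc => //; rewrite subrr nm0.
have a3 : nm (2 * w - z) <= (2 + nm z) * N.
 apply: le_trans (nm_leD _ _) _; rewrite nmN nmM (nm_nat 2) /N; nra.
have D0 : 0 < (d' * N) ^+ 2 * (c * N) ^+ 2 by rewrite mulr_gt0// exprn_gt0// mulr_gt0.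
have b1 : (d' * N) ^+ 2 * (c * N) ^+ 2 <= nm w ^+ 2 * nm (z - w) ^+ 2.
 apply: ler_pM; rewrite ?sqr_ge0//.
  by rewrite lerXn2r ?nnegrE ?(mulr_ge0 (ltW d'0) (ltW N0)) ?(ltW nw).
 by rewrite lerXn2r ?nnegrE ?(mulr_ge0 (ltW c0) (ltW N0)) ?nm_ge0.
apply: (@le_trans _ _ (nm z * ((2 + nm z) * N) / ((d' * N) ^+ 2 * (c * N) ^+ 2))).
 apply: ler_pM; rewrite ?invr_ge0 ?mulr_ge0 ?nm_ge0//.
  by rewrite ler_wpM2l.
 rewrite lef_pV2 ?posrE//; apply: lt_le_trans b1; exact: D0.
rewrite le_eqVlt; apply/orP; left; apply/eqP; field.
by rewrite !gt_eqF.
Qed.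

Lemma wp_has_sum z : has_sum (wpterm z) (P z).
Proof.
have [M M0 hM] := nm_wpterm_le z.
have [s hs] : exists s, has_sum (wpterm z) s.
 have L0 := lat0 w1 w2. pose K := M + nm (wpterm z 0) + nm (wpterm z z) * (1 + nm z) ^+ 3.
 have K1 : 0 <= nm (wpterm z z) * (1 + nm z) ^+ 3 by rewrite mulr_ge0 ?nm_ge0// exprn_ge0// addr_ge0 ?nm_ge0.
 have K2 := nm_ge0 (wpterm z 0). apply: (@weight_dom w1 w2 tau _ K) => w; have W0 := weight_ge0 w1 w2 w.
 have [->|w0] := eqVneq w 0.
  rewrite weightE// nm0 addr0 expr1n invr1 mulr1 /K; lra.
 have [->|wz] := eqVneq w z.
  have [Lz|Lz] := pselect (L z); last first.
   by rewrite /wpterm memNset// nm0 mulr_ge0 ?weight_ge0// /K; lra.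
  rewrite weightE// ler_pdivlMr; last by rewrite exprn_gt0// ltr_pwDl ?nm_ge0. by rewrite /K; lra.
 apply: le_trans (hM w w0 wz) _; rewrite ler_wpM2r// /K; lra.
suff -> : P z = s by [].
rewrite /wp /lattice_sum (@has_sum_sum _ (s + - z ^- 2)); first by rewrite addrC subrK.
have := has_sumD hs (has_sum_single 0 (- z ^- 2)); congr (has_sum _ _); apply/funext => w.
rewrite /wpterm; have [->|w0] := eqVneq w 0.
 rewrite mem_set; last exact: lat0. rewrite memNset; last by move=> [_ h]; apply: h.
 by rewrite subr0 expr0n/= invr0 subr0 subrr.
rewrite addr0; have [Lw|Lw] := pselect (L w).
 by rewrite !mem_set//; split => //; exact/eqP.
by rewrite !memNset// => -[].
Qed.

Lemma wp_even z : P (- z) = P z.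
Proof.
apply: has_sum_uniq (wp_has_sum (- z)) _.
have := has_sum_reindex (@opprK _) (@opprK _) (wp_has_sum z).
congr (has_sum _ _); apply/funext => w; rewrite /wpterm.
have -> : (- w \in L) = (w \in L) by apply/idP/idP => /set_mem h; apply/mem_set/(latNE w1 w2).
by case: ifP => // _; rewrite sqrrN opprK -[z + w]opprK opprD sqrrN.
Qed.

(** After the reindexing w -> w + l, the difference wp(v + l) - wp(v) is the sum of a family D
    independent of v. At v = -l/2 evenness makes it 0. The argument does not distinguish poles from
    other points. *)
Lemma wp_per l z : L l -> P (z + l) = P z.
Proof.
move=> Ll; pose D w : C := if w \in L then w ^- 2 - (w + l) ^- 2 else 0.
have hD v : has_sum D (P (v + l) + (- 1) * P v).
 have fg : cancel (fun w => w + l) (fun w => w - l) by move=> w; rewrite addrK.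
 have gf : cancel (fun w => w - l) (fun w => w + l) by move=> w; rewrite subrK.
 have := has_sumD (has_sum_reindex fg gf (wp_has_sum (v + l))) (has_sumZ (-1) (wp_has_sum v)).
 congr (has_sum _ _); apply/funext => w; rewrite /wpterm /D.
 have -> : (w + l \in L) = (w \in L) by apply/idP/idP => /set_mem /(latDr _ Ll) h; apply/mem_set.
 case: ifP => _; last by rewrite mulr0 addr0. have -> : v + l - (w + l) = v - w by ring. ring.
have := has_sum_uniq (hD z) (hD (- (l / 2))).
have -> : - (l / 2) + l = l / 2 by field.
by rewrite wp_even !mulN1r subrr => /eqP; rewrite subr_eq0 => /eqP.
Qed.

(** Termwise differentiation: the second-order remainder of the term of w is at most (3/c^4) |v -
    z|^2 [weight w], so the sum of the remainders is quadratic in v - z. Removing the single term w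
    = z0 treats poles and regular points alike. *)
Lemma wp_minus_term_holo z0 : holo (fun z => P z - wpterm z z0) z0.
Proof.
have [c c0 hc] := lat_far z0; have [B B0 hB] := weight_dom_le tau.
pose T z w := if w == z0 then 0 else wpterm z w.
have hT z : has_sum (T z) (P z - wpterm z z0).
 have := has_sumD (wp_has_sum z) (has_sum_single z0 (- wpterm z z0)); congr (has_sum _ _).
 by apply/funext => w; rewrite /T; case: eqP => [->|]; rewrite ?subrr ?addr0.
exists c => // z hz.
pose D w : C := if (w \in L) && (w != z0) then - 2 * (z - w)^-1 ^+ 3 else 0.
have nv v w : nm (v - z0) < c -> L w -> w != z0 -> v - w != 0 /\ nm (v - w)^-1 <= (c * (1 + nm w))^-1.
 move=> hv Lw wz; have h := hc w Lw wz v hv. have h0 : 0 < c * (1 + nm w) by rewrite mulr_gt0// ltr_pwDl ?nm_ge0.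
 have h1 : 0 < nm (v - w) by apply: lt_le_trans h. by rewrite -nm_gt0; split=> //; rewrite nmV lef_pV2.
have [d hd] : exists d, has_sum D d.
 apply: (@weight_dom w1 w2 tau _ (2 / c ^+ 3)) => w; rewrite /D.
 case: ifP => [/andP[/set_mem Lw wz]|_]; last by rewrite nm0 mulr_ge0 ?weight_ge0// divr_ge0// exprn_ge0// ltW.
 have [_ h] := nv z w hz Lw wz; rewrite weightE// mulNr nmN nmM (nm_nat 2) nmX -mulrA ler_wpM2l//.
 rewrite -invfM -exprMn -exprVn lerXn2r ?nnegrE ?nm_ge0// invr_ge0 mulr_ge0 ?addr_ge0 ?nm_ge0//; exact: ltW.
exists d => e e0.
pose M := 3 / c ^+ 4; have M0 : 0 <= M by rewrite divr_ge0// exprn_ge0// ltW.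
have MB : 0 < M * B + 1 by rewrite ltr_wpDl// mulr_ge0.
exists (Num.min (c - nm (z - z0)) (e / (M * B + 1))).
 by rewrite lt_min subr_gt0 hz divr_gt0.
move=> v; rewrite lt_min => /andP[v1 v2].
have hv : nm (v - z0) < c.
 by have := nm_distD z v z0; lra.
have S := has_sumD (has_sumD (hT v) (has_sumZ (-1) (hT z))) (has_sumZ (- (v - z)) hd).
have -> : P v - wpterm v z0 - (P z - wpterm z z0) - d * (v - z) =
 P v - wpterm v z0 + -1 * (P z - wpterm z z0) + - (v - z) * d by ring.
apply: le_trans (hB _ (M * nm (v - z) ^+ 2) _ _ _ S) _.
- by rewrite mulr_ge0 ?exprn_ge0 ?nm_ge0.
- move=> w; rewrite /T /D; have [->|wz] := eqVneq w z0.
  by rewrite !andbF !mulr0 !addr0 nm0 mulr_ge0 ?weight_ge0// mulr_ge0 ?exprn_ge0 ?nm_ge0.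
 rewrite andbT /wpterm; case: ifP => [/set_mem Lw|_]; last first.
  by rewrite !mulr0 !addr0 nm0 mulr_ge0 ?weight_ge0// mulr_ge0 ?exprn_ge0 ?nm_ge0.
 have [zw0 h1] := nv z w hz Lw wz; have [vw0 h2] := nv v w hv Lw wz.
 have -> : (v - w) ^- 2 - w ^- 2 + -1 * ((z - w) ^- 2 - w ^- 2) + - (v - z) * (-2 * (z - w)^-1 ^+ 3) =
  (v - z) ^+ 2 * ((v - w)^-1 * (z - w)^-1 ^+ 2 * ((v - w)^-1 + 2 * (z - w)^-1)).
  by move: (w ^- 2) => q; field; rewrite zw0 vw0.
 rewrite nmM nmX [X in _ <= X]mulrAC [X in _ <= X]mulrC ler_wpM2l ?exprn_ge0 ?nm_ge0//.
 rewrite weightE//; set x := (v - w)^-1 in h2 *; set y := (z - w)^-1 in h1 *.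
 set k := (c * (1 + nm w))^-1 in h1 h2 *. have N0 : 0 < 1 + nm w by rewrite ltr_pwDl ?nm_ge0.
 have k0 : 0 <= k by rewrite invr_ge0 mulr_ge0 ?(ltW c0) ?(ltW N0). have h3 : nm (x + 2 * y) <= 3 * k.
  by apply: le_trans (nm_leD _ _) _; rewrite nmM (nm_nat 2); lra.
 have h4 : nm (x * y ^+ 2) <= k * k ^+ 2.
  by rewrite nmM nmX; apply: ler_pM; rewrite ?exprn_ge0 ?nm_ge0// lerXn2r ?nnegrE ?nm_ge0.
 rewrite nmM; apply: le_trans (ler_pM (nm_ge0 _) (nm_ge0 _) h4 h3) _.
 have -> : k * k ^+ 2 * (3 * k) = M * (((1 + nm w) ^+ 3)^-1 * (1 + nm w)^-1).
  by rewrite /M /k; field; rewrite !gt_eqF.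
 rewrite ler_wpM2l// ler_piMr ?invr_ge0 ?exprn_ge0 ?(ltW N0)// invf_le1// lerDl nm_ge0. by [].
rewrite expr2 mulrA mulrAC ler_wpM2r ?nm_ge0// mulrAC.
move: v2; rewrite ltr_pdivlMr// mulrC => /ltW; apply: le_trans; rewrite ler_wpM2r ?nm_ge0//.
by rewrite lerDl.
Qed.

Lemma wp_holo z : ~ L z -> holo P z.
Proof.
move=> Lz; apply: holo_ext (wp_minus_term_holo z); apply: nearcT => w.
by rewrite /wpterm memNset// subr0.
Qed.

Lemma wp_at0 : exists g, [/\ holo g 0, g 0 = 0, forall w, g (- w) = g w & forall w, P w = w ^- 2 + g w].
Proof.
have T0 z : wpterm z 0 = z ^- 2.
 by rewrite /wpterm mem_set; [rewrite subr0 expr0n/= invr0 subr0|exact: lat0].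
have hg := wp_minus_term_holo 0.
exists (fun z => P z - wpterm z 0); split => //.
- have T00 w : wpterm 0 w = 0.
  by rewrite /wpterm sub0r sqrrN subrr if_same.
 rewrite T00 subr0; apply: has_sum_uniq (wp_has_sum 0) _.
 move=> e e0; exists fset0%fset => A _; rewrite big1 ?subrr ?nm0// => i _; exact: T00.
- by move=> w; rewrite !T0 wp_even sqrrN.
by move=> w; rewrite T0 addrC subrK.
Qed.

Lemma wp_ord l : L l -> ord P l (- 2).
Proof.
move=> Ll; have [g [hg g0 _ E]] := wp_at0.
exists (fun w => 1 + (w - l) ^+ 2 * g (w - l)); split.
- apply: holoD (holo_cst 1 l) _; apply: holoM.
  by apply: holoX; apply: holoB (holo_id l) (holo_cst l l).
 by apply: (@holo_shift g); rewrite subrr.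
- by rewrite subrr expr0n mul0r addr0 oner_neq0.
apply: nearpS (nearp_neq l) => w wl.
have -> : P w = P (w - l) by rewrite wp_per//; exact/latNE.
rewrite E -exprnN; field; exact: wl.
Qed.
End WeierstrassP.

(** * Lower bounds on orders, and parity *)

Section OrderBounds.
Implicit Types (z w a b : C) (k l : int).

(** In contrast with [ord], the factor g may vanish at z, so the zero function satisfies every
    bound. *)
Definition ordge H z k := exists2 g, holo g z & nearp z (fun w => H w = (w - z) ^ k * g w).

Lemma ord_ordge H z k : ord H z k -> ordge H z k.
Proof. by move=> [g [g1 _ g3]]; exists g. Qed.
Lemma ordge_ext H K z k : nearp z (fun w => H w = K w) -> ordge H z k -> ordge K z k.
Proof. by move=> h [g hg E]; exists g => //; apply: nearpS2 h E => w <-. Qed.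
Lemma ordge0 H z : ordge H z 0 <-> reg H z.
Proof. by split=> -[g hg E]; exists g => //; apply: nearpS E => w ->; rewrite expr0z mul1r. Qed.

Lemma ordgeW H z k l : l <= k -> ordge H z k -> ordge H z l.
Proof.
move=> lk [g hg E].
have [n En] : exists n : nat, k - l = n%:Z by exists `|k - l|%N; rewrite gez0_abs// subr_ge0.
exists (fun w => (w - z) ^+ n * g w).
 by apply: holoM => //; apply: holoX; apply: holoB (holo_id z) (holo_cst z z).
apply: nearpS2 (nearp_neq z) E => w wz ->.
by rewrite mulrA -[(w - z) ^+ n]/((w - z) ^ n%:Z) -expfzDr// -En subrKC.
Qed.
Lemma ordge_reg H z k : 0 <= k -> ordge H z k -> reg H z.
Proof. by move=> k0 h; apply/ordge0; apply: ordgeW h. Qed.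

Lemma ordgeM H K z k l : ordge H z k -> ordge K z l -> ordge (fun w => H w * K w) z (k + l).
Proof.
move=> [g hg E] [g' hg' E']; exists (fun w => g w * g' w); first exact: holoM.
by apply: nearpS3 (nearp_neq z) E E' => w wz -> ->; rewrite expfzDr// mulrACA.
Qed.

Lemma ordgeD H K z k : ordge H z k -> ordge K z k -> ordge (fun w => H w + K w) z k.
Proof.
move=> [g hg E] [g' hg' E']; exists (fun w => g w + g' w); first exact: holoD.
by apply: nearpS2 E E' => w -> ->; rewrite mulrDr.
Qed.

Lemma ordgeN H z k : ordge H z k -> ordge (fun w => - H w) z k.
Proof.
move=> [g hg E]; exists (fun w => - g w); first exact: holoN.
by apply: nearpS E => w ->; rewrite mulrN.
Qed.
Lemma ordgeB H K z k : ordge H z k -> ordge K z k -> ordge (fun w => H w - K w) z k.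
Proof. by move=> h /ordgeN; exact: ordgeD. Qed.

Lemma ordgeX H z k n : ordge H z k -> ordge (fun w => H w ^+ n) z (k * n%:Z).
Proof.
move=> [g hg E]; exists (fun w => g w ^+ n); first exact: holoX.
by apply: nearpS E => w ->; rewrite exprMn -exprz_exp.
Qed.

Lemma holo_ordge1 H z : holo H z -> H z = 0 -> ordge H z 1.
Proof.
move=> /holo_factor[g hg E] Hz; exists g => //; apply: nearc_p.
by apply: nearcS E => w ->; rewrite Hz add0r expr1z.
Qed.

Lemma nearp_reflect z (Q : C -> Prop) : nearp z Q -> nearp z (fun w => Q (z + z - w)).
Proof.
move=> h; have : nearp (- - z) Q by rewrite opprK.
move/nearp_opp => h1; have : nearp (z + (- z - z)) (fun w => Q (- w)) by rewrite addrA subrr sub0r.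
by move/nearp_shift; apply: nearpS => w; rewrite !opprD !opprK; congr Q; ring.
Qed.

(** Reflection about z multiplies the leading term by (-1)^k, so a symmetry of H with a different
    factor s forces the leading coefficient to be 0. *)
Lemma ordge_parity_lead H z k s g : holo g z -> nearp z (fun w => H w = (w - z) ^ k * g w) ->
 nearp z (fun w => H (z + z - w) = s * H w) -> s != (-1) ^ k -> g z = 0.
Proof.
move=> hg E hs sk; have E' := nearp_reflect E.
suff : (s - (-1) ^ k) * g z = 0.
 by move=> /eqP; rewrite mulf_eq0 subr_eq0 (negbTE sk) => /eqP.
have cg := holo_cts hg.
have cg' : ccts (fun w => g (z + z - w)) z.
 have : holo (fun w => g (z + z - w)) z.
  apply: (@holo_comp g (fun w => z + z - w)); last by rewrite addrK. exact: holoB (holo_cst _ _) (holo_id z).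
 exact: holo_cts.
have Hq : nearp z (fun w => s * g w = (-1) ^ k * g (z + z - w)).
 apply: nearpS3 (nearp_neq z) (nearpS2 (fun w (a : H w = _) (b : H (z + z - w) = _) => conj a b) E E') hs => w wz [Ew Ew'].
 have e1 : z + z - w - z = (w - z) * (-1) by ring. rewrite e1 in Ew'.
 rewrite Ew Ew' expfzMl => Es; apply: (mulfI (expfz_neq0 k wz)). by rewrite mulrCA -Es mulrA.
have h1 : ccts (fun w => s * g w) z by apply: cctsM => //; apply: ccts_cst.
have h2 : ccts (fun w => (-1) ^ k * g (z + z - w)) z by apply: cctsM => //; apply: ccts_cst.
by have := ccts_eq_at h1 h2 Hq; rewrite /= addrK mulrBl => ->; rewrite subrr.
Qed.

(** A bound of the wrong parity improves by one. Double zeros at half periods and the cancellations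
    for odd differences are obtained this way. *)
Lemma ordge_parity H z k s : ordge H z k -> nearp z (fun w => H (z + z - w) = s * H w) ->
 s != (-1) ^ k -> ordge H z (k + 1).
Proof.
move=> [g hg E] hs sk; have g0 := ordge_parity_lead hg E hs sk.
have [g' hg' E'] := holo_factor hg; exists g' => //.
apply: nearpS3 (nearp_neq z) E (nearc_p E') => w wz -> ->.
by rewrite g0 add0r expfzDr// expr1z mulrA.
Qed.

Lemma ord_parity H z k s : ord H z k -> nearp z (fun w => H (z + z - w) = s * H w) -> s = (-1) ^ k.
Proof.
move=> [g [hg /eqP g0 E]] hs; apply/eqP/negPn/negP => sk.
exact: g0 (ordge_parity_lead hg E hs sk).
Qed.

Lemma ordD_reg H K z k : ord H z k -> k < 0 -> reg K z -> ord (fun w => H w + K w) z k.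
Proof.
move=> [g [hg g0 E]]; case: k => // n in E *; rewrite NegzE in E * => _ [g' hg' E'].
exists (fun w => g w + (w - z) ^+ n.+1 * g' w); split.
- apply: holoD => //; apply: holoM => //; apply: holoX; exact: holoB (holo_id z) (holo_cst z z).
- by rewrite subrr expr0n mul0r addr0.
apply: nearpS3 (nearp_neq z) E E' => w wz -> ->; rewrite mulrDr mulrA.
by rewrite -[(w - z) ^+ n.+1]/((w - z) ^ n.+1%:Z) -expfzDr// addNr expr0z mul1r.
Qed.

Lemma reg_holo H : (forall z, reg H z) ->
 exists2 G, forall z, holo G z & forall z, nearp z (fun w => H w = G w).
Proof.
move=> hr; have /choice[g hg] : forall z, exists g, holo g z /\ nearp z (fun w => H w = g w).
 by move=> z; have [g] := hr z; exists g.
have key z : nearc z (fun w => g w w = g z w).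
 have [hz Ez] := hg z; have h1 := nearp_open Ez. have h2 := nearc_p (holo_near hz).
 have [r r0 hh] := nearpS2 (fun w (a : nearc w (fun v => H v = g z v)) (b : holo (g z) w) => conj a b) h1 h2.
 exists r => // w wr; have [->//|wz] := eqVneq w z. have [a b] := hh w wr wz; have [hw Ew] := hg w.
 apply: ccts_eq_at (holo_cts hw) (holo_cts b) _. by apply: nearpS2 Ew (nearc_p a) => v -> ->.
exists (fun z => g z z) => z.
 by have [hz _] := hg z; apply: holo_ext hz; apply: nearcS (key z) => w ->.
by have [_ E] := hg z; apply: nearpS2 E (nearc_p (key z)) => w -> ->.
Qed.
Lemma nearp_and z (P Q : C -> Prop) : nearp z P -> nearp z Q -> nearp z (fun w => P w /\ Q w).
Proof. by apply: nearpS2 => w. Qed.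
Lemma nearp_false z (P Q : C -> Prop) : (forall w, P w -> Q w -> False) -> nearp z P -> nearp z Q -> False.
Proof. by move=> h p q; have [w _ [a b]] := nearp_ex (nearp_and p q); exact: h a b. Qed.

Lemma mero_ord H z0 k0 : mero H -> ord H z0 k0 -> forall z, exists k, ord H z k.
Proof.
move=> m o z; have [h|//] := m z; have h0 := mero_zero m h z0.
by exfalso; apply: nearp_false h0 (ord_neq0 o) => w ->; rewrite eqxx.
Qed.
End OrderBounds.

(** * Liouville's theorem for functions known off isolated points *)

Section NearlyPeriodic.
Implicit Types (z w a c : C) (l : int).
Variables (w1 w2 : C) (tau : 0 < Im (w2 / w1)).
Local Notation L := (lattice w1 w2).

(** Periodicity off isolated points is what quotients satisfy, given the default values of
    division. *)
Definition nper H a := forall z, nearp z (fun w => H (w + a) = H w).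

Lemma liouville_nper H : (forall z, reg H z) -> nper H w1 -> nper H w2 ->
 exists c, forall z, nearp z (fun w => H w = c).
Proof.
move=> /reg_holo[G hG E] p1 p2.
have gp a : nper H a -> forall z, G (z + a) = G z.
 move=> pa z; have := @ccts_eq_at (fun w => G (w + a)) G z; apply.
 - by apply: holo_cts; apply: (@holo_shift G).
 - exact: holo_cts. by apply: nearpS3 (pa z) (E z) (nearp_shift (E (z + a))) => w h1 h2 h3; rewrite -h3 h1.
have [c hc] := liouville tau (fun z => holo_reg (hG z)) (gp _ p1) (gp _ p2).
by exists c => z; apply: nearpS2 (E z) (hc z) => w ->.
Qed.

Lemma liouville0_nper H z0 : (forall z, reg H z) -> nper H w1 -> nper H w2 ->
 ordge H z0 1 -> forall z, nearp z (fun w => H w = 0).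
Proof.
move=> hr p1 p2 [g hg E]; have [c hc] := liouville_nper hr p1 p2.
suff -> : 0 = c by [].
have := @ccts_eq_at (fun w => (w - z0) * g w) (fun=> c) z0; rewrite subrr mul0r => -> //.
- by apply: cctsM (holo_cts hg); apply: holo_cts; apply: holoB (holo_id _) (holo_cst _ _).
- exact: ccts_cst.
by apply: nearpS2 E (hc z0) => w ->; rewrite expr1z.
Qed.

Lemma reg_nper H z (l : C) : nper H w1 -> nper H w2 -> L l -> reg H (z + l) <-> reg H z.
Proof.
move=> p1 p2 Ll.
have aux a : nper H a -> forall v, reg H (v + a) = reg H v.
 move=> pa v; apply/propext; split=> h.
  by apply: reg_ext (reg_shift h); exact: pa.
 have -> : reg H (v + a) <-> reg (fun w => H (w - a + a)) (v + a).
  by split; apply: reg_ext; apply: nearpT => w; rewrite subrK.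
 apply: (@reg_shift (fun w => H (w + a))); rewrite addrK. by apply: reg_ext h; apply: nearpS (pa v) => w ->.
by rewrite (per_lat (aux _ p1) (aux _ p2)).
Qed.
End NearlyPeriodic.

(** * Half periods, the differential equation and the fibres of wp *)

Section EllipticFunctions.
Implicit Types (z w l h p q a b c d : C).
Variables (w1 w2 : C) (tau : 0 < Im (w2 / w1)).
Local Notation L := (lattice w1 w2).
Local Notation P := (wp L).
Local Notation dP := (cderiv P).

Lemma wp_cdiff z : ~ L z -> cdiff P z (dP z).
Proof. by move=> /(wp_holo tau)/holoW/cdiff_ex. Qed.

Lemma dwp_per l z : L l -> dP (z + l) = dP z.
Proof.
move=> Ll; rewrite -(cderiv_shift P z l); congr (cderiv _ z).
by apply/funext => w; rewrite (wp_per tau).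
Qed.
Lemma dwp_ord l : L l -> ord dP l (- 3).
Proof. by move=> Ll; have := ord_deriv (wp_ord tau Ll); apply. Qed.
Lemma dwp_holo z : ~ L z -> holo dP z.
Proof. by move=> /(wp_holo tau)/holo_deriv. Qed.
Lemma wpB_ord c l : L l -> ord (fun z => P z - c) l (- 2).
Proof. by move=> Ll; apply: (ordD_reg (wp_ord tau Ll)) => //; apply: reg_cst. Qed.
Lemma wpB_holo c z : ~ L z -> holo (fun z => P z - c) z.
Proof. by move=> Lz; apply: holoB (wp_holo tau Lz) (holo_cst c z). Qed.

Lemma wp_reflect h w : L (2 * h) -> P (h + h - w) = P w.
Proof.
by move=> L2; rewrite -mulr2n -mulr_natl addrC (wp_per tau)// (wp_even tau).
Qed.

(** The points of order exactly two in C/L. *)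
Definition half h := L (2 * h) /\ ~ L h.

Lemma dwp_at0 g w : (forall w, P w = w ^- 2 + g w) -> w != 0 -> holo g w ->
 dP w = w ^- 3 * (- 2 + w ^+ 3 * cderiv g w).
Proof.
move=> Eg w0 hgw; apply: cdiff_cderiv.
have := cdiffD (@cdiffV (fun w => w ^+ 2) _ _ (expf_neq0 2 w0) (cdiffX 2 (cdiff_id w))) (cdiff_ex (holoW hgw)).
have -> : (fun w => (w ^+ 2)^-1 + g w) = P by apply/funext => v; rewrite Eg.
by congr (cdiff _ _ _); rewrite /=; field.
Qed.

Lemma wpB_ex_ord c z : exists k, ord (fun z => P z - c) z k.
Proof.
apply: (@mero_ord _ 0 (- 2)); last exact: wpB_ord (lat0 w1 w2).
move=> v; have [Lv|Lv] := pselect (L v); first by right; exists (- 2); exact: wpB_ord.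
have [k|[n k]] := holo_dich (wpB_holo c Lv); last by right; exists n%:Z.
by left; apply: nearc_p.
Qed.

Lemma dwp_ex_ord z : exists k, ord dP z k.
Proof.
apply: (@mero_ord _ 0 (- 3)); last exact: dwp_ord (lat0 w1 w2).
move=> v; have [Lv|Lv] := pselect (L v); first by right; exists (- 3); exact: dwp_ord.
have [k|[n k]] := holo_dich (dwp_holo Lv); last by right; exists n%:Z.
by left; apply: nearc_p.
Qed.

Lemma half_ordge h l : half h -> L l -> ordge (fun z => P z - P h) (h + l) 2.
Proof.
move=> hh Ll; have [L2 Lh] := hh; have Lhl : ~ L (h + l) by rewrite latDr.
have := @ordge_parity (fun z => P z - P h) (h + l) 1 1; rewrite expr1z; apply.
- by apply: holo_ordge1 (wpB_holo _ Lhl) _; rewrite (wp_per tau)// subrr.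
- apply: nearpT => w; rewrite mul1r wp_reflect// mulrDr latDr//.
 by rewrite mulr_natl mulr2n; apply: latD.
by rewrite eq_sym eqNr oner_neq0.
Qed.

(** The double pole of each factor meets a zero of order at least two of the other, so the product
    is elliptic without poles, hence constant; near 0 neither factor vanishes, so K is nonzero.
    Translation by h thus acts on wp - wp(h) as x -> K/x. *)
Lemma half_shift h : half h -> exists2 K, K != 0 &
 forall z, ~ L z -> ~ L (z + h) -> (P z - P h) * (P (z + h) - P h) = K.
Proof.
move=> hh; have [L2 Lh] := hh; have L0 := lat0 w1 w2.
pose Q z := (P z - P h) * (P (z + h) - P h).
have hQ z : ~ L z -> ~ L (z + h) -> holo Q z.
 move=> Lz Lzh; apply: holoM (wpB_holo _ Lz) _. exact: (@holo_shift (fun z => P z - P h)) (wpB_holo _ Lzh).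
have Qr z : reg Q z.
 have [Lz|Lz] := pselect (L z).
  apply/ordge0; rewrite -[X in ordge _ _ X](addNr 2). apply: ordgeM; first exact: ord_ordge (wpB_ord _ Lz).
  have [g hg E] := half_ordge hh Lz; exists (fun w => g (w + h)).
   by apply: (@holo_shift g); rewrite addrC.
  by rewrite addrC in E; apply: nearpS (nearp_shift E) => w ->; congr (_ ^ _ * _); ring.
 have [Lzh|Lzh] := pselect (L (z + h)); last exact/holo_reg/hQ. apply/ordge0; rewrite -[X in ordge _ _ X](subrr 2).
 apply: ordgeM; last by apply: ord_ordge; apply: (@ord_shift (fun z => P z - P h)); exact: wpB_ord.
 have -> : z = h + (z + h - 2 * h) by ring. by apply: half_ordge => //; apply: latB.
have Qp l : L l -> forall z, Q (z + l) = Q z.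
 move=> Ll z; rewrite /Q (addrAC z l h); by rewrite !(wp_per tau _ Ll).
have [K hK] := liouville tau Qr (Qp _ (lat_w1 w1 w2)) (Qp _ (lat_w2 w1 w2)).
exists K.
 apply/eqP => K0; have [k o1] := wpB_ex_ord (P h) h. have o2 : ord (fun z => P (z + h) - P h) 0 k.
  by apply: (@ord_shift (fun z => P z - P h)); rewrite add0r.
 apply: nearp_false (hK 0) (ord_neq0 (ordM (wpB_ord (P h) L0) o2)) => w E. by rewrite -/(Q w) E K0 eqxx.
move=> z Lz Lzh; have := @ccts_eq_at Q (fun=> K) z; apply => //.
- exact: holo_cts (hQ _ Lz Lzh).
- exact: ccts_cst.
Qed.

Lemma wp_eq_half h z : half h -> ~ L z -> P z = P h -> L (z - h).
Proof.
move=> hh Lz E; have [K K0 hK] := half_shift hh; have [L2 Lh] := hh.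
have [Lzh|Lzh] := pselect (L (z + h)).
 have -> : z - h = z + h - 2 * h by ring. exact: latB.
by move: K0; rewrite -(hK z Lz Lzh) E subrr mul0r eqxx.
Qed.

(** By [half_shift] the zero at h is K over the double pole of the translated factor: order exactly
    2, with no count of zeros. *)
Lemma half_ord h : half h -> ord (fun z => P z - P h) h 2.
Proof.
move=> hh; have [K K0 hK] := half_shift hh; have [L2 Lh] := hh.
have o1 : ord (fun z => P (z + h) - P h) h (- 2).
 by apply: (@ord_shift (fun z => P z - P h)); apply: wpB_ord; rewrite -mulr2n -mulr_natl.
have := ordM (holo_ord (holo_cst K h) K0) (ordV o1); rewrite add0r opprK.
apply: ord_ext.
have n1 := nearp_shift (lat_near tau (h + h)).
apply: nearpS3 (lat_near tau h) n1 (ord_neq0 o1) => w Lw Lwh nz.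
by rewrite -(hK w Lw Lwh) mulfK.
Qed.

Lemma dwp_half_ord h : half h -> ord dP h 1.
Proof.
move=> hh; have := ord_deriv (half_ord hh) isT; apply: ord_ext; apply: nearpS (lat_near tau h) => w Lw.
by apply: cdiff_cderiv; rewrite -[dP w]subr0; apply: cdiffB (wp_cdiff Lw) (cdiff_cst _ _).
Qed.

Let h1 := w1 / 2.
Let h2 := w2 / 2.
Let h3 := (- w1 - w2) / 2.

Lemma lat_half (m n : int) : L ((m%:~R * w1 + n%:~R * w2) / 2) -> (2 %| m)%Z /\ (2 %| n)%Z.
Proof.
move=> [m' [n' E]]; have : rpt w1 w2 m%:~R n%:~R = rpt w1 w2 (2 * m')%:~R (2 * n')%:~R.
 have e2 := divfK (_ : 2 != 0 :> C) (m%:~R * w1 + n%:~R * w2); rewrite !rpt_int -e2 ?pnatr_eq0// E !rmorphM/=; ring.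
move=> /(rpt_inj tau)[/eqP a /eqP b].
by move: a b; rewrite !eqr_int => /eqP -> /eqP ->; rewrite !dvdz_mulr.
Qed.

Lemma half_h (m n : int) : ~~ ((2 %| m)%Z && (2 %| n)%Z) -> half ((m%:~R * w1 + n%:~R * w2) / 2).
Proof.
move=> mn; split; first by rewrite mulrC divfK//; exists m, n.
by move=> /lat_half[a b]; move: mn; rewrite a b.
Qed.
Lemma half1 : half h1.
Proof. by have := @half_h 1 0 isT; rewrite mul1r mul0r addr0. Qed.
Lemma half2 : half h2.
Proof. by have := @half_h 0 1 isT; rewrite mul1r mul0r add0r. Qed.
Lemma half3 : half h3.
Proof. by have := @half_h (-1) (-1) isT; rewrite mulrN1z !mulN1r. Qed.

Lemma half_cases z : half z -> [\/ L (z - h1), L (z - h2) | L (z - h3)].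
Proof.
move=> [[m [n E]] Lz].
have Ez : z = (m%:~R * w1 + n%:~R * w2) / 2 by rewrite -E mulrC mulKf.
have Dm := divz_eq m 2; have Dn := divz_eq n 2.
have cs k : (k %% 2)%Z = 0 \/ (k %% 2)%Z = 1.
 have a := modz_ge0 k (isT : (2 : int) != 0); have b := ltz_pmod k (isT : 0 < (2:int)).
 by move: (k %% 2)%Z a b => [[|[|i]]|i] //; [left|right].
set m' := (m %/ 2)%Z in Dm; set n' := (n %/ 2)%Z in Dn.
have Em : m%:~R = m'%:~R * 2 + (m %% 2)%Z%:~R :> C by rewrite {1}Dm rmorphD/= rmorphM.
have En : n%:~R = n'%:~R * 2 + (n %% 2)%Z%:~R :> C by rewrite {1}Dn rmorphD/= rmorphM.
rewrite {}Em {}En in Ez; case: (cs m) (cs n) => -> [] -> in Ez.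
- by case: Lz; exists m', n'; rewrite Ez; field.
- by apply: Or32; exists m', n'; rewrite Ez /h2; field.
- by apply: Or31; exists m', n'; rewrite Ez /h1; field.
by apply: Or33; exists (m' + 1), (n' + 1); rewrite Ez /h3 !rmorphD/=; field.
Qed.

Local Notation e1 := (P h1).
Local Notation e2 := (P h2).
Local Notation e3 := (P h3).

Lemma half_neq12 : e1 != e2.
Proof.
apply/eqP => /(wp_eq_half half2 half1.2).
have -> : h1 - h2 = (1%:~R * w1 + (-1)%:~R * w2) / 2 by rewrite /h1 /h2 mulrN1z; field.
by move/lat_half => [].
Qed.
Lemma half_neq13 : e1 != e3.
Proof.
apply/eqP => /(wp_eq_half half3 half1.2).
have -> : h1 - h3 = (2%:~R * w1 + (1)%:~R * w2) / 2 by rewrite /h1 /h3; field.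
by move/lat_half => [].
Qed.
Lemma half_neq23 : e2 != e3.
Proof.
apply/eqP => /(wp_eq_half half3 half2.2).
have -> : h2 - h3 = (1%:~R * w1 + (2)%:~R * w2) / 2 by rewrite /h2 /h3; field.
by move/lat_half => [].
Qed.

Lemma wp_sub_neq0 h z : half h -> ~ L z -> ~ L (z - h) -> P z - P h != 0.
Proof.
by move=> hh Lz Lzh; rewrite subr_eq0; apply/eqP => /(wp_eq_half hh Lz).
Qed.

Lemma half_translate h l z : half h -> l = z - h -> L l -> half z.
Proof.
move=> [a b] E Ll; have -> : z = h + l by rewrite E subrKC.
split; last by rewrite latDr.
by rewrite mulrDr latDr// mulr_natl mulr2n; apply: latD.
Qed.

Lemma half_ord' h z : half h -> L (z - h) -> ord (fun w => P w - P h) z 2.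
Proof.
move=> hh Lz; have hz := half_translate hh erefl Lz.
by rewrite -(wp_per tau h Lz) subrKC; apply: half_ord.
Qed.
Lemma wpB_ord0 c z : ~ L z -> P z != c -> ord (fun w => P w - c) z 0.
Proof. by move=> Lz zc; apply: holo_ord; [exact: wpB_holo|rewrite subr_eq0]. Qed.

(** The quotient of wp'^2 by the cubic has order 0 at lattice points, where both have order -6, and
    at half periods, where both have order 2; elsewhere the cubic does not vanish. So it is
    constant, and the leading coefficients at 0 give 4. *)
Lemma wp_ode z : ~ L z -> dP z ^+ 2 = 4 * (P z - e1) * (P z - e2) * (P z - e3).
Proof.
pose T z := (P z - e1) * (P z - e2) * (P z - e3); pose V z := dP z ^+ 2 / T z.
have oT v k1 k2 k3 : ord (fun z => P z - e1) v k1 -> ord (fun z => P z - e2) v k2 -> ord (fun z => P z - e3) v k3 -> ord T v (k1 + k2 + k3).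
 by move=> a b c; apply: ordM c; apply: ordM.
have N12 := half_neq12; have N13 := half_neq13; have N23 := half_neq23.
move=> Lz0; have o0 c v : ~ L v -> c != P v -> ord (fun w => P w - c) v 0 by move=> a b; apply: wpB_ord0 => //; rewrite eq_sym.
have oh v : half v -> ord T v 2.
 move=> hz; have Lz : ~ L v := hz.2. have [Lh|Lh|Lh] := half_cases hz.
 - have E : P v = e1 by rewrite -(wp_per tau h1 Lh) subrKC.
  change (ord T v (2 + 0 + 0)); apply: oT; first exact: half_ord' half1 Lh.
   by apply: o0; rewrite ?E 1?eq_sym.
  by apply: o0; rewrite ?E 1?eq_sym.
 - have E : P v = e2 by rewrite -(wp_per tau h2 Lh) subrKC.
  change (ord T v (0 + 2 + 0)); apply: oT; last by apply: o0; rewrite ?E 1?eq_sym.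
   by apply: o0; rewrite ?E.
  exact: half_ord' half2 Lh.
 have E : P v = e3 by rewrite -(wp_per tau h3 Lh) subrKC.
 change (ord T v (0 + 0 + 2)); apply: oT; last exact: half_ord' half3 Lh.
  by apply: o0; rewrite ?E.
 by apply: o0; rewrite ?E.
have on v : ~ L v -> ~ half v -> T v != 0.
 move=> Lz nz; rewrite !mulf_neq0//.
 - by apply: wp_sub_neq0 half1 Lz _ => /(half_translate half1 erefl).
 - by apply: wp_sub_neq0 half2 Lz _ => /(half_translate half2 erefl).
 - by apply: wp_sub_neq0 half3 Lz _ => /(half_translate half3 erefl).
have hT v : ~ L v -> holo T v by move=> Lz; apply: holoM; [apply: holoM|]; exact: wpB_holo.
have oT0 l : L l -> ord T l (- 6).
 by move=> Ll; change (ord T l (- 2 - 2 - 2)); apply: oT; exact: wpB_ord.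
have Vr v : reg V v.
 have [Lz|Lz] := pselect (L v).
  apply: (@ord_reg _ _ 0) => //; have := ordM (ordX 2 (dwp_ord Lz)) (ordV (oT0 _ Lz)).
  by rewrite -[X in ord _ _ X]/(0 : int).
 have [hz|nz] := pselect (half v).
  apply: (@ord_reg _ _ 0) => //; have := ordM (ordX 2 (dwp_half_ord hz)) (ordV (oh _ hz)).
  by rewrite -[X in ord _ _ X]/(0 : int).
 apply: holo_reg; apply: holoM; first by apply: holoX; exact: dwp_holo. by apply: holoV; [exact: hT|exact: on].
have Vp l : L l -> forall z, V (z + l) = V z.
 by move=> Ll v; rewrite /V /T dwp_per// !(wp_per tau).
have [c hc] := liouville tau Vr (Vp _ (lat_w1 w1 w2)) (Vp _ (lat_w2 w1 w2)).
have key v : nearp v (fun w => dP w ^+ 2 = c * T w).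
 have [k oTv] : exists k, ord T v k.
  have [k1 a1] := wpB_ex_ord e1 v; have [k2 a2] := wpB_ex_ord e2 v; have [k3 a3] := wpB_ex_ord e3 v.
  by exists (k1 + k2 + k3); apply: oT.
 by apply: nearpS2 (hc v) (ord_neq0 oTv) => w <- nz; rewrite /V divfK.
have c4 : c = 4.
 have [g [hg g0 _ Eg]] := wp_at0 tau.
 pose G1 w := (- 2 + w ^+ 3 * cderiv g w) ^+ 2; pose u e w := 1 + w ^+ 2 * (g w - e).
 pose G2 w := c * (u e1 w * u e2 w * u e3 w). have hid : holo id (0 : C) by exact: holo_id. have hu e : holo (u e) 0.
  by apply: holoD (holo_cst 1 0) _; apply: holoM; [exact: (holoX 2 hid)|exact: holoB hg (holo_cst e 0)].
 have h1' : ccts G1 0.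
  apply: holo_cts; apply: holoX; apply: holoD (holo_cst _ 0) _.
  by apply: holoM (holo_deriv hg); exact: (holoX 3 hid).
 have h2' : ccts G2 0.
  by apply: holo_cts; apply: holoM (holo_cst c 0) _; apply: holoM; [apply: holoM|].
 have := ccts_eq_at h1' h2'; rewrite /G1 /G2 /u !expr0n/= !mul0r !addr0 !mulr1 sqrrN => <-; first by ring.
 apply: nearpS3 (nearp_neq 0) (key 0) (nearc_p (holo_near hg)) => w; rewrite subr0 => w0.
 have -> : T w = w ^- 6 * (u e1 w * u e2 w * u e3 w) by rewrite /T /u (Eg w); move: (P h1) (P h2) (P h3) (g w) => b1 b2 b3 b4; field.
 move=> E hgw. rewrite (dwp_at0 Eg w0 hgw) in E. move: E; rewrite exprMn -exprVn -exprM /= [c * _]mulrCA exprVn.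
 by apply: mulfI; rewrite invr_eq0 expf_neq0.
have := @ccts_eq_at (fun w => dP w ^+ 2) (fun w => c * T w) z.
rewrite /T c4 !mulrA => -> //.
- by apply: holo_cts; apply: holoX; apply: dwp_holo.
- by apply: holo_cts; apply: holoM (holo_cst _ _) _; exact: hT.
by rewrite -c4; exact: key.
Qed.

Lemma dwp_neq0 z : ~ L z -> ~ L (2 * z) -> dP z != 0.
Proof.
move=> Lz L2; rewrite -sqrf_eq0 wp_ode// !mulf_neq0 ?pnatr_eq0//.
- by apply: wp_sub_neq0 half1 Lz _ => /(half_translate half1 erefl)[].
- by apply: wp_sub_neq0 half2 Lz _ => /(half_translate half2 erefl)[].
- by apply: wp_sub_neq0 half3 Lz _ => /(half_translate half3 erefl)[].
Qed.

(** Comparison of the terms w^-4 in the differential equation: [G1] and [G2] are its two sides times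
    w^4, after removal of the common leading term 4 w^-2. This relation lets e2 be eliminated from
    the final constants. *)
Lemma sum_e : e1 + e2 + e3 = 0.
Proof.
have [g [hg g0 _ Eg]] := wp_at0 tau.
pose G1 w := - 4 * w * cderiv g w + w ^+ 4 * cderiv g w ^+ 2.
pose G2 w := 4 * ((g w - e1) + (g w - e2) + (g w - e3) +
 w ^+ 2 * ((g w - e1) * (g w - e2) + (g w - e1) * (g w - e3) + (g w - e2) * (g w - e3)) +
 w ^+ 4 * ((g w - e1) * (g w - e2) * (g w - e3))).
have hid : holo id (0 : C) by exact: holo_id.
have hx n : holo (fun w => w ^+ n) (0 : C) by exact: (holoX n hid).
have hd := holo_deriv hg.
have he e : holo (fun w => g w - e) 0 by exact: holoB hg (holo_cst e 0).
have h1' : ccts G1 0.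
 apply: holo_cts; apply: holoD; apply: holoM => //; first by apply: holoM (holo_cst _ 0) hid. exact: holoX.
have h2' : ccts G2 0.
 apply: holo_cts; apply: holoM (holo_cst 4 0) _; apply: holoD; first apply: holoD.
 - by apply: holoD => //; apply: holoD.
 - by apply: holoM => //; apply: holoD; [apply: holoD|]; apply: holoM.
 - by apply: holoM => //; apply: holoM => //; apply: holoM.
have := ccts_eq_at h1' h2'; rewrite /G1 /G2 g0 !expr0n/= !mulr0 !mul0r !addr0 !sub0r => E.
have : 0 = 4 * (- (e1 + e2 + e3)).
 rewrite {1}E; first by ring.
 apply: nearpS3 (nearp_neq 0) (lat_near tau 0) (nearc_p (holo_near hg)) => w; rewrite subr0 => w0 Lw hgw.
 have := wp_ode Lw. rewrite (dwp_at0 Eg w0 hgw).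
 rewrite !(Eg w); move: (cderiv g w) (g w) (P h1) (P h2) (P h3) => d0 gw a b c Eq.
 have e4 : w ^+ 4 * (w ^- 3 * (-2 + w ^+ 3 * d0)) ^+ 2 = w ^+ 4 * (4 * (w ^- 2 + gw - a) * (w ^- 2 + gw - b) * (w ^- 2 + gw - c)) by rewrite Eq.
 have e5 : - 4 * w * d0 + w ^+ 4 * d0 ^+ 2 = w ^+ 4 * (w ^- 3 * (-2 + w ^+ 3 * d0)) ^+ 2 - 4 * w ^- 2 by field.
 by rewrite e5 e4; field.
move=> /eqP; rewrite eq_sym mulf_eq0 pnatr_eq0/= oppr_eq0 => /eqP ->.
by [].
Qed.

(** If c were omitted, 1/(wp - c) would be elliptic without poles, hence constant, although it
    vanishes to order 2 at 0. *)
Lemma wp_surj c : exists2 z, ~ L z & P z = c.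
Proof.
apply: contrapT => hn; have nz z : ~ L z -> P z - c != 0.
 by move=> Lz; rewrite subr_eq0; apply/eqP => E; apply: hn; exists z.
pose V z := (P z - c)^-1; have o2 l : L l -> ord V l 2 by move=> Ll; exact: ordV (wpB_ord c Ll).
have Vr z : reg V z.
 have [Lz|Lz] := pselect (L z); first by apply: (@ord_reg _ _ 2) => //; exact: o2.
 by apply/holo_reg/holoV; [exact: wpB_holo|exact: nz].
have Vp l : L l -> forall z, V (z + l) = V z by move=> Ll v; rewrite /V (wp_per tau).
have [k hk] := liouville tau Vr (Vp _ (lat_w1 w1 w2)) (Vp _ (lat_w2 w1 w2)).
have o := o2 0 (lat0 w1 w2); have [k0|k0] := eqVneq k 0.
 by apply: nearp_false (hk 0) (ord_neq0 o) => w ->; rewrite k0 eqxx.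
have := ord_uniq (ord_ext (hk 0) o) (holo_ord (holo_cst k 0) k0); by [].
Qed.

(** The square cancels the double poles at p and -p; oddness of the difference under reflection
    cancels the zeros of wp' at half periods; at lattice points the orders are 1 - 4 + 3 = 0. The
    quotient by wp' is therefore constant. *)
Lemma wp_addition p : ~ L p -> ~ L (2 * p) -> exists c, forall z, ~ L z -> ~ L (z - p) -> ~ L (z + p) ->
 (P (z + p) - P (z - p)) * (P z - P p) ^+ 2 = c * dP z.
Proof.
move=> Lp L2p; pose D z := P (z + p) - P (z - p).
pose V z := D z * (P z - P p) ^+ 2 / dP z.
have hD z : ~ L (z - p) -> ~ L (z + p) -> holo D z.
 move=> a b; apply: holoB; first by apply: (@holo_shift P); exact: wp_holo.
 by apply: (@holo_shift P); exact: wp_holo.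
have Dodd z l : L l -> D (l - z) = - D z.
 move=> Ll; rewrite /D opprB; have -> : l - z + p = - (z - p) + l by ring.
 have -> : l - z - p = - (z + p) + l by ring. by rewrite !(wp_per tau _ Ll) !(wp_even tau).
have Lpp l : L l -> ~ L (l - p) /\ ~ L (l + p).
 by move=> Ll; split; rewrite addrC latDr ?latNE.
have Dz z : L (2 * z) -> ~ L (z - p) -> ~ L (z + p) -> ordge D z 1.
 move=> L2 a b; rewrite -[X in ordge _ _ X](add0r 1). apply: (@ordge_parity _ _ _ (-1)); rewrite ?expr0z.
 - by apply/ordge0/holo_reg/hD.
 - by apply: nearpT => w; rewrite -mulr2n -mulr_natl Dodd// mulN1r.
 - by rewrite eqNr oner_neq0.
have ge1 z : L (z - p) \/ L (z + p) -> ordge (fun z => (P z - P p) ^+ 2) z 2.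
 move=> h; have [Lz E] : ~ L z /\ P z = P p.
  case: h => h.
   rewrite -(wp_per tau p h) subrKC; split=> // Lz; apply: Lp. have -> : p = z - (z - p) by ring. exact: latB.
  split.
   move=> Lz; apply: Lp; have -> : p = (z + p) - z by ring. exact: latB.
  by rewrite -(wp_even tau p) -(wp_per tau (- p) h); congr P; ring.
 have -> : 2 = 1 * 2%:Z by []. by apply: ordgeX; apply: holo_ordge1; [exact: wpB_holo|rewrite E subrr].
have gem2 a z : ordge (fun z => P (z + a)) z (- 2).
 have [Lz|Lz] := pselect (L (z + a)).
  by apply: ord_ordge; apply: (@ord_shift P); exact: wp_ord.
 by apply: (@ordgeW _ _ 0) => //; apply/ordge0; apply: (@reg_shift P); apply: holo_reg; exact: wp_holo.
have gD z : ordge D z (- 2) by apply: ordgeB; apply: gem2.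
have Vr z : reg V z.
 apply/ordge0; have [Lz|Lz] := pselect (L z).
  have [a b] := Lpp z Lz; rewrite -[X in ordge _ _ X](_ : 1 + (-2) * 2 + 3 = 0)//.
  apply: ordgeM; last exact: ord_ordge (ordV (dwp_ord Lz)).
  apply: ordgeM; last exact: ord_ordge (ordX 2 (wpB_ord _ Lz)).
  by apply: Dz => //; rewrite mulr_natl mulr2n; apply: latD.
 have [Lp1|Lp1] := pselect (L (z - p) \/ L (z + p)).
  have L2 : ~ L (2 * z).
   case: Lp1 => h L2; apply: L2p.
    have -> : 2 * p = 2 * z - ((z - p) + (z - p)) by ring. by apply: latB => //; apply: latD.
   have -> : 2 * p = ((z + p) + (z + p)) - 2 * z by ring. by apply: latB => //; apply: latD.
  rewrite -[X in ordge _ _ X](_ : -2 + 2 + 0 = 0)//; apply: ordgeM; first exact: ordgeM (gD z) (ge1 _ Lp1).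
  apply/ordge0/holo_reg/holoV; [exact: dwp_holo|exact: dwp_neq0].
 have a : ~ L (z - p) by move=> h; apply: Lp1; left. have b : ~ L (z + p) by move=> h; apply: Lp1; right.
 have sq : ordge (fun z => (P z - P p) ^+ 2) z 0.
  by apply/ordge0/holo_reg/holoX; exact: wpB_holo.
 have [L2|L2] := pselect (L (2 * z)).
  rewrite -[X in ordge _ _ X](_ : 1 + 0 - 1 = 0)//; apply: ordgeM; first exact: ordgeM (Dz _ L2 a b) sq.
  by apply: ord_ordge; apply: ordV; apply: dwp_half_ord.
 rewrite -[X in ordge _ _ X](_ : 0 + 0 + 0 = 0)//; apply: ordgeM; first by apply: ordgeM sq; apply/ordge0/holo_reg/hD.
 apply/ordge0/holo_reg/holoV; [exact: dwp_holo|exact: dwp_neq0].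
have Vp l : L l -> forall z, V (z + l) = V z.
 by move=> Ll v; rewrite /V /D dwp_per// (addrAC v l p) (addrAC v l (- p)) !(wp_per tau _ Ll).
have [c hc] := liouville tau Vr (Vp _ (lat_w1 w1 w2)) (Vp _ (lat_w2 w1 w2)).
exists c => z Lz a b.
have := @ccts_eq_at (fun z => D z * (P z - P p) ^+ 2) (fun w => c * dP w) z; apply.
- by apply: holo_cts; apply: holoM; [exact: hD|apply: holoX; exact: wpB_holo].
- by apply: holo_cts; apply: holoM (holo_cst _ _) (dwp_holo Lz).
have [k ok] := dwp_ex_ord z.
by apply: nearpS2 (hc z) (ord_neq0 ok) => w <- nz; rewrite /V divfK.
Qed.

(** If p is neither q nor -q modulo L, [wp_addition] at z = p reads c wp'(p) = 0, so c = 0. Then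
    wp(z + q) - wp(z - q) vanishes near q, where it has a double pole. Half periods are covered by
    [wp_eq_half]. *)
Lemma wp_eq p q : ~ L p -> ~ L q -> P p = P q -> L (p - q) \/ L (p + q).
Proof.
move=> Lp Lq E; apply: contrapT => hn.
have a : ~ L (p - q) by move=> h; apply: hn; left.
have b : ~ L (p + q) by move=> h; apply: hn; right.
have [L2|L2] := pselect (L (2 * q)); first by apply: a; apply: wp_eq_half.
have [c hc] := wp_addition Lq L2.
have := hc p Lp a b; rewrite E subrr expr0n mulr0 => /esym/eqP.
have L2p : ~ L (2 * p).
 move=> L2p; apply: a; have -> : p - q = - (q - p) by ring. by apply: latN; apply: wp_eq_half.
rewrite mulf_eq0 (negbTE (dwp_neq0 Lp L2p)) orbF => /eqP c0.
have o1 : ord (fun z => P (z + q) - P (z - q)) q (- 2).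
 have o3 : ord (fun z => P (z - q)) q (- 2).
  by apply: (@ord_shift P); rewrite subrr; exact: (wp_ord tau (lat0 w1 w2)).
 have r3 : reg (fun z => - P (z + q)) q.
  apply: regN; apply: (@reg_shift P); apply: holo_reg; apply: wp_holo => //. by rewrite -mulr2n -mulr_natl.
 have := ordM (holo_ord (holo_cst (-1) q) _) (ordD_reg o3 isT r3); rewrite add0r oppr_eq0 oner_neq0 => /(_ isT).
 by apply: ord_ext; apply: nearpT => w; ring.
have [k o2] := wpB_ex_ord (P q) q.
have := ord_neq0 (ordM o1 (ordX 2 o2)).
have n1 := nearp_shift (lat_near tau (q + q)); have n2 := nearp_shift (lat_near tau (q - q)).
apply: nearp_false (nearp_and (lat_near tau q) (nearp_and n1 n2)) => w [Lw [Lw1 Lw2]].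
by rewrite hc// c0 mul0r eqxx.
Qed.
End EllipticFunctions.

Lemma holo_ord1 (H : C -> C) z : holo H z -> H z = 0 -> cderiv H z != 0 -> ord H z 1.
Proof.
move=> hz H0 dH; have [g hg E] := holo_factor hz; exists g; split=> //; last first.
 by apply: nearc_p; apply: nearcS E => w ->; rewrite H0 add0r expr1z.
have : cdiff H z (1 * g z + (z - z) * cderiv g z).
 have := cdiffM (cdiffB (cdiff_id z) (cdiff_cst z z)) (cdiff_ex (holoW hg)); rewrite subr0.
 by apply: cdiff_ext; apply: nearcS E => w ->; rewrite H0 add0r.
by rewrite subrr mul0r addr0 mul1r => /cdiff_cderiv <-.
Qed.

(** * Even elliptic functions with poles on the lattice are polynomials in wp *)

Section EvenEllipticFunctions.
Implicit Types (z w l h p a c : C).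
Variables (w1 w2 : C) (tau : 0 < Im (w2 / w1)).
Local Notation L := (lattice w1 w2).
Local Notation P := (wp L).

(** Subtracting the leading coefficient times wp^(m+1) gains one order at 0 and evenness gains
    another, so the induction descends by two pole orders at a time. *)
Lemma even_elliptic (m : nat) H : (forall z, ~ L z -> reg H z) -> nper H w1 -> nper H w2 ->
 nearp 0 (fun w => H (- w) = H w) -> ordge H 0 (- (2 * m)%:Z) ->
 exists2 p : {poly C}, (size p <= m.+1)%N & forall z, nearp z (fun w => H w = p.[P w]).
Proof.
elim: m H => [|m IH] H hr p1 p2 he h0.
 have hr' z : reg H z.
  have [Lz|] := pselect (L z); last exact: hr.
  by rewrite -[z]add0r (reg_nper _ p1 p2 Lz); apply/ordge0; rewrite muln0 oppr0 in h0.
 have [c hc] := liouville_nper tau hr' p1 p2; exists c%:P; first by rewrite size_polyC leq_b1.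
 by move=> z; apply: nearpS (hc z) => w ->; rewrite hornerC.
have [g hg E] := h0; have [gP [hgP gP0 gPe EP]] := wp_at0 tau.
pose a : C := g 0; pose K w := H w - a * P w ^+ m.+1.
have perK l : L l -> nper H l -> nper K l.
 by move=> Ll ph z; apply: nearpS (ph z) => w; rewrite /K (wp_per tau _ Ll) => ->.
have evK : nearp 0 (fun w => K (- w) = K w).
 by apply: nearpS he => w; rewrite /K (wp_even tau) => ->.
have [||p sp hp] := IH K _ (perK _ (lat_w1 w1 w2) p1) (perK _ (lat_w2 w1 w2) p2) evK.
- move=> z Lz; apply: regB (hr z Lz) _; apply: holo_reg; apply: holoM (holo_cst _ _) _.
 exact/holoX/wp_holo.
- have -> : - (2 * m)%:Z = - (2 * m.+1)%:Z + 1 + 1 by rewrite !PoszM intS; ring.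
 apply: (@ordge_parity _ _ _ 1).
 + pose G w := g w - a * (1 + w ^+ 2 * gP w) ^+ m.+1.
  have hid : holo id (0 : C) by exact: holo_id. have hG : holo G 0.
   apply: holoB hg _; apply: holoM (holo_cst a 0) _; apply: holoX.
   by apply: holoD (holo_cst 1 0) _; apply: holoM => //; exact: (holoX 2 hid).
  have G0 : G 0 = 0 by rewrite /G expr0n mul0r addr0 expr1n mulr1 subrr. have [g' hg' E'] := holo_ordge1 hG G0.
  exists g' => //; apply: nearpS3 (nearp_neq 0) E E' => w; rewrite subr0 => w0.
  rewrite expr1z => Hw Gw; rewrite expfzDr// expr1z -mulrA -Gw /K Hw /G EP mulrBr; congr (_ - _).
  have -> : w ^- 2 + gP w = w ^- 2 * (1 + w ^+ 2 * gP w) by field. rewrite exprMn [RHS]mulrCA; congr (_ * (_ * _)).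
  by rewrite -exprVn -exprM exprVn.
 + by apply: nearpS evK => w; rewrite add0r sub0r mul1r.
 have -> : - (2 * m.+1)%:Z + 1 = - (2 * m + 1)%N%:Z by rewrite !PoszD !PoszM intS; ring.
 by rewrite -exprnN exprD exprM sqrrN !expr1n mul1r expr1 invrN invr1 eq_sym eqNr oner_neq0.
exists (p + a *: 'X^(m.+1)).
 rewrite (leq_trans (size_polyD _ _))// geq_max (leq_trans sp)//.
 by rewrite (leq_trans (size_scale_leq _ _))// size_polyXn.
by move=> z; apply: nearpS (hp z) => w; rewrite hornerD hornerZ hornerXn => <-; rewrite /K subrK.
Qed.
End EvenEllipticFunctions.

(** * The lattice L' and the function X *)

Section DoubledLattice.
Implicit Types (x z w l h a b : C).
Variables (w1 w2 : C) (tau : 0 < Im (w2 / w1)).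
Local Notation L := (lattice w1 w2).
Local Notation L' := (lattice w1 (2 * w2)).
Local Notation P := (wp L').
Local Notation e1 := (P (w1 / 2)).
Local Notation e2 := (P (2 * w2 / 2)).
Local Notation e3 := (P ((- w1 - 2 * w2) / 2)).
(** Since e1 + e2 + e3 = 0, [a1] and [a3] are e1 - e2 and e3 - e2, the values of X at w1/2 and w1/2
    + w2; in this form they involve e1 and e3 only. *)
Let a1 := 2 * e1 + e3.
Let a3 := 2 * e3 + e1.

Lemma tau_double : 0 < Im (2 * w2 / w1).
Proof.
by rewrite -mulrA mulrC mulr_natr mulr2n; case: (w2 / w1) tau => u v /= h; rewrite addr_gt0.
Qed.
Local Notation tau' := tau_double.

Lemma lat_double z : L z <-> L' z \/ L' (z - w2).
Proof.
split=> [[m [n ->]]|[[m [n ->]]|[m [n E]]]].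
- have Dn := divz_eq n 2; have a := modz_ge0 n (isT : (2 : int) != 0).
 have b := ltz_pmod n (isT : 0 < (2:int)).
 case: (n %% 2)%Z Dn a b => [[|[|i]]|i] // -> _ _; [left|right]; exists m, (n %/ 2)%Z.
  by rewrite addr0 rmorphM/=; ring.
 by rewrite rmorphD rmorphM/=; ring.
- by exists m, (n * 2); rewrite rmorphM/=; ring.
by exists m, (n * 2 + 1); rewrite -[z](subrK w2) E rmorphD rmorphM/=; ring.
Qed.

Definition Xw z := P z - e2.

Let w22 : 2 * w2 / 2 = w2. Proof. by rewrite mulrAC divff ?mul1r ?pnatr_eq0. Qed.

Lemma half_w1 : half w1 (2 * w2) (w1 / 2). Proof. exact: (half1 tau'). Qed.
Lemma half_w2 : half w1 (2 * w2) w2. Proof. by rewrite -{2}w22; exact: (half2 tau'). Qed.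
Lemma half_w3 : half w1 (2 * w2) (w1 / 2 + w2).
Proof.
have [a b] := half3 tau'; have E : w1 / 2 + w2 = - ((- w1 - 2 * w2) / 2) by field.
by split; rewrite E ?mulrN latNE.
Qed.
Lemma e2E : e2 = - (e1 + e3).
Proof. by have /eqP := sum_e tau'; rewrite addrAC addr_eq0 => /eqP ->; rewrite opprK. Qed.
Lemma Xw_w1 : Xw (w1 / 2) = a1.
Proof. by rewrite /Xw /a1 e2E; ring. Qed.
Lemma Xw_w3 : Xw (w1 / 2 + w2) = a3.
Proof.
rewrite /Xw /a3; have -> : w1 / 2 + w2 = - ((- w1 - 2 * w2) / 2) by field.
by rewrite (wp_even tau') e2E; ring.
Qed.
Lemma Xw_w2 : Xw w2 = 0.
Proof. by rewrite /Xw w22 subrr. Qed.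
Lemma XwB x z : Xw z - x = P z - (e2 + x). Proof. by rewrite /Xw -addrA -opprD. Qed.
Lemma XwBE x : (fun z => Xw z - x) = (fun z => P z - (e2 + x)).
Proof. by apply/funext => z; rewrite XwB. Qed.
Lemma Xw_even z : Xw (- z) = Xw z. Proof. by rewrite /Xw (wp_even tau'). Qed.
Lemma Xw_per z l : L' l -> Xw (z + l) = Xw z. Proof. by move=> Ll; rewrite /Xw (wp_per tau'). Qed.
Lemma Xw_holo z : ~ L' z -> holo Xw z. Proof. exact: (wpB_holo tau'). Qed.
Lemma XwB_ord x l : L' l -> ord (fun z => Xw z - x) l (- 2).
Proof. by rewrite XwBE; exact: (wpB_ord tau'). Qed.
Lemma Xw_ord l : L' l -> ord Xw l (- 2). Proof. exact: (wpB_ord tau'). Qed.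
Lemma XwB_half h z : half w1 (2 * w2) h -> L' (z - h) -> ord (fun w => Xw w - Xw h) z 2.
Proof. by move=> hh Lz; rewrite XwBE /Xw subrKC; exact: (half_ord' tau'). Qed.
Lemma Xw_eq_half h z : half w1 (2 * w2) h -> ~ L' z -> Xw z = Xw h -> L' (z - h).
Proof. by move=> hh Lz /addIr; exact: (wp_eq_half tau'). Qed.
Lemma Xw_eq z w : ~ L' z -> ~ L' w -> Xw z = Xw w -> L' (z - w) \/ L' (z + w).
Proof. by move=> hz hw /addIr; exact: (wp_eq tau'). Qed.
Lemma Xw_surj x : exists2 z, ~ L' z & Xw z = x.
Proof. by have [z Lz E] := wp_surj tau' (e2 + x); exists z => //; rewrite /Xw E addrC addKr. Qed.

Lemma Xw_neq0 z : ~ L z -> Xw z != 0.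
Proof.
move=> Lz; apply/eqP; rewrite -Xw_w2 => E; apply: Lz; apply/lat_double.
have [Lz|Lz] := pselect (L' z); first by left.
by right; apply: Xw_eq_half half_w2 Lz E.
Qed.

Lemma Xw_neq0_ord z : ~ L z -> ord Xw z 0.
Proof.
move=> Lz; apply: holo_ord (Xw_neq0 Lz); apply: Xw_holo => h; apply: Lz.
by apply/lat_double; left.
Qed.

Lemma Xw_ord2 z : L' (z - w2) -> ord Xw z 2.
Proof.
by have -> : Xw = (fun z => Xw z - Xw w2) by [apply/funext => v; rewrite Xw_w2 subr0]; exact: XwB_half half_w2.
Qed.

Lemma a1_neq0 : a1 != 0.
Proof.
rewrite -Xw_w1; apply: Xw_neq0 => /lat_double[]; first exact: half_w1.2.
move=> h; apply: half_w3.2; have -> : w1 / 2 + w2 = w1 / 2 - w2 + 2 * w2 by ring.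
exact/latD/lat_w2.
Qed.
Lemma a3_neq0 : a3 != 0.
Proof.
rewrite -Xw_w3; apply: Xw_neq0 => /lat_double[]; first exact: half_w3.2.
by rewrite addrK; exact: half_w1.2.
Qed.
Lemma a13_neq : a1 != a3.
Proof.
rewrite -Xw_w3 -Xw_w1; apply/eqP => /(Xw_eq_half half_w3 half_w1.2).
by rewrite opprD addrA subrr sub0r latNE; exact: half_w2.2.
Qed.

Lemma Xw_shift z : ~ L z -> Xw z * Xw (z + w2) = a1 * a3.
Proof.
have [K _ hK] := half_shift tau' half_w2.
have hX v : ~ L v -> Xw v * Xw (v + w2) = K.
 move=> Lv; rewrite /Xw w22; apply: hK => h; apply: Lv; apply/lat_double; [by left|right].
 have -> : v - w2 = v + w2 - 2 * w2 by ring. by apply: latB => //; apply: lat_w2.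
move=> Lz; rewrite (hX z Lz) -(hX (w1 / 2)) ?Xw_w1 ?Xw_w3// => /lat_double[]; first exact: half_w1.2.
move=> h; apply: half_w3.2; have -> : w1 / 2 + w2 = w1 / 2 - w2 + 2 * w2 by ring.
exact/latD/lat_w2.
Qed.
Lemma XwB_ord0 x z : ~ L' z -> Xw z != x -> ord (fun w => Xw w - x) z 0.
Proof. by move=> Lz zx; apply: holo_ord; rewrite ?subr_eq0// XwBE; exact: (wpB_holo tau'). Qed.

Lemma dXw_off z : ~ L' z -> cderiv Xw z = cderiv P z.
Proof.
move=> Lz; apply: cdiff_cderiv; rewrite -[cderiv P z]subr0.
exact: cdiffB (wp_cdiff tau' Lz) (cdiff_cst _ _).
Qed.
Lemma dXw_neq0 z : ~ L' z -> ~ L' (2 * z) -> cderiv Xw z != 0.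
Proof. by move=> a b; rewrite dXw_off//; exact: (dwp_neq0 tau'). Qed.

Lemma XwB_ord1 z : ~ L' z -> ~ L' (2 * z) -> ord (fun w => Xw w - Xw z) z 1.
Proof.
move=> Lz L2; have hz := Xw_holo Lz; apply: holo_ord1; rewrite ?subrr//.
 exact: holoB hz (holo_cst _ _).
have := cdiffB (cdiff_ex (holoW hz)) (cdiff_cst (Xw z) z).
by move=> /cdiff_cderiv ->; rewrite subr0 dXw_neq0.
Qed.
End DoubledLattice.

(** * Meromorphic maps to the sphere and their density *)

Section SphereValuedMaps.
Implicit Types (z w a b d : C) (f g : C -> sphere R).

Lemma holomorphic_atP f z : holomorphic_at f z <-> nearc z (fun w => f w <> None) /\ holo (fin f) z.
Proof.
split=> [/nearcP h|[h1 h2]]; last first.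
 by apply/nearcP; apply: nearcS2 h1 h2 => w a /cdiff_derivable b.
by split; apply: nearcS h => w [a /cdiff_derivable b].
Qed.

(** Exact at zeros and poles too: the default value 0 of [fin] at infinity matches 0^-1 = 0. *)
Lemma fin_invE f : fin (@sph_inv R \o f) = (fun w => (fin f w)^-1).
Proof.
apply/funext => w; rewrite /fin /=; case: (f w) => [a|]/=; last by rewrite invr0.
by case: eqP => [->|]//=; rewrite invr0.
Qed.

(** At a pole [fin f] is 0 by default and so is its inverse; thus (fin f)^-1 takes the true value of
    1/f there and is holomorphic. *)
Lemma sph_local f z : meromorphic f ->
 [/\ f z = Some (fin f z), holo (fin f) z & nearc z (fun w => f w <> None)] \/
 [/\ f z = None, holo (fun w => (fin f w)^-1) z & nearc z (fun w => f w <> Some 0)].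
Proof.
move=> [/(_ z)[/holomorphic_atP[h1 h2]|/holomorphic_atP[h1 h2]] _].
 left; split=> //; have := nearc_at h1; rewrite /fin; by case: (f z).
rewrite fin_invE in h2.
have n0 : nearc z (fun w => f w <> Some 0).
 by apply: nearcS h1 => w; rewrite /= => h e; apply: h; rewrite e /= eqxx.
have nz := nearc_at n0; case E : (f z) => [a|]; last by right.
have Fz : fin f z = a by rewrite /fin E.
have a0 : a != 0 by apply/eqP => a0; apply: nz; rewrite E a0.
have b0 : (fin f z)^-1 != 0 by rewrite Fz invr_neq0.
left; split; first by rewrite Fz.
 have := holoV h2 b0; congr (holo _ z); apply/funext => w; exact: invrK.
apply: nearcS (ccts_neq0 (holo_cts h2) b0) => w /eqP h E2; apply: h.
have -> : fin f w = 0 by rewrite /fin E2.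
exact: invr0.
Qed.

Lemma mero_fin f : meromorphic f -> mero (fin f).
Proof.
move=> mf z; have [[_ h _]|[_ h n0]] := sph_local z mf.
 by have [a|[n a]] := holo_dich h; [left; exact: nearc_p|right; exists n%:Z].
have [a|[n a]] := holo_dich h.
 by left; apply: nearc_p; apply: nearcS a => w /eqP; rewrite invr_eq0 => /eqP.
by right; exists (- n%:Z); have := ordV a; congr (ord _ z _); apply/funext => w; exact: invrK.
Qed.

(** Finite values agree by continuity. If one map were finite at z and the other infinite, fin f /
    fin g, or its inverse, would be 1 near z but 0 at z; nonvanishing makes the quotient 1. *)
Lemma mero_eq f g z : meromorphic f -> meromorphic g -> nearp z (fun w => fin f w = fin g w) ->
 nearp z (fun w => fin f w != 0) -> f z = g z.
Proof.
move=> mf mg.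
have aux f' g' : nearp z (fun w => fin f' w = fin g' w) -> nearp z (fun w => fin f' w != 0) ->
  holo (fin f') z -> holo (fun w => (fin g' w)^-1) z -> g' z = None -> False.
 move=> E nz hf hg Ez.
 have := @ccts_eq_at (fun w => fin f' w * (fin g' w)^-1) (fun=> 1) z (cctsM (holo_cts hf) (holo_cts hg)) (ccts_cst _ _).
 have E1 : nearp z (fun w => fin f' w * (fin g' w)^-1 = 1).
  by apply: nearpS2 E nz => w -> ne; rewrite divff.
 by move=> /(_ E1); rewrite /fin Ez /= invr0 mulr0 => /esym/eqP; rewrite oner_eq0.
move=> E nz; have E' : nearp z (fun w => fin g w = fin f w) by apply: nearpS E.
have nz' : nearp z (fun w => fin g w != 0) by apply: nearpS2 E nz => w ->.
have [[a hf _]|[a hf _]] := sph_local z mf; have [[b hg _]|[b hg _]] := sph_local z mg.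
- by rewrite a b; congr Some; exact: ccts_eq_at (holo_cts hf) (holo_cts hg) E.
- by case: (aux f g E nz hf hg b).
- by case: (aux g f E' nz' hg hf a).
- by rewrite a b.
Qed.

Lemma density_someE f z : f z = Some (fin f z) ->
 density f z = 8 * nm (cderiv (fin f) z) ^+ 2 / (1 + nm (fin f z) ^+ 2) ^+ 2.
Proof. by rewrite /density => ->. Qed.

Lemma density_noneE f z : f z = None ->
 density f z = 8 * nm (cderiv (fun w => (fin f w)^-1) z) ^+ 2.
Proof. by rewrite /density => ->; rewrite -/(cderiv _ z) fin_invE. Qed.

Lemma density_some f z a : f z = Some a -> 0 < density f z -> cderiv (fin f) z != 0.
Proof.
move=> E; rewrite density_someE ?/fin ?E// -/(fin f) => h; apply/eqP => h0; move: h.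
by rewrite h0 nm0 expr0n/= mulr0 mul0r ltxx.
Qed.

Lemma density_none f z : f z = None -> 0 < density f z -> cderiv (fun w => (fin f w)^-1) z != 0.
Proof.
move=> E; rewrite density_noneE// => h; apply/eqP => h0; move: h.
by rewrite h0 nm0 expr0n/= mulr0 ltxx.
Qed.

Lemma holo_ord0_neq0 H z : holo H z -> ord H z 0 -> H z != 0.
Proof.
move=> h [g [hg g0 Eg]]; rewrite (@ccts_eq_at H g z (holo_cts h) (holo_cts hg))//.
by apply: nearpS Eg => w ->; rewrite expr0z mul1r.
Qed.

(** Positive density means local injectivity: a finite value with nonzero derivative, or a simple
    pole. *)
Lemma dens_local f z : meromorphic f -> 0 < density f z ->
 [/\ f z = Some (fin f z), holo (fin f) z, cderiv (fin f) z != 0 & ord (cderiv (fin f)) z 0] \/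
 [/\ f z = None, ord (fin f) z (- 1) & ord (cderiv (fin f)) z (- 2)].
Proof.
move=> mf dz; have [[a h _]|[a h _]] := sph_local z mf.
 have d := density_some a dz; left; split=> //; exact: holo_ord (holo_deriv h) d.
have d := density_none a dz; right.
have o1 : ord (fin f) z (- 1).
 have := ordV (holo_ord1 h (_ : (fin f z)^-1 = 0) d); rewrite {1}/fin a /= invr0 => /(_ erefl).
 by congr (ord _ z _); apply/funext => w; exact: invrK.
by split=> //; have := ord_deriv o1 isT.
Qed.

Lemma meromorphic_opp_arg f : meromorphic f -> meromorphic (fun z => f (- z)).
Proof.
move=> [h [z0 hz]]; split=> [z|]; last by exists (- z0); rewrite opprK.
have [/holomorphic_atP[a b]|/holomorphic_atP[a b]] := h (- z); [left|right].
 apply/holomorphic_atP; split; first exact: (@nearc_opp _ (fun w => f w <> None)). exact: (@holo_opp_arg (fin f)).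
apply/holomorphic_atP; split; first exact: (@nearc_opp _ (fun w => (@sph_inv R \o f) w <> None)).
exact: (@holo_opp_arg (fin (@sph_inv R \o f))).
Qed.

Lemma meromorphic_inv f : meromorphic f -> (exists z, f z <> Some 0) -> meromorphic (@sph_inv R \o f).
Proof.
move=> [h [z0 hz]] [z1 h1]; split=> [z|].
 have [a|a] := h z; [right|by left]. have -> : @sph_inv R \o (@sph_inv R \o f) = f; last by [].
 apply/funext => w /=; case: (f w) => [b|]/=; last by rewrite eqxx.
 by case: eqP => [->|/eqP nb]//=; rewrite invr_eq0 (negbTE nb) invrK.
exists z1; move: h1; rewrite /=; case: (f z1) => [b|]//=.
by case: eqP => [->|].
Qed.

Lemma density_opp_arg f z : meromorphic f -> (forall z, f (- z) = f z) -> density f (- z) = density f z.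
Proof.
move=> mf ev; have evF w : fin f (- w) = fin f w by rewrite /fin ev.
have aux H : holo H z -> (forall w, H (- w) = H w) -> nm (cderiv H (- z)) = nm (cderiv H z).
 move=> hz hH; have -> : cderiv H (- z) = - cderiv H z; last by rewrite nmN.
 apply: cdiff_cderiv; have := @cdiff_opp_arg H (- z) (cderiv H z); rewrite opprK => /(_ (cdiff_ex (holoW hz))).
 by apply: cdiff_ext; apply: nearcT => w; rewrite hH.
have [[E h _]|[E h _]] := sph_local z mf.
 have E' : f (- z) = Some (fin f (- z)) by rewrite ev evF.
 refine (etrans (density_someE E') (etrans _ (esym (density_someE E)))).
 exact (congr2 (fun a b : R => 8 * a ^+ 2 / (1 + b ^+ 2) ^+ 2) (aux _ h evF) (congr1 nm (evF z))).
have E' : f (- z) = None by rewrite ev.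
refine (etrans (density_noneE E') (etrans _ (esym (density_noneE E)))).
exact (congr1 (fun a : R => 8 * a ^+ 2) (aux _ h (fun w => congr1 (@GRing.inv _) (evF w)))).
Qed.
End SphereValuedMaps.

(** * Normalized developing maps: the reciprocal logarithmic derivative and evenness *)

Section NormalizedMaps.
Implicit Types (x z w a b d : C).
Variables (w1 w2 : C) (tau : 0 < Im (w2 / w1)).
Local Notation L := (lattice w1 w2).
Variable f : C -> sphere R.
Hypotheses (mf : meromorphic f) (nf : normalized w1 w2 f) (df : forall z, ~ L z -> 0 < density f z).
Local Notation F := (fin f).
Local Notation dF := (cderiv F).

Lemma fin_w1 z : F (z + w1) = - F z.
Proof. by rewrite /fin nf.1; case: (f z) => [a|]//=; rewrite oppr0. Qed.
Lemma fin_w2 z : F (z + w2) = (F z)^-1.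
Proof. by have := congr1 (@^~ z) (fin_invE f); rewrite /fin/= => <-; rewrite nf.2. Qed.

Lemma fin_ex_ord z : exists k, ord F z k.
Proof.
have [z1 L1] : exists z1, ~ L z1 by exists (w1 / 2); exact: (half1 tau).2.
have [h0|[k o]] := mero_fin mf z1; last exact: mero_ord (mero_fin mf) o z.
have [[_ _ _ o]|[_ o _]] := dens_local mf (df L1); last exact: mero_ord (mero_fin mf) o z.
exfalso; apply: nearp_false (nearp_open h0) (ord_neq0 o) => w hw.
have -> : dF w = 0; last by rewrite eqxx.
by apply: cdiff_cderiv; apply: cdiff_ext (cdiff_cst 0 w); apply: nearcS hw.
Qed.

Lemma fin_near z : nearp z (fun w => [/\ holo F w, F w != 0, f w = Some (F w) & dF w != 0]).
Proof.
have [k o] := fin_ex_ord z.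
have h : nearp z (fun w => holo F w /\ f w <> None).
 have [[_ h n]|[_ h n]] := sph_local z mf.
  by apply: nearc_p; apply: nearcS2 (holo_near h) n.
 apply: nearpS3 (nearc_p (holo_near h)) (nearc_p n) (ord_neq0 o) => w hw nw Fw; split.
  have := holoV hw; rewrite invr_neq0// => /(_ isT); congr (holo _ w); apply/funext => v; exact: invrK.
 by move=> E; move: Fw; rewrite /fin E eqxx.
apply: nearpS3 h (lat_near tau z) (ord_neq0 o) => w [hw fw] Lw Fw.
have E : f w = Some (F w) by move: fw; rewrite /fin; case: (f w).
by split=> //; exact: density_some E (df Lw).
Qed.

Lemma dfin_w1 z : nearp z (fun w => dF (w + w1) = - dF w).
Proof.
apply: nearpS (fin_near z) => w [hw _ _ _]; rewrite -cderiv_shift; apply: cdiff_cderiv.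
by have := cdiffN (cdiff_ex (holoW hw)); apply: cdiff_ext; apply: nearcT => v; rewrite fin_w1.
Qed.

Lemma dfin_w2 z : nearp z (fun w => dF (w + w2) = - dF w / F w ^+ 2).
Proof.
apply: nearpS (fin_near z) => w [hw F0 _ _]; rewrite -cderiv_shift; apply: cdiff_cderiv.
have := cdiffV F0 (cdiff_ex (holoW hw)); apply: cdiff_ext; apply: nearcT => v; by rewrite fin_w2.
Qed.

(** The reciprocal of the logarithmic derivative. Off L it is regular, with simple zeros exactly at
    the zeros and poles of f; it is invariant under w1 and changes sign under w2. *)
Definition phi z := F z / dF z.

Lemma phi_w1 : nper phi w1.
Proof. by move=> z; apply: nearpS (dfin_w1 z) => w; rewrite /phi fin_w1 => ->; rewrite invrN mulrNN. Qed.

Lemma phi_w2 z : nearp z (fun w => phi (w + w2) = - phi w).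
Proof.
apply: nearpS2 (dfin_w2 z) (fin_near z) => w; rewrite /phi fin_w2 => -> [_ a _ b].
by field; rewrite a b.
Qed.

Lemma phi_ord_zero z k : ord F z k -> k != 0 -> ord phi z 1.
Proof.
move=> o k0; have := ordM o (ordV (ord_deriv o k0)).
by rewrite opprB addrA addrAC subrr add0r.
Qed.

Lemma fin_ord_zero z : ~ L z -> f z = Some 0 -> ord F z 1.
Proof.
move=> Lz E; have [[_ h d _]|[]] := dens_local mf (df Lz); last by rewrite E.
by apply: holo_ord1 => //; rewrite /fin E.
Qed.
Lemma fin_ord_pole z : ~ L z -> f z = None -> ord F z (- 1).
Proof. by move=> Lz E; have [[]|[]//] := dens_local mf (df Lz); rewrite E. Qed.

Lemma phi_ord0 z : ~ L z -> f z <> Some 0 -> f z <> None -> ord phi z 0.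
Proof.
move=> Lz a b; have [[E h d o]|[//]] := dens_local mf (df Lz).
rewrite -[X in ord _ _ X](subr0 0); apply: ordM (ordV o); apply: holo_ord => //.
by apply/eqP => F0; apply: a; rewrite E F0.
Qed.

Lemma phi_ord1 z : ~ L z -> f z = Some 0 \/ f z = None -> ord phi z 1.
Proof.
move=> Lz [E|E]; first exact: phi_ord_zero (fin_ord_zero Lz E) isT.
exact: phi_ord_zero (fin_ord_pole Lz E) isT.
Qed.

(** If f(0) were 0 or infinity, phi would have a simple zero at 0, and phi^2 would be elliptic,
    without poles and zero at 0, hence identically zero, which its order 2 at 0 excludes. *)
Lemma fin_at0 : f 0 = Some (F 0) /\ F 0 != 0.
Proof.
apply: contrapT => hn; have o1 : ord phi 0 1.
 have [k o] := fin_ex_ord 0; apply: (phi_ord_zero o); apply/eqP => k0. move: o; rewrite k0 => o; apply: hn.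
 have [[E h _]|[E h _]] := sph_local 0 mf; first by split=> //; exact: holo_ord0_neq0.
 by have := holo_ord0_neq0 h (ordV o); rewrite /fin E /= invr0 eqxx.
pose H z := phi z ^+ 2.
have p1 : nper H w1 by move=> z; apply: nearpS (phi_w1 z) => w; rewrite /H => ->.
have p2 : nper H w2 by move=> z; apply: nearpS (phi_w2 z) => w; rewrite /H => ->; rewrite sqrrN.
have hr z : reg H z.
 have [Lz|Lz] := pselect (L z).
  by rewrite -[z]add0r (reg_nper _ p1 p2 Lz); apply: (ord_reg _ (ordX 2 o1)).
 apply: regX; have [a|a] := pselect (f z = Some 0 \/ f z = None).
  by apply: (@ord_reg _ _ 1) => //; exact: phi_ord1.
 by apply: (@ord_reg _ _ 0) => //; apply: phi_ord0 => // e; apply: a; [left|right].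
have g1 : ordge H 0 1 by apply: ordgeW (ord_ordge (ordX 2 o1)).
by apply: nearp_false (liouville0_nper tau hr p1 p2 g1 0) (ord_neq0 (ordX 2 o1)) => w E; rewrite /H in E; by rewrite E eqxx.
Qed.
Lemma fin_holo0 : holo F 0.
Proof. by have [E _] := fin_at0; have [[]|[]] := sph_local 0 mf; rewrite ?E. Qed.

Lemma dfin_ord0_ex : exists m : nat, ord dF 0 m%:Z.
Proof.
have [h|//] := holo_dich (holo_deriv fin_holo0).
by exfalso; apply: nearp_false (nearc_p h) (fin_near 0) => w -> []; rewrite eqxx.
Qed.

Section Evenness.
Variable n : nat.
Hypothesis om : ord dF 0 (2 * n + 1)%N.

Lemma finB_ord0 : ord (fun z => F z - F 0) 0 (2 * n + 2)%N.
Proof.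
have hF := fin_holo0; have hB : holo (fun z => F z - F 0) 0 by apply: holoB (holo_cst _ _).
have dB : nearp 0 (fun w => cderiv (fun z => F z - F 0) w = dF w).
 apply: nearc_p; apply: nearcS (holo_near hF) => w hw; apply: cdiff_cderiv.
 by rewrite -[dF w]subr0; apply: cdiffB (cdiff_ex (holoW hw)) (cdiff_cst _ _).
have [h|[k o]] := holo_dich hB.
 exfalso; apply: nearp_false (nearp_open (nearc_p h)) (fin_near 0) => w hw [_ _ _].
 have -> : dF w = 0; last by rewrite eqxx. apply: cdiff_cderiv; apply: cdiff_ext (cdiff_cst (F 0) w).
 by apply: nearcS hw => v /eqP; rewrite subr_eq0 => /eqP.
have k0 : k%:Z != 0.
 by apply/eqP => k0; have := holo_ord0_neq0 hB; rewrite -k0 => /(_ o); rewrite subrr eqxx.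
have := ord_uniq (ord_ext dB (ord_deriv o k0)) om => /eqP; rewrite subr_eq => /eqP E.
by move: o; rewrite E; congr (ord _ _ _); rewrite !PoszD -addrA.
Qed.

(** Under f -> -f and f -> 1/f the numerator [N] and the denominator [D] acquire the same factor, so
    [X] is elliptic for L. Off L the poles of f are simple and its derivative does not vanish at
    finite values, so [X] is regular there; the orders at 0 decide. *)
Lemma fin_even z : nearp z (fun w => F w = F (- w)).
Proof.
pose N w := (F w - F (- w)) ^+ 2; pose D w := dF w * dF (- w); pose X w := N w / D w.
have dn z' : nearp z' (fun w => [/\ holo F (- w), F (- w) != 0, f (- w) = Some (F (- w)) & dF (- w) != 0]).
 exact: (nearp_opp (fin_near (- z'))).
have Fm1 w : F (- (w + w1)) = - F (- w).
 by have := fin_w1 (- (w + w1)); rewrite opprD subrK => ->; rewrite opprK.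
have Fm2 w : F (- (w + w2)) = (F (- w))^-1.
 by have := fin_w2 (- (w + w2)); rewrite opprD subrK => ->; rewrite invrK.
have p1 : nper X w1.
 move=> v; have q := nearp_opp (dfin_w1 (- (v + w1))); have q' := nearp_shift q.
 apply: nearpS2 (dfin_w1 v) q' => w E E'; rewrite /X /N /D fin_w1 Fm1 E. move: E'; rewrite opprD subrK => ->.
 by rewrite mulrN mulNr -mulrN opprK; congr (_ / _); ring.
have aux3 (u v : C) : v != 0 -> u ^+ 2 / v = 0 -> u = 0.
 by move=> v0 /eqP; rewrite mulf_eq0 invr_eq0 (negbTE v0) orbF sqrf_eq0 => /eqP.
have aux2 (d0 d1 b : C) : b != 0 -> d1 = - d0 / b^-1 ^+ 2 -> d0 = - d1 / b ^+ 2.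
 by move=> b0 ->; field.
have p2 : nper X w2.
 move=> v; have q := nearp_opp (dfin_w2 (- (v + w2))); have q' := nearp_shift q.
 have nv := fin_near v; have nv' := dn v.
 apply: nearpS3 (dfin_w2 v) q' (nearp_and nv nv') => w E E' [[_ a _ b] [_ a' _ b']].
 rewrite /X /N /D fin_w2 Fm2 E; move: E'; rewrite Fm2 opprD subrK => E'.
 have -> : dF (- w - w2) = - dF (- w) / F (- w) ^+ 2.
  exact: aux2 E'.
 by move: a a' b b'; move: (F w) (F (- w)) (dF w) (dF (- w)) => x1 x2 x3 x4 a a' b b'; field; rewrite a a' b b'.
have reg0 v : ~ L v -> exists s : nat, ordge F v (- s%:Z) /\ ord dF v (- (2 * s)%N%:Z) /\ (s <= 1)%N.
 move=> Lv; have [[_ h _ o]|[_ o o']] := dens_local mf (df Lv); [exists 0%N|exists 1%N].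
  by rewrite muln0 oppr0; split=> //; apply/ordge0; exact: holo_reg.
 by split; [exact: ord_ordge|].
have opp_ge v k : ordge F (- v) k -> ordge (fun w => F (- w)) v k.
 move=> [g hg E]; exists (fun w => (-1) ^ k * g (- w)).
  by apply: holoM (holo_cst _ _) _; apply: (@holo_opp_arg g).
 apply: nearpS (nearp_opp E) => w ->; rewrite mulrA -expfzMl; congr (_ ^ _ * _); ring.
have X4 : ordge X 0 4.
 have [fo go] : ord (fun w => F (- w) - F 0) 0 (2 * n + 2)%N /\ ord (fun w => dF (- w)) 0 (2 * n + 1)%N.
  by split; [apply: (@ord_opp_arg (fun w => F w - F 0))|apply: ord_opp_arg]; rewrite oppr0//; exact: finB_ord0.
 (* F - F(0) has even order 2n + 2, so its leading term drops out of the odd difference and parity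
    adds one. Squared, this exceeds the order 2(2n + 1) of the denominator by 4. *)
 have g0 : ordge (fun w => F w - F (- w)) 0 ((2 * n + 2)%N%:Z + 1).
  apply: (@ordge_parity _ _ _ (-1)).
  - apply: ordge_ext (ordgeB (ord_ordge finB_ord0) (ord_ordge fo)); apply: nearpT => w; ring.
  - by apply: nearpT => w; rewrite add0r sub0r opprK mulN1r opprB.
  by rewrite -[_ ^ _]/((-1) ^+ (2 * n + 2)) exprD exprM sqrrN !expr1n mul1r eqNr oner_neq0.
 have := ordgeM (ordgeX 2 g0) (ord_ordge (ordV (ordM om go))). by congr (ordge _ _ _); lia.
have hr v : reg X v.
 have [Lv|Lv] := pselect (L v).
  by rewrite -[v]add0r (reg_nper _ p1 p2 Lv); exact: ordge_reg X4.
 have Lv' : ~ L (- v) by rewrite latNE. have [s [F1 [D1 s1]]] := reg0 v Lv; have [s' [F2 [D2 s2]]] := reg0 _ Lv'.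
 have oN : ordge N v ((- (maxn s s')%:Z) * 2%:Z).
  apply: ordgeX; apply: ordgeB; first by apply: ordgeW F1; rewrite lerN2 lez_nat leq_maxl.
  by apply: opp_ge; apply: ordgeW F2; rewrite lerN2 lez_nat leq_maxr.
 have oD := ordV (ordM D1 (ord_opp_arg D2)). apply: ordge_reg (ordgeM oN (ord_ordge oD)).
 by case: s s1 {F1 D1 oN oD} => [|[|]]//; case: s' s2 {F2 D2} => [|[|]].
have X1 : ordge X 0 1 by apply: ordgeW X4.
have X0 := liouville0_nper tau hr p1 p2 X1 z.
apply: nearpS3 X0 (fin_near z) (dn z) => w X0 [_ _ _ a] [_ _ _ b].
exact: subr0_eq (aux3 _ _ (mulf_neq0 a b) X0).
Qed.

Lemma normalized_even z : f (- z) = f z.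
Proof.
apply: (@mero_eq (fun z => f (- z)) f z (meromorphic_opp_arg mf) mf).
 by apply: nearpS (fin_even z) => w ->.
by apply: nearpS2 (fin_even z) (fin_near z) => w; rewrite /fin => <- [].
Qed.
End Evenness.
End NormalizedMaps.

(** * Weighted power sums of roots as coefficients of partial fractions *)

Section WeightedRoots.
Variables (K : fieldType) (I : finType) (x w : I -> K).
Implicit Types (n j : nat) (i k : I).

Definition rprod : {poly K} := \prod_i ('X - (x i)%:P).
Definition rprod' i : {poly K} := \prod_(k | k != i) ('X - (x k)%:P).
(** The numerator of the sum of w i / ('X - x i) over the common denominator [rprod]. *)
Definition wsum : {poly K} := \sum_i w i *: rprod' i.

Lemma rprodE i : ('X - (x i)%:P) * rprod' i = rprod.
Proof. by rewrite /rprod (bigD1 i). Qed.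
Lemma size_rprod : size rprod = #|I|.+1.
Proof. by rewrite /rprod size_prod_XsubC /index_enum -enumT -cardT. Qed.
Lemma rprod_neq0 : rprod != 0.
Proof. by rewrite -size_poly_eq0 size_rprod. Qed.

Lemma size_rprod' i : size (rprod' i) = #|I|.
Proof.
have := size_rprod; rewrite -(rprodE i) size_proper_mul ?size_XsubC ?lead_coefXsubC ?mul1r//.
 by move=> [].
rewrite lead_coef_eq0; apply/eqP => h; have := size_rprod; rewrite -(rprodE i) h mulr0 size_poly0.
by [].
Qed.

Lemma size_sum_rprod' (u : I -> K) : (size (\sum_i u i *: rprod' i)%R <= #|I|)%N.
Proof.
apply: (leq_trans (size_sum _ _ _)); apply/bigmax_leqP => i _.
by rewrite (leq_trans (size_scale_leq _ _))// size_rprod'.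
Qed.

(** The expansion of wsum/rprod at infinity, whose coefficients are the weighted power sums,
    truncated to a polynomial identity with remainder. *)
Lemma wsum_high n : 'X^(n.+1) * wsum =
 (\sum_(j < n.+1) (\sum_i w i * x i ^+ j) *: 'X^(n - j)) * rprod
 + \sum_i (w i * x i ^+ n.+1) *: rprod' i.
Proof.
rewrite /wsum mulr_sumr.
have -> : \sum_(j < n.+1) (\sum_i w i * x i ^+ j) *: 'X^(n - j) =
  \sum_i \sum_(j < n.+1) (w i * x i ^+ j) *: 'X^(n - j) :> {poly K}.
 by rewrite exchange_big; apply: eq_bigr => j _; rewrite scaler_suml.
rewrite mulr_suml -big_split; apply: eq_bigr => i _ /=.
have -> : \sum_(j < n.+1) (w i * x i ^+ j) *: 'X^(n - j) =
  w i *: \sum_(j < n.+1) 'X^(n - j) * (x i)%:P ^+ j :> {poly K}.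
 rewrite scaler_sumr; apply: eq_bigr => j _; rewrite -scalerA -rmorphXn/= mulrC mul_polyC. by [].
rewrite -scalerAr -[(w i * _) *: _]scalerA -scalerAl -scalerDr; congr (_ *: _).
rewrite -(rprodE i) mulrA [_ * ('X - _)]mulrC.
have -> : ('X - (x i)%:P) * (\sum_(j < n.+1) 'X^(n - j) * (x i)%:P ^+ j) = 'X^(n.+1) - (x i)%:P ^+ n.+1.
 by rewrite subrXX.
by rewrite -rmorphXn/= mulrBl mul_polyC subrK.
Qed.

Lemma wsum_size n : (forall j, (j <= n)%N -> \sum_i w i * x i ^+ j = 0) ->
 (size wsum <= #|I| - n.+1)%N.
Proof.
move=> h; have := wsum_high n; rewrite big1 => [|j _]; last by rewrite h ?scale0r// -ltnS ltn_ord.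
rewrite mul0r add0r => E; have := size_sum_rprod' (fun i => w i * x i ^+ n.+1); rewrite -E.
have [->|nz] := eqVneq wsum 0; first by rewrite size_poly0.
by rewrite mulrC size_mulXn// => s; rewrite leq_subRL ?(leq_trans _ s)// leq_addr.
Qed.

(** With 2n + 2 roots, k 'X^n / rprod decays at infinity like the power -(n + 2), so the first n + 1
    coefficients of the expansion are 0. *)
Lemma wsum_powers n (k : K) : (2 * n + 2 = #|I|)%N -> wsum = k *: 'X^n ->
 forall j, (j <= n)%N -> \sum_i w i * x i ^+ j = 0.
Proof.
move=> cI E j jn; have := wsum_high n; rewrite E => h.
set S := \sum_(j < n.+1) _ in h.
have S0 : S = 0.
 apply/eqP; apply: contraT => S0. have : (size (S * rprod)%R <= #|I|)%N.
  have -> : S * rprod = 'X^(n.+1) * (k *: 'X^n) - \sum_i (w i * x i ^+ n.+1) *: rprod' i.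
   by rewrite h addrK.
  rewrite (leq_trans (size_polyD _ _))// geq_max size_polyN size_sum_rprod' andbT.
  rewrite -scalerAr -exprD (leq_trans (size_scale_leq _ _))// size_polyXn -cI. by rewrite mul2n -addnn; lia.
 rewrite size_mul ?rprod_neq0// size_rprod addnS /=. have : (0 < size S)%N by rewrite size_poly_gt0.
 by move: (size S) => [//|s] _; rewrite addSn ltnNge leq_addl.
have e0 := congr1 (fun p : {poly K} => p`_(n - j)) S0; rewrite coef0 in e0; rewrite -[RHS]e0.
rewrite /S coef_sum (bigD1 (Ordinal (jn : (j < n.+1)%N)))//= coefZ coefXn eqxx mulr1.
set T := (X in _ = _ + X); suff -> : T = 0 by rewrite addr0.
rewrite /T big1// => l; rewrite -val_eqE /= => lj.
rewrite coefZ coefXn; case: eqP => [e|]; last by rewrite mulr0.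
by move: lj (ltn_ord l); lia.
Qed.

(** The dual expansion at 0: the coefficients of wsum/rprod are minus the sums of w i (x i)^-(j+1),
    so the vanishing of the first n makes [wsum] divisible by 'X^n. *)
Lemma wsum_low n : (forall i, x i != 0) -> (forall j, (j < n)%N -> \sum_i w i * (x i)^-1 ^+ j.+1 = 0) ->
 exists q, wsum = 'X^n * q.
Proof.
move=> x0 h; exists (\sum_i (w i * (x i)^-1 ^+ n) *: rprod' i); rewrite mulr_sumr.
suff : \sum_i (w i *: rprod' i - 'X^n * ((w i * (x i)^-1 ^+ n) *: rprod' i)) = 0.
 by rewrite sumrB => /eqP; rewrite subr_eq0 => /eqP.
have -> : \sum_i (w i *: rprod' i - 'X^n * ((w i * (x i)^-1 ^+ n) *: rprod' i)) =
  \sum_i \sum_(j < n) (- (w i * (x i)^-1 ^+ j.+1)) *: ('X^j * rprod).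
 apply: eq_bigr => i _; have := subrXX 1 ((x i)^-1 *: 'X) n; rewrite expr1n exprZn => E.
 have -> : 'X^n * ((w i * (x i)^-1 ^+ n) *: rprod' i) = w i *: ((x i)^-1 ^+ n *: 'X^n * rprod' i).
  by rewrite -scalerAr -scalerAl scalerA.
 rewrite -scalerBr -{1}[rprod' i]mul1r -mulrBl E. have -> : 1 - (x i)^-1 *: 'X = - ((x i)^-1 *: ('X - (x i)%:P)).
  by rewrite scalerBr -[_ *: (x i)%:P]mul_polyC -polyCM mulVf// opprB.
 rewrite mulNr mulNr -!scalerAl [('X - _) * _]mulrC -mulrA rprodE scalerN scalerA mulr_suml.
 rewrite scaler_sumr -sumrN; apply: eq_bigr => j _.
 by rewrite expr1n mul1r exprZn -scalerAl scalerA scaleNr exprS mulrA.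
rewrite exchange_big big1// => j _ /=; rewrite -scaler_suml sumrN h ?oppr0 ?scale0r//.
Qed.
End WeightedRoots.

Lemma rprod_roots (K : fieldType) (I : finType) (x : I -> K) (D : {poly K}) :
 injective x -> size D = #|I|.+1 -> (forall i, root D (x i)) -> D = lead_coef D *: rprod x.
Proof.
move=> xi sD rD; have sI : size [seq x i | i <- index_enum I] = #|I|.
 by rewrite size_map /index_enum -enumT -cardT.
have := @all_roots_prod_XsubC _ D [seq x i | i <- index_enum I].
rewrite sI sD big_map => E; apply: E => //.
 by apply/allP => y /mapP[i _ ->].
by rewrite uniq_rootsE map_inj_uniq// /index_enum -enumT enum_uniq.
Qed.
Lemma card_sroot (n : nat) : #|{: bool * 'I_n.+1}| = (2 * n + 2)%N.
Proof. by rewrite card_prod card_bool card_ord; lia. Qed.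

(** * Zeros and poles as one signed family of roots *)

Section SignedRoots.
Variables (K : fieldType) (n : nat) (a : bool -> K) (z : bool -> 'I_n -> K).
Hypothesis two0 : 2 != 0 :> K.

(** In use, [true] marks zeros of f and [false] its poles; the index [ord0] stands for the half
    period and [lift ord0 i] for the i-th point. *)
Definition sroot (p : bool * 'I_n.+1) : K := if unlift ord0 p.2 is Some i then z p.1 i else a p.1.
(** The order of f divided by the order of X - x at the point: X takes its value doubly at the half
    periods, whence 2^-1. *)
Definition sweight (p : bool * 'I_n.+1) : K :=
 (if p.1 then 1 else -1) * (if unlift ord0 p.2 is Some i then 1 else 2^-1).

Lemma big_sroot (T : nmodType) (F : bool * 'I_n.+1 -> T) :
 \sum_p F p = F (true, ord0) + \sum_(i < n) F (true, lift ord0 i)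
  + (F (false, ord0) + \sum_(i < n) F (false, lift ord0 i)).
Proof.
rewrite (eq_bigr (fun p => F (p.1, p.2))) => [|[]//].
by rewrite -(pair_bigA _ (fun b i => F (b, i)))/= big_bool !big_ord_recl.
Qed.

Lemma sroot_powers j : \sum_p sweight p * sroot p ^+ j =
 (a true ^+ j - a false ^+ j) / 2 + (\sum_i z true i ^+ j - \sum_i z false i ^+ j).
Proof.
rewrite big_sroot /sweight /sroot /= !unlift_none.
under eq_bigr do rewrite liftK mulr1 mul1r.
under [X in _ + (_ + X)]eq_bigr do rewrite liftK mulr1 mulN1r.
by rewrite sumrN mul1r mulN1r; field.
Qed.
End SignedRoots.

(** * Orders of polynomials in a function *)

Section PolynomialsInElliptic.
Implicit Types (z w l c : C).

Lemma ordge_ord_le H z (k l : int) : ordge H z k -> ord H z l -> k <= l.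
Proof.
move=> h [g [hg g0 E]]; rewrite leNgt; apply/negP => lk.
have [g' hg' E'] : ordge H z (l + 1) by apply: ordgeW h; rewrite lezD1.
have hg2 : holo (fun w => (w - z) * g' w) z by apply: holoM hg'; exact: holoB (holo_id z) (holo_cst z z).
have := ccts_eq_at (holo_cts hg) (holo_cts hg2); rewrite subrr mul0r => e0.
have : g z = 0.
 apply: e0; apply: nearpS3 (nearp_neq z) E E' => w wz -> e.
 apply: (mulfI (expfz_neq0 l wz)); rewrite e expfzDr// expr1z mulrA. by [].
by move=> e; move: g0; rewrite e eqxx.
Qed.

Lemma ordge1_val H z : holo H z -> ordge H z 1 -> H z = 0.
Proof.
move=> h [g hg E].
have hg2 : holo (fun w => (w - z) * g w) z by apply: holoM hg; exact: holoB (holo_id z) (holo_cst z z).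
have := ccts_eq_at (holo_cts h) (holo_cts hg2); rewrite subrr mul0r; apply.
by apply: nearpS E => w ->; rewrite expr1z.
Qed.

Lemma ord_horner H z (k : int) (p : {poly C}) : (forall c, ord (fun w => H w - c) z k) -> p != 0 ->
 ord (fun w => p.[H w]) z (k * (size p).-1%:Z).
Proof.
move=> hc; move: {2}(size p) (erefl (size p)) => m; elim: m p => [|m IH] p sp p0.
 by move: p0; rewrite -size_poly_eq0 sp.
have [m0|m0] := eqVneq m 0%N.
 have /size_poly1P[c c0 ->] : size p == 1%N by rewrite sp m0.
 rewrite size_polyC c0 /= mulr0; apply: ord_ext (holo_ord (holo_cst c z) c0). by apply: nearpT => w; rewrite hornerC.
have /closed_rootP[r /factor_theorem[q E]] : size p != 1%N by rewrite sp; apply: contra m0 => /eqP[->].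
have q0 : q != 0 by apply: contraNneq p0 => q0; rewrite E q0 mul0r.
have sq : size q = m.
 by have := sp; rewrite E size_Mmonic ?monicXsubC// size_XsubC addn2 => -[].
rewrite sp E; have := ordM (IH q sq q0) (hc r).
have -> : k * (size q).-1%:Z + k = k * m.+1.-1%:Z.
 rewrite sq; case: m m0 {IH sp sq} => // m _ /=; rewrite -[RHS]/(k * m.+1%:Z) -addn1 PoszD mulrDr mulr1. by [].
by apply: ord_ext; apply: nearpT => w; rewrite hornerM hornerXsubC.
Qed.
End PolynomialsInElliptic.

(** * The divisor of a normalized developing map and its power sums *)

Section DivisorOfNormalizedMap.
Implicit Types (x y z w l r : C).
Variables (w1 w2 : C) (tau : 0 < Im (w2 / w1)).
Local Notation L := (lattice w1 w2).
Local Notation L' := (lattice w1 (2 * w2)).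
Variable f : C -> sphere R.
Hypotheses (mf : meromorphic f) (nf : normalized w1 w2 f) (df : forall z, ~ L z -> 0 < density f z).
Variable n : nat.
Hypotheses (om : ord (cderiv (fin f)) 0 (2 * n + 1)%N) (f1 : f (w1 / 2) = Some 0).
Local Notation F := (fin f).
Local Notation dF := (cderiv F).
Local Notation ph := (phi f).
Local Notation X := (Xw w1 w2).
Local Notation dX := (cderiv X).
Local Notation mu := (X (w1 / 2) * X (w1 / 2 + w2)).
Let tau' := tau_double tau.
Let fev := normalized_even tau mf nf df om.

Let LL z : ~ L z -> ~ L' z.
Proof. by move=> h k; apply: h; apply/lat_double; left. Qed.
Let Lw2 z : ~ L z -> ~ L (z + w2).
Proof. by rewrite latDr//; exact: lat_w2. Qed.

Lemma not_lat_w1 : ~ L (w1 / 2). Proof. exact: (half1 tau).2. Qed.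
Lemma Xw_shift_mu z : ~ L z -> X z * X (z + w2) = mu.
Proof. by move=> Lz; rewrite Xw_shift// -(Xw_shift tau not_lat_w1). Qed.
Lemma mu_neq0 : mu != 0.
Proof. by apply: mulf_neq0; [rewrite (Xw_w1 tau); exact: (a1_neq0 tau)|rewrite (Xw_w3 tau); exact: (a3_neq0 tau)]. Qed.

(** f itself changes sign under w1; only the sets of its zeros and poles are L'-periodic. *)
Lemma fval_per l z : L' l -> (f (z + l) = Some 0 <-> f z = Some 0) /\ (f (z + l) = None <-> f z = None).
Proof.
move=> Ll; have p1 v : (f (v + w1) = Some 0, f (v + w1) = None) = (f v = Some 0, f v = None) :> Prop * Prop.
 rewrite nf.1; case: (f v) => [b|]//=; congr pair; apply/propext; split=> // -[] => [/eqP|->]; last by rewrite oppr0.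
 by rewrite oppr_eq0 => /eqP ->.
have p2 v : (f (v + 2 * w2) = Some 0, f (v + 2 * w2) = None) = (f v = Some 0, f v = None) :> Prop * Prop.
 rewrite mulr_natl mulr2n addrA !nf.2; case: (f v) => [b|]/=; last by rewrite eqxx.
 by case: eqP => [->//|/eqP nb]/=; rewrite invr_eq0 (negbTE nb) invrK.
have := per_lat (F := fun v => (f v = Some 0, f v = None)) p1 p2 z Ll.
by move=> [-> ->].
Qed.

Lemma fval_w2 z : (f (z + w2) = Some 0 <-> f z = None) /\ (f (z + w2) = None <-> f z = Some 0).
Proof.
rewrite nf.2; case: (f z) => [b|]/=; last by split; split.
case: eqP => [->|/eqP nb]; first by split; split.
split; split=> //; first by move=> [] /eqP; rewrite invr_eq0 (negbTE nb).
by move=> [e]; move: nb; rewrite e eqxx.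
Qed.

Lemma fval_Xw z z' : ~ L z -> ~ L z' -> X z = X z' -> (f z = Some 0 <-> f z' = Some 0) /\ (f z = None <-> f z' = None).
Proof.
move=> /LL Lz /LL Lz' /(Xw_eq tau Lz Lz')[h|h].
 by have := fval_per z' h; rewrite subrKC.
have := fval_per (- z') h; rewrite addrC addrK => -[a b]; rewrite fev in a, b.
by [].
Qed.

Lemma dX_per l z : L' l -> dX (z + l) = dX z.
Proof.
move=> Ll; rewrite -(cderiv_shift X z l); congr (cderiv _ z).
by apply/funext => w; rewrite Xw_per.
Qed.

Lemma dX_ord z x k : ord (fun w => X w - x) z k -> k != 0 -> ord dX z (k - 1).
Proof.
move=> o k0; have := ord_deriv o k0; apply: ord_ext.
apply: nearpS (lat_near tau' z) => w Lw; apply: cdiff_cderiv; rewrite -[dX w]subr0.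
exact: cdiffB (cdiff_ex (holoW (Xw_holo tau Lw))) (cdiff_cst _ _).
Qed.

Lemma phi_ord_lat l : L l -> ord ph l (- (2 * n + 1)%N%:Z).
Proof.
move=> Ll; have o0 : ord ph 0 (- (2 * n + 1)%N%:Z).
 rewrite -[X in ord _ _ X]add0r; apply: ordM (ordV om); apply: holo_ord (fin_at0 tau mf nf df).2.
 exact: (fin_holo0 tau mf nf df).
have sg (s a : C) v : s != 0 -> nearp v (fun w => ph (w + a) = s * ph w) ->
  ord ph (v + a) (- (2 * n + 1)%N%:Z) = ord ph v (- (2 * n + 1)%N%:Z).
 move=> s0 E; apply/propext; split=> o.
  have := ordM (holo_ord (holo_cst s^-1 v) _) (ord_shift o); rewrite invr_eq0 add0r => /(_ s0).
  by apply: ord_ext; apply: nearpS E => w ->; rewrite mulKf.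
 have o' : ord (fun w => ph (w + a)) (v + a - a) (- (2 * n + 1)%N%:Z).
  rewrite addrK; have := ordM (holo_ord (holo_cst s v) s0) o; rewrite add0r.
  by apply: ord_ext; apply: nearpS E => w ->.
 have := @ord_shift (fun w => ph (w + a)) (v + a) (- a) _ o'. by apply: ord_ext; apply: nearpT => w; rewrite subrK.
have p1 v : ord ph (v + w1) (- (2 * n + 1)%N%:Z) = ord ph v (- (2 * n + 1)%N%:Z).
 by apply: (sg 1); rewrite ?oner_neq0//; apply: nearpS (phi_w1 tau mf nf df v) => w ->; rewrite mul1r.
have p2 v : ord ph (v + w2) (- (2 * n + 1)%N%:Z) = ord ph v (- (2 * n + 1)%N%:Z).
 apply: (sg (-1)); first by rewrite oppr_eq0 oner_neq0.
 by apply: nearpS (phi_w2 tau mf nf df v) => w ->; rewrite mulN1r.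
by have := per_lat (F := fun v => ord ph v _) p1 p2 0 Ll; rewrite add0r => ->.
Qed.

Let H z := ph z * dX z * X z ^+ n.

(** This explains the exponent n: at w2, phi has a pole of order 2n + 1, X' a simple zero and X a
    double one, so X^n makes H regular and nonzero. *)
Lemma H_ord_w2 z : L' (z - w2) -> ord H z 0.
Proof.
move=> Lz; have Lz1 : L z by apply/lat_double; right.
have o2 := Xw_ord2 tau Lz; have od : ord dX z 1.
 by apply: (@dX_ord z 0 2) => //; apply: ord_ext o2; apply: nearpT => w; rewrite subr0.
have := ordM (ordM (phi_ord_lat Lz1) od) (ordX n o2).
by have -> : - (2 * n + 1)%N%:Z + 1 + 2 * n%:Z = 0 by lia.
Qed.

(** At 0 the pole orders 2n + 1, 3 and 2n add up to 2(2n + 2), which gives the degree 2n + 2. The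
    sign of phi under w2 disappears for 2 w2, so H is L'-periodic. The value at w2, where X = 0,
    gives D(0) nonzero; translating by e2 turns a polynomial in wp into one in X. *)
Lemma H_poly : exists D : {poly C}, [/\ size D = (2 * n + 3)%N, D.[0] != 0 &
 forall z, nearp z (fun w => H w = D.[X w])].
Proof.
have hr z : ~ L' z -> reg H z.
 move=> Lz; have [Lz1|Lz1] := pselect (L z).
  by apply: (@ord_reg _ _ 0) => //; apply: H_ord_w2; case/lat_double: Lz1.
 have hX := Xw_holo tau Lz; apply: regM; last by apply: regX; apply: holo_reg.
 apply: regM; last by apply: holo_reg; apply: holo_deriv. have [a|a] := pselect (f z = Some 0 \/ f z = None).
  by apply: (@ord_reg _ _ 1) => //; exact: (phi_ord1 mf df Lz1).
 by apply: (@ord_reg _ _ 0) => //; apply: (phi_ord0 mf df Lz1) => // e; apply: a; [left|right].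
have p1 : nper H w1.
 move=> z; apply: nearpS (phi_w1 tau mf nf df z) => w E.
 by rewrite /H E (dX_per _ (lat_w1 _ _)) (Xw_per tau _ (lat_w1 _ _)).
have p2 : nper H (2 * w2).
 move=> z; have q := phi_w2 tau mf nf df; have q' := nearp_shift (q (z + w2)).
 apply: nearpS2 (q z) q' => w E E'; rewrite /H (dX_per _ (lat_w2 _ _)) (Xw_per tau _ (lat_w2 _ _)).
 have -> : w + 2 * w2 = w + w2 + w2 by ring. by rewrite E' E opprK.
have ev : nearp 0 (fun w => H (- w) = H w).
 apply: nearpS2 (fin_near tau mf df 0) (lat_near tau' 0) => w [hw _ _ _] Lw.
 have evF v : F (- v) = F v by rewrite /fin fev. have dXN : dX (- w) = - dX w.
  apply: cdiff_cderiv; have := @cdiff_opp_arg X (- w) (dX w); rewrite opprK => /(_ (cdiff_ex (holoW (Xw_holo tau Lw)))).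
  by apply: cdiff_ext; apply: nearcT => v; rewrite (Xw_even tau).
 have dFN : dF (- w) = - dF w.
  apply: cdiff_cderiv; have := @cdiff_opp_arg F (- w) (dF w); rewrite opprK => /(_ (cdiff_ex (holoW hw))).
  by apply: cdiff_ext; apply: nearcT => v; rewrite evF.
 have gen (a b c d : C) : a / (- b) * (- c) * d = a / b * c * d by rewrite invrN; ring.
 refine (etrans _ (gen (F w) (dF w) (dX w) (X w ^+ n))).
 exact (congr2 *%R (congr2 *%R (congr2 (fun a b : C => a / b) (evF w) dFN) dXN) (congr1 (fun a : C => a ^+ n) (Xw_even tau w))).
have L0 := lat0 w1 (2 * w2); have oX := Xw_ord tau L0.
have o0 : ord H 0 (- (2 * (2 * n + 2))%N%:Z).
 have od : ord dX 0 (- 3).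
  by apply: (@dX_ord 0 0 (- 2)) => //; apply: ord_ext oX; apply: nearpT => w; rewrite subr0.
 have := ordM (ordM (phi_ord_lat (lat0 w1 w2)) od) (ordX n oX). by congr (ord _ _ _); lia.
have [p sp hp] := even_elliptic tau' hr p1 p2 ev (ord_ordge o0).
pose e2 := wp L' (2 * w2 / 2); pose D := p \Po ('X + e2%:P).
have hD z : nearp z (fun w => H w = D.[X w]).
 by apply: nearpS (hp z) => w ->; rewrite /D horner_comp hornerD hornerX hornerC /Xw subrK.
have D0 : D != 0.
 apply/eqP => D0; apply: nearp_false (hD 0) (ord_neq0 o0) => w ->. by rewrite D0 horner0 eqxx.
have oD := ord_horner (fun c => XwB_ord tau c L0) D0.
exists D; split=> //.
 have := ord_uniq (ord_ext (hD 0) o0) oD. have : (0 < size D)%N by rewrite size_poly_gt0.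
 by move: (size D) => [//|s] _ /=; lia.
have := @holo_ord0_neq0 (fun w => D.[X w]) w2; rewrite (Xw_w2 w1 w2); apply.
 by apply: holo_horner; apply: (Xw_holo tau); exact: (half_w2 tau).2.
by apply: ord_ext (hD _) (H_ord_w2 _); rewrite subrr; exact: lat0.
Qed.

Lemma XwB_ex_ord1 z : ~ L' z -> exists2 k : int, 1 <= k & ord (fun w => X w - X z) z k.
Proof.
move=> Lz; have [k o] := wpB_ex_ord tau' (wp L' (2 * w2 / 2) + X z) z; rewrite -XwBE in o.
exists k => //; apply: ordge_ord_le o; apply: holo_ordge1; rewrite ?subrr//.
by apply: holoB (Xw_holo tau Lz) (holo_cst _ _).
Qed.

Lemma H_ord z k e : ~ L z -> ord (fun w => X w - X z) z k -> k != 0 -> ord ph z e -> ord H z (e + (k - 1)).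
Proof.
move=> Lz o k0 oe; rewrite -[X in ord _ _ X]addr0; apply: ordM; first by apply: ordM oe (dX_ord o k0).
by have := ordX n (Xw_neq0_ord tau Lz); rewrite mul0r.
Qed.

Lemma ph_ord_ex z : ~ L z -> (ord ph z 1 /\ (f z = Some 0 \/ f z = None)) \/ ord ph z 0.
Proof.
move=> Lz; have [a|a] := pselect (f z = Some 0 \/ f z = None).
 by left; split=> //; exact: (phi_ord1 mf df Lz).
by right; apply: (phi_ord0 mf df Lz) => e; apply: a; [left|right].
Qed.

Section RootsOfD.
Variable D : {poly C}.
Hypotheses (sD : size D = (2 * n + 3)%N) (D0 : D.[0] != 0)
 (hD : forall z, nearp z (fun w => H w = D.[X w])).

(** Where X takes the value r, X - r has some order k >= 1, so D(X) has order at least k. At a point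
    that is neither a zero nor a pole of f, phi has order 0 and H only order k - 1. That D(0) is
    nonzero keeps the point off L. *)
Lemma D_root_pre r : root D r -> exists z, [/\ ~ L z, X z = r & f z = Some 0 \/ f z = None].
Proof.
move=> rD; have [z Lz Ez] := Xw_surj tau r.
have Lz1 : ~ L z.
 move=> /lat_double[//|h]; have Xz : X z = 0.
  by rewrite -(Xw_w2 w1 w2) -(Xw_per tau w2 h) subrKC.
 by move: rD; rewrite -Ez Xz /root (negbTE D0).
exists z; split=> //; have [k k1 o] := XwB_ex_ord1 Lz.
have k0 : k != 0 by rewrite gt_eqF// (lt_le_trans _ k1).
have [[//]|e0] := ph_ord_ex Lz1.
have oH := H_ord Lz1 o k0 e0; rewrite add0r in oH.
have [q E] := factor_theorem _ _ rD.
have : ordge H z (k + 0).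
 have hq : ordge (fun w => q.[X w]) z 0 by apply/ordge0/holo_reg/holo_horner/(Xw_holo tau).
 apply: ordge_ext (ordgeM (ord_ordge o) hq); apply: nearpS (hD z) => w ->. by rewrite E hornerM hornerXsubC Ez mulrC.
by move=> /(fun h => ordge_ord_le h oH); lia.
Qed.

Lemma D_zero z : ~ L z -> f z = Some 0 \/ f z = None -> root D (X z).
Proof.
move=> Lz e; have hX := Xw_holo tau (LL Lz); apply/rootP.
apply: (@ordge1_val (fun w => D.[X w])); first exact: holo_horner.
apply: ordge_ext (hD z) _; rewrite -[X in ordge _ _ X](_ : 1 + 0 + 0 = 1)//.
apply: ordgeM; last by apply/ordge0/holo_reg/holoX.
apply: ordgeM; first by apply: ord_ordge; exact: (phi_ord1 mf df Lz e).
by apply/ordge0/holo_reg/holo_deriv.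
Qed.

(** At the corresponding zero or pole of f, H has order exactly 1 + (k - 1) = k, where k is the
    order of X - r; a double root of D would force order at least 2k. *)
Lemma D_simple r q : D = q * ('X - r%:P) -> ~~ root q r.
Proof.
move=> E; apply/negP => rq; have [q' E'] := factor_theorem _ _ rq.
have rD : root D r by rewrite E rootM root_XsubC eqxx orbT.
have [z [Lz Ez e]] := D_root_pre rD; have [k k1 o] := XwB_ex_ord1 (LL Lz).
have k0 : k != 0 by rewrite gt_eqF// (lt_le_trans _ k1).
have oH := H_ord Lz o k0 (phi_ord1 mf df Lz e).
have hq : ordge (fun w => q'.[X w]) z 0 by apply/ordge0/holo_reg/holo_horner/(Xw_holo tau (LL Lz)).
have : ordge H z (k + (k + 0)).
 apply: ordge_ext (ordgeM (ord_ordge o) (ordgeM (ord_ordge o) hq)); apply: nearpS (hD z) => w ->.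
 by rewrite E E' !hornerM !hornerXsubC Ez; ring.
by move=> /(fun h => ordge_ord_le h oH); lia.
Qed.

Lemma D_split : exists rs : seq C, [/\ uniq rs, size rs = (2 * n + 2)%N & forall r, (r \in rs) = root D r].
Proof.
have [rs E] := closed_field_poly_normal D; set c := lead_coef D in E.
have Dn : D != 0 by rewrite -size_poly_eq0 sD addnS.
have c0 : c != 0 by rewrite lead_coef_eq0.
have mem r : (r \in rs) = root D r by rewrite E rootZ// root_prod_XsubC.
exists rs; split=> //; last first.
 by apply: succn_inj; rewrite -(size_prod_XsubC rs id) -(size_scale _ c0) -E sD; lia.
apply: count_mem_uniq => r; have [h|/count_memPn ->//] := boolP (r \in rs).
have P1 := perm_to_rem h; rewrite (seq.permP P1) /= eqxx.
have Eq : D = (c *: \prod_(z <- rem r rs) ('X - z%:P)) * ('X - r%:P).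
 by rewrite {1}E (perm_big _ P1)/= big_cons -scalerAl mulrC.
by have := D_simple Eq; rewrite rootZ// root_prod_XsubC => /count_memPn ->.
Qed.

(** The involution r -> mu/r, induced by translation by w2, exchanges values at zeros with values at
    poles. So exactly half of the 2n + 2 roots belong to zeros. *)
Lemma D_zeros : exists zs : seq C, [/\ uniq zs, size zs = n.+1 &
 forall r, r \in zs <-> exists z, [/\ ~ L z, X z = r & f z = Some 0]].
Proof.
have [rs [urs srs mem]] := D_split.
pose T r := `[< exists z, [/\ ~ L z, X z = r & f z = Some 0] >].
pose io r := mu / r.
have r0 r : r \in rs -> r != 0.
 by rewrite mem; apply: contraTneq => ->; rewrite /root (negbTE D0).
have ioX z : ~ L z -> io (X z) = X (z + w2).
 by move=> Lz; rewrite /io -(Xw_shift_mu Lz) mulrAC divff ?mul1r// (Xw_neq0 tau).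
have ioK r : r \in rs -> io (io r) = r.
 by move=> /r0 h; rewrite /io invf_div mulrCA divff ?mulr1// mu_neq0.
have ior r : r \in rs -> io r \in rs.
 rewrite mem => /D_root_pre[z [Lz <- e]]; rewrite ioX// mem; apply: D_zero; first exact: Lw2.
 by have [[_ a] [_ b]] := fval_w2 z; case: e => e; [right; apply: b|left; apply: a].
have Tio r : r \in rs -> T (io r) = ~~ T r.
 move=> hr; have := hr; rewrite mem => /D_root_pre[z [Lz Ez e]].
 apply/asboolP/negP => [[z' [Lz' Ez' e']] /asboolP[z1 [Lz1 Ez1 e1]]|hn].
  have E1 : X (z' + w2) = X z1 by rewrite Ez1 -ioX// Ez' ioK. have [_ [h _]] := fval_Xw (Lw2 Lz') Lz1 E1.
  by have := h ((fval_w2 z').2.2 e'); rewrite e1.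
 case: e => e; first by case: hn; apply/asboolP; exists z.
 exists (z + w2); split; [exact: Lw2|by rewrite -Ez ioX//|exact: (fval_w2 z).1.2].
have Tmem r : T r -> r \in rs.
 by move=> /asboolP[z [Lz <- e]]; rewrite mem; apply: D_zero => //; left.
have cnt : (count T rs + count (predC T) rs = 2 * n + 2)%N by rewrite count_predC.
have P2 : perm_eq (map io rs) rs.
 apply: uniq_perm => //.
  by rewrite map_inj_in_uniq// => x y /ioK {2}<- /ioK {2}<- ->.
 move=> r; apply/mapP/idP => [[x hx ->]|hr]; first exact: ior. by exists (io r); rewrite ?ioK ?ior.
have cnt2 : count (predC T) rs = count T rs.
 have <- := seq.permP P2 T; rewrite count_map; apply: eq_in_count => r hr /=. by rewrite Tio.
exists [seq r <- rs | T r]; split; first exact: filter_uniq.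
 by rewrite size_filter; move: cnt; rewrite cnt2; move: (count T rs) => k; lia.
move=> r; rewrite mem_filter; split=> [/andP[/asboolP]//|h].
have hT : T r by apply/asboolP.
by rewrite hT Tmem.
Qed.
End RootsOfD.

Lemma simple_zero_of z : ~ L z -> f z = Some 0 -> simple_zero f z.
Proof.
move=> Lz E; have [[_ h d _]|[]] := dens_local mf (df Lz); last by rewrite E.
split=> //; apply/holomorphic_atP; split=> //.
by have [[_ _ //]|[]] := sph_local z mf; rewrite E.
Qed.

Lemma simple_pole_of z : ~ L z -> f z = None -> simple_pole f z.
Proof.
move=> Lz E; have [[]|[_ _ _]] := dens_local mf (df Lz); first by rewrite E.
have [[]|[_ h nz]] := sph_local z mf; first by rewrite E.
have d := density_none E (df Lz).
split; last by rewrite fin_invE.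
 apply/holomorphic_atP; split; last by rewrite fin_invE.
 by apply: nearcS nz => w; rewrite /=; case: (f w) => [b|]//=; case: eqP => [->|].
by rewrite /= E.
Qed.

Lemma half_not_L z : ~ L' (2 * z) -> ~ L z.
Proof.
move=> h /lat_double[k|k]; apply: h.
 have -> : 2 * z = z + z by ring. exact: latD.
have -> : 2 * z = (z - w2) + (z - w2) + 2 * w2 by ring.
by apply: latD; [apply: latD|exact: lat_w2].
Qed.

(** The root X(w1/2) is set aside, and each of the n remaining values of X at zeros receives one
    preimage; the two preimages of a value are p and -p modulo L'. *)
Lemma divisor_exists : exists p : 'I_n -> C, divisor_data w1 w2 f p.
Proof.
have [D [sD D0 hD]] := H_poly; have [zs [uzs szs hzs]] := D_zeros sD D0 hD.
have L1 := not_lat_w1; have m1 : X (w1 / 2) \in zs by apply/hzs; exists (w1 / 2).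
pose ys := rem (X (w1 / 2)) zs.
have sys : size ys = n by rewrite size_rem// szs.
have uys : uniq ys by exact: rem_uniq.
have memy r : r \in ys = (r != X (w1 / 2)) && (r \in zs) by rewrite mem_rem_uniq// !inE.
have /choice[p hp] : forall i : 'I_n, exists z, [/\ ~ L z, X z = nth 0 ys i & f z = Some 0].
 move=> i; have : nth 0 ys i \in ys by rewrite mem_nth// sys. by rewrite memy => /andP[_ /hzs].
have pin i : X (p i) \in ys by have [_ -> _] := hp i; rewrite mem_nth// sys.
have pinj i j : X (p i) = X (p j) -> i = j.
 have [_ -> _] := hp i; have [_ -> _] := hp j => /eqP. by rewrite nth_uniq ?sys// => /eqP /val_inj.
(* No half period can occur: w1/2 carries the root that was set aside, w2 lies in L, and w1/2 + w2
   is a pole. *)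
have L2 i : ~ L' (2 * p i).
 have [Li Xi fi] := hp i => h; have hh : half w1 (2 * w2) (p i) by split=> //; exact: LL.
 have [k|k|k] := half_cases hh.
 - have := pin i; rewrite memy => /andP[/eqP k2 _]; apply: k2.
  by rewrite -(Xw_per tau (w1 / 2) k) subrKC.
 - apply: Li; apply/lat_double; right; move: k; have -> // : 2 * w2 / 2 = w2 by field.
 - have Ep : X (p i) = X (w1 / 2 + w2).
   rewrite -(Xw_even tau (w1 / 2 + w2)); have -> : - (w1 / 2 + w2) = (- w1 - 2 * w2) / 2 by field.
   by rewrite -(Xw_per tau ((- w1 - 2 * w2) / 2) k) subrKC.
  have [[h1 _] _] := fval_Xw Li (Lw2 L1) Ep. have := h1 fi; have [_ [_ h2]] := fval_w2 (w1 / 2). by rewrite (h2 f1).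
have sz : simple_zeros_poles w1 w2 f p.
 split; first exact: simple_zero_of.
 - move=> i; have [Li Xi fi] := hp i; split; apply: simple_zero_of => //; first by rewrite latNE.
  by rewrite fev.
 - by apply: simple_pole_of; [exact: Lw2|exact: (fval_w2 _).2.2].
 - move=> i; have [Li Xi fi] := hp i; split; apply: simple_pole_of; try (apply: Lw2; rewrite ?latNE//).
   exact: (fval_w2 _).2.2.
  by apply: (fval_w2 _).2.2; rewrite fev.
exists p; split=> //.
 move=> i j ij; have [Li Xi fi] := hp i; split=> h; move/eqP: ij; apply; apply: pinj.
  by rewrite -(Xw_even tau (p j)) -(Xw_per tau (- p j) h); congr X; ring.
 by rewrite -(Xw_per tau (p j) h) subrKC.
have key z : ~ L z -> f z = Some 0 -> exists2 a, a = w1 / 2 \/ exists i, a = p i \/ a = - p i & L' (z - a).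
 move=> Lz fz; have : X z \in zs by apply/hzs; exists z. have [e _|ne h] := eqVneq (X z) (X (w1 / 2)).
  by exists (w1 / 2); [left|exact: Xw_eq_half (half_w1 tau) (LL Lz) e].
 have hy : X z \in ys by rewrite memy ne. pose i := index (X z) ys; have ii : (i < n)%N by rewrite -sys index_mem.
 have [Li Xi fi] := hp (Ordinal ii). have Ei : X z = X (p (Ordinal ii)) by rewrite Xi /= nth_index.
 have [k|k] := Xw_eq tau (LL Lz) (LL Li) Ei.
  by exists (p (Ordinal ii)) => //; right; exists (Ordinal ii); left.
 by exists (- p (Ordinal ii)); [right; exists (Ordinal ii); right|rewrite opprK].
have nL z : f z = Some 0 \/ f z = None -> ~ L z.
 move=> e Lz; have [E F0] := fin_at0 tau mf nf df. case/lat_double: Lz => h.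
  have [[h1 _] [h2 _]] := fval_per 0 h; rewrite add0r in h1, h2.
  case: e => [/h1|/h2]; rewrite E//= => -[e]; move: F0; rewrite e eqxx//.
 have [[h1 _] [h2 _]] := fval_per w2 h; rewrite subrKC in h1, h2.
 have [[g1 _] [g2 _]] := fval_w2 0; rewrite add0r in g1, g2.
 by case: e => [/h1/g1|/h2/g2]; rewrite E//= => -[e]; move: F0; rewrite e eqxx.
move=> z e; have Lz := nL z e; case: e => e.
 by have [a [->|[i h]] k] := key z Lz e; [exists (w1 / 2); [left|]|exists a => //; right; right; exists i; case: h; [left|right; left]].
have [|a h k] := key (z + w2) (Lw2 Lz); first exact: (fval_w2 z).1.2.
exists (a + w2); last first.
 have -> : z - (a + w2) = z + w2 - a - 2 * w2 by ring. by apply: latB => //; exact: lat_w2.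
case: h => [->|[i [->|->]]]; [by right; left| |]; right; right; exists i; right; right; [by left|by right].
Qed.
Lemma pole_at a : simple_pole f a -> f a = None.
Proof. by move=> [_ /= + _]; case: (f a) => [b|]//=; case: eqP => //= /eqP nb [] /eqP; rewrite invr_eq0 (negbTE nb). Qed.

Lemma divisor_unique (p p' : 'I_n -> C) : divisor_data w1 w2 f p -> divisor_data w1 w2 f p' ->
 exists s : {perm 'I_n}, forall i, L' (p' i - p (s i)) \/ L' (p' i + p (s i)).
Proof.
move=> [_ _ [_ z1 z2 z3] key] [L2 inj [_ z1' _ _] _].
have /choice[s hs] : forall i, exists j, L' (p' i - p j) \/ L' (p' i + p j).
 move=> i; have [[_ fi _] _] := z1' i. have np a : simple_pole f a -> ~ L' (p' i - a).
  move=> /pole_at fa h; have [_ [_ k]] := fval_per a h; rewrite subrKC in k. by have := k fa; rewrite fi.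
 have [a [->|[->|[j [->|[->|[->|->]]]]]] h] := key (p' i) (or_introl fi).
 - case: (L2 i); have -> : 2 * p' i = (p' i - w1 / 2) + (p' i - w1 / 2) + w1 by field.
  by apply: latD; [apply: latD|exact: lat_w1].
 - by case: (np _ z2).
 - by exists j; left.
 - by exists j; right; rewrite opprK in h.
 - by case: (np _ (z3 j).1).
 - by case: (np _ (z3 j).2).
have si : injective s.
 move=> i k e; apply/eqP/negPn/negP => ik; have [h1 h2] := inj i k ik.
 have := hs i; have := hs k; rewrite e => -[a|a] [b|b].
 - by apply: h2; have -> : p' i - p' k = (p' i - p (s k)) - (p' k - p (s k)) by [ring|]; apply: latB.
 - by apply: h1; have -> : p' i + p' k = (p' i + p (s k)) + (p' k - p (s k)) by [ring|]; apply: latD.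
 - by apply: h1; have -> : p' i + p' k = (p' i - p (s k)) + (p' k + p (s k)) by [ring|]; apply: latD.
 - by apply: h2; have -> : p' i - p' k = (p' i + p (s k)) - (p' k + p (s k)) by [ring|]; apply: latB.
by exists (perm si) => i; rewrite permE.
Qed.

(** The residues at z of X' X^n / D(X) and of f'/f agree. With E = D / ('X - X z), so that E(X z) =
    D'(X z), the first is k X(z)^n / E(X z) and the second is e. *)
Lemma residue_identity z (k e : int) (E : {poly C}) : ~ L z -> ord (fun w => X w - X z) z k -> ord F z e ->
 nearp z (fun w => H w = (X w - X z) * E.[X w]) -> E.[X z] * e%:~R = k%:~R * X z ^+ n.
Proof.
move=> Lz oX oF hE; have hX := Xw_holo tau (LL Lz).
have [h hh Eh] := logderiv oX; have [g hg Eg] := logderiv oF.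
pose A w := E.[X w] * (e%:~R + (w - z) * g w); pose B w := (k%:~R + (w - z) * h w) * X w ^+ n.
have hwz : holo (fun w => w - z) z by exact: holoB (holo_id z) (holo_cst z z).
have hA : holo A z.
 by apply: holoM; [exact: holo_horner|apply: holoD (holo_cst _ _) _; exact: holoM].
have hB : holo B z.
 by apply: holoM; [apply: holoD (holo_cst _ _) _; exact: holoM|exact: holoX].
have := ccts_eq_at (holo_cts hA) (holo_cts hB); rewrite /A /B subrr !mul0r !addr0; apply.
have dX' : nearp z (fun w => cderiv (fun w => X w - X z) w = dX w).
 apply: nearpS (lat_near tau' z) => w Lw; apply: cdiff_cderiv; rewrite -[dX w]subr0.
 exact: cdiffB (cdiff_ex (holoW (Xw_holo tau Lw))) (cdiff_cst _ _).
have q := nearp_and (nearp_and (nearp_neq z) (ord_neq0 oX)) (nearp_and dX' (fin_near tau mf df z)).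
apply: nearpS3 q hE (nearp_and Eh Eg) => w [[wz Xne] [-> [_ F0 _ dF0]]].
rewrite /H /phi.
move: (E.[X w]) (X w - X z) (F w) (dF w) (dX w) (X w ^+ n) (w - z) (h w) (g w) wz Xne F0 dF0.
move=> e0 x0 F1 d1 dx xn u h0 g0 u0 x00 F10 d10 e1 [e2 e3].
have -> : e%:~R + u * g0 = u * (d1 / F1) by rewrite e3; field.
have -> : k%:~R + u * h0 = u * (dx / x0) by rewrite e2; field.
have -> : e0 = F1 / d1 * dx * xn / x0 by rewrite e1; field.
by field; rewrite x00 F10 d10.
Qed.

Lemma divisor_powers (p : 'I_n -> C) : divisor_data w1 w2 f p ->
 polynomial_system mu (fun j : 'I_n => (X (w1 / 2 + w2) ^+ j.+1 - X (w1 / 2) ^+ j.+1) / 2)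
  (fun i => X (p i)) (fun i => X (p i + w2)).
Proof.
move=> [L2 inj [_ z1 z2 z3] key]; have L1 := not_lat_w1.
have Lp i : ~ L (p i) by apply: half_not_L; exact: L2.
pose base (k : 'I_n.+1) := if unlift ord0 k is Some i then p i else w1 / 2.
pose pt (q : bool * 'I_n.+1) := if q.1 then base q.2 else base q.2 + w2.
pose x (q : bool * 'I_n.+1) := X (pt q).
pose wt := @sweight C n.
have Lb k : ~ L (base k) by rewrite /base; case: unliftP.
have fb k : f (base k) = Some 0.
 by rewrite /base; case: unliftP => // i _; have [[]] := z1 i.
have Lpt q : ~ L (pt q) by rewrite /pt; case: q.1; [|apply: Lw2]; exact: Lb.
have f_pt q : f (pt q) = if q.1 then Some 0 else None.
 by rewrite /pt; case: q.1; [exact: fb|exact: (fval_w2 _).2.2 (fb _)].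
have bi : forall k l : 'I_n.+1, X (base k) = X (base l) -> k = l.
 have h1 i : X (p i) <> X (w1 / 2).
  move=> e; apply: (L2 i); have h := Xw_eq_half tau (half_w1 tau) (LL (Lp i)) e.
  have -> : 2 * p i = (p i - w1 / 2) + (p i - w1 / 2) + w1 by field. by apply: latD; [apply: latD|exact: lat_w1].
 move=> k l; rewrite /base; case: unliftP => [i ->|->]; case: unliftP => [j ->|->] //.
 - move=> e; congr (lift _ _); apply/eqP/negPn/negP => ij; have [a b] := inj i j ij.
  by have [] := Xw_eq tau (LL (Lp i)) (LL (Lp j)) e.
 - by move/h1.
 - by move/esym/h1.
have xi : injective x.
 move=> [b k] [c l] e; have [[e1 _] [e2 _]] := fval_Xw (Lpt (b, k)) (Lpt (c, l)) e.
 have bc : b = c by move: e1 e2; rewrite !f_pt /=; case: b e => _; case: c => // e1 e2; [have := e1 erefl|have := e2 erefl].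
 subst c; congr pair; apply: bi; move: e; rewrite /x /pt /=; case: b {e1 e2} => // e.
 have := Xw_shift_mu (Lb l); rewrite -e -(Xw_shift_mu (Lb k)). by move/(mulIf (Xw_neq0 tau (Lw2 (Lb k)))).
have [D [sD D0 hD]] := H_poly.
have rD q : root D (x q).
 by apply: (D_zero hD (Lpt q)); rewrite f_pt; case: q.1; [left|right].
have cI := card_sroot n.
have sD' : size D = #|{: bool * 'I_n.+1}|.+1 by rewrite cI sD; lia.
have ED := rprod_roots xi sD' rD; set c := lead_coef D in ED.
have c0 : c != 0 by rewrite lead_coef_eq0 -size_poly_eq0 sD addnS.
pose ep (q : bool * 'I_n.+1) : int := if q.1 then 1 else -1.
pose kk (q : bool * 'I_n.+1) : int := if unlift ord0 q.2 is Some _ then 1 else 2.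
(* The leading coefficient c times [rprod' x q] at x q is D' at that root, so [residue_identity]
   identifies x^n/D'(x) with e/k, which is the weight. *)
have main q : wt q * (rprod' x q).[x q] = c^-1 * x q ^+ n.
 have oX : ord (fun w => X w - X (pt q)) (pt q) (kk q).
  rewrite /kk /pt /base; case: unliftP => [i _|_].
   apply: (XwB_ord1 tau); first by apply: LL; case: q.1; [|apply: Lw2].
   case: q.1 => // h; apply: (L2 i); have -> : 2 * p i = 2 * (p i + w2) - 2 * w2 by ring.
   by apply: latB => //; exact: lat_w2.
  case: q.1; [apply: XwB_half (half_w1 tau) _|apply: XwB_half (half_w3 tau) _] => //; rewrite subrr; exact: lat0.
 have oF : ord F (pt q) (ep q).
  rewrite /ep; have := f_pt q; case: q.1; [exact: (fin_ord_zero mf df (Lpt q))|exact: (fin_ord_pole mf df (Lpt q))].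
 have := @residue_identity (pt q) (kk q) (ep q) (c *: rprod' x q) (Lpt q) oX oF.
 have hE : nearp (pt q) (fun w => H w = (X w - X (pt q)) * (c *: rprod' x q).[X w]).
  have Eq : D = ('X - (x q)%:P) * (c *: rprod' x q) by rewrite -scalerAr rprodE -ED.
  by apply: nearpS (hD (pt q)) => w ->; rewrite {1}Eq hornerM hornerXsubC.
 move=> /(_ hE); rewrite hornerZ -/(x q) => e.
 have [t [E1 E2]] : exists t : C, wt q = (ep q)%:~R * t /\ t * (kk q)%:~R = 1.
  rewrite /wt /sweight /ep /kk; case: unliftP => [i _|_]; [exists 1|exists 2^-1].
   by rewrite mulr1; split=> //; case: q.1; rewrite ?mulrN1z mulr1.
  by rewrite mulVf ?pnatr_eq0//; split=> //; case: q.1; rewrite ?mulrN1z.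
 apply: (mulfI c0); rewrite mulVKf// E1.
 move: e E2; move: (rprod' x q).[x q] ((ep q)%:~R) ((kk q)%:~R : C) (x q ^+ n) => M s k u e E2.
 have -> : c * (s * t * M) = t * (c * M * s) by ring. by rewrite e mulrA E2 mul1r.
(* Both sides have size at most 2n + 2 and agree at the 2n + 2 distinct roots. *)
have ws : wsum x wt = c^-1 *: 'X^n.
 apply/eqP; rewrite -subr_eq0; apply/eqP. apply: (@roots_geq_poly_eq0 _ _ [seq x q | q <- enum {: bool * 'I_n.+1}]).
 - apply/allP => y /mapP[q _ ->]; apply/rootP; rewrite hornerD hornerN hornerZ hornerXn.
  rewrite -main horner_sum (bigD1 q)//= hornerZ big1 ?addr0 ?subrr// => q' qq.
  by rewrite hornerZ /rprod' horner_prod (bigD1 q) 1?eq_sym//= hornerXsubC subrr mul0r mulr0.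
 - by rewrite map_inj_uniq// enum_uniq.
 - rewrite size_map -cardT (leq_trans (size_polyD _ _))// geq_max size_polyN.
  rewrite size_sum_rprod' (leq_trans (size_scale_leq _ _))// size_polyXn cI. by lia.
have hp := wsum_powers (esym cI) ws.
pose a (b : bool) := if b then X (w1 / 2) else X (w1 / 2 + w2).
pose zz (b : bool) (i : 'I_n) := if b then X (p i) else X (p i + w2).
have xE q : x q = sroot a zz q.
 by rewrite /x /pt /base /sroot /a /zz; case: unliftP => [i _|_]; case: q.1.
move=> j; split; last by rewrite Xw_shift_mu.
have := hp j.+1 (ltn_ord j); under eq_bigr do rewrite xE.
rewrite (sroot_powers a zz _) ?pnatr_eq0// => /eqP; rewrite addrC addr_eq0 => /eqP ->.
by rewrite -mulNr opprB.
Qed.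
End DivisorOfNormalizedMap.

(** * Measurability and translation invariance in the plane *)

Section PlaneMeasure.
Implicit Types (x y s t : R) (p q v : R * R) (a b : RR -> R).

(** The sigma-algebra on the plane is the product one; the preimage of an open interval is the
    countable union of the rational boxes inside it. *)
Lemma continuous2_measurable (f : R * R -> R) : continuous f -> meas2 (f : RR -> R).
Proof.
move=> cf; apply: (measurability _ (RGenOpens.measurableE R)).
move=> _ [_ [x [y ->] <-]]; rewrite setTI.
pose box (c : (rat * rat) * (rat * rat)) : set (R * R) :=
 `]ratr c.1.1, ratr c.1.2[%classic `*` `]ratr c.2.1, ratr c.2.2[%classic.
pose B c := if `[< box c `<=` f @^-1` `]x, y[%classic >] then box c else set0.
have -> : f @^-1` `]x, y[%classic = \bigcup_c B c.
 apply/seteqP; split=> [p fp|p [c _]]; last by rewrite /B; case: asboolP => // h /h.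
 have /andP[x1 x2] : x < f p < y by move: fp; rewrite /= in_itv.
 have [d d0 hd] := (cont2P f p).1 (cf p) (Num.min (f p - x) (y - f p)) ltac:(by rewrite lt_min !subr_gt0 x1 x2).
 have box1 t : exists c : rat * rat, [/\ ratr c.1 < t, t < ratr c.2 &
   forall s, ratr c.1 < s -> s < ratr c.2 -> `|s - t| < d].
  have [c1 h1] := @rat_in_itvoo R (t - d) t ltac:(by rewrite ltrBlDr ltrDl).
  have [c2 h2] := @rat_in_itvoo R t (t + d) ltac:(by rewrite ltrDl).
  move: h1 h2; rewrite !in_itv /= => /andP[h1 h2] /andP[h3 h4]; exists (c1, c2); split=> // s /= h5 h6.
  by rewrite ltr_norml; apply/andP; split; lra.
 have [c1 [h1 h1' k1]] := box1 p.1; have [c2 [h2 h2' k2]] := box1 p.2.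
 exists (c1, c2) => //; rewrite /B; case: asboolP => [_|h].
  by split; rewrite /= in_itv/=; apply/andP.
 case: h => q []; rewrite /= !in_itv/= => /andP[a1 a2] /andP[b1 b2].
 have := hd q (k1 _ a1 a2) (k2 _ b1 b2); rewrite lt_min !ltr_norml => /andP[/andP[u1 u2] /andP[u3 u4]].
 by apply/andP; split; lra.
apply: countable_bigcupT_measurable; first exact: countableP.
move=> c; rewrite /B; case: asboolP => // _.
by apply: measurableX; exact: measurable_itv.
Qed.

Lemma leb_shift x (A : set R) : measurable A ->
 pushforward leb ((fun y => y + x) : _ -> measurableTypeR R) A = leb A.
Proof.
move=> mA; apply/esym/lebesgue_measure_unique => //=.
 by apply: measurable_funD.
move=> _ _ [[u v]] _ <-.
have E : (fun y => y + x) @^-1` `]u, v]%classic = `]u - x, v - x]%classic.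
 by apply/seteqP; split=> y /=; rewrite !in_itv/= ltrBlDr lerBrDr.
rewrite /pushforward E !lebesgue_measure_itv/= !lte_fin ltrD2.
case: ifP => // _; rewrite -!EFinB; congr EFin; ring.
Qed.

Lemma leb2_shift v (A : set (R * R)) : measurable A ->
 pushforward mu2 (fun p => (p.1 + v.1, p.2 + v.2) : measurableTypeR R * measurableTypeR R) A = mu2 A.
Proof.
move=> mA; have msh : measurable_fun [set: R * R] (fun p => (p.1 + v.1, p.2 + v.2) : measurableTypeR R * measurableTypeR R).
 by apply: measurable_fun_pair; apply: measurable_funD.
apply/esym; apply: (@product_measure_unique _ _ _ _ R leb leb) => //.
move=> B D mB mD.
change (mu2 ((fun p : R * R => (p.1 + v.1, p.2 + v.2)) @^-1` (B `*` D)) = (leb B * leb D)%E).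
have -> : (fun p : R * R => (p.1 + v.1, p.2 + v.2)) @^-1` (B `*` D) =
 ((fun y => y + v.1) @^-1` B) `*` ((fun y => y + v.2) @^-1` D) by [].
have mS x (E : set R) : measurable E -> measurable ((fun y : R => y + x) @^-1` E).
 move=> mE; rewrite -[X in measurable X]setTI.
 have : measurable_fun [set: measurableTypeR R] ((fun y => y + x) : _ -> measurableTypeR R) by apply: measurable_funD.
 by apply.
rewrite /lebesgue2 product_measure1E; [|exact: mS|exact: mS].
by congr (_ * _)%E; exact: leb_shift.
Qed.

Definition pshift v (p : RR) : RR := (p.1 + v.1, p.2 + v.2).

Lemma pshift_meas v : meas2 (pshift v).
Proof.
by apply: measurable_fun_pair; apply: measurable_funD.
Qed.

Lemma integral_pshift v (D : set RR) a : measurable D -> meas2 a ->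
 mu2.-integrable D (EFin \o a) ->
 mu2.-integrable (pshift v @^-1` D) (EFin \o (a \o pshift v)) /\
 \int[mu2]_(p in pshift v @^-1` D) a (pshift v p) = \int[mu2]_(p in D) a p.
Proof.
move=> mD ma ia.
have mpre w (E : set RR) : measurable E -> measurable (pshift w @^-1` E).
 by move=> mE; rewrite -[X in measurable X]setTI; apply: pshift_meas.
have ms := pshift_meas v.
have i1 : mu2.-integrable (pshift v @^-1` D) (EFin \o (a \o pshift v)).
 apply/integrableP; split; first by apply/measurable_EFinP; apply: (measurable_funS measurableT) => //; exact: measurableT_comp.
 have m1 : measurable_fun D (fun p => `|(a p)%:E|%E).
  by apply: measurableT_comp => //; apply/measurable_EFinP; apply: (measurable_funS measurableT).
 have -> : (\int[mu2]_(p in pshift v @^-1` D) `|(EFin \o (a \o pshift v)) p|)%E =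
   (\int[pushforward mu2 (pshift v)]_(p in D) `|(a p)%:E|)%E.
  by rewrite (ge0_integral_pushforward ms).
 rewrite (@eq_measure_integral _ _ _ D mu2); first by case/integrableP: ia. by move=> A mA _; exact: leb2_shift.
split=> //; rewrite /Rintegral; congr fine.
have := integral_pushforward ms (mu := mu2) (D := D) (f := EFin \o a).
move=> /(_ _ i1 mD) <-; last exact/measurable_EFinP.
by apply: eq_measure_integral => A mA _; exact: leb2_shift.
Qed.
End PlaneMeasure.

(** * Integration over the torus *)

Section TorusIntegral.
Implicit Types (x y r s t : R) (p q v e : R * R) (a b : RR -> R).
Variables (w1 w2 : C) (tau : 0 < Im (w2 / w1)).
Local Notation L := (lattice w1 w2).
Local Notation P := (fundamental_parallelogram w1 w2 : set RR).

Let D := Re w1 * Im w2 - Im w1 * Re w2.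

Lemma cplx_rpt s t : rpt w1 w2 s t = cplx (s * Re w1 + t * Re w2, s * Im w1 + t * Im w2).
Proof. by rewrite /rpt /cplx; case: w1 => u1 u2; case: w2 => v1 v2; simpc. Qed.
Lemma cplx_inj p q : cplx p = cplx q -> p = q.
Proof. by case: p q => [x y] [x' y'] [-> ->]. Qed.

Lemma area_neq0 : D != 0.
Proof.
apply/eqP => D0; have z0 : rpt w1 w2 0 0 = cplx (0, 0) by rewrite cplx_rpt !mul0r !addr0.
have [h1 h2] : Re w2 = 0 /\ - Re w1 = 0.
 apply: (rpt_inj tau); rewrite z0 cplx_rpt; congr cplx; congr pair; first by ring.
 by rewrite -[RHS]oppr0 -D0 /D; ring.
have [h3 h4] : Im w2 = 0 /\ - Im w1 = 0.
 apply: (rpt_inj tau); rewrite z0 cplx_rpt; congr cplx; congr pair; last by ring. by rewrite -[RHS]D0 /D; ring.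
move/eqP: (w1_neq0 tau); apply; move: h2 h4; case: w1 => u1 u2 /=.
by move=> /eqP; rewrite oppr_eq0 => /eqP -> /eqP; rewrite oppr_eq0 => /eqP ->.
Qed.

(** [cs] and [ct] are the real coordinates with respect to w1 and w2, by Cramer's rule. *)
Definition cs p := (p.1 * Im w2 - p.2 * Re w2) / D.
Definition ct p := (p.2 * Re w1 - p.1 * Im w1) / D.

Lemma rpt_csct p : rpt w1 w2 (cs p) (ct p) = cplx p.
Proof.
have D0 := area_neq0; rewrite cplx_rpt; congr cplx; case: p => x y; congr pair; rewrite /cs /ct /=.
 by move: D0; rewrite /D => D0; field; exact: D0.
by move: D0; rewrite /D => D0; field; exact: D0.
Qed.
Lemma csct_rpt s t p : rpt w1 w2 s t = cplx p -> cs p = s /\ ct p = t.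
Proof. by rewrite -rpt_csct => /(rpt_inj tau)[-> ->]. Qed.
Lemma meas_lin (u v : R) : meas2 (fun p : RR => p.1 * u - p.2 * v).
Proof. by apply: measurable_funB; apply: measurable_funM. Qed.
Lemma cs_meas : meas2 (cs : RR -> R).
Proof. by apply: measurable_funM => //; exact: meas_lin. Qed.
Lemma ct_meas : meas2 (ct : RR -> R).
Proof.
apply: measurable_funM => //; have := meas_lin (- Im w1) (- Re w1).
by apply: eq_measurable_fun => p _; ring.
Qed.

Definition strip (c : RR -> R) x y : set RR := [set p | x <= c p < y].

Lemma strip_meas c x y : meas2 c -> measurable (strip c x y).
Proof.
move=> mc; rewrite -[X in measurable X]setTI.
have -> : strip c x y = c @^-1` `[x, y[%classic by apply/seteqP; split=> p /=; rewrite /strip/= in_itv.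
by apply: mc => //; exact: measurable_itv.
Qed.

Lemma parE : P = strip cs 0 1 `&` strip ct 0 1.
Proof.
apply/seteqP; split=> [p [s [t [hs ht E]]]|p [hs ht]].
 by have [a b] := csct_rpt (esym E); rewrite /strip/= a b.
by exists (cs p), (ct p); split=> //; rewrite -rpt_csct.
Qed.
Lemma par_meas : measurable P.
Proof. by rewrite parE; apply: measurableI; apply: strip_meas; [exact: cs_meas|exact: ct_meas]. Qed.

Lemma par_bounded : exists2 M : R, 0 <= M & forall p, P p -> `|p.1| <= M /\ `|p.2| <= M.
Proof.
exists (`|Re w1| + `|Re w2| + (`|Im w1| + `|Im w2|)); first by rewrite !addr_ge0.
move=> p [s [t [/andP[s0 s1] /andP[t0 t1] E]]].
have {E} -> : p = (s * Re w1 + t * Re w2, s * Im w1 + t * Im w2).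
 by apply: cplx_inj; rewrite E -cplx_rpt.
have key (u v : R) : `|s * u + t * v| <= `|u| + `|v|.
 rewrite (le_trans (ler_normD _ _))// !normrM (ger0_norm s0) (ger0_norm t0). by apply: lerD; rewrite ler_piMl// ltW.
by split=> /=; rewrite (le_trans (key _ _))// ?lerDl ?lerDr ?addr_ge0.
Qed.

Lemma par_finite : (mu2 P < +oo)%E.
Proof.
have [M M0 hM] := par_bounded.
have sub : P `<=` `[- M, M]%classic `*` `[- M, M]%classic.
 by move=> p /hM[h1 h2]; split; rewrite /= in_itv/= -ler_norml.
apply: (@le_lt_trans _ _ (mu2 (`[- M, M]%classic `*` `[- M, M]%classic))).
 apply: le_measure => //; apply/mem_set; first exact: par_meas. by apply: measurableX; exact: measurable_itv.
rewrite /lebesgue2 product_measure1E; [|exact: measurable_itv|exact: measurable_itv].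
pose I : set R := `[- M, M]%classic.
change (lebesgue_measure I * lebesgue_measure I < +oo)%E; rewrite /I.
rewrite lebesgue_measure_itv/=; case: ifP => _; last by rewrite mul0e ltry.
by rewrite -EFinB -EFinM ltry.
Qed.

(** Boundedness and measurability on the whole plane, not only on the parallelogram: the class is
    closed under translations and products, and its members are integrable over the
    parallelogram. *)
Definition bm a := meas2 a /\ exists M : R, forall p, `|a p| <= M.
Definition J a := \int[mu2]_(p in P) a p.
Definition pper a := forall p v, L (cplx v) -> a (pshift v p) = a p.

Lemma bm_integrable (Q : set RR) a : measurable Q -> (mu2 Q < +oo)%E -> bm a -> mu2.-integrable Q (EFin \o a).
Proof.
move=> mQ fQ [ma [M hM]]; apply: measurable_bounded_integrable => //.
 by apply: measurable_funS ma.
exists M; split; first by rewrite num_real.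
by move=> y My p _; apply: le_trans (hM p) (ltW My).
Qed.
Lemma bm_int a : bm a -> mu2.-integrable P (EFin \o a).
Proof. by apply: bm_integrable; [exact: par_meas|exact: par_finite]. Qed.

Lemma bm_pshift v a : bm a -> bm (a \o pshift v).
Proof.
move=> [ma [M hM]]; split; last by exists M => p; exact: hM.
exact: measurableT_comp ma (pshift_meas v).
Qed.
Lemma pshiftA u v p : pshift u (pshift v p) = pshift (u.1 + v.1, u.2 + v.2) p.
Proof. by rewrite /pshift/=; congr pair; ring. Qed.

(* A slab [0 <= c < 1] is cut at height [1 - x]; shifting by [x e], the upper
  piece re-enters at the bottom after a translation by the period [- e]. *)
Lemma slab_shift (c : RR -> R) (Q : set RR) e x a : meas2 c -> measurable Q ->
 (forall y p, c (pshift (y * e.1, y * e.2) p) = c p + y) ->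
 (forall y p, Q (pshift (y * e.1, y * e.2) p) <-> Q p) ->
 (mu2 (strip c 0 1 `&` Q) < +oo)%E -> bm a -> (forall p, a (pshift e p) = a p) -> 0 <= x < 1 ->
 \int[mu2]_(p in strip c 0 1 `&` Q) a (pshift (x * e.1, x * e.2) p) = \int[mu2]_(p in strip c 0 1 `&` Q) a p.
Proof.
move=> mc mQ ce Qe fin ba per /andP[x0 x1].
have mst (u v : R) : measurable (strip c u v `&` Q) by apply: measurableI => //; exact: strip_meas.
have sub (u v : R) : 0 <= u -> v <= 1 -> strip c u v `&` Q `<=` strip c 0 1 `&` Q.
 move=> u0 v1 p [/andP[h1 h2] h3]; split=> //; apply/andP; split; lra.
have fin' (u v : R) : 0 <= u -> v <= 1 -> (mu2 (strip c u v `&` Q) < +oo)%E.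
 by move=> u0 v1; apply: le_lt_trans fin; apply: le_measure; [exact/mem_set|apply/mem_set; exact: mst|exact: sub].
have split_at y b : 0 <= y <= 1 -> bm b ->
  \int[mu2]_(p in strip c 0 1 `&` Q) b p = \int[mu2]_(p in strip c 0 y `&` Q) b p + \int[mu2]_(p in strip c y 1 `&` Q) b p.
 move=> /andP[y0 y1] hb; have E : strip c 0 1 `&` Q = (strip c 0 y `&` Q) `|` (strip c y 1 `&` Q).
  apply/seteqP; split=> p; last by case=> h; [apply: (sub 0 y)|apply: (sub y 1)].
  move=> [/andP[h1 h2] h3]; have [h|h] := ltP (c p) y; [left|right]; split=> //; exact/andP.
 rewrite E Rintegral_setU//; first by rewrite -E; exact: bm_integrable.
 apply/disj_set2P; apply/seteqP; split=> // p [[/andP[_ h2] _] [/andP[h3 _] _]]. by move: h2; rewrite ltNge h3.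
have mv (y u v : R) : 0 <= u -> v <= 1 -> \int[mu2]_(p in strip c (u - y) (v - y) `&` Q) a (pshift (y * e.1, y * e.2) p) =
  \int[mu2]_(p in strip c u v `&` Q) a p.
 move=> u0 v1; have -> : strip c (u - y) (v - y) `&` Q = pshift (y * e.1, y * e.2) @^-1` (strip c u v `&` Q).
  apply/seteqP; split=> p; rewrite /strip/= ce => -[/andP[h1 h2] h3]; split; try (by apply/Qe);
   try (by apply/(Qe y)); apply/andP; split; lra.
 by apply: (integral_pshift _ (mst u v) ba.1 _).2; apply: bm_integrable => //; exact: fin'.
rewrite (split_at (1 - x)); [|apply/andP; split; lra|exact: bm_pshift].
rewrite [RHS](split_at x); [|apply/andP; split; lra|exact: ba].
rewrite addrC; congr (_ + _).
 rewrite -(mv (x - 1) 0 x) ?(ltW x1)//; have -> : 0 - (x - 1) = 1 - x by ring. have -> : x - (x - 1) = 1 by ring.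
 apply: eq_Rintegral => p _; rewrite -(per (pshift ((x - 1) * e.1, (x - 1) * e.2) p)) pshiftA.
 by congr a; congr (pshift _ p); congr pair => /=; ring.
by rewrite -(mv x x 1)//; have -> : x - x = 0 by ring.
Qed.

Lemma csct_shift y z p : cs (pshift (y * Re w1 + z * Re w2, y * Im w1 + z * Im w2) p) = cs p + y /\
 ct (pshift (y * Re w1 + z * Re w2, y * Im w1 + z * Im w2) p) = ct p + z.
Proof.
apply: csct_rpt; have E : p = (cs p * Re w1 + ct p * Re w2, cs p * Im w1 + ct p * Im w2).
 by apply: cplx_inj; rewrite -cplx_rpt rpt_csct.
by rewrite cplx_rpt [in RHS]E; congr cplx; congr pair; rewrite /=; ring.
Qed.

(** Lattice translations reduce v to coordinates in [0, 1); then [slab_shift] is applied once in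
    each of the two period directions. *)
Lemma J_shift v a : bm a -> pper a -> J (a \o pshift v) = J a.
Proof.
move=> ba pa; set s := cs v; set t := ct v.
have Ev : v = (s * Re w1 + t * Re w2, s * Im w1 + t * Im w2).
 by apply: cplx_inj; rewrite -cplx_rpt rpt_csct.
pose e1 := (Re w1, Im w1); pose e2 := (Re w2, Im w2).
have step1 x b : bm b -> pper b -> 0 <= x < 1 -> J (b \o pshift (x * e1.1, x * e1.2)) = J b.
 move=> bb pb hx; rewrite /J parE; apply: slab_shift => //.
 - exact: cs_meas.
 - by apply: strip_meas; exact: ct_meas.
 - by move=> y p; have [+ _] := csct_shift y 0 p; rewrite !mul0r !addr0.
 - by move=> y p; have [_ +] := csct_shift y 0 p; rewrite !mul0r !addr0 /strip /= => ->.
 - by rewrite -parE; exact: par_finite.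
 - by move=> p; apply: pb; rewrite /cplx /=; case: w1 (lat_w1 w1 w2).
have step2 x b : bm b -> pper b -> 0 <= x < 1 -> J (b \o pshift (x * e2.1, x * e2.2)) = J b.
 move=> bb pb hx; rewrite /J parE setIC; apply: slab_shift => //.
 - exact: ct_meas.
 - by apply: strip_meas; exact: cs_meas.
 - by move=> y p; have [_ +] := csct_shift 0 y p; rewrite !mul0r !add0r.
 - by move=> y p; have [+ _] := csct_shift 0 y p; rewrite !mul0r !add0r addr0 /strip /= => ->.
 - by rewrite setIC -parE; exact: par_finite.
 - by move=> p; apply: pb; rewrite /cplx /=; case: w2 (lat_w2 w1 w2).
pose s' := s - (Num.floor s)%:~R; pose t' := t - (Num.floor t)%:~R.
have hs : 0 <= s' < 1.
 by rewrite subr_ge0 Num.Theory.floor_le ltrBlDl -intrD1 Num.Theory.floorD1_gt.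
have ht : 0 <= t' < 1.
 by rewrite subr_ge0 Num.Theory.floor_le ltrBlDl -intrD1 Num.Theory.floorD1_gt.
rewrite -[RHS](step1 s' a)// -[RHS](step2 t' _)//; last 2 first.
- exact: bm_pshift.
- move=> p u Lu /=; rewrite -(pa (pshift _ p) u Lu) !pshiftA; congr a; congr (pshift _ p).
 by congr pair; rewrite /=; ring.
rewrite /J; apply: eq_Rintegral => p _ /=; rewrite pshiftA.
pose l : R * R := ((Num.floor s)%:~R * Re w1 + (Num.floor t)%:~R * Re w2, (Num.floor s)%:~R * Im w1 + (Num.floor t)%:~R * Im w2).
rewrite -[RHS](pa _ l); last by rewrite -cplx_rpt rpt_int; exists (Num.floor s), (Num.floor t).
rewrite pshiftA; congr a; congr (pshift _ p); rewrite {1}Ev /l /s' /t' /=.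
by congr pair; ring.
Qed.

Lemma J_dct (f : nat -> RR -> R) a (M : R) : (forall n, meas2 (f n)) -> meas2 a ->
 (forall n p, `|f n p| <= M) -> (forall p, f n p @[n --> \oo] --> a p) -> J (f n) @[n --> \oo] --> J a.
Proof.
move=> mf ma hM cv.
have bf n : bm (f n) by split=> //; exists M.
have mE b : meas2 b -> measurable_fun P (EFin \o b).
 by move=> mb; apply/measurable_EFinP; apply: measurable_funS mb.
have bM : bm (cst M) by split; [exact: measurable_cst|exists `|M|].
have := @dominated_convergence _ _ _ mu2 P par_meas (fun n => EFin \o f n) (EFin \o a) (EFin \o cst M).
move=> /(_ (fun n => mE _ (mf n)) (mE _ ma)) /(_ _ (bm_int bM))[||ia _ h].
- by apply: aeW => p _; apply: cvg_EFin; [apply: nearW|exact: cv].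
- by apply: aeW => p n _; rewrite /= lee_fin.
apply: fine_cvg; rewrite fineK//; last exact: (integrable_fin_num par_meas ia).
Qed.

Lemma bmB a b : bm a -> bm b -> bm (fun p => a p - b p).
Proof.
move=> [ma [M hM]] [mb [N hN]]; split; first exact: measurable_funB.
by exists (M + N) => p; rewrite (le_trans (ler_normB _ _))// lerD.
Qed.

Lemma bmZ r a : bm a -> bm (fun p => r * a p).
Proof.
move=> [ma [M hM]]; split; first by apply: measurable_funM => //; exact: measurable_cst.
by exists (`|r| * M) => p; rewrite normrM ler_wpM2l.
Qed.

Lemma bmM a b : bm a -> bm b -> bm (fun p => a p * b p).
Proof.
move=> [ma [M hM]] [mb [N hN]]; split; first exact: measurable_funM.
by exists (M * N) => p; rewrite normrM ler_pM.
Qed.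

Lemma bmD a b : bm a -> bm b -> bm (fun p => a p + b p).
Proof.
move=> [ma [M hM]] [mb [N hN]]; split; first exact: measurable_funD.
by exists (M + N) => p; rewrite (le_trans (ler_normD _ _))// lerD.
Qed.
Lemma JD a b : bm a -> bm b -> J (fun p => a p + b p) = J a + J b.
Proof. by move=> ba bb; apply: RintegralD; [exact: par_meas|exact: bm_int|exact: bm_int]. Qed.
Lemma JB a b : bm a -> bm b -> J (fun p => a p - b p) = J a - J b.
Proof. by move=> ba bb; apply: RintegralB; [exact: par_meas|exact: bm_int|exact: bm_int]. Qed.
Lemma JZ r a : bm a -> J (fun p => r * a p) = r * J a.
Proof. by move=> ba; apply: RintegralZl; [exact: par_meas|exact: bm_int]. Qed.

(** The divergence theorem on the torus: difference quotients of a have integral 0 by translation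
    invariance, are bounded by the mean value theorem, and converge to b, so dominated convergence
    applies. *)
Lemma J_deriv v a b : bm a -> bm b -> pper a ->
 (forall p t, is_derive t 1 (fun t => a (pshift (t * v.1, t * v.2) p)) (b (pshift (t * v.1, t * v.2) p))) -> J b = 0.
Proof.
move=> ba bb pa hd; have [M hM] := bb.2.
pose k n : R := n.+1%:R; have k0 n : 0 < (k n)^-1 by rewrite invr_gt0 ltr0n.
pose sh n := pshift ((k n)^-1 * v.1, (k n)^-1 * v.2).
pose f n p := k n * (a (sh n p) - a p).
have bf n : bm (f n) by apply: bmZ; apply: bmB => //; exact: (bm_pshift _ ba).
have Jf n : J (f n) = 0.
 by rewrite JZ ?JB//; [rewrite (J_shift _ ba pa) subrr mulr0|exact: (bm_pshift _ ba)|apply: bmB => //; exact: (bm_pshift _ ba)].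
have p0 p : pshift (0 * v.1, 0 * v.2) p = p by rewrite /pshift !mul0r !addr0; case: p.
have f_le n p : `|f n p| <= M.
 have ct0 t : {for t, continuous (fun t => a (pshift (t * v.1, t * v.2) p))}.
  by have [h _] := hd p t; apply: differentiable_continuous; apply/derivable1_diffP.
 have [c _ E] := @MVT _ (fun t => a (pshift (t * v.1, t * v.2) p)) (fun t => b (pshift (t * v.1, t * v.2) p)) 0 (k n)^-1
   (k0 n) (fun t _ => hd p t) (continuous_subspaceT ct0).
 rewrite p0 subr0 in E; rewrite /f /sh E mulrCA mulfV ?mulr1//. by rewrite -invr_eq0 gt_eqF.
have cvf p : f n p @[n --> \oo] --> b p.
 set g := fun t => a (pshift (t * v.1, t * v.2) p). have [h1 h2] := hd p 0; rewrite p0 in h2.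
 have hc : (h^-1 *: (g (h *: 1 + 0) - g 0)) @[h --> 0^'] --> b p.
  by rewrite -h2; exact: h1.
 have u0 : (forall n, (k n)^-1 != 0) /\ (k n)^-1 @[n --> \oo] --> (0 : R).
  by split=> [n|]; [rewrite gt_eqF|exact: cvg_harmonic].
 have := (@cvgr_dnbhsP R (fun h => h^-1 *: (g (h *: 1 + 0) - g 0)) 0 (b p)).1 hc _ u0.
 apply: cvg_trans; apply: near_eq_cvg; apply: nearW => n. by rewrite /f /sh invrK /g p0 addr0 /GRing.scale/= mulr1.
have := J_dct (fun n => (bf n).1) bb.1 f_le cvf.
under eq_fun do rewrite Jf.
by move=> /(cvg_unique (@Rhausdorff R) (cvg_cst 0)).
Qed.
End TorusIntegral.

(** * Functions bundled with their first and second derivatives *)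

Section Jets.
Implicit Types (x y r s t : R) (p q v : R * R) (E F : R * R -> R).

Definition pdv v E p (d : R) := is_derive (0 : R) (1 : R) (fun t : R => E (pshift (t * v.1, t * v.2) p)) d.

Lemma pshift0 p v : pshift (0 * v.1, 0 * v.2) p = p.
Proof. by rewrite /pshift !mul0r !addr0; case: p. Qed.

Lemma pdv_cst v r p : pdv v (fun=> r) p 0.
Proof. exact: is_derive_cst. Qed.
Lemma pdvD v E F p d d' : pdv v E p d -> pdv v F p d' -> pdv v (fun p => E p + F p) p (d + d').
Proof. by move=> h h'; exact: is_deriveD. Qed.
Lemma pdvN v E p d : pdv v E p d -> pdv v (fun p => - E p) p (- d).
Proof. by move=> h; exact: is_deriveN. Qed.

Lemma pdvM v E F p d d' : pdv v E p d -> pdv v F p d' -> pdv v (fun p => E p * F p) p (d * F p + E p * d').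
Proof.
move=> h h'; have := is_deriveM h h'; rewrite !pshift0 /GRing.scale/= => k.
by apply: is_derive_eq k _; rewrite addrC [d * _]mulrC.
Qed.

Lemma pdv_comp v E (f : R -> R) p d d' : pdv v E p d -> is_derive (E p) 1 f d' ->
 pdv v (fun p => f (E p)) p (d' * d).
Proof.
move=> h h'; rewrite /pdv; have := @is_derive1_comp R f (fun t => E (pshift (t * v.1, t * v.2) p)) 0 d' d.
by apply => //; rewrite pshift0.
Qed.

Lemma near2P p (Q : R * R -> Prop) : (\forall q \near p, Q q) <->
 exists2 d : R, 0 < d & forall q, `|q.1 - p.1| < d -> `|q.2 - p.2| < d -> Q q.
Proof.
split=> [/nbhs_ballP[d d0 h]|[d d0 h]].
 by exists d => // q h1 h2; apply: h; split; rewrite /ball/= distrC.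
by apply/nbhs_ballP; exists d => // q [h1 h2]; apply: h; rewrite distrC.
Qed.

Lemma near_line v p (Q : R * R -> Prop) : (\forall q \near p, Q q) ->
 \forall t \near (0 : R), Q (pshift (t * v.1, t * v.2) p).
Proof.
move=> /near2P[d d0 h]; have K0 : 0 < 1 + `|v.1| + `|v.2| by have := normr_ge0 v.1; have := normr_ge0 v.2; lra.
apply/nbhs_ballP; exists (d / (1 + `|v.1| + `|v.2|)) => /=; first exact: divr_gt0.
move=> t; rewrite /ball/= sub0r normrN ltr_pdivlMr// => ht; have t0 := normr_ge0 t.
have a1 := normr_ge0 v.1; have a2 := normr_ge0 v.2.
by apply: h; rewrite /pshift /= addrAC subrr add0r normrM; nra.
Qed.

Lemma pdv_ext v E F p d : (\forall q \near p, E q = F q) -> pdv v E p d -> pdv v F p d.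
Proof.
move=> h hE; rewrite /pdv; apply: (@near_eq_is_derive _ _ _ (fun t => E (pshift (t * v.1, t * v.2) p))) => //.
 exact: (near_line v h).
Qed.
Lemma pdv_uniq v E p d d' : pdv v E p d -> pdv v E p d' -> d = d'.
Proof. by move=> [_ <-] [_ <-]. Qed.

Lemma pdv_shift v E u p d : pdv v E (pshift u p) d -> pdv v (fun p => E (pshift u p)) p d.
Proof.
rewrite /pdv; congr (is_derive _ _ _ _); apply/funext => t.
by rewrite !pshiftA; congr (E (pshift _ p)); congr pair; rewrite /=; ring.
Qed.

Lemma pdv_line v E (G : R * R -> R) : (forall p, pdv v E p (G p)) ->
 forall p t, is_derive t (1 : R) (fun t => E (pshift (t * v.1, t * v.2) p)) (G (pshift (t * v.1, t * v.2) p)).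
Proof.
move=> h p t; apply/is_derive_eps => e e0.
have /is_derive_eps/(_ e e0)[del d0 hd] := h (pshift (t * v.1, t * v.2) p).
exists del => // s hs; have := hd (s - t); rewrite subr0 => /(_ hs).
rewrite !pshift0 pshiftA; congr (`|E (pshift _ p) - _ - _| <= _).
by congr pair; rewrite /=; ring.
Qed.

(** A function together with candidates for its first and pure second derivatives, the ones from
    which the Laplacian is formed; [jet_ok] certifies them at a point. Sums, products and
    compositions then compute Laplacians symbolically. *)
Record jet := Jet {j0 : R * R -> R; jx : R * R -> R; jy : R * R -> R; jxx : R * R -> R; jyy : R * R -> R}.
Implicit Types (j k : jet).
Local Notation ex := ((1, 0) : R * R).
Local Notation ey := ((0, 1) : R * R).
Local Notation cont E p := {for p, continuous (E : R * R -> R)}.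

Definition jet_ok j p := [/\ pdv ex (j0 j) p (jx j p), pdv ex (jx j) p (jxx j p),
 pdv ey (j0 j) p (jy j p), pdv ey (jy j) p (jyy j p) &
 [/\ cont (j0 j) p, cont (jx j) p, cont (jy j) p, cont (jxx j) p & cont (jyy j) p]].

Definition jcst r := Jet (fun=> r) (fun=> 0) (fun=> 0) (fun=> 0) (fun=> 0).
Definition jadd j k := Jet (fun p => j0 j p + j0 k p) (fun p => jx j p + jx k p) (fun p => jy j p + jy k p)
 (fun p => jxx j p + jxx k p) (fun p => jyy j p + jyy k p).
Definition jmul j k := Jet (fun p => j0 j p * j0 k p)
 (fun p => jx j p * j0 k p + j0 j p * jx k p) (fun p => jy j p * j0 k p + j0 j p * jy k p)
 (fun p => jxx j p * j0 k p + jx j p * jx k p + (jx j p * jx k p + j0 j p * jxx k p))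
 (fun p => jyy j p * j0 k p + jy j p * jy k p + (jy j p * jy k p + j0 j p * jyy k p)).
Definition jcomp (f f1 f2 : R -> R) j := Jet (fun p => f (j0 j p))
 (fun p => f1 (j0 j p) * jx j p) (fun p => f1 (j0 j p) * jy j p)
 (fun p => f2 (j0 j p) * jx j p * jx j p + f1 (j0 j p) * jxx j p)
 (fun p => f2 (j0 j p) * jy j p * jy j p + f1 (j0 j p) * jyy j p).

Lemma jcst_ok r p : jet_ok (jcst r) p.
Proof. by split; try exact: pdv_cst; split; exact: cst_continuous. Qed.
Lemma contD E F p : cont E p -> cont F p -> cont (fun p => E p + F p) p.
Proof. by move=> h h'; exact: continuousD. Qed.
Lemma contN E p : cont E p -> cont (fun p => - E p) p.
Proof. by move=> h; exact: continuousN. Qed.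
Lemma contM E F p : cont E p -> cont F p -> cont (fun p => E p * F p) p.
Proof. by move=> h h'; exact: continuousM. Qed.
Lemma cont_comp (f : R -> R) E p : cont E p -> {for E p, continuous f} -> cont (fun p => f (E p)) p.
Proof. by move=> h h'; exact: continuous_comp. Qed.

Lemma jadd_ok j k p : jet_ok j p -> jet_ok k p -> jet_ok (jadd j k) p.
Proof.
move=> [a1 a2 a3 a4 [a5 a6 a7 a8 a9]] [b1 b2 b3 b4 [b5 b6 b7 b8 b9]].
by split; try exact: pdvD; split; exact: contD.
Qed.

Lemma jmul_ok j k p : jet_ok j p -> jet_ok k p -> jet_ok (jmul j k) p.
Proof.
move=> [a1 a2 a3 a4 [a5 a6 a7 a8 a9]] [b1 b2 b3 b4 [b5 b6 b7 b8 b9]].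
split; [exact: pdvM|by apply: pdvD; exact: pdvM|exact: pdvM|by apply: pdvD; exact: pdvM|].
split; [exact: contM|by apply: contD; exact: contM|by apply: contD; exact: contM| |];
 by apply: contD; apply: contD; exact: contM.
Qed.

Lemma jcomp_ok (f f1 f2 : R -> R) j p : jet_ok j p ->
 is_derive (j0 j p) (1 : R) f (f1 (j0 j p)) -> is_derive (j0 j p) (1 : R) f1 (f2 (j0 j p)) -> {for j0 j p, continuous f2} ->
 jet_ok (jcomp f f1 f2 j) p.
Proof.
move=> [a1 a2 a3 a4 [a5 a6 a7 a8 a9]] h1 h2 c2.
have dc (g : R -> R) d : is_derive (j0 j p) (1 : R) g d -> {for j0 j p, continuous g}.
 by move=> [h _]; apply: differentiable_continuous; apply/derivable1_diffP.
have c0 := dc _ _ h1; have c1 := dc _ _ h2.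
split; [exact: pdv_comp| |exact: pdv_comp| |].
- by have := pdvM (pdv_comp a1 h2) a2.
- by have := pdvM (pdv_comp a3 h2) a4.
have k0 := cont_comp a5 c0; have k1 := cont_comp a5 c1; have k2 := cont_comp a5 c2.
split=> //; [exact: contM|exact: contM| |]; by apply: contD; [apply: contM => //; exact: contM|exact: contM].
Qed.

(** Cauchy-Riemann: differentiating in the second coordinate multiplies the complex derivative by i,
    which exchanges real and imaginary parts. *)
Definition jre H := Jet (fun p => Re (H (cplx p))) (fun p => Re (cderiv H (cplx p)))
 (fun p => - Im (cderiv H (cplx p))) (fun p => Re (cderiv (cderiv H) (cplx p))) (fun p => - Re (cderiv (cderiv H) (cplx p))).
Definition jim H := Jet (fun p => Im (H (cplx p))) (fun p => Im (cderiv H (cplx p)))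
 (fun p => Re (cderiv H (cplx p))) (fun p => Im (cderiv (cderiv H) (cplx p))) (fun p => - Im (cderiv (cderiv H) (cplx p))).

Lemma cplx_pshift v p t : cplx (pshift (t * v.1, t * v.2) p) = cplx p + t%:C * cplx v.
Proof. by case: p v => [x y] [a b]; rewrite /cplx /pshift /=; simpc; congr (_ +i* _); ring. Qed.

Lemma holo_pdv H p v : holo H (cplx p) ->
 pdv v (fun p => Re (H (cplx p))) p (Re (cderiv H (cplx p) * cplx v)) /\
 pdv v (fun p => Im (H (cplx p))) p (Im (cderiv H (cplx p) * cplx v)).
Proof.
move=> h; have dH := cdiff_ex (holoW h).
have L := rdiff_line (cplx p) (cplx v) 0.
have /rdiffP[a b] : rdiff (fun t : R => H (cplx (pshift (t * v.1, t * v.2) p))) 0 (cderiv H (cplx p) * cplx v).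
 have -> : (fun t : R => H (cplx (pshift (t * v.1, t * v.2) p))) = (fun t => H (cplx p + t%:C * cplx v)).
  by apply/funext => t; rewrite cplx_pshift.
 by apply: (rdiff_comp L); rewrite rmorph0 mul0r addr0.
by split.
Qed.

Lemma holo_cont H p : holo H (cplx p) -> cont (fun p => Re (H (cplx p))) p /\ cont (fun p => Im (H (cplx p))) p.
Proof.
move=> /holo_cts h; split; apply/cont2P => e e0; have [d d0 hd] := h e e0;
 (exists (d / 2); first by rewrite divr_gt0); move=> q h1 h2;
 (have : nm (cplx q - cplx p) < d by apply: le_lt_trans (nm_le_ReIm _) _; rewrite /=; lra);
 move=> /hd; apply: le_lt_trans. by have := Re_le_nm (H (cplx q) - H (cplx p)); rewrite raddfB.
by have := Im_le_nm (H (cplx q) - H (cplx p)); rewrite raddfB.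
Qed.
Lemma dir_ex (d : C) : Re (d * cplx ex) = Re d /\ Im (d * cplx ex) = Im d.
Proof. by case: d => a b; rewrite /cplx /=; split; ring. Qed.
Lemma dir_ey (d : C) : Re (d * cplx ey) = - Im d /\ Im (d * cplx ey) = Re d.
Proof. by case: d => a b; rewrite /cplx /=; split; ring. Qed.

Lemma holo_pdx H p : holo H (cplx p) ->
 pdv ex (fun p => Re (H (cplx p))) p (Re (cderiv H (cplx p))) /\
 pdv ex (fun p => Im (H (cplx p))) p (Im (cderiv H (cplx p))).
Proof.
move=> h; have [a b] := holo_pdv ex h; have [u v] := dir_ex (cderiv H (cplx p)).
by split; [exact: is_derive_eq a u|exact: is_derive_eq b v].
Qed.

Lemma holo_pdy H p : holo H (cplx p) ->
 pdv ey (fun p => Re (H (cplx p))) p (- Im (cderiv H (cplx p))) /\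
 pdv ey (fun p => Im (H (cplx p))) p (Re (cderiv H (cplx p))).
Proof.
move=> h; have [a b] := holo_pdv ey h; have [u v] := dir_ey (cderiv H (cplx p)).
by split; [exact: is_derive_eq a u|exact: is_derive_eq b v].
Qed.

Lemma jre_ok H p : holo H (cplx p) -> jet_ok (jre H) p.
Proof.
move=> h; have h' := holo_deriv h; have h'' := holo_deriv h'.
have [a1 _] := holo_pdx h; have [a2 _] := holo_pdy h.
have [b1 _] := holo_pdx h'; have [_ b2] := holo_pdy h'.
have [c1 _] := holo_cont h; have [c2 c2'] := holo_cont h'; have [c3 _] := holo_cont h''.
split; [exact a1|exact b1|exact a2|exact (pdvN b2)|].
by split; [exact c1|exact c2|exact (contN c2')|exact c3|exact (contN c3)].
Qed.

Lemma jim_ok H p : holo H (cplx p) -> jet_ok (jim H) p.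
Proof.
move=> h; have h' := holo_deriv h; have h'' := holo_deriv h'.
have [_ a1] := holo_pdx h; have [_ a2] := holo_pdy h.
have [_ b1] := holo_pdx h'; have [b2 _] := holo_pdy h'.
have [_ c1] := holo_cont h; have [c2 c2'] := holo_cont h'; have [_ c3] := holo_cont h''.
split; [exact a1|exact b1|exact a2|exact b2|].
by split; [exact c1|exact c2'|exact c2|exact c3|exact (contN c3)].
Qed.
End Jets.

(** * Green's formula on the torus and gluing of local jets *)

Section Green.
Implicit Types (x y s t : R) (p q v : R * R) (j k : jet).
Variables (w1 w2 : C) (tau : 0 < Im (w2 / w1)).
Local Notation J := (J w1 w2).
Local Notation pper := (pper w1 w2).
Local Notation L := (lattice w1 w2).
Local Notation ex := ((1, 0) : R * R).
Local Notation ey := ((0, 1) : R * R).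

Lemma pper_bm (a : R * R -> R) : continuous a -> pper a -> bm a.
Proof.
move=> ca pa; split; first exact: continuous2_measurable.
have [M M0 hM] := par_bounded w1 w2.
have cB : compact (`[- M, M]%classic `*` `[- M, M]%classic : set (R * R)).
 by apply: compact_setX; exact: segment_compact.
have cI : compact (a @` (`[- M, M]%classic `*` `[- M, M]%classic)).
 by apply: continuous_compact cB; apply: continuous_subspaceT.
have [N [_ hN]] := compact_bounded cI; exists (N + 1) => p.
have [l [s [t [Ll hs ht E]]]] := lat_reduce tau (cplx p).
pose q : R * R := (s * complex.Re w1 + t * complex.Re w2, s * complex.Im w1 + t * complex.Im w2).
have Eq : cplx q = rpt w1 w2 s t by rewrite cplx_rpt.
pose l' : R * R := (complex.Re l, complex.Im l).
have El : cplx l' = l by rewrite /cplx /l'; case: l {Ll E l'}.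
have -> : p = pshift l' q.
 by apply: cplx_inj; rewrite E -Eq -El /cplx /pshift /=; simpc.
rewrite pa ?El//; apply: hN; first by rewrite ltrDl.
have [h1 h2] : `|q.1| <= M /\ `|q.2| <= M by apply: hM; exists s, t.
by exists q => //; split; rewrite /= in_itv /= -ler_norml.
Qed.

Definition C2p j := (forall p, jet_ok j p) /\ pper (j0 j).

Lemma pper_pdv v (E G : R * R -> R) : pper E -> (forall p, pdv v E p (G p)) -> pper G.
Proof.
move=> pE h p u Lu; have := pdv_shift (h (pshift u p)).
have -> : (fun p => E (pshift u p)) = E by apply/funext => q; exact: pE.
by move/(pdv_uniq (h p)).
Qed.

Lemma C2p_bm j : C2p j -> [/\ [/\ bm (j0 j), bm (jx j), bm (jy j), bm (jxx j) & bm (jyy j)],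
 pper (jx j) & pper (jy j)].
Proof.
move=> [ok p0]; have px : pper (jx j) by apply: (@pper_pdv ex (j0 j) (jx j) p0) => p; have [] := ok p.
have py : pper (jy j) by apply: (@pper_pdv ey (j0 j) (jy j) p0) => p; have [] := ok p.
split=> //; split; apply: pper_bm => //; try (by move=> p; have [_ _ _ _ []] := ok p).
 by apply: (@pper_pdv ex (jx j) (jxx j) px) => p; have [] := ok p.
by apply: (@pper_pdv ey (jy j) (jyy j) py) => p; have [] := ok p.
Qed.

(** In each coordinate direction A B'' - A'' B is the derivative of the periodic function A B' - A'
    B, so its integral vanishes by [J_deriv]. *)
Lemma green j k : C2p j -> C2p k ->
 J (fun p => j0 j p * (jxx k p + jyy k p)) = J (fun p => (jxx j p + jyy j p) * j0 k p).
Proof.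
move=> hj hk; have [[b0 bx by' bxx byy] px py] := C2p_bm hj; have [[c0 cx cy cxx cyy] qx qy] := C2p_bm hk.
have one v (A B B' A1 B1 A2 : R * R -> R) : bm A -> bm A1 -> bm A2 -> bm B -> bm B1 -> bm B' ->
  pper A -> pper A1 -> pper B -> pper B1 ->
  (forall p, pdv v A p (A1 p)) -> (forall p, pdv v A1 p (A2 p)) ->
  (forall p, pdv v B p (B1 p)) -> (forall p, pdv v B1 p (B' p)) ->
  J (fun p => A p * B' p) = J (fun p => A2 p * B p).
 move=> m0 m1 m2 n0 n1 n2 pA pA1 pB pB1 dA dA1 dB dB1; apply/eqP; rewrite -subr_eq0; apply/eqP.
 rewrite -JB; [|exact: tau|exact: bmM|exact: bmM]. apply: (@J_deriv _ _ tau v (fun p => A p * B1 p - A1 p * B p)).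
 - by apply: bmB; exact: bmM.
 - by apply: bmB; exact: bmM.
 - by move=> p u Lu; rewrite pA// pA1// pB// pB1.
 have dAB p : pdv v (fun p => A p * B1 p - A1 p * B p) p (A p * B' p - A2 p * B p).
  have h := pdvD (pdvM (dA p) (dB1 p)) (pdvN (pdvM (dA1 p) (dB p))). by apply: is_derive_eq h _; ring.
 exact (pdv_line dAB).
have sp (A B D : R * R -> R) : (fun p => A p * (B p + D p)) = (fun p => A p * B p + A p * D p).
 by apply/funext => p; rewrite mulrDr.
have sp' (A B D : R * R -> R) : (fun p => (B p + D p) * A p) = (fun p => B p * A p + D p * A p).
 by apply/funext => p; rewrite mulrDl.
rewrite sp sp' !JD//; try exact: bmM.
have [ok p0] := hj; have [ok' p0'] := hk.
congr (_ + _).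
 by apply: (@one ex (j0 j) (j0 k) (jxx k) (jx j) (jx k) (jxx j)) => // p; [have [] := ok p|have [] := ok p|have [] := ok' p|have [] := ok' p].
apply: (@one ey (j0 j) (j0 k) (jyy k) (jy j) (jy k) (jyy j)) => // p.
- by have [_ _ h _ _] := ok p.
- by have [_ _ _ h _] := ok p.
- by have [_ _ h _ _] := ok' p.
- by have [_ _ _ h _] := ok' p.
Qed.
Lemma near_near p (Q : R * R -> Prop) : (\forall q \near p, Q q) -> \forall q \near p, \forall q' \near q, Q q'.
Proof. by move=> h; exact: near_join. Qed.

(** Derivatives are determined by the function, so local jets of V agree near each point, and taking
    at every point its own jet defines a global one. *)
Lemma jet_glue (V Lap : R * R -> R) : pper V ->
 (forall p, exists j, \forall q \near p, [/\ V q = j0 j q, jet_ok j q & jxx j q + jyy j q = Lap q]) ->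
 exists2 j, C2p j & [/\ j0 j = V & forall p, jxx j p + jyy j p = Lap p].
Proof.
move=> pV /choice[g hg].
have eqV p : \forall q \near p, j0 (g p) q = V q by apply: filterS (hg p) => q [].
have step v (A : jet -> R * R -> R) (B : jet -> R * R -> R) p :
  (forall q, \forall q' \near q, A (g q) q' = A (g q') q') ->
  (forall j q, jet_ok j q -> pdv v (A j) q (B j q)) ->
  \forall q \near p, B (g p) q = B (g q) q.
 move=> hA hB; have h1 := near_near (hA p); have h2 : \forall q \near p, jet_ok (g p) q by apply: filterS (hg p) => q [].
 apply: filterS2 h1 h2 => q h1 h2; have ok : jet_ok (g q) q by have [] := nbhs_singleton (hg q).
 apply: pdv_uniq (hB _ _ h2) _; apply: pdv_ext (hB _ _ ok). by have h3 := hA q; apply: filterS2 h1 h3 => q' -> ->.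
have e0 p : \forall q \near p, j0 (g p) q = j0 (g q) q.
 apply: filterS (eqV p) => q ->; by have [-> ] := nbhs_singleton (hg q).
have e1 p : \forall q \near p, jx (g p) q = jx (g q) q.
 by apply: (step ex j0 jx) => // j q [].
have e2 p : \forall q \near p, jy (g p) q = jy (g q) q.
 by apply: (step ey j0 jy) => // j q [].
have e3 p : \forall q \near p, jxx (g p) q = jxx (g q) q.
 by apply: (step ex jx jxx) => // j q [].
have e4 p : \forall q \near p, jyy (g p) q = jyy (g q) q.
 by apply: (step ey jy jyy) => // j q [].
pose G := Jet (fun p => j0 (g p) p) (fun p => jx (g p) p) (fun p => jy (g p) p) (fun p => jxx (g p) p) (fun p => jyy (g p) p).
have G0 : j0 G = V by apply/funext => p /=; have [-> ] := nbhs_singleton (hg p).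
have ce (A : R * R -> R) (B : R * R -> R) p : (\forall q \near p, A q = B q) -> {for p, continuous A} -> {for p, continuous B}.
 move=> h c; have E := nbhs_singleton h. change (B q @[q --> p] --> B p); rewrite -E; apply: cvg_trans c.
 by apply: near_eq_cvg; apply: filterS h => q ->.
exists G; last by split=> // p; have [] := nbhs_singleton (hg p).
split=> [p|]; last by rewrite G0.
have [_ [a1 a2 a3 a4 [b0 b1 b2 b3 b4]] _] := nbhs_singleton (hg p).
split.
- exact: pdv_ext (e0 p) a1.
- exact: pdv_ext (e1 p) a2.
- exact: pdv_ext (e0 p) a3.
- exact: pdv_ext (e2 p) a4.
split; [exact: ce (e0 p) b0|exact: ce (e1 p) b1|exact: ce (e2 p) b2|exact: ce (e3 p) b3|exact: ce (e4 p) b4].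
Qed.

Lemma derivable_pdv v (E : R * R -> R) p : derivable E p v -> pdv v E p ('D_v E p).
Proof.
have E0 : (fun h : R => h^-1 *: (E (pshift ((h *: (1 : R) + 0) * v.1, (h *: (1 : R) + 0) * v.2) p) - E (pshift (0 * v.1, 0 * v.2) p))) =
  (fun h : R => h^-1 *: (E (h *: v + p) - E p)).
 apply/funext => h; rewrite pshift0; congr (_ *: (E _ - _)). have -> : h%:A + 0 = h by rewrite addr0; exact: mulr1.
 by case: v p => [a b] [x y]; rewrite /pshift /=; congr pair; exact: addrC.
by move=> h; split; rewrite /derivable /derive E0.
Qed.

Lemma test_jet (h : C -> R) : Defs.periodic L h -> smooth (h \o @cplx R) ->
 exists2 k, C2p k & j0 k = h \o @cplx R /\ forall p, laplacian (h \o @cplx R) p = jxx k p + jyy k p.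
Proof.
move=> ph sh; have [c0 [d1 d2 [c1 [d11 _ [c11 _] _]] [c2 [_ d22 _ [c22 _]]]]] := sh 2%N.
pose E := h \o @cplx R.
exists (Jet E (dx E) (dy E) (dx (dx E)) (dy (dy E))); last exact (conj erefl (fun p => erefl)).
split=> [p|p u Lu].
 split; [exact (derivable_pdv (d1 p))|exact (derivable_pdv (d11 p))|exact (derivable_pdv (d2 p))|exact (derivable_pdv (d22 p))|].
 by split; [exact (c0 p)|exact (c1 p)|exact (c2 p)|exact (c11 p)|exact (c22 p)].
change (h (cplx (pshift u p)) = h (cplx p)).
have -> : cplx (pshift u p) = cplx p + cplx u by case: p u {Lu} => [a b] [x y]; rewrite /cplx /pshift /=; simpc.
exact: ph.
Qed.
End Green.

(** * A cut-off logarithm and a bump, as functions of the squared radius *)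

Section CutoffLogarithm.
Implicit Types (q s t : R).

Lemma ln_le_sub1 s : 0 < s -> ln s <= s - 1.
Proof.
move=> s0; have := expR_ge1Dx (s - 1); rewrite subrKC => h.
by rewrite -[leRHS]expRK ler_ln ?posrE ?expR_gt0.
Qed.

Lemma ln_ge_sub s : 0 < s -> 1 - s^-1 <= ln s.
Proof.
move=> s0; have := @ln_le_sub1 s^-1; rewrite invr_gt0 lnV ?posrE// => /(_ s0); lra.
Qed.

Definition m1 q := Num.min q 1.
(** For q < 1 the logarithm minus its second Taylor polynomial at 1, and 0 for q >= 1: a logarithm
    with compact support which is C^2 at the seam. Off 0, [th1] and [th2] are its derivatives. *)
Definition th q := ln (m1 q) - (m1 q - 1) + (m1 q - 1) ^+ 2 / 2.
Definition th1 q := (1 - m1 q) ^+ 2 / m1 q.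
Definition th2 q := 1 - (m1 q) ^- 2.

Lemma m1_lt q : q < 1 -> m1 q = q. Proof. by move=> h; apply: min_l; exact: ltW. Qed.
Lemma m1_ge q : 1 <= q -> m1 q = 1. Proof. by move=> h; exact: min_r. Qed.
Lemma m1_gt0 q : 0 < q -> 0 < m1 q. Proof. by move=> h; rewrite lt_min h ltr01. Qed.
Lemma m1_le1 q : m1 q <= 1. Proof. by rewrite ge_min lexx orbT. Qed.
Lemma th_ge1 q : 1 <= q -> th q = 0.
Proof. by move=> h; rewrite /th m1_ge// ln1 subrr expr0n/= mul0r subr0 addr0. Qed.
Lemma th1_ge1 q : 1 <= q -> th1 q = 0.
Proof. by move=> h; rewrite /th1 m1_ge// subrr expr0n/= mul0r. Qed.
Lemma th2_ge1 q : 1 <= q -> th2 q = 0.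
Proof. by move=> h; rewrite /th2 m1_ge// expr1n invr1 subrr. Qed.
Lemma m1_cont q : {for q, continuous m1}.
Proof. by apply: continuous_min; [exact: cvg_id|exact: cvg_cst]. Qed.

(** Used at q = 1, where the cut-off functions change formula: a quadratic bound on both sides gives
    derivative 0. *)
Lemma is_derive_quad (f : R -> R) (M : R) : 0 <= M -> f 1 = 0 ->
 (forall s, 2^-1 < s -> `|f s| <= M * (s - 1) ^+ 2) -> is_derive (1 : R) (1 : R) f 0.
Proof.
move=> M0 f1 hf; apply/is_derive_eps => e e0; have M1 : 0 < M + 1 by lra.
exists (Num.min (2^-1) (e / (M + 1))); first by rewrite lt_min invr_gt0 ltr0n divr_gt0.
move=> s; rewrite lt_min ltr_pdivlMr// => /andP[h1 h2]; rewrite f1 subr0 mul0r subr0.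
have hs : 2^-1 < s by move: h1; rewrite ltr_norml => /andP[a _]; lra.
apply: le_trans (hf s hs) _.
have n0 := normr_ge0 (s - 1); rewrite -(real_normK (num_real (s - 1))) expr2 mulrA ler_wpM2r//.
move: h2 n0 M0; set u := `|s - 1|; nra.
Qed.
Lemma near_lt1 q : q < 1 -> \forall s \near q, s < 1.
Proof. by move=> h; exact: lt_nbhsl. Qed.
Lemma near_gt1 q : 1 < q -> \forall s \near q, 1 < s.
Proof. by move=> h; exact: lt_nbhsr. Qed.

Lemma is_derive_affine q s t : is_derive q (1 : R) (fun x => s * x + t) s.
Proof.
apply/is_derive_eps => e e0; exists 1 => // x _.
have -> : s * x + t - (s * q + t) - s * (x - q) = 0 by ring.
by rewrite normr0 mulr_ge0// ltW.
Qed.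

Lemma derive_near (f g : R -> R) q d d' : is_derive q (1 : R) f d -> (\forall s \near q, f s = g s) -> d = d' ->
 is_derive q (1 : R) g d'.
Proof. by move=> h E <-; apply: (@near_eq_is_derive _ _ _ f) => //; exact: oner_neq0. Qed.

Lemma th_derive q : 0 < q -> is_derive q (1 : R) th (th1 q).
Proof.
move=> q0; case: (ltgtP q 1) => h.
- have d1 := is_derive_affine q 1 (-1).
 have d2 := is_deriveD (is_deriveB (is_derive1_ln q0) d1) (is_deriveZ 2^-1 (is_deriveM d1 d1)).
 apply: (derive_near d2).
 - by apply: filterS (near_lt1 h) => s hs; rewrite /th m1_lt//; change (ln s - (1 * s + -1) + 2^-1 * ((1 * s + -1) * (1 * s + -1)) = ln s - (s - 1) + (s - 1) ^+ 2 / 2); move: (ln s) => l; field.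
 by rewrite /th1 m1_lt// /GRing.scale/=; field; rewrite gt_eqF.
- apply: (@near_eq_is_derive _ _ _ (cst 0)); rewrite ?oner_neq0//.
  by apply: filterS (near_gt1 h) => s /ltW hs; rewrite th_ge1.
 by rewrite th1_ge1 ?ltW//; exact: is_derive_cst.
rewrite h th1_ge1//; apply: (@is_derive_quad _ 2) => //; first by rewrite th_ge1.
move=> s s2; have [h1|h1] := ltP s 1; last by rewrite th_ge1// normr0 mulr_ge0// sqr_ge0.
have s0 : 0 < s by lra.
have a := ln_le_sub1 s0; have b := ln_ge_sub s0; rewrite /th m1_lt//.
have e1 : s^-1 - 1 + (s - 1) = (s - 1) ^+ 2 * s^-1 by field; rewrite gt_eqF.
have e2 : (s - 1) ^+ 2 * s^-1 <= (s - 1) ^+ 2 * 2.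
 rewrite ler_wpM2l ?sqr_ge0// -[leRHS]invrK lef_pV2 ?posrE ?invr_gt0//; lra.
have e3 := sqr_ge0 (s - 1); rewrite ler_norml; apply/andP; split; lra.
Qed.

Lemma th1_derive q : 0 < q -> is_derive q (1 : R) th1 (th2 q).
Proof.
move=> q0; case: (ltgtP q 1) => h.
- have d1 := is_derive_affine q (-1) 1.
 have d2 := is_deriveM (is_deriveM d1 d1) (is_deriveV (lt0r_neq0 q0) (is_derive_id q (1 : R))).
 apply: (derive_near d2).
 - apply: filterS (near_lt1 h) => s hs; rewrite /th1 m1_lt//; congr (_ / _); rewrite expr2.
  by change ((-1 * s + 1) * (-1 * s + 1) = (1 - s) * (1 - s)); ring.
 rewrite /th2 m1_lt//.
 change ((-1 * q + 1) * (-1 * q + 1) * (- q ^- 2 * 1) + q^-1 * ((-1 * q + 1) * -1 + (-1 * q + 1) * -1) = 1 - q ^- 2).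
 by field; rewrite gt_eqF.
- apply: (@near_eq_is_derive _ _ _ (cst 0)); rewrite ?oner_neq0//.
  by apply: filterS (near_gt1 h) => s /ltW hs; rewrite th1_ge1.
 by rewrite th2_ge1 ?ltW//; exact: is_derive_cst.
rewrite h th2_ge1//; apply: (@is_derive_quad _ 2) => //; first by rewrite th1_ge1.
move=> s s2; have [h1|h1] := ltP s 1; last by rewrite th1_ge1// normr0 mulr_ge0// sqr_ge0.
have s0 : 0 < s by lra.
rewrite /th1 m1_lt// ger0_norm ?divr_ge0 ?sqr_ge0 ?(ltW s0)// mulrC -sqrrN opprB.
rewrite ler_wpM2r ?sqr_ge0// -[leRHS]invrK lef_pV2 ?posrE ?invr_gt0//; lra.
Qed.
Lemma th_cont q : 0 < q -> {for q, continuous th}.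
Proof. by move=> /th_derive[h _]; apply: differentiable_continuous; apply/derivable1_diffP. Qed.

Lemma th2_cont q : 0 < q -> {for q, continuous th2}.
Proof.
move=> q0; apply: continuousB; first exact: cst_continuous.
apply: continuousV; first by rewrite expf_neq0// gt_eqF// m1_gt0.
change {for q, continuous (fun s => m1 s * m1 s)}; by apply: continuousM; exact: m1_cont.
Qed.

Lemma th_mono s q : 0 < s -> s <= q -> th s <= th q.
Proof.
move=> s0; rewrite le_eqVlt => /orP[/eqP ->//|h1].
have hd x : x \in `]s, q[ -> is_derive x (1 : R) th (th1 x).
 by move=> /itvP x1; apply: th_derive; apply: lt_trans s0 _; rewrite x1.
have hc : {within `[s, q], continuous th}.
 apply: continuous_in_subspaceT => y /set_mem /itvP yq; apply: th_cont. by apply: lt_le_trans s0 _; rewrite yq.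
have [c /itvP cq E] := MVT h1 hd hc; rewrite -subr_ge0 E.
have c0 : 0 < c by apply: lt_trans s0 _; rewrite cq.
by rewrite /th1 mulr_ge0 ?subr_ge0 ?(ltW h1)// divr_ge0 ?sqr_ge0// ltW// m1_gt0.
Qed.

Lemma th_le0 q : 0 < q -> th q <= 0.
Proof.
move=> q0; have [h|h] := ltP q 1; last by rewrite th_ge1.
by rewrite -[leRHS](th_ge1 (lexx 1)); apply: th_mono => //; exact: ltW.
Qed.

(** A C^2 function of compact support. As a test function of the squared radius it has positive
    Laplacian near the centre, which is what controls the integral of the logarithm. *)
Definition cub q := - (1 - m1 q) ^+ 3.
Definition cub1 q := 3 * (1 - m1 q) ^+ 2.
Definition cub2 q := - 6 * (1 - m1 q).

Lemma cub_ge1 q : 1 <= q -> [/\ cub q = 0, cub1 q = 0 & cub2 q = 0].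
Proof. by move=> h; rewrite /cub /cub1 /cub2 m1_ge// subrr !expr0n/= !mulr0 oppr0. Qed.

Lemma cub_derive q : is_derive q (1 : R) cub (cub1 q) /\ is_derive q (1 : R) cub1 (cub2 q).
Proof.
case: (ltgtP q 1) => h.
- have d1 := is_derive_affine q (-1) 1.
 have d2 := is_deriveM d1 d1; have d3 := is_deriveN (is_deriveM d1 d2). split.
  apply: (derive_near d3).
   by apply: filterS (near_lt1 h) => s hs; rewrite /cub m1_lt//; change (- ((-1 * s + 1) * ((-1 * s + 1) * (-1 * s + 1))) = - (1 - s) ^+ 3); ring.
  rewrite /cub1 m1_lt//.
  change (- ((-1 * q + 1) * ((-1 * q + 1) * -1 + (-1 * q + 1) * -1) + (-1 * q + 1) * (-1 * q + 1) * -1) = 3 * (1 - q) ^+ 2).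
  by ring.
 apply: (derive_near (is_deriveZ 3 d2)).
  by apply: filterS (near_lt1 h) => s hs; rewrite /cub1 m1_lt//; change (3 * ((-1 * s + 1) * (-1 * s + 1)) = 3 * (1 - s) ^+ 2); ring.
 by rewrite /cub2 m1_lt// /GRing.scale/=; ring.
- have [_ e1 e2] := cub_ge1 (ltW h); rewrite e1 e2; split.
  apply: (@near_eq_is_derive _ _ _ (cst 0)); rewrite ?oner_neq0//.
  by apply: filterS (near_gt1 h) => s /ltW /cub_ge1[->].
 apply: (@near_eq_is_derive _ _ _ (cst 0)); rewrite ?oner_neq0//.
 by apply: filterS (near_gt1 h) => s /ltW /cub_ge1[_ ->].
have [e0 e1 e2] := cub_ge1 (lexx 1); rewrite h e1 e2; split.
 apply: (@is_derive_quad _ 2^-1) => // s s2.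
 have [h1|h1] := ltP s 1; last by have [-> _ _] := cub_ge1 h1; rewrite normr0 mulr_ge0// sqr_ge0.
 have h1' : 0 <= 1 - s by rewrite subr_ge0 ltW. rewrite /cub m1_lt// normrN ger0_norm ?exprn_ge0//.
 have -> : (1 - s) ^+ 3 = (1 - s) * (s - 1) ^+ 2 by ring. rewrite ler_wpM2r ?sqr_ge0//; lra.
apply: (@is_derive_quad _ 3) => // s s2.
have [h1|h1] := ltP s 1; last by have [_ -> _] := cub_ge1 h1; rewrite normr0 mulr_ge0// sqr_ge0.
rewrite /cub1 m1_lt// ger0_norm; last by apply: mulr_ge0; [|exact: sqr_ge0].
by rewrite -sqrrN opprB.
Qed.

Lemma cub2_cont q : {for q, continuous cub2}.
Proof.
apply: continuousM; first exact: cst_continuous.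
by apply: continuousB; [exact: cst_continuous|exact: m1_cont].
Qed.
End CutoffLogarithm.

(** * The truncated squared distance to the lattice *)

Section PeriodicRadius.
Implicit Types (x y r s t e : R) (p q v : R * R) (j : jet) (l : C).
Variables (w1 w2 : C) (tau : 0 < Im (w2 / w1)).
Local Notation pper := (pper w1 w2).
Local Notation L := (lattice w1 w2).

(** The factor 3 forbids a point within r of one lattice point and within 2r of another; the last
    condition places the disc about 0 inside the parallelogram centred at 0. *)
Lemma good_radius_ex : exists r : R, [/\ 0 < r, forall l, L l -> l != 0 -> 3 * r <= nm l &
 forall s t, nm (rpt w1 w2 s t) < r -> `|s| < 2^-1 /\ `|t| < 2^-1].
Proof.
have [K K0 hK] := coord_bound tau; exists (3 * K)^-1; split; first by rewrite invr_gt0 mulr_gt0.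
 move=> _ [m [n ->]] l0; rewrite -(rpt_int w1 w2) in l0 *; have := hK m%:~R n%:~R.
 have h : 1 <= `|m%:~R : R| + `|n%:~R : R|.
  rewrite -!intr_norm -intrD (ler_int _ 1). have : (m != 0) || (n != 0).
   by rewrite -negb_and; apply: contra l0 => /andP[/eqP -> /eqP ->]; rewrite /rpt !mulr0z !mul0r addr0.
  by lia.
 move=> h2; rewrite invfM mulrA mulfV// mul1r -(ler_pM2l K0) mulfV ?gt_eqF//; exact: le_trans h h2.
move=> s t; have := hK s t; have := normr_ge0 s; have := normr_ge0 t; move=> a b c.
rewrite invfM -(ltr_pM2l K0) mulrCA mulfV ?gt_eqF// mulr1 => d.
have : `|s| + `|t| < 3^-1 by exact: le_lt_trans d.
by split; lra.
Qed.

Definition rad : R := projT1 (cid good_radius_ex).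
Lemma rad0 : 0 < rad. Proof. by rewrite /rad; case: cid => r []. Qed.
Lemma rad_sep l : L l -> l != 0 -> 3 * rad <= nm l.
Proof. by rewrite /rad; case: cid => r [/= _ h _]; exact: h. Qed.
Lemma rad_coord s t : nm (rpt w1 w2 s t) < rad -> `|s| < 2^-1 /\ `|t| < 2^-1.
Proof. by rewrite /rad; case: cid => r [/= _ _ h]; exact: h. Qed.

Definition qd l p : R := ((p.1 - Re l) ^+ 2 + (p.2 - Im l) ^+ 2) / rad ^+ 2.

Lemma qdE l p : qd l p = (nm (cplx p - l) / rad) ^+ 2.
Proof.
rewrite /qd exprMn exprVn; congr (_ / _); case: l p => a b [x y]; rewrite /cplx /=.
by rewrite sqr_sqrtr// addr_ge0 ?sqr_ge0.
Qed.
Lemma qd_ge0 l p : 0 <= qd l p. Proof. by rewrite qdE sqr_ge0. Qed.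
Lemma qd_lt l p c : 0 <= c -> (qd l p < c ^+ 2) = (nm (cplx p - l) < c * rad).
Proof. by move=> c0; rewrite qdE ltr_pXn2r// ?nnegrE ?divr_ge0 ?nm_ge0 ?(ltW rad0)// ltr_pdivrMr ?rad0. Qed.
Lemma qd_lt1 l p : (qd l p < 1) = (nm (cplx p - l) < rad).
Proof. by rewrite -[X in _ < X](expr1n _ 2) qd_lt// mul1r. Qed.

(** The squared distance to the lattice in units of [rad], cut off at 1; off the discs of radius
    [rad] it is 1. *)
Definition Q p : R := if pselect (exists2 l, L l & qd l p < 1) is left h then qd (projT1 (cid2 h)) p else 1.

Lemma qd_uniq l l' p : L l -> L l' -> qd l p < 1 -> nm (cplx p - l') < 2 * rad -> l' = l.
Proof.
move=> Ll Ll'; rewrite qd_lt1 => h h'; apply/eqP; rewrite -subr_eq0; apply/negP => /negP n.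
have := rad_sep (latB Ll' Ll) n; have := nm_leD (cplx p - l) (l' - cplx p).
have -> : cplx p - l + (l' - cplx p) = l' - l by ring.
rewrite (nmB l' (cplx p)); lra.
Qed.

Lemma Q_in l p : L l -> qd l p < 1 -> Q p = qd l p.
Proof.
move=> Ll h; rewrite /Q; case: pselect => [h'|[]]; last by exists l.
case: cid2 => l' /= Ll' hl'; congr (qd _ p); apply/esym; apply: (qd_uniq Ll' Ll hl').
by move: h; rewrite qd_lt1; have := rad0; lra.
Qed.
Lemma Q_out p : (forall l, L l -> 1 <= qd l p) -> Q p = 1.
Proof. by move=> h; rewrite /Q; case: pselect => // h'; exfalso; have [l Ll] := h'; rewrite ltNge h. Qed.
Lemma Q_ge0 p : 0 <= Q p.
Proof. by rewrite /Q; case: pselect => // h; exact: qd_ge0. Qed.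
Lemma Q_le1 p : Q p <= 1.
Proof. by rewrite /Q; case: pselect => // h; case: cid2 => l /= _ /ltW. Qed.

Lemma Q_m1 l p : L l -> nm (cplx p - l) < 2 * rad -> Q p = m1 (qd l p).
Proof.
move=> Ll h; have [h1|h1] := ltP (qd l p) 1; first by rewrite (Q_in Ll h1) m1_lt.
rewrite m1_ge// Q_out// => l' Ll'; rewrite leNgt; apply/negP => h'.
by move: h1; rewrite (qd_uniq Ll' Ll h' h) leNgt h'.
Qed.

Lemma nm_cplxB p q : nm (cplx p - cplx q) <= `|p.1 - q.1| + `|p.2 - q.2|.
Proof. exact: (nm_le_ReIm (cplx p - cplx q)). Qed.

Lemma nm_near r p l : nm (cplx p - l) < r -> \forall q \near p, nm (cplx q - l) < r.
Proof.
move=> h; apply/near2P; exists ((r - nm (cplx p - l)) / 2); first by rewrite divr_gt0 ?subr_gt0.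
move=> q h1 h2; have := nm_distD (cplx p) (cplx q) l; move=> a.
by have := nm_cplxB q p; lra.
Qed.

(** Within 2 [rad] of a lattice point the formula holds in a neighbourhood, so the rim of the disc
    is covered too. Farther away both sides are 1, with 0 as a dummy centre. *)
Lemma Q_local p : exists2 l, L l & \forall q \near p, Q q = m1 (qd l q).
Proof.
have r0 := rad0; have [[l Ll h]|h] := pselect (exists2 l, L l & nm (cplx p - l) < 2 * rad).
 by exists l => //; apply: filterS (nm_near h) => q; exact: Q_m1.
exists 0; first exact: lat0.
have f l : L l -> 2 * rad <= nm (cplx p - l).
 by move=> Ll; rewrite leNgt; apply/negP => h'; apply: h; exists l.
apply/near2P; exists (rad / 2); first by rewrite divr_gt0.
move=> q h1 h2; have g l : L l -> 1 <= qd l q.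
 move=> /f hl; rewrite leNgt qd_lt1 -leNgt; have := nm_distD (cplx q) (cplx p) l; move=> a.
 by have := nm_cplxB p q; rewrite (distrC p.1) (distrC p.2); lra.
by rewrite Q_out// m1_ge//; apply: g; exact: lat0.
Qed.

Lemma qd_pshift l p v : qd (l + cplx v) (pshift v p) = qd l p.
Proof.
rewrite !qdE; have -> : cplx (pshift v p) = cplx p + cplx v by case: p v => [a b] [x y]; rewrite /cplx /pshift /=; simpc.
by rewrite opprD addrACA subrr addr0.
Qed.

Lemma Q_per : pper Q.
Proof.
move=> p v Lv; have [[l Ll h]|h] := pselect (exists2 l, L l & qd l p < 1).
 by rewrite (Q_in Ll h) (@Q_in (l + cplx v)) ?qd_pshift//; exact: latD.
have h' l : L l -> 1 <= qd l p by move=> Ll; rewrite leNgt; apply/negP => a; apply: h; exists l.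
rewrite (Q_out h') Q_out// => l Ll; rewrite -[l](subrK (cplx v)) qd_pshift; apply: h'; exact: latB.
Qed.

Definition qjet l : jet := Jet (qd l) (fun p => 2 * (p.1 - Re l) / rad ^+ 2) (fun p => 2 * (p.2 - Im l) / rad ^+ 2)
 (fun=> 2 / rad ^+ 2) (fun=> 2 / rad ^+ 2).

Lemma pdv_fst v p : pdv v fst p v.1.
Proof.
have -> : pdv v fst p v.1 = is_derive (0 : R) (1 : R) (fun t => v.1 * t + p.1) v.1; last exact: is_derive_affine.
by rewrite /pdv; congr (is_derive _ _ _ _); apply/funext => t /=; rewrite addrC mulrC.
Qed.

Lemma pdv_snd v p : pdv v snd p v.2.
Proof.
have -> : pdv v snd p v.2 = is_derive (0 : R) (1 : R) (fun t => v.2 * t + p.2) v.2; last exact: is_derive_affine.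
by rewrite /pdv; congr (is_derive _ _ _ _); apply/funext => t /=; rewrite addrC mulrC.
Qed.

Lemma qjet_ok l p : jet_ok (qjet l) p.
Proof.
have X v : pdv v (fun p => p.1 - Re l) p (v.1 + 0) by apply: pdvD; [exact: pdv_fst|exact: pdv_cst].
have Y v : pdv v (fun p => p.2 - Im l) p (v.2 + 0) by apply: pdvD; [exact: pdv_snd|exact: pdv_cst].
have h0 v : pdv v (qd l) p (((v.1 + 0) * (p.1 - Re l) + (p.1 - Re l) * (v.1 + 0) +
  ((v.2 + 0) * (p.2 - Im l) + (p.2 - Im l) * (v.2 + 0))) * rad ^- 2 +
  ((p.1 - Re l) * (p.1 - Re l) + (p.2 - Im l) * (p.2 - Im l)) * 0).
 exact (pdvM (pdvD (pdvM (X v) (X v)) (pdvM (Y v) (Y v))) (pdv_cst v (rad ^- 2) p)).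
have hx v : pdv v (jx (qjet l)) p ((0 * (p.1 - Re l) + 2 * (v.1 + 0)) * rad ^- 2 + 2 * (p.1 - Re l) * 0).
 exact (pdvM (pdvM (pdv_cst v 2 p) (X v)) (pdv_cst v (rad ^- 2) p)).
have hy v : pdv v (jy (qjet l)) p ((0 * (p.2 - Im l) + 2 * (v.2 + 0)) * rad ^- 2 + 2 * (p.2 - Im l) * 0).
 exact (pdvM (pdvM (pdv_cst v 2 p) (Y v)) (pdv_cst v (rad ^- 2) p)).
have cc (r : R) : {for p, continuous (fun=> r : R)} by exact: cst_continuous.
have cX : {for p, continuous (fun p => p.1 - Re l : R)}.
 by apply: contD; [exact: cvg_fst|exact: cc].
have cY : {for p, continuous (fun p => p.2 - Im l : R)}.
 by apply: contD; [exact: cvg_snd|exact: cc].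
split.
- by apply: is_derive_eq (h0 (1, 0)) _; rewrite /= -/(rad ^- 2); move: (rad ^- 2) => a; ring.
- by apply: is_derive_eq (hx (1, 0)) _; rewrite /=; move: (rad ^- 2) => a; ring.
- by apply: is_derive_eq (h0 (0, 1)) _; rewrite /=; move: (rad ^- 2) => a; ring.
- by apply: is_derive_eq (hy (0, 1)) _; rewrite /=; move: (rad ^- 2) => a; ring.
split; [|exact (contM (contM (cc 2) cX) (cc (rad ^- 2)))|exact (contM (contM (cc 2) cY) (cc (rad ^- 2)))|exact: cc|exact: cc].
exact (contM (contD (contM cX cX) (contM cY cY)) (cc (rad ^- 2))).
Qed.

(* In [(p - l) / rad] polar coordinates, [4 (q f'' + f')] is the Laplacian of [f (|.|^2)]. *)
Lemma radial_jet (f f1 f2 : R -> R) e : 0 <= e ->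
 (forall x, e <= x -> [/\ is_derive x (1 : R) f (f1 x), is_derive x (1 : R) f1 (f2 x) & {for x, continuous f2}]) ->
 (forall x, 1 <= x -> [/\ f x = 0, f1 x = 0 & f2 x = 0]) ->
 exists2 j, C2p w1 w2 j & j0 j = (fun p => f (Q p + e)) /\
  forall p, jxx j p + jyy j p = 4 / rad ^+ 2 * (Q p * f2 (Q p + e) + f1 (Q p + e)).
Proof.
move=> e0 hd h1; have r0 := rad0; have r2 : rad ^+ 2 != 0 by rewrite expf_neq0// gt_eqF.
have [j C2j [E1 E2]] : exists2 j, C2p w1 w2 j & [/\ j0 j = (fun p => f (Q p + e)) &
  forall p, jxx j p + jyy j p = 4 / rad ^+ 2 * (Q p * f2 (Q p + e) + f1 (Q p + e))].
 apply: jet_glue; first by move=> p v Lv; rewrite Q_per.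
 move=> p; have [l Ll hl] := Q_local p; exists (jcomp f f1 f2 (jadd (qjet l) (jcst e))). apply: filterS hl => q ->.
 have [hm|hm] := ltP (qd l q) 1; [rewrite (m1_lt hm)|rewrite (m1_ge hm)].
  split=> //.
   have [a b c] := hd (qd l q + e) (ler_wpDl (qd_ge0 l q) (lexx e)).
   exact: (@jcomp_ok f f1 f2 (jadd (qjet l) (jcst e)) q (jadd_ok (qjet_ok l q) (jcst_ok e q)) a b c).
  change (f2 (qd l q + e) * (2 * (q.1 - Re l) / rad ^+ 2 + 0) * (2 * (q.1 - Re l) / rad ^+ 2 + 0) + f1 (qd l q + e) * (2 / rad ^+ 2 + 0) +
   (f2 (qd l q + e) * (2 * (q.2 - Im l) / rad ^+ 2 + 0) * (2 * (q.2 - Im l) / rad ^+ 2 + 0) + f1 (qd l q + e) * (2 / rad ^+ 2 + 0)) =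
   4 / rad ^+ 2 * (((q.1 - Re l) ^+ 2 + (q.2 - Im l) ^+ 2) / rad ^+ 2 * f2 (qd l q + e) + f1 (qd l q + e))).
  by move: (f2 _) (f1 _) (q.1 - _) (q.2 - _) => u v a b; field; rewrite gt_eqF.
 have [a1 a2 a3] := h1 (1 + e) (ler_wpDr e0 (lexx 1)). have [b1 b2 b3] := h1 (qd l q + e) (ler_wpDr e0 hm).
 split; first by rewrite a1 /= b1.
  have [a b c] := hd (qd l q + e) (ler_wpDl (qd_ge0 l q) (lexx e)).
  exact: (@jcomp_ok f f1 f2 (jadd (qjet l) (jcst e)) q (jadd_ok (qjet_ok l q) (jcst_ok e q)) a b c).
 by rewrite /= b2 b3 a2 a3 !mul0r !addr0 !mulr0.
by exists j.
Qed.

Lemma Q_cont : continuous (Q : R * R -> R).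
Proof.
move=> p; have [l Ll h] := Q_local p; have E := nbhs_singleton h.
change (Q q @[q --> p] --> Q p); rewrite E.
have c : {for p, continuous (fun q => m1 (qd l q))}.
 by apply: cont_comp; [have [_ _ _ _ []] := qjet_ok l p|exact: m1_cont].
by apply: cvg_trans c; apply: near_eq_cvg; apply: filterS h => q ->.
Qed.

Lemma Q0 : Q (0, 0) = 0.
Proof.
have e : qd 0 (0, 0) = 0 by rewrite /qd /= !subr0 !expr0n /= addr0 mul0r.
by rewrite (@Q_in 0) ?e//; exact: lat0.
Qed.

Lemma Q_small (E : R * R -> R) : continuous E -> pper E -> forall e, 0 < e ->
 exists2 d, 0 < d & forall p, Q p < d -> `|E p - E (0, 0)| < e.
Proof.
move=> cE pE e e0; have [d d0 hd] := (cont2P E (0, 0)).1 (cE (0, 0)) e e0; have r0 := rad0.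
have c0 : 0 < Num.min 1 (d / rad) by rewrite lt_min ltr01 divr_gt0.
exists (Num.min 1 (d / rad) ^+ 2); first by rewrite exprn_gt0.
move=> p hp; have [[l Ll h]|h] := pselect (exists2 l, L l & qd l p < 1); last first.
 have : Q p = 1 by apply: Q_out => l Ll; rewrite leNgt; apply/negP => a; apply: h; exists l.
 move=> Q1; move: hp; rewrite Q1 ltNge => /negP[]. by rewrite expr_le1 ?(ltW c0)// ge_min lexx.
move: hp; rewrite (Q_in Ll h) qd_lt ?(ltW c0)// => hp.
have hp' : nm (cplx p - l) < d.
 by apply: lt_le_trans hp _; rewrite -ler_pdivlMr// ge_min lexx orbT.
pose v : R * R := (- Re l, - Im l).
have Ev : cplx v = - l by rewrite /cplx /v; case: (l).
rewrite -(pE p v) ?Ev ?latNE//; apply: hd; rewrite /pshift /= subr0.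
 by apply: le_lt_trans hp'; have := Re_le_nm (cplx p - l); rewrite raddfB.
by apply: le_lt_trans hp'; have := Im_le_nm (cplx p - l); rewrite raddfB.
Qed.
End PeriodicRadius.

(** * An explicit integral over a disc *)

Section DiscIntegral.
Implicit Types (x y t a b r : R).

Lemma is_derive_cont (f : R -> R) x d : is_derive x (1 : R) f d -> {for x, continuous f}.
Proof. by move=> [h _]; apply: differentiable_continuous; apply/derivable1_diffP. Qed.

Lemma integral_segment (f F : R -> R) a b : a < b -> (forall x, is_derive x (1 : R) F (f x)) -> continuous f ->
 (\int[leb]_(x in `[a, b]) (f x)%:E = (F b - F a)%:E)%E.
Proof.
move=> ab dF cf; have cF x : {for x, continuous F} := is_derive_cont (dF x).
rewrite (@continuous_FTC2 R f F a b ab) ?EFinB//.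
- exact: continuous_subspaceT.
- split; first by move=> x _; have [] := dF x.
 + exact: cvg_at_right_filter (cF a).
 + exact: cvg_at_left_filter (cF b).
by move=> x _; rewrite derive1E; have [_ ->] := dF x.
Qed.

Lemma integral_support (f : R -> R) a b : (forall x, ~ (a <= x <= b) -> f x = 0) ->
 (\int[leb]_x (f x)%:E = \int[leb]_(x in `[a, b]) (f x)%:E)%E.
Proof.
move=> h; rewrite [RHS]integral_mkcond; apply: eq_integral => x _; rewrite patchE.
by case: ifPn => // /negP hx; rewrite h// => hx'; apply: hx; apply/mem_set; rewrite /= in_itv.
Qed.

Lemma cont_quad (c : R) : continuous (fun x : R => c - x ^+ 2).
Proof.
move=> x; have c1 : {for x, continuous (fun y : R => y)} by exact: cvg_id.
have c2 : {for x, continuous (fun y : R => c)} by exact: cst_continuous.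
exact: (continuousB c2 (continuousM c1 c1)).
Qed.

Lemma integral_parabola b : 0 < b -> (\int[leb]_(y in `[(- b)%R, b]) (b ^+ 2 - y ^+ 2)%:E = (4 / 3 * b ^+ 3)%:E)%E.
Proof.
move=> b0; pose F y := b ^+ 2 * y - 3^-1 * (y * (y * y)); pose f y := b ^+ 2 - y ^+ 2.
have dF x : is_derive x (1 : R) F (f x).
 have d1 := is_derive_affine x 1 0; have d2 := is_derive_affine x (b ^+ 2) 0.
 apply: (derive_near (is_deriveB d2 (is_deriveZ 3^-1 (is_deriveM d1 (is_deriveM d1 d1))))).
  apply: (@nearW _ (nbhs x)) => y; change (b ^+ 2 * y + 0 - 3^-1 * ((1 * y + 0) * ((1 * y + 0) * (1 * y + 0))) = b ^+ 2 * y - 3^-1 * (y * (y * y))).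
  by ring.
 change (b ^+ 2 - 3^-1 * ((1 * x + 0) * ((1 * x + 0) * 1 + (1 * x + 0) * 1) + (1 * x + 0) * (1 * x + 0) * 1) = b ^+ 2 - x ^+ 2).
 by field.
have cf : continuous f by exact: cont_quad.
have ab : - b < b by lra.
by rewrite (integral_segment ab dF cf); congr EFin; rewrite /F; field.
Qed.

Lemma cos4_primitive t : is_derive t (1 : R) (fun t => 3 / 8 * t + (3 / 8 * (sin t * cos t) + 4^-1 * (sin t * (cos t * (cos t * cos t))))) (cos t ^+ 4).
Proof.
have ds := is_derive_sin t; have dc := is_derive_cos t; have d1 := is_derive_affine t (3 / 8) 0.
apply: (derive_near (is_deriveD d1 (is_deriveD (is_deriveZ (3 / 8) (is_deriveM ds dc))
 (is_deriveZ 4^-1 (is_deriveM ds (is_deriveM dc (is_deriveM dc dc))))))).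
 apply: (@nearW _ (nbhs t)) => y; change (3 / 8 * y + 0 + (3 / 8 * (sin y * cos y) + 4^-1 * (sin y * (cos y * (cos y * cos y)))) =
  3 / 8 * y + (3 / 8 * (sin y * cos y) + 4^-1 * (sin y * (cos y * (cos y * cos y))))).
 by rewrite addr0.
have e : sin t ^+ 2 = 1 - cos t ^+ 2 by rewrite -(cos2Dsin2 t) addrAC subrr add0r.
move: e; set c := cos t; set s := sin t => e.
change (3 / 8 + (3 / 8 * (s * (- s) + c * c) + 4^-1 * (s * (c * (c * - s + c * - s) + c * c * - s) + c * (c * c) * c)) = c ^+ 4).
have -> : 3 / 8 + (3 / 8 * (s * (- s) + c * c) + 4^-1 * (s * (c * (c * - s + c * - s) + c * c * - s) + c * (c * c) * c)) =
 3 / 8 + (3 / 8 * (c ^+ 2 - s ^+ 2) + 4^-1 * (c ^+ 4 - 3 * s ^+ 2 * c ^+ 2)) by ring.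
by rewrite e; field.
Qed.

(** The substitution x = r sin t leaves r^4 times the integral of cos^4 over [-pi/2, pi/2], which is
    3 pi/8. *)
Lemma integral_sqrt3 r : 0 < r ->
 (\int[leb]_(x in `[(- r)%R, r]) (Num.sqrt (r ^+ 2 - x ^+ 2) ^+ 3)%:E = (3 / 8 * pi * r ^+ 4)%:E)%E.
Proof.
move=> r0; pose F t : R := r * sin t; pose G x : R := Num.sqrt (r ^+ 2 - x ^+ 2) ^+ 3.
have p0 : 0 < pi / 2 :> R by rewrite divr_gt0// pi_gt0.
have dF t : is_derive t (1 : R) F (r * cos t) by exact: (is_deriveZ r (is_derive_sin t)).
have F'E : F^`()%classic = (fun t => r * cos t) by apply/funext => t; rewrite derive1E; have [_ ->] := dF t.
have cF' : continuous (fun t : R => r * cos t).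
 by move=> t; apply: continuousM; [exact: cst_continuous|exact: continuous_cos].
have cF t : {for t, continuous F} := is_derive_cont (dF t).
have e1 : F (- (pi / 2)) = - r by rewrite /F sinN sin_pihalf mulrN1.
have e2 : F (pi / 2) = r by rewrite /F sin_pihalf mulr1.
have cG : continuous G.
 move=> x; have c : {for x, continuous (fun x => Num.sqrt (r ^+ 2 - x ^+ 2))}.
  apply: (@continuous_comp _ _ _ (fun x : R => r ^+ 2 - x ^+ 2) (@Num.sqrt R)); last exact: sqrt_continuous.
  exact: cont_quad.
 have -> : G = (fun x => Num.sqrt (r ^+ 2 - x ^+ 2) * (Num.sqrt (r ^+ 2 - x ^+ 2) * Num.sqrt (r ^+ 2 - x ^+ 2))).
  by apply/funext => y; rewrite /G exprS expr2.
 exact: (continuousM c (continuousM c c)).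
have S := @integration_by_substitution_increasing R F G (- (pi / 2)) (pi / 2).
rewrite e1 e2 in S; rewrite -/G S; first 1 last.
- by lra.
- by move=> x y hx hy xy; rewrite /F ltr_pM2l// ltr_sin.
- by rewrite F'E => x _; exact: cF'.
- by rewrite F'E; apply: (cvgP (r * cos (- (pi / 2)))); exact: cvg_at_right_filter (cF' _).
- by rewrite F'E; apply: (cvgP (r * cos (pi / 2))); exact: cvg_at_left_filter (cF' _).
- split; first by move=> x _; have [] := dF x.
 + exact: cvg_at_right_filter (cF _).
 + exact: cvg_at_left_filter (cF _).
- exact: continuous_subspaceT.
rewrite F'E; transitivity (\int[leb]_(x in `[(- (pi / 2))%R, (pi / 2)%R]) (r ^+ 4 * cos x ^+ 4)%:E)%E.
 apply: eq_integral => x /set_mem /=; rewrite in_itv/= => hx; congr EFin.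
 have c0 : 0 <= cos x by exact: cos_ge0_pihalf.
 have -> : ((G \o F) * (fun t => r * cos t)) x = G (F x) * (r * cos x) by []. have -> : G (F x) = (r * cos x) ^+ 3.
  rewrite /G /F; have -> : r ^+ 2 - (r * sin x) ^+ 2 = (r * cos x) ^+ 2.
   by rewrite !exprMn -[X in X - _]mulr1 -(cos2Dsin2 x); ring.
  by rewrite sqrtr_sqr ger0_norm// mulr_ge0// ltW.
 by ring.
pose H t := r ^+ 4 * (3 / 8 * t + (3 / 8 * (sin t * cos t) + 4^-1 * (sin t * (cos t * (cos t * cos t))))).
pose h t := r ^+ 4 * cos t ^+ 4.
have dH t : is_derive t (1 : R) H (h t) by exact: (is_deriveZ (r ^+ 4) (cos4_primitive t)).
have ch : continuous h.
 move=> x; have c := @continuous_cos R x.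
 have c0 : {for x, continuous (fun y : R => r ^+ 4)} by exact: cst_continuous.
 exact: (continuousM c0 (continuousM c (continuousM c (continuousM c c)))).
have ab : - (pi / 2) < pi / 2 :> R by lra.
rewrite (integral_segment ab dH ch) /H cosN cos_pihalf !(mulr0, mul0r, addr0); congr EFin; field => //.
Qed.

(** The volume under the paraboloid 1 - |p|^2/r^2, by slices. It is the one place where pi enters
    the Dirac mass: through [J_Q] it determines the 4 pi. *)
Lemma integral_cone r : 0 < r ->
 (\int[mu2]_p (1 - m1 ((p.1 ^+ 2 + p.2 ^+ 2) / r ^+ 2))%:E = (pi * r ^+ 2 / 2)%:E)%E.
Proof.
move=> r0; have r2 : 0 < r ^+ 2 by rewrite exprn_gt0.
pose W (p : RR) := 1 - m1 ((p.1 ^+ 2 + p.2 ^+ 2) / r ^+ 2).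
have W0 p : 0 <= W p by rewrite subr_ge0 m1_le1.
have mW : meas2 (fun p => (W p)%:E).
 apply/measurable_EFinP; apply: continuous2_measurable => p.
 have cc (c : R) : {for p, continuous (fun=> c : R)} by exact: cst_continuous.
 have c1 : {for p, continuous (fun p : R * R => p.1)} by exact: cvg_fst.
 have c2 : {for p, continuous (fun p : R * R => p.2)} by exact: cvg_snd.
 have c3 := cont_comp (contM (contD (contM c1 c1) (contM c2 c2)) (cc (r ^- 2))) (@m1_cont _).
 exact (contD (cc 1) (contN c3)).
change (\int[leb \x leb]_p (W p)%:E = (pi * r ^+ 2 / 2)%:E)%E.
rewrite fubini_tonelli1//=.
have inner x : (\int[leb]_y (W (x, y))%:E = (4 / (3 * r ^+ 2) * Num.sqrt (r ^+ 2 - x ^+ 2) ^+ 3)%:E)%E.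
 have [h|h] := leP (r ^+ 2) (x ^+ 2).
  have -> : Num.sqrt (r ^+ 2 - x ^+ 2) = 0 by apply/eqP; rewrite sqrtr_eq0 subr_le0.
  rewrite expr0n /= mulr0; apply: integral0_eq => y _.
  rewrite /W /= m1_ge ?subrr// ler_pdivlMr// mul1r; have := sqr_ge0 y; lra.
 set b := Num.sqrt _; have b0 : 0 < b by rewrite sqrtr_gt0 subr_gt0.
 have bE : b ^+ 2 = r ^+ 2 - x ^+ 2 by rewrite sqr_sqrtr// subr_ge0 ltW.
 have yb y : (- b <= y <= b) = (y ^+ 2 <= b ^+ 2).
  by rewrite -ler_norml -(@ler_pXn2r _ 2)// ?nnegrE ?(ltW b0)// real_normK ?num_real.
 rewrite (@integral_support _ (- b) b); last first.
  move=> y; rewrite yb => /negP; rewrite -ltNge => hy; rewrite /W /= m1_ge ?subrr//.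
  by rewrite ler_pdivlMr// mul1r; lra.
 transitivity (\int[leb]_(y in `[(- b)%R, b]) ((r ^- 2)%:E * (b ^+ 2 - y ^+ 2)%:E))%E.
  apply: eq_integral => y /set_mem /=; rewrite in_itv/= yb => hy; rewrite -EFinM; congr EFin; rewrite /W /=.
  have -> : m1 ((x ^+ 2 + y ^+ 2) / r ^+ 2) = (x ^+ 2 + y ^+ 2) / r ^+ 2.
   by apply: min_l; rewrite ler_pdivrMr// mul1r; lra.
  by rewrite bE; field; rewrite gt_eqF.
 rewrite ge0_integralZl//.
 - by rewrite integral_parabola// -EFinM; congr EFin; field; rewrite gt_eqF.
 - apply/measurable_EFinP; apply: measurable_funS (measurableT) _ _ => //.
  by apply: continuous_measurable_fun; exact: cont_quad.
 - by move=> y /=; rewrite in_itv/= yb lee_fin subr_ge0.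
 - by rewrite lee_fin invr_ge0 ltW.
transitivity (\int[leb]_x ((4 / (3 * r ^+ 2) * Num.sqrt (r ^+ 2 - x ^+ 2) ^+ 3)%:E))%E.
 by apply: eq_integral => x _; exact: inner.
rewrite (@integral_support _ (- r) r); last first.
 move=> x hx; have -> : Num.sqrt (r ^+ 2 - x ^+ 2) = 0; last by rewrite expr0n /= mulr0.
 apply/eqP; rewrite sqrtr_eq0 subr_le0 leNgt; apply/negP => h; apply: hx.
 by rewrite -ler_norml -(@ler_pXn2r _ 2)// ?nnegrE ?(ltW r0)// real_normK ?num_real// ltW.
under eq_integral do rewrite EFinM.
rewrite ge0_integralZl//.
- by rewrite integral_sqrt3// -EFinM; congr EFin; field; rewrite gt_eqF.
- apply/measurable_EFinP; apply: measurable_funX; apply: measurable_funS (measurableT) _ _ => //.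
 apply: continuous_measurable_fun => x.
 apply: (@continuous_comp _ _ _ (fun x : R => r ^+ 2 - x ^+ 2) (@Num.sqrt R)); last exact: sqrt_continuous.
 exact: cont_quad.
by rewrite lee_fin divr_ge0// mulr_ge0// ltW.
Qed.
End DiscIntegral.

(** * The periodic logarithm and its Laplacian as a distribution *)

Section LogarithmicPotential.
Implicit Types (x r s t e : R) (p q v : R * R) (j k : jet) (l : C) (a b : RR -> R).
Variables (w1 w2 : C) (tau : 0 < Im (w2 / w1)).
Local Notation J := (J w1 w2).
Local Notation L := (lattice w1 w2).
Local Notation P := (fundamental_parallelogram w1 w2 : set RR).
Local Notation Q := (Q tau).
Local Notation rad := (rad tau).
Local Notation C2p := (C2p w1 w2).
Local Notation cs := (cs w1 w2).
Local Notation ct := (ct w1 w2).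

Lemma J_le a b : bm a -> bm b -> (forall p, a p <= b p) -> J a <= J b.
Proof.
move=> ba bb h; have mP := par_meas tau.
by apply: le_Rintegral => //; apply: (bm_int tau).
Qed.

Lemma J_abs_le a b : bm a -> bm b -> (forall p, `|a p| <= b p) -> `|J a| <= J b.
Proof.
move=> ba bb h; rewrite ler_norml -[- J b]mulN1r -(JZ tau)//; apply/andP; split.
 by apply: J_le => //; [exact: bmZ|move=> p; rewrite mulN1r; have := h p; rewrite ler_norml => /andP[]].
by apply: J_le => // p; apply: le_trans (h p); exact: ler_norm.
Qed.

Lemma bmQ (f : R -> R) e : (forall x, e <= x -> {for x, continuous f}) -> bm (fun p => f (Q p + e)).
Proof.
move=> cf; apply: (pper_bm tau); last by move=> p v Lv; rewrite Q_per.
move=> p; apply: cont_comp; last by apply: cf; rewrite lerDr Q_ge0.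
by apply: contD; [exact: Q_cont|exact: cst_continuous].
Qed.
Lemma bm_cst r : bm (fun=> r : R).
Proof. by split; [exact: measurable_cst|exists `|r|]. Qed.

(** A lattice point within [rad] of p has coordinates differing from those of p by less than 1/2,
    hence of absolute value less than 1: it is 0. *)
Lemma Q_center p : `|cs p| <= 2^-1 -> `|ct p| <= 2^-1 -> Q p = m1 (qd tau 0 p).
Proof.
move=> hs ht; have [h|h] := ltP (qd tau 0 p) 1.
 by rewrite (@Q_in _ _ tau 0) ?m1_lt//; exact: lat0.
rewrite m1_ge// Q_out// => l [m [n El]]; rewrite leNgt; apply/negP => h'.
have {}El : l = rpt w1 w2 m%:~R n%:~R by rewrite rpt_int.
move: (h'); rewrite qd_lt1 El -(rpt_csct tau p).
have -> : rpt w1 w2 (cs p) (ct p) - rpt w1 w2 m%:~R n%:~R = rpt w1 w2 (cs p - m%:~R) (ct p - n%:~R).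
 by rewrite /rpt !rmorphB /=; ring.
move=> /rad_coord[a b].
have z (x : R) (i : int) : `|x| <= 2^-1 -> `|x - i%:~R| < 2^-1 -> i = 0.
 move=> h1 h2; have h3 := ler_normB x (x - i%:~R); rewrite subKr in h3. have : `|i%:~R : R| < 1 by lra.
 by rewrite -intr_norm (ltr_int _ _ 1); lia.
move: h'; rewrite El (z _ _ hs a) (z _ _ ht b).
have -> : rpt w1 w2 0%:~R 0%:~R = 0 by rewrite /rpt !mul0r addr0.
by rewrite ltNge h.
Qed.

(** Shifting the parallelogram by -(w1 + w2)/2 centres it at 0. There 1 - Q is the paraboloid about
    0, which vanishes outside, so the integral is one over the whole plane. *)
Lemma J_Q : J (fun p => 1 - Q p) = pi * rad ^+ 2 / 2.
Proof.
have r0 : 0 < rad := rad0 tau; have mP := par_meas tau.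
pose W (p : RR) := 1 - m1 ((p.1 ^+ 2 + p.2 ^+ 2) / rad ^+ 2).
have W0 p : 0 <= W p by rewrite subr_ge0 m1_le1.
have WE p : W p = 1 - m1 (qd tau 0 p) by rewrite /W /qd !subr0.
have bW : meas2 W.
 apply: continuous2_measurable => p. have h : {for p, continuous (fun p => 1 - m1 (qd tau 0 p) : R)}.
  apply: contD; first exact: cst_continuous.
  by apply: contN; apply: cont_comp; [have [_ _ _ _ []] := qjet_ok tau 0 p|exact: m1_cont].
 by have <- : (fun p => 1 - m1 (qd tau 0 p)) = (W : R * R -> R) by apply/funext => q; rewrite WE.
have iW : mu2.-integrable [set: RR] (EFin \o W).
 apply/integrableP; split; first exact/measurable_EFinP. under eq_integral do rewrite /= ger0_norm//.
 by rewrite integral_cone// ltry.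
pose v : R * R := (- 2^-1 * Re w1 + - 2^-1 * Re w2, - 2^-1 * Im w1 + - 2^-1 * Im w2).
have bQ : bm (fun p => 1 - Q p).
 apply: bmB; first exact: bm_cst.
 have := @bmQ id 0 (fun x _ => @cvg_id _ _); congr bm; apply/funext => p /=; exact: addr0.
rewrite -(J_shift tau v)//; last by move=> p u Lu; rewrite Q_per.
have [_] := integral_pshift v measurableT bW iW; rewrite preimage_setT => E.
have -> : pi * rad ^+ 2 / 2 = \int[mu2]_p W p by rewrite /Rintegral integral_cone.
rewrite -E /J Rintegral_mkcond; apply: eq_Rintegral => p _; rewrite patchE.
have [cp tp] := csct_shift tau (- 2^-1) (- 2^-1) p.
have half_abs (x : R) : 0 <= x < 1 -> `|x - 2^-1| <= 2^-1 by move=> ?; rewrite ler_norml; lra.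
case: ifPn => [/set_mem|/negP hp].
 rewrite (parE tau) => -[h1 h2]; rewrite /= WE; congr (1 - _); apply: Q_center.
  by rewrite cp; exact: half_abs.
 by rewrite tp; exact: half_abs.
apply/eqP; rewrite eq_sym WE subr_eq0 eq_sym; apply/eqP; apply: m1_ge; rewrite leNgt; apply/negP => h.
apply: hp; apply/mem_set; rewrite (parE tau); move: h; rewrite qd_lt1 subr0 -(rpt_csct tau) => /rad_coord[].
rewrite /strip /= cp tp !ltr_norml; split; lra.
Qed.

(** The Laplacian of th(Q + e) is lreg e + lker e. The first part is bounded uniformly in e; the
    second is nonnegative and concentrates on the lattice as e tends to 0. *)
Definition lreg e p := 8 / rad ^+ 2 * (m1 (Q p + e) - 1).
Definition lker e p := 4 * e / rad ^+ 2 * ((m1 (Q p + e)) ^- 2 - 1).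
Definition logQ p := th (Q p).
Definition dlogQ p := 8 / rad ^+ 2 * (Q p - 1).

Lemma rho0 : 0 < rad ^+ 2. Proof. by rewrite exprn_gt0// rad0. Qed.
Lemma m1Q0 e p : 0 < e -> 0 < m1 (Q p + e).
Proof. by move=> e0; apply: m1_gt0; rewrite ltr_wpDl// Q_ge0. Qed.

Lemma bm_reg e : bm (lreg e).
Proof.
apply: bmZ; apply: bmB; last exact: bm_cst.
by apply: bmQ => x _; exact: m1_cont.
Qed.

Lemma bm_ker e : 0 < e -> bm (lker e).
Proof.
move=> e0; apply: bmZ; apply: bmB; last exact: bm_cst.
apply: (@bmQ (fun x => (m1 x) ^- 2)) => x ex; have x0 : 0 < x by exact: lt_le_trans ex.
apply: continuousV; first by rewrite expf_neq0// gt_eqF// m1_gt0.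
exact: (continuousM (@m1_cont x) (@m1_cont x)).
Qed.

Lemma log_jet e : 0 < e -> exists2 j, C2p j & j0 j = (fun p => th (Q p + e)) /\
 forall p, jxx j p + jyy j p = lreg e p + lker e p.
Proof.
move=> e0; have [||j Cj [E1 E2]] := @radial_jet _ _ tau (@th) (@th1) (@th2) e (ltW e0).
- move=> x ex; have x0 : 0 < x by exact: lt_le_trans ex.
 by split; [exact: th_derive|exact: th1_derive|exact: th2_cont].
- by move=> x x1; rewrite th_ge1// th1_ge1// th2_ge1.
exists j => //; split=> // p; rewrite E2 /lreg /lker; have := m1Q0 p e0; have r0 := rho0.
have [h|h] := ltP (Q p + e) 1; last first.
 by rewrite th1_ge1// th2_ge1// m1_ge// expr1n invr1 subrr !mulr0 addr0 mulr0.
rewrite /th1 /th2 m1_lt//; move: (Q p) => u ue; field.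
by rewrite (gt_eqF ue) (gt_eqF (rad0 tau)).
Qed.

(** Green's formula against the constant 1: the Laplacian of a periodic function has integral 0. The
    mass of the kernel is thereby read off from the bounded part. *)
Lemma J_ker e : 0 < e -> J (lker e) = - J (lreg e).
Proof.
move=> e0; have [j Cj [E1 E2]] := log_jet e0.
have C1 : C2p (jcst 1) by split=> [p|//]; exact: jcst_ok.
have := green tau Cj C1; rewrite /=.
have -> : (fun p => (jxx j p + jyy j p) * 1) = (fun p => lreg e p + lker e p) by apply/funext => p; rewrite mulr1.
have -> : (fun p => j0 j p * (0 + 0)) = (fun p => 0 * (1 : R)) by apply/funext => p; rewrite addr0 mulr0 mul0r.
rewrite (JZ tau 0 (bm_cst 1)) mul0r (JD tau (bm_reg e) (bm_ker e0)) => h.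
by apply/eqP; rewrite -addr_eq0 addrC -h.
Qed.

Local Notation eps := (@harmonic R).
Lemma eps0 n : 0 < eps n. Proof. by rewrite /harmonic/= invr_gt0 ltr0n. Qed.

Lemma reg_le e p : 0 < e -> `|lreg e p| <= 8 / rad ^+ 2.
Proof.
move=> e0; have h := m1Q0 p e0; have h' := m1_le1 (Q p + e); have r0 := rho0.
have c0 : 0 <= 8 / rad ^+ 2 by rewrite divr_ge0// ltW.
rewrite /lreg normrM (ger0_norm c0) -[leRHS]mulr1 ler_wpM2l// ler_norml; lra.
Qed.

Lemma ker_ge0 e p : 0 < e -> 0 <= lker e p.
Proof.
move=> e0; have h := m1Q0 p e0; have h' := m1_le1 (Q p + e); have r0 := rho0.
rewrite /lker mulr_ge0//; first by rewrite divr_ge0 ?(ltW r0)// mulr_ge0// ltW.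
by rewrite subr_ge0 -[leLHS]invr1 lef_pV2 ?posrE ?exprn_gt0// expr_le1// ltW.
Qed.
Lemma Qeps_cvg p : Q p + eps n @[n --> \oo] --> Q p.
Proof. by rewrite -[X in _ --> X]addr0; apply: cvgD; [exact: cvg_cst|exact: cvg_harmonic]. Qed.

Lemma cvg_seq_comp (f : R -> R) x (u : nat -> R) : {for x, continuous f} ->
 u n @[n --> \oo] --> x -> f (u n) @[n --> \oo] --> f x.
Proof.
move=> /cvgrPdist_lt c /cvgrPdist_lt h; apply/cvgrPdist_lt => e /c /nbhs_ballP[d /= d0 hd].
by move: (h d d0); apply: filterS => n; exact: hd.
Qed.

Lemma reg_cvg p : lreg (eps n) p @[n --> \oo] --> dlogQ p.
Proof.
have -> : dlogQ p = 8 / rad ^+ 2 * (m1 (Q p) - 1) by rewrite /dlogQ /m1 min_l// Q_le1.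
apply: cvgM; first exact: cvg_cst.
by apply: cvgB; [exact: (cvg_seq_comp (@m1_cont (Q p)) (@Qeps_cvg p))|exact: cvg_cst].
Qed.

Lemma bm_dlogQ : bm dlogQ.
Proof.
apply: bmZ; apply: bmB; last exact: bm_cst.
have := @bmQ id 0 (fun x _ => @cvg_id _ _); congr bm; apply/funext => p /=; exact: addr0.
Qed.

Lemma J_dlogQ : J dlogQ = - (4 * pi).
Proof.
have bQ : bm (fun p => 1 - Q p).
 apply: bmB; first exact: bm_cst.
 have := @bmQ id 0 (fun x _ => @cvg_id _ _); congr bm; apply/funext => p /=; exact: addr0.
have -> : dlogQ = (fun p => - (8 / rad ^+ 2) * (1 - Q p)) by apply/funext => p; rewrite /dlogQ; ring.
by rewrite (JZ tau _ bQ) J_Q; field; rewrite gt_eqF// rad0.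
Qed.

Lemma J_reg_cvg b : bm b -> J (fun p => lreg (eps n) p * b p) @[n --> \oo] --> J (fun p => dlogQ p * b p).
Proof.
move=> bb; have [mb [M hM]] := bb.
apply: (@J_dct _ _ tau (fun n p => lreg (eps n) p * b p) (fun p => dlogQ p * b p) (8 / rad ^+ 2 * M)).
- by move=> n; have [] := bmM (bm_reg (eps n)) bb.
- by have [] := bmM bm_dlogQ bb.
- by move=> n p; rewrite normrM ler_pM//; apply: reg_le; exact: eps0.
by move=> p; apply: cvgM; [exact: reg_cvg|exact: cvg_cst].
Qed.

Lemma J_ker_cvg : J (lker (eps n)) @[n --> \oo] --> 4 * pi.
Proof.
have h := J_reg_cvg (bm_cst 1).
have e1 a : (fun p => a p * 1 : R) = a by apply/funext => p; rewrite mulr1.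
under eq_fun do rewrite J_ker ?eps0//.
rewrite -[4 * pi]opprK; apply: cvgN; rewrite -J_dlogQ.
by move: h; rewrite e1; under eq_fun do rewrite e1.
Qed.

Lemma J1_ge0 : 0 <= J (fun=> 1). Proof. exact: Rintegral_ge0. Qed.

Lemma J_ker_le e : 0 < e -> J (lker e) <= 8 / rad ^+ 2 * J (fun=> 1).
Proof.
move=> e0; rewrite J_ker// -(JZ tau _ (bm_cst 1)).
apply: le_trans (ler_norm _) _; rewrite normrN; apply: J_abs_le; [exact: bm_reg|exact: bmZ (bm_cst 1)|].
by move=> p; rewrite mulr1; exact: reg_le.
Qed.

(* The kernels [lker e] form an approximate identity of mass [4 pi] at the lattice. *)
Lemma J_ker_test k : C2p k -> J (fun p => lker (eps n) p * j0 k p) @[n --> \oo] --> 4 * pi * j0 k (0, 0).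
Proof.
move=> Ck; have [[bk _ _ _ _] _ _] := C2p_bm tau Ck; have [ok pk] := Ck.
set c := j0 k (0, 0); have [_ [M hM]] := bk.
have M0 : 0 <= M := le_trans (normr_ge0 _) (hM (0, 0)).
have bd : bm (fun p => j0 k p - c) by apply: bmB; [|exact: bm_cst].
have dM p : `|j0 k p - c| <= 2 * M.
 by have := ler_normB (j0 k p) c; have := hM p; have := hM (0, 0); rewrite -/c; lra.
have small : J (fun p => lker (eps n) p * (j0 k p - c)) @[n --> \oo] --> 0.
 apply/cvgr0Pnorm_le => e e0. pose B := 8 / rad ^+ 2 * J (fun=> 1) + 1; have r0 := rho0.
 have B0 : 0 < B by rewrite ltr_wpDl// mulr_ge0 ?J1_ge0// divr_ge0// ltW.
 have e2 : 0 < e / (2 * B) by rewrite divr_gt0// mulr_gt0.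
 have ck : continuous (j0 k) by move=> p; have [_ _ _ _ []] := ok p. have [d d0 hd] := Q_small tau ck pk e2.
 pose d' := Num.min d 1; have d'0 : 0 < d' by rewrite lt_min d0 ltr01. pose A := 4 / rad ^+ 2 * d' ^- 2 * (2 * M).
 have A0 : 0 <= A.
  rewrite /A; apply: mulr_ge0; last by rewrite mulr_ge0. by rewrite !divr_ge0// ?(ltW r0)// exprn_ge0// ltW.
 have key n : `|J (fun p => lker (eps n) p * (j0 k p - c))| <= e / 2 + eps n * (A * J (fun=> 1)).
  have n0 := eps0 n; have bK := bm_ker n0.
  apply: (@le_trans _ _ (J (fun p => e / (2 * B) * lker (eps n) p + eps n * A * 1))).
   apply: J_abs_le; [exact: bmM|apply: bmD; [exact: bmZ|exact: bmZ (bm_cst 1)]|].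
   move=> p; have K0 := ker_ge0 p n0; rewrite normrM (ger0_norm K0) mulr1. have [h|h] := ltP (Q p) d.
    rewrite -[leLHS]addr0; apply: lerD; last by rewrite mulr_ge0// ltW. by rewrite mulrC ler_wpM2r// ltW// hd.
   have a1 : lker (eps n) p <= eps n * (4 / rad ^+ 2 * d' ^- 2).
    have -> : lker (eps n) p = eps n * (4 / rad ^+ 2 * ((m1 (Q p + eps n)) ^- 2 - 1)).
     by rewrite /lker; move: (rad ^- 2) (m1 (Q p + eps n) ^- 2) => u1 u2; ring.
    apply: ler_wpM2l; first exact: ltW. apply: ler_wpM2l; first by rewrite divr_ge0// ltW.
    apply: (@le_trans _ _ ((m1 (Q p + eps n)) ^- 2)); first by rewrite gerBl.
    rewrite lef_pV2 ?posrE ?exprn_gt0// ?m1Q0// ler_pXn2r// ?nnegrE ?(ltW d'0) ?(ltW (m1Q0 p n0))//.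
    by rewrite le_min !ge_min lexx orbT andbT; apply/orP; left; lra.
   apply: (@le_trans _ _ (eps n * A)); last by rewrite lerDr mulr_ge0// ltW. by rewrite /A mulrA; apply: ler_pM.
  rewrite (JD tau (bmZ _ bK) (bmZ _ (bm_cst 1))) (JZ tau _ bK) (JZ tau _ (bm_cst 1)) -[eps n * A * _]mulrA lerD//.
  apply: (@le_trans _ _ (e / (2 * B) * B)).
   by rewrite ler_wpM2l ?(ltW e2)//; apply: le_trans (J_ker_le n0) _; rewrite lerDl.
  by rewrite le_eqVlt; apply/orP; left; apply/eqP; field; rewrite gt_eqF.
 have lim : eps n * (A * J (fun=> 1)) @[n --> \oo] --> 0.
  by rewrite -[X in _ --> X](mul0r (A * J (fun=> 1))); apply: cvgM; [exact: cvg_harmonic|exact: cvg_cst].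
 have e3 := half_pos e0.
 move/cvgr0Pnorm_le: lim => /(_ _ e3); apply: filterS => n hn; apply: le_trans (key n) _.
 by have := le_trans (ler_norm _) hn; lra.
have -> : (fun n => J (fun p => lker (eps n) p * j0 k p)) =
  (fun n => J (fun p => lker (eps n) p * (j0 k p - c)) + J (lker (eps n)) * c).
 apply/funext => n; have bK := bm_ker (eps0 n).
 rewrite [_ * c]mulrC -(JZ tau _ bK) -(JD tau (bmM bK bd) (bmZ _ bK)); congr J; apply/funext => p; ring.
rewrite -[X in _ --> X]add0r; apply: cvgD => //; apply: cvgM; [exact: J_ker_cvg|exact: cvg_cst].
Qed.

Lemma F_test k : C2p k -> J (fun p => th (Q p + eps n) * (jxx k p + jyy k p)) @[n --> \oo] -->
 J (fun p => dlogQ p * j0 k p) + 4 * pi * j0 k (0, 0).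
Proof.
move=> Ck; have [[bk _ _ _ _] _ _] := C2p_bm tau Ck.
have -> : (fun n => J (fun p => th (Q p + eps n) * (jxx k p + jyy k p))) =
  (fun n => J (fun p => lreg (eps n) p * j0 k p) + J (fun p => lker (eps n) p * j0 k p)).
 apply/funext => n; have [j Cj [E1 E2]] := log_jet (eps0 n). have := green tau Cj Ck; rewrite E1 => ->.
 rewrite -(JD tau (bmM (bm_reg _) bk) (bmM (bm_ker (eps0 n)) bk)); congr J; apply/funext => p. by rewrite E2 mulrDl.
by apply: cvgD; [exact: J_reg_cvg|exact: J_ker_test].
Qed.
Lemma bm_F n : bm (fun p => th (Q p + eps n)).
Proof. by apply: bmQ => x hx; apply: th_cont; apply: lt_le_trans hx; exact: eps0. Qed.

(** The Laplacian of the bump is 12 (1 - Q)(1 - 3Q)/rad^2. For Q < 1/4, rad^2 times it is at least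
    9/4, so the product alone dominates - th. For Q >= 1/4 it is at least -4 and - th(Q + e) is at
    most - th(1/4), whence the factor 5 = 1 + 4. *)
Lemma cub_test : exists2 k, C2p k & forall p e, 0 < e ->
 - th (Q p + e) <= - (rad ^+ 2) * (th (Q p + e) * (jxx k p + jyy k p)) + 5 * - th (4^-1 : R).
Proof.
have [||k Ck [E1 E2]] := @radial_jet _ _ tau (@cub) (@cub1) (@cub2) 0 (lexx 0).
- by move=> x _; have [a b] := cub_derive x; split=> //; exact: cub2_cont.
- by move=> x; exact: cub_ge1.
exists k => // p e e0; rewrite E2 /cub1 /cub2 addr0 /m1 (min_l (Q_le1 tau p)); have r0 := rho0.
have q0 := Q_ge0 tau p; have q1 := Q_le1 tau p.
have T0 : 0 <= - th (4^-1 : R) by rewrite oppr_ge0; apply: th_le0; rewrite invr_gt0.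
have F0 : 0 <= - th (Q p + e) by rewrite oppr_ge0; apply: th_le0; rewrite ltr_wpDl.
have -> : - rad ^+ 2 * (th (Q p + e) * (4 / rad ^+ 2 * (Q p * (- 6 * (1 - Q p)) + 3 * (1 - Q p) ^+ 2))) =
  (- th (Q p + e)) * (12 * ((1 - Q p) * (1 - 3 * Q p))) by field; rewrite gt_eqF// rad0.
have [h|h] := leP (4^-1) (Q p).
 have : - th (Q p + e) <= - th 4^-1 by rewrite lerN2; apply: th_mono; rewrite ?invr_gt0//; lra.
 move: T0 F0; set T := - th 4^-1; set F := - th _; move: (Q p) h q0 q1 => u h q0 q1 T0 F0 FT.
 have : - 3^-1 <= (1 - u) * (1 - 3 * u) by have := sqr_ge0 (u - 2 / 3); nra. by move: ((1 - u) * _) => w hw; nra.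
move: T0 F0; set T := - th 4^-1; set F := - th _; move: (Q p) h q0 q1 => u h q0 q1 T0 F0.
have : 3 / 16 <= (1 - u) * (1 - 3 * u) by nra.
by move: ((1 - u) * _) => w hw; nra.
Qed.

(** The integrals of th(Q + eps n) against the Laplacian of the bump converge by [F_test], hence are
    bounded; [cub_test] converts this into a bound on the integrals of |th(Q + eps n)|. *)
Lemma J_F_bounded : exists B : R, forall n, J (fun p => `|th (Q p + eps n)|) <= B.
Proof.
have [k Ck hk] := cub_test; have cv := F_test Ck.
have [[_ _ _ bxx byy] _ _] := C2p_bm tau Ck.
have [M [_ hM]] : bounded_fun (fun n => J (fun p => th (Q p + eps n) * (jxx k p + jyy k p))).
 by apply: cvg_seq_bounded; apply/cvg_ex; eexists; exact: cv.
have r0 := rho0.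
exists (rad ^+ 2 * (M + 1) + 5 * - th (4^-1 : R) * J (fun=> 1)) => n.
have bT := bmM (bm_F n) (bmD bxx byy).
have FE p : `|th (Q p + eps n)| = - th (Q p + eps n).
 by rewrite ler0_norm//; apply: th_le0; rewrite ltr_wpDl ?Q_ge0 ?eps0.
under eq_fun do rewrite FE.
apply: (@le_trans _ _ (J (fun p => - (rad ^+ 2) * (th (Q p + eps n) * (jxx k p + jyy k p)) + 5 * - th (4^-1 : R) * 1))).
 apply: J_le.
 - have := bmZ (-1) (bm_F n); congr bm; apply/funext => p; exact: mulN1r.
 - by apply: bmD; [exact: bmZ|exact: bmZ (bm_cst 1)]. by move=> p; rewrite mulr1; apply: hk; exact: eps0.
rewrite (JD tau (bmZ _ bT) (bmZ _ (bm_cst 1))) (JZ tau _ bT) (JZ tau _ (bm_cst 1)) lerD2r mulNr -mulrN.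
rewrite ler_pM2l//; apply: le_trans (ler_norm _) _; rewrite normrN.
by apply: (hM (M + 1)); rewrite ?ltrDl.
Qed.

Lemma Q_eq0 p : P p -> Q p = 0 -> p = (0, 0).
Proof.
move=> [s [t [hs ht E]]] Q0.
have [[l [m [n El]] h]|h] := pselect (exists2 l, L l & qd tau l p < 1); last first.
 have : Q p = 1 by apply: Q_out => l Ll; rewrite leNgt; apply/negP => a; apply: h; exists l.
 by rewrite Q0 => /eqP; rewrite eq_sym oner_eq0.
have Ll : L l by exists m, n.
move: Q0; rewrite (Q_in Ll h) qdE => /eqP; rewrite sqrf_eq0 mulf_eq0 invr_eq0 (gt_eqF (rad0 tau)) orbF nm_eq0 subr_eq0 => /eqP El'.
have := rpt_inj tau (s := s) (t := t) (s' := m%:~R) (t' := n%:~R); rewrite rpt_int -El -El' => /(_ (esym E))[e1 e2].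
have z (x : R) (i : int) : 0 <= x < 1 -> x = i%:~R -> i = 0.
 move=> /andP[a b] xi; move: a b; rewrite xi ler0z (ltrz1 R) => a b; lia.
apply: cplx_inj; rewrite El' El (z _ _ hs e1) (z _ _ ht e2) !mul0r addr0.
by rewrite /cplx.
Qed.

Lemma ae_Q : {ae mu2, forall p : RR, P p -> 0 < Q p}.
Proof.
exists ([set (0 : R)] `*` [set (0 : R)]); split.
- exact: measurableX.
- have e : lebesgue_measure [set (0 : R)] = 0%E by exact: lebesgue_measure_set1.
 rewrite /lebesgue2 product_measure1E//.
 have e' : mule (lebesgue_measure [set (0 : R)]) (lebesgue_measure [set (0 : R)]) = 0%E by rewrite e mule0. exact e'.
move=> p /= h; have [Pp hq] : P p /\ ~ 0 < Q p by apply/not_implyP.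
have : Q p = 0 by apply/eqP; rewrite eq_le Q_ge0 andbT leNgt; apply/negP.
by move=> /(Q_eq0 Pp) ->.
Qed.
Lemma F_cvg p : 0 < Q p -> th (Q p + eps n) @[n --> \oo] --> logQ p.
Proof. by move=> q0; exact: (cvg_seq_comp (th_cont q0) (@Qeps_cvg p)). Qed.
Lemma m1_meas : measurable_fun [set: R] (@m1).
Proof. by apply: continuous_measurable_fun => x; exact: m1_cont. Qed.

Lemma logQ_meas : meas2 (logQ : RR -> R).
Proof.
have mQ : meas2 (fun p : RR => m1 (Q p)).
 by apply: (measurableT_comp m1_meas); apply: continuous2_measurable; exact: Q_cont.
have m2 : meas2 (fun p : RR => m1 (Q p) - 1) by apply: measurable_funB.
apply: measurable_funD.
 by apply: measurable_funB => //; exact: (measurableT_comp (@measurable_ln R) mQ).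
by apply: measurable_funM => //; exact: measurable_funM.
Qed.

(** |th(Q + eps n)| increases with n to |logQ| off the lattice, so monotone convergence turns the
    uniform bound into integrability. *)
Lemma logQ_integrable : mu2.-integrable P (EFin \o logQ).
Proof.
have mP := par_meas tau; have [B hB] := J_F_bounded.
pose g n (p : RR) := (`|th (Q p + eps n)|)%:E.
have bg n : bm (fun p => `|th (Q p + eps n)|).
 have [m [M hM]] := bm_F n; split; last by exists M => p; rewrite normr_id.
 exact: (measurableT_comp (@normr_measurable R setT) m).
have mg n : measurable_fun P (g n).
 by apply/measurable_EFinP; apply: measurable_funS (bg n).1.
have nd p : nondecreasing_seq (g ^~ p).
 move=> m n mn; rewrite /g lee_fin. have pos i : 0 < Q p + eps i by rewrite ltr_wpDl ?Q_ge0 ?eps0.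
 rewrite !ler0_norm ?th_le0// lerN2 th_mono// lerD2l /harmonic/= lef_pV2 ?posrE ?ltr0n// ler_nat//.
have cg p : cvgn (g ^~ p) by exact: ereal_nondecreasing_is_cvgn.
apply/integrableP; split; first by apply/measurable_EFinP; apply: measurable_funS logQ_meas.
have mc := @monotone_convergence _ _ _ mu2 P mP g mg (fun n p _ => ltac:(by rewrite lee_fin)) (fun p _ => nd p).
apply: (@le_lt_trans _ _ (\int[mu2]_(p in P) (limn (g ^~ p)))%E); last first.
 rewrite mc; apply: (@le_lt_trans _ _ B%:E); last exact: ltry. apply: lime_le.
  apply: ereal_nondecreasing_is_cvgn => m n mn; apply: ge0_le_integral => //.
  - by move=> p _; rewrite lee_fin.
  - by move=> p _; exact: nd.
 apply: nearW => n; have := hB n; rewrite -lee_fin /J /Rintegral fineK//.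
 exact: (integrable_fin_num mP (bm_int tau (bg n))).
apply: ae_ge0_le_integral => //.
- by apply: measurableT_comp => //; apply/measurable_EFinP; apply: measurable_funS logQ_meas.
- by move=> p _; apply: lime_ge => //; apply: nearW => n; rewrite lee_fin.
- by apply: (emeasurable_fun_cvg g) => // p _; exact: cg.
have := ae_Q; apply: filterS => p h Pp; have q0 := h Pp.
suff -> : limn (g ^~ p) = `|(EFin \o logQ) p|%E by [].
apply: cvg_lim => //; apply: cvg_EFin; first exact: nearW.
by apply: cvg_norm; exact: F_cvg.
Qed.

(** The limit of [F_test], dominated by a multiple of |logQ|: as a distribution on the torus, the
    Laplacian of [logQ] is [dlogQ] plus 4 pi times the Dirac measure. *)
Lemma logQ_test k : C2p k ->
 J (fun p => logQ p * (jxx k p + jyy k p)) = J (fun p => dlogQ p * j0 k p) + 4 * pi * j0 k (0, 0).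
Proof.
move=> Ck; have [[_ _ _ bxx byy] _ _] := C2p_bm tau Ck; have mP := par_meas tau.
have bL := bmD bxx byy; set Lk := (fun p => jxx k p + jyy k p) in bL *; have [mL [M hM]] := bL.
have M0 : 0 <= M := le_trans (normr_ge0 _) (hM (0, 0)).
have mF n : measurable_fun P (EFin \o (fun p => th (Q p + eps n) * Lk p)).
 by apply/measurable_EFinP; apply: measurable_funS (bmM (bm_F n) bL).1.
have ml : measurable_fun P (EFin \o (fun p => logQ p * Lk p)).
 by apply/measurable_EFinP; apply: measurable_funS (measurable_funM logQ_meas mL).
have ig : mu2.-integrable P (fun p => M%:E * `|(EFin \o logQ) p|)%E.
 by apply: integrableZl => //; exact: integrable_abse logQ_integrable.
have [||ia _ h] := @dominated_convergence _ _ _ mu2 P mP (fun n => EFin \o (fun p => th (Q p + eps n) * Lk p))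
 (EFin \o (fun p => logQ p * Lk p)) _ mF ml _ ig.
- have := ae_Q; apply: filterS => p q0 Pp; apply: cvg_EFin; first exact: nearW.
 by apply: cvgM; [exact: F_cvg (q0 Pp)|exact: cvg_cst].
- have := ae_Q; apply: filterS => p q0 n Pp; rewrite /= lee_fin normrM mulrC ler_pM//.
 have pos : 0 < Q p + eps n by rewrite ltr_wpDl ?Q_ge0 ?eps0.
 rewrite !ler0_norm ?th_le0 ?q0// lerN2; apply: th_mono; first exact: q0. by rewrite lerDl ltW// eps0.
have cv : J (fun p => th (Q p + eps n) * Lk p) @[n --> \oo] --> J (fun p => logQ p * Lk p).
 by apply: fine_cvg; rewrite fineK//; exact: (integrable_fin_num mP ia).
exact: (cvg_unique _ cv (F_test Ck)).
Qed.
End LogarithmicPotential.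

(** * Invariance of the density under inversion, sign change and periods *)

Section DensityInvariance.
Implicit Types (z w l a b d : C) (f g : C -> sphere R).

Definition dens H z : R := 8 * nm (cderiv H z) ^+ 2 / (1 + nm (H z) ^+ 2) ^+ 2.

Lemma sph_invK (s : sphere R) : sph_inv (sph_inv s) = s.
Proof.
case: s => [b|]/=; last by rewrite eqxx.
by case: eqP => [->|/eqP nb]//=; rewrite invr_eq0 (negbTE nb) invrK.
Qed.

Lemma density_inv f z : meromorphic f -> density (@sph_inv R \o f) z = density f z.
Proof.
move=> mf; set g := @sph_inv R \o f.
have gg : @sph_inv R \o g = f by apply/funext => w; exact: sph_invK.
have [[E h _]|[E h _]] := sph_local z mf; last first.
 have E' : g z = Some (fin g z) by rewrite /g /fin /= E /=.
 refine (etrans (density_someE E') (etrans _ (esym (density_noneE E)))).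
 have -> : fin g z = 0 by rewrite /fin /g /= E. by rewrite nm0 expr0n /= addr0 expr1n divr1 /g fin_invE.
have [F0|F0] := eqVneq (fin f z) 0.
 have E' : g z = None by rewrite /g /= E /= F0 eqxx.
 refine (etrans (density_noneE E') (etrans _ (esym (density_someE E)))).
 rewrite F0 nm0 expr0n /= addr0 expr1n divr1; congr (_ * nm (cderiv _ z) ^+ 2).
 by apply/funext => w; rewrite -[in RHS]gg fin_invE.
have E' : g z = Some (fin g z) by rewrite /g /fin /= E /= (negbTE F0).
refine (etrans (density_someE E') (etrans _ (esym (density_someE E)))).
rewrite /g fin_invE (cdiff_cderiv (cdiffV F0 (cdiff_ex (holoW h)))) nmM nmN !nmV nmX.
move: F0; rewrite -nm_gt0; move: (nm (fin f z)) (nm (cderiv _ z)) => a b a0.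
have t0 : 0 < 1 + a ^+ 2 by rewrite ltr_wpDr ?sqr_ge0.
have -> : 1 + a^-1 ^+ 2 = (1 + a ^+ 2) / a ^+ 2 by field; rewrite gt_eqF.
by move: t0; move: (1 + a ^+ 2) => t t0; field; rewrite (gt_eqF a0) (gt_eqF t0).
Qed.

Lemma density_opp f z : meromorphic f -> density (@sph_opp R \o f) z = density f z.
Proof.
move=> mf; set g := @sph_opp R \o f.
have Fg : fin g = (fun w => - fin f w).
 by apply/funext => w; rewrite /g /fin /=; case: (f w) => [a|]//=; rewrite oppr0.
have Fg' : fin (@sph_inv R \o g) = (fun w => - (fin f w)^-1).
 by rewrite fin_invE Fg; apply/funext => w; rewrite invrN.
have [[E h _]|[E h _]] := sph_local z mf.
 have E' : g z = Some (fin g z) by rewrite Fg /g /= E.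
 refine (etrans (density_someE E') (etrans _ (esym (density_someE E)))).
 by rewrite Fg (cdiff_cderiv (cdiffN (cdiff_ex (holoW h)))) !nmN.
have E' : g z = None by rewrite /g /= E.
refine (etrans (density_noneE E') (etrans _ (esym (density_noneE E)))).
have -> : (fun w => (fin g w)^-1) = (fun w => - (fin f w)^-1) by rewrite -Fg' fin_invE.
by rewrite (cdiff_cderiv (cdiffN (cdiff_ex (holoW h)))) nmN.
Qed.

Lemma density_shift f a z : density (fun w => f (w + a)) z = density f (z + a).
Proof.
have e := cderiv_shift (fin f) z a; have e' := cderiv_shift (fin (@sph_inv R \o f)) z a.
rewrite /density; case: (f (z + a)) => [b|].
 exact (congr1 (fun d => 8 * nm d ^+ 2 / (1 + nm b ^+ 2) ^+ 2) e).
exact (congr1 (fun d => 8 * nm d ^+ 2) e').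
Qed.

(** The density of 1/f equals that of f, so near every point, pole or not, it is the density of a
    holomorphic function. *)
Lemma density_near f z : meromorphic f -> exists2 H, holo H z & nearc z (fun w => density f w = dens H w).
Proof.
move=> mf; have some g w : g w <> None -> density g w = dens (fin g) w.
 by move=> h; apply: density_someE; rewrite /fin; case: (g w) h.
have [[E h n]|[E h n]] := sph_local z mf.
 by exists (fin f) => //; apply: nearcS n => w; exact: some.
exists (fin (@sph_inv R \o f)); first by rewrite fin_invE.
apply: nearcS n => w hw; rewrite -density_inv//; apply: some => /=.
by case E' : (f w) hw => [b|]//= hb; case: eqP => // b0; case: hb; rewrite b0.
Qed.

Lemma lat_periodic (T : Type) (F : C -> T) (w1 w2 : C) : (forall z, F (z + w1) = F z) -> (forall z, F (z + w2) = F z) ->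
 Defs.periodic (lattice w1 w2) F.
Proof.
have nat_per w : (forall z, F (z + w) = F z) -> forall (k : int) z, F (z + k%:~R * w) = F z.
 move=> h; have hn (n : nat) z : F (z + n%:R * w) = F z.
  elim: n z => [|n ih] z; first by rewrite mul0r addr0. by rewrite -natr1 mulrDl mul1r addrA h.
 case=> n z; first exact: hn. have -> : (Negz n)%:~R * w = - (n.+1%:R * w) by rewrite NegzE mulrNz mulNr.
 by have := hn n.+1 (z - n.+1%:R * w); rewrite subrK.
by move=> h1 h2 z l [m [n ->]]; rewrite addrA !nat_per.
Qed.

Lemma density_normalized f (w1 w2 : C) : meromorphic f -> normalized w1 w2 f -> Defs.periodic (lattice w1 w2) (density f).
Proof.
move=> mf [n1 n2]; apply: lat_periodic => z.
 by rewrite -density_shift -[RHS]density_opp//; congr (density _ z); apply/funext => w; exact: n1.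
by rewrite -density_shift -[RHS]density_inv//; congr (density _ z); apply/funext => w; exact: n2.
Qed.
End DensityInvariance.

(** * The logarithm of the density solves the equation *)

Section LiouvilleEquation.
Implicit Types (x y r t e : R) (p q v : R * R) (j k : jet) (l z w : C).

(** The jet of ln(c + |H|^2). It is used with c = 0 for the derivative, where the function is
    harmonic, and with c = 1 for the map, where the Laplacian is half the density. *)
Definition lnjet H (c : R) : jet := jcomp (@ln R) (fun x => x^-1) (fun x => - x ^- 2)
 (jadd (jcst c) (jadd (jmul (jre H) (jre H)) (jmul (jim H) (jim H)))).

Lemma inv_derive (N : R) : 0 < N -> is_derive N (1 : R) (fun x : R => x^-1) (- N ^- 2).
Proof.
by move=> N0; apply: is_derive_eq (is_deriveV (lt0r_neq0 N0) (is_derive_id N (1 : R))) _; exact: mulr1.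
Qed.

Lemma lnjet_ok H c p : holo H (cplx p) -> 0 < c + nm (H (cplx p)) ^+ 2 -> jet_ok (lnjet H c) p.
Proof.
move=> hH; rewrite nm_sqr; set N := _ + _ => h0.
have ok : jet_ok (jadd (jcst c) (jadd (jmul (jre H) (jre H)) (jmul (jim H) (jim H)))) p.
 by apply: jadd_ok (jcst_ok _ _) _; apply: jadd_ok; apply: jmul_ok; (exact: jre_ok || exact: jim_ok).
have a1 : is_derive N (1 : R) (@ln R) N^-1 by exact: is_derive1_ln.
have a3 : {for N, continuous (fun x : R => - x ^- 2)}.
 apply: continuousN; apply: continuousV; first by rewrite expf_neq0// lt0r_neq0.
 by have i : {for N, continuous (fun x : R => x)} by []; exact: (continuousM i i).
exact: (jcomp_ok ok a1 (inv_derive h0) a3).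
Qed.
Lemma lnjet_j0 H c p : j0 (lnjet H c) p = ln (c + nm (H (cplx p)) ^+ 2).
Proof. by rewrite nm_sqr. Qed.

Lemma lnjet_lap H c p : 0 < c + nm (H (cplx p)) ^+ 2 ->
 jxx (lnjet H c) p + jyy (lnjet H c) p = 4 * c * nm (cderiv H (cplx p)) ^+ 2 / (c + nm (H (cplx p)) ^+ 2) ^+ 2.
Proof.
rewrite !nm_sqr => h0; pose A := H (cplx p); pose A1 := cderiv H (cplx p); pose A2 := cderiv (cderiv H) (cplx p).
change (- (c + (Re A * Re A + Im A * Im A)) ^- 2 * (0 + ((Re A1 * Re A + Re A * Re A1) + (Im A1 * Im A + Im A * Im A1))) *
  (0 + ((Re A1 * Re A + Re A * Re A1) + (Im A1 * Im A + Im A * Im A1))) +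
 (c + (Re A * Re A + Im A * Im A))^-1 * (0 + ((Re A2 * Re A + Re A1 * Re A1 + (Re A1 * Re A1 + Re A * Re A2)) +
  (Im A2 * Im A + Im A1 * Im A1 + (Im A1 * Im A1 + Im A * Im A2)))) +
 (- (c + (Re A * Re A + Im A * Im A)) ^- 2 * (0 + ((- Im A1 * Re A + Re A * - Im A1) + (Re A1 * Im A + Im A * Re A1))) *
  (0 + ((- Im A1 * Re A + Re A * - Im A1) + (Re A1 * Im A + Im A * Re A1))) +
 (c + (Re A * Re A + Im A * Im A))^-1 * (0 + ((- Re A2 * Re A + - Im A1 * - Im A1 + (- Im A1 * - Im A1 + Re A * - Re A2)) +
  (- Im A2 * Im A + Re A1 * Re A1 + (Re A1 * Re A1 + Im A * - Im A2))))) =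
 4 * c * (Re A1 * Re A1 + Im A1 * Im A1) / (c + (Re A * Re A + Im A * Im A)) ^+ 2).
have {}h0 : 0 < c + (Re A * Re A + Im A * Im A) by exact h0.
clearbody A A1 A2.
move: A A1 A2 h0 => [a b] [a1 b1] [a2 b2] h0.
change (Re (a +i* b)) with a in *; change (Im (a +i* b)) with b in *.
change (Re (a1 +i* b1)) with a1; change (Im (a1 +i* b1)) with b1; change (Re (a2 +i* b2)) with a2; change (Im (a2 +i* b2)) with b2.
rewrite -!exprVn; have := mulVf (lt0r_neq0 h0); move: (_^-1) => i hi.
apply/eqP; rewrite -subr_eq0; apply/eqP.
transitivity (4 * (a1 ^+ 2 + b1 ^+ 2) * i * (1 - i * (c + (a * a + b * b)))); last by rewrite hi subrr mulr0.
by ring.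
Qed.

Lemma th_lap (q : R) : 0 < q -> q * th2 q + th1 q = 2 * (m1 q - 1) :> R.
Proof.
move=> q0; have [h|h] := ltP q 1; last by rewrite th1_ge1// th2_ge1// m1_ge// subrr !mulr0 addr0.
by rewrite /th1 /th2 m1_lt//; field; rewrite gt_eqF.
Qed.
Lemma th_m1 (q : R) : th (m1 q) = th q :> R.
Proof. by rewrite /th /m1 -minA minxx. Qed.

Definition jshift v j : jet := Jet (j0 j \o pshift v) (jx j \o pshift v) (jy j \o pshift v) (jxx j \o pshift v) (jyy j \o pshift v).

Lemma jshift_ok v j p : jet_ok j (pshift v p) -> jet_ok (jshift v j) p.
Proof.
move=> [a1 a2 a3 a4 [b0 b1 b2 b3 b4]].
have cp (E : R * R -> R) : {for pshift v p, continuous E} -> {for p, continuous (E \o pshift v)}.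
 move=> /cont2P h; apply/cont2P => e /h[d d0 hd]; exists d => // q h1 h2.
 by apply: hd; rewrite /pshift /= opprD addrACA subrr addr0.
split; [exact: pdv_shift|exact: pdv_shift|exact: pdv_shift|exact: pdv_shift|].
by split; exact: cp.
Qed.

Lemma nearc_near z p (T : C -> Prop) : cplx p = z -> nearc z T -> \forall q \near p, T (cplx q).
Proof.
move=> <- [r r0 h]; apply/near2P; exists (r / 2); first by rewrite divr_gt0.
by move=> q h1 h2; apply: h; have := nm_cplxB q p; lra.
Qed.

Lemma dens_ln H z : cderiv H z != 0 ->
 ln (dens H z) = ln 8 + ln (0 + nm (cderiv H z) ^+ 2) - 2 * ln (1 + nm (H z) ^+ 2).
Proof.
rewrite -nm_gt0 /dens => h; have h1 : 0 < 1 + nm (H z) ^+ 2 by rewrite ltr_wpDr ?sqr_ge0.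
have h2 : 0 < nm (cderiv H z) ^+ 2 by rewrite exprn_gt0.
move: h1 h2; move: (nm (cderiv H z) ^+ 2) (1 + nm (H z) ^+ 2) => a b b0 a0.
by rewrite ln_div ?posrE ?exprn_gt0 ?mulr_gt0// lnM ?posrE// lnXn// add0r mulr_natl.
Qed.

(** This and the next three are the scalar identities behind [potential], stated over free reals so
    that [ring] and [field] see variables and not unfolded jets. *)
Let value_near (l8 lr lc lg lf q k t g h A : R) : t = (lc - lr) - (q - 1) + (q - 1) ^+ 2 / 2 -> g = lg -> h = lf ->
 A = k * lc + lg -> l8 + A - 2 * lf - k * t = l8 + k * lr + (g + (- 2 * h + k * (2 * q + (- 2^-1 * (q * q) - 3 / 2)))).
Proof. by move=> -> -> -> ->; field. Qed.

Let value_off (l8 lg lf k t g h : R) : g = lg -> h = lf ->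
 l8 + lg - 2 * lf - k * t = l8 + (g + (- 2 * h + - k * t)).
Proof. by move=> -> ->; ring. Qed.

Let quad_lap (q X Y r k a b c d : R) : r != 0 -> q = (X ^+ 2 + Y ^+ 2) / r ^+ 2 ->
 (0 * (2 * q + (- 2^-1 * (q * q) - 3 / 2)) + 0 * a + (0 * a + k *
    ((0 * q + 0 * (2 * X / r ^+ 2) + (0 * (2 * X / r ^+ 2) + 2 * (2 / r ^+ 2))) +
     ((0 * (q * q) + 0 * c + (0 * c + - 2^-1 *
     (2 / r ^+ 2 * q + 2 * X / r ^+ 2 * (2 * X / r ^+ 2) + (2 * X / r ^+ 2 * (2 * X / r ^+ 2) + q * (2 / r ^+ 2))))) + 0)))) +
   (0 * (2 * q + (- 2^-1 * (q * q) - 3 / 2)) + 0 * b + (0 * b + k *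
    ((0 * q + 0 * (2 * Y / r ^+ 2) + (0 * (2 * Y / r ^+ 2) + 2 * (2 / r ^+ 2))) +
     ((0 * (q * q) + 0 * d + (0 * d + - 2^-1 *
     (2 / r ^+ 2 * q + 2 * Y / r ^+ 2 * (2 * Y / r ^+ 2) + (2 * Y / r ^+ 2 * (2 * Y / r ^+ 2) + q * (2 / r ^+ 2))))) + 0)))) =
   - (k * (8 / r ^+ 2 * (q - 1))).
Proof. by move=> r0 ->; field. Qed.

Let lap_sum (u1 u2 u3 u4 u5 u6 u7 u8 u9 dd ll : R) : u1 + u2 = 0 -> u6 + u7 = dd -> u8 + u9 = ll ->
 0 + (u1 + ((0 * u3 + 0 * u4 + (0 * u4 + -2 * u6)) + u8)) + (0 + (u2 + ((0 * u3 + 0 * u5 + (0 * u5 + -2 * u7)) + u9))) = - (2 * dd) + ll.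
Proof.
move=> h <- <-; have -> : u2 = - u1 by apply/eqP; rewrite -addr_eq0 addrC h.
by ring.
Qed.
Lemma dens_lap H z : dens H z = 2 * (4 * 1 * nm (cderiv H z) ^+ 2 / (1 + nm (H z) ^+ 2) ^+ 2).
Proof. by rewrite /dens; move: (_ ^- 2) (_ ^+ 2) => a b; ring. Qed.

Variables (w1 w2 : C) (tau : 0 < Im (w2 / w1)).
Local Notation J := (J w1 w2).
Local Notation pper := (pper w1 w2).
Local Notation L := (lattice w1 w2).
Local Notation P := (fundamental_parallelogram w1 w2 : set RR).
Local Notation Q := (Q tau).
Local Notation rad := (rad tau).
Local Notation C2p := (C2p w1 w2).
Local Notation logQ := (logQ tau).
Local Notation dlogQ := (dlogQ tau).
Local Notation qd := (qd tau).
Local Notation qjet := (qjet tau).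

Lemma Q_eq0_L p : (Q p == 0) <-> L (cplx p).
Proof.
split=> [/eqP Q0|Lp].
 have [[l Ll h]|h] := pselect (exists2 l, L l & qd l p < 1); last first.
  have : Q p = 1 by apply: Q_out => l Ll; rewrite leNgt; apply/negP => a; apply: h; exists l.
  by rewrite Q0 => /eqP; rewrite eq_sym oner_eq0.
 move: Q0; rewrite (Q_in Ll h) qdE => /eqP; rewrite sqrf_eq0 mulf_eq0 invr_eq0 (gt_eqF (rad0 tau)) orbF nm_eq0 subr_eq0.
 by move=> /eqP ->.
have e : qd (cplx p) p = 0 by rewrite qdE subrr nm0 mul0r expr0n.
by rewrite (Q_in Lp) e.
Qed.

Lemma J_ae (a b : RR -> R) : meas2 a -> meas2 b -> (forall p, 0 < Q p -> a p = b p) -> J a = J b.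
Proof.
move=> ma mb h; rewrite /J /Rintegral; congr fine; apply: ae_eq_integral.
- exact: (par_meas tau).
- by apply/measurable_EFinP; apply: measurable_funS ma.
- by apply/measurable_EFinP; apply: measurable_funS mb.
by have := ae_Q tau; apply: filterS => p q0 Pp; rewrite h// q0.
Qed.

Lemma logQ_int (b : RR -> R) : bm b -> mu2.-integrable P (EFin \o (fun p => logQ p * b p)).
Proof.
move=> [mb [M hM]]; have mP := par_meas tau.
have ig : mu2.-integrable P (fun p => M%:E * `|(EFin \o logQ) p|)%E.
 by apply: integrableZl => //; exact: integrable_abse (logQ_integrable tau).
apply: le_integrable ig => //.
 by apply/measurable_EFinP; apply: measurable_funS (measurable_funM (logQ_meas tau) mb).
move=> p _; rewrite /= lee_fin normrM normrM normr_id mulrC ler_wpM2r//.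
exact: le_trans (hM p) (ler_norm _).
Qed.

Variable f : C -> sphere R.
Hypotheses (mf : meromorphic f) (pd : forall z l, ~ L z -> L l -> density f (z + l) = density f z).
Hypotheses (df : forall z, ~ L z -> 0 < density f z) (f0 : f 0 <> None).
Variable m : nat.
Hypothesis om : ord (cderiv (fin f)) 0 m%:Z.
Local Notation F := (fin f).

(** Periodicity of the density is assumed only off L, so at lattice points the value at 0 is
    imposed; this makes [Dens] periodic everywhere. *)
Definition Dens p : R := if Q p == 0 then density f 0 else density f (cplx p).

Lemma cplx_shift p v : cplx (pshift v p) = cplx p + cplx v.
Proof. by case: p v => [a b] [x y]; rewrite /cplx /pshift /=; simpc. Qed.

Lemma Dens_per : pper Dens.
Proof.
move=> p v Lv; rewrite /Dens; have -> : Q (pshift v p) = Q p by exact: Q_per.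
have [e|e] := boolP (Q p == 0); first by [].
rewrite cplx_shift; exact: (pd (fun Lp => negP e ((Q_eq0_L p).2 Lp)) Lv).
Qed.

(** Near 0, f' = w^m G with G nonzero, so ln density contains m ln |w|^2, which m logQ cancels: the
    difference extends to a C^2 function. Its Laplacian is - Dens from the term -2 ln(1 + |f|^2),
    minus m dlogQ. *)
Lemma potential : exists j : jet, [/\ C2p j,
 forall p, 0 < Q p -> j0 j p = ln (density f (cplx p)) - m%:R * logQ p &
 forall p, jxx j p + jyy j p = - Dens p - m%:R * dlogQ p].
Proof.
have r0 : 0 < rad := rad0 tau; have rho := rho0 tau.
have [hF fN] : holo F 0 /\ nearc 0 (fun w => f w <> None).
 by have [[_ a b]|[a _ _]] := sph_local 0 mf.
have [G [hG G0 EG]] := om.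
(* For q <= 1, ln q - th q = 2q - q^2/2 - 3/2, which accounts for the coefficients; the term
   ln(rad^2) in [V0] undoes the scaling of [qd]. *)
pose quad : jet := jadd (jmul (jcst 2) (qjet 0)) (jadd (jmul (jcst (- 2^-1)) (jmul (qjet 0) (qjet 0))) (jcst (- (3 / 2)))).
pose V0 := jadd (jcst (ln 8 + m%:R * ln (rad ^+ 2))) (jadd (lnjet G 0) (jadd (jmul (jcst (- 2)) (lnjet F 1)) (jmul (jcst m%:R) quad))).
pose V p := if Q p == 0 then j0 V0 (0, 0) else ln (density f (cplx p)) - m%:R * logQ p.
have pV : pper V.
 move=> p v Lv; rewrite /V /logQ; have -> : Q (pshift v p) = Q p by exact: Q_per.
 have [e|e] := boolP (Q p == 0); first by [].
 rewrite cplx_shift; exact (congr1 (fun d => ln d - m%:R * th (Q p)) (pd (fun Lp => negP e ((Q_eq0_L p).2 Lp)) Lv)).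
pose N w := [/\ holo G w, G w != 0, holo F w /\ f w <> None, w != 0 -> cderiv F w = w ^+ m * G w & nm w < rad].
have near0 : nearc 0 N.
 have n1 : nearc 0 (fun w => nm w < rad) by exists rad => // w; rewrite subr0.
 have n2 := nearcS2 (fun w a b => conj a b) (holo_near hG) (ccts_neq0 (holo_cts hG) G0).
 have n3 := nearcS2 (fun w a b => conj a b) (holo_near hF) fN.
 have n4 := nearcS2 (fun w a b => conj a b) n2 n3; have n5 := nearcS2 (fun w a b => conj a b) n1 EG.
 by apply: nearcS2 n4 n5 => w [[a b] [c d]] [e g]; split; [exact a|exact b|exact (conj c d)| |exact e]; move=> w0; rewrite g// subr0.
have pos1 H z : 0 < 1 + nm (H z) ^+ 2 by rewrite ltr_wpDr ?sqr_ge0.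
have V0_near p : N (cplx p) ->
  [/\ V p = j0 V0 p, jet_ok V0 p & jxx V0 p + jyy V0 p = - Dens p - m%:R * dlogQ p].
 move=> [a b [c d] e g]. have qE : Q p = qd 0 p by apply: Q_in; [exact: lat0|rewrite qd_lt1 subr0].
 have gp : 0 < 0 + nm (G (cplx p)) ^+ 2 by rewrite add0r exprn_gt0// nm_gt0.
 have D1 : density f (cplx p) = dens F (cplx p) by apply: density_someE; rewrite /fin; case: (f _) d. split.
 - rewrite /V; case: ifPn => [|q0].
   rewrite qE qdE subr0 sqrf_eq0 mulf_eq0 invr_eq0 (gt_eqF r0) orbF nm_eq0 => /eqP p0.
   by congr (j0 V0 _); apply: cplx_inj; rewrite p0 /cplx.
  have z0 : cplx p != 0.
   by apply: contra q0 => /eqP p0; apply/Q_eq0_L; rewrite p0; exact: lat0.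
  have nz : 0 < nm (cplx p) by rewrite nm_gt0.
  have F'0 : cderiv F (cplx p) != 0 by rewrite e// mulf_neq0// expf_neq0. rewrite D1 dens_ln//.
  change (ln 8 + ln (0 + nm (cderiv F (cplx p)) ^+ 2) - 2 * ln (1 + nm (F (cplx p)) ^+ 2) - m%:R * th (Q p) =
   ln 8 + m%:R * ln (rad ^+ 2) + (j0 (lnjet G 0) p + (-2 * j0 (lnjet F 1) p +
   m%:R * (2 * qd 0 p + (- 2^-1 * (qd 0 p * qd 0 p) + - (3 / 2)))))).
  have q1 : m1 (qd 0 p) = qd 0 p by apply: min_l; rewrite -qE Q_le1.
  have eth : th (Q p) = ln (qd 0 p) - (qd 0 p - 1) + (qd 0 p - 1) ^+ 2 / 2 by rewrite qE /th q1.
  have e1 : ln (nm (cderiv F (cplx p)) ^+ 2) = m%:R * ln (nm (cplx p) ^+ 2) + ln (nm (G (cplx p)) ^+ 2).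
   have Gp : 0 < nm (G (cplx p)) by rewrite nm_gt0.
   rewrite e// nmM nmX exprMn exprAC; move: nz Gp; move: (nm (cplx p)) (nm (G _)) => u v u0 v0.
   by rewrite lnM ?posrE ?exprn_gt0// lnXn ?exprn_gt0// mulr_natl.
  have e2 : ln (qd 0 p) = ln (nm (cplx p) ^+ 2) - ln (rad ^+ 2).
   by rewrite qdE subr0 expr_div_n ln_div ?posrE ?exprn_gt0.
  rewrite e2 in eth.
  exact (value_near (ln 8) eth (etrans (lnjet_j0 G 0 p) (congr1 (@ln R) (add0r _))) (lnjet_j0 F 1 p) (etrans (congr1 (@ln R) (add0r _)) e1)).
 - apply: jadd_ok (jcst_ok _ _) _; apply: jadd_ok (lnjet_ok a gp) _.
  apply: jadd_ok; first by apply: jmul_ok (jcst_ok _ _) _; exact: lnjet_ok.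
  apply: jmul_ok (jcst_ok _ _) _; apply: jadd_ok; first exact: jmul_ok (jcst_ok _ _) (qjet_ok _ _ _).
  apply: jadd_ok (jcst_ok _ _); apply: jmul_ok (jcst_ok _ _) _; exact: jmul_ok (qjet_ok _ _ _) (qjet_ok _ _ _).
 have D2 : Dens p = dens F (cplx p).
  rewrite /Dens -D1; have [q0|q0] := boolP (Q p == 0); last by []. have -> : cplx p = 0; last by [].
  by apply/eqP; rewrite -nm_eq0; move: q0; rewrite qE qdE subr0 sqrf_eq0 mulf_eq0 invr_eq0 (gt_eqF r0) orbF.
 have l1 := lnjet_lap gp; rewrite mulr0 mul0r mul0r in l1. have l2 := lnjet_lap (pos1 F (cplx p)).
 have l3 : jxx (jmul (jcst m%:R) quad) p + jyy (jmul (jcst m%:R) quad) p = - (m%:R * (8 / rad ^+ 2 * (qd 0 p - 1))).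
  exact (@quad_lap (qd 0 p) (p.1 - 0) (p.2 - 0) rad m%:R (jx quad p) (jy quad p) (jx (jmul (qjet 0) (qjet 0)) p)
   (jy (jmul (qjet 0) (qjet 0)) p) (lt0r_neq0 r0) erefl).
 have eD : dlogQ p = 8 / rad ^+ 2 * (qd 0 p - 1) by rewrite -qE. rewrite D2 (dens_lap F (cplx p)) eD.
 exact (lap_sum (j0 (lnjet F 1) p) (jx (lnjet F 1) p) (jy (lnjet F 1) p) l1 l2 l3).
have loc p : exists j, \forall q \near p, [/\ V q = j0 j q, jet_ok j q & jxx j q + jyy j q = - Dens q - m%:R * dlogQ q].
 have [q0|q0] := eqVneq (Q p) 0.
  (* At any other lattice point the jet found at 0 is translated, V and [Dens] being periodic. *)
  have Lp : L (cplx p) by apply/Q_eq0_L; rewrite q0. pose v : R * R := (- p.1, - p.2).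
  have cv : cplx v = - cplx p by rewrite /cplx /v; simpc. have Lv : L (cplx v) by rewrite cv; exact: latN.
  exists (jshift v V0). have cp : cplx (pshift v p) = 0 by rewrite cplx_shift cv subrr.
  have nn : nearc (cplx p + cplx v) N.
   by rewrite cv subrr.
  have := nearc_near erefl (nearc_shift nn); apply: filterS => q; rewrite -cplx_shift => /V0_near[a b c].
  rewrite (pV _ _ Lv) in a; rewrite (Dens_per _ Lv) /dlogQ (Q_per tau _ Lv) in c. by split=> //; exact: jshift_ok.
 have Lp : ~ L (cplx p) by move=> /Q_eq0_L; apply/negP. have [H hH dH] := density_near (cplx p) mf.
 have H'0 : cderiv H (cplx p) != 0.
  apply/eqP => h; have := df Lp; rewrite (nearc_at dH) /dens h nm0 expr0n /= mulr0 mul0r ltxx //.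
 have [l Ll hl] := Q_local tau p.
 exists (jadd (jcst (ln 8)) (jadd (lnjet (cderiv H) 0) (jadd (jmul (jcst (- 2)) (lnjet H 1))
  (jmul (jcst (- m%:R)) (jcomp (@th) (@th1) (@th2) (qjet l)))))).
 have hH' := holo_deriv hH. have n1 := nearc_near erefl dH; have n2 := nearc_near erefl (holo_near hH).
 have n3 := nearc_near erefl (ccts_neq0 (holo_cts hH') H'0). have n4 : \forall q \near p, 0 < Q q.
  have Qp : 0 < Q p by rewrite lt_neqAle eq_sym q0 Q_ge0.
  have [d d0 hd] := (cont2P (Q : R * R -> R) p).1 (@Q_cont w1 w2 tau p) _ Qp.
  by apply/near2P; exists d => // q h1 h2; have := hd q h1 h2; rewrite ltr_norml; lra.
 near=> q. have Hq : holo H (cplx q) by near: q; exact: n2. have H'q : cderiv H (cplx q) != 0 by near: q; exact: n3.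
 have Qq : 0 < Q q by near: q; exact: n4. have Dq : density f (cplx q) = dens H (cplx q) by near: q; exact: n1.
 have Eq : Q q = m1 (qd l q) by near: q; exact: hl. have q1 : 0 < qd l q.
  by move: Qq; rewrite Eq /m1; case: (ltP (qd l q) 1) => // h _; exact: lt_le_trans h.
 have gp : 0 < 0 + nm (cderiv H (cplx q)) ^+ 2 by rewrite add0r exprn_gt0// nm_gt0.
 have DE : Dens q = dens H (cplx q) by rewrite /Dens gt_eqF. split.
 - have VE : V q = ln (density f (cplx q)) - m%:R * th (Q q) by rewrite /V gt_eqF.
  rewrite VE Dq (dens_ln H'q) Eq th_m1.
  change (ln 8 + ln (0 + nm (cderiv H (cplx q)) ^+ 2) - 2 * ln (1 + nm (H (cplx q)) ^+ 2) - m%:R * th (qd l q) =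
   ln 8 + (j0 (lnjet (cderiv H) 0) q + (-2 * j0 (lnjet H 1) q + - m%:R * th (qd l q)))).
  exact (value_off (ln 8) m%:R (th (qd l q)) (lnjet_j0 (cderiv H) 0 q) (lnjet_j0 H 1 q)).
 - apply: jadd_ok (jcst_ok _ _) _; apply: jadd_ok (lnjet_ok (holo_deriv Hq) gp) _.
  apply: jadd_ok; first by apply: jmul_ok (jcst_ok _ _) _; exact: lnjet_ok. apply: jmul_ok (jcst_ok _ _) _.
  exact: (@jcomp_ok (@th) (@th1) (@th2) (qjet l) q (qjet_ok tau l q) (th_derive q1) (th1_derive q1) (th2_cont q1)).
 have l1 := lnjet_lap gp; rewrite mulr0 mul0r mul0r in l1. have l2 := lnjet_lap (pos1 H (cplx q)).
 pose jt := jcomp (@th) (@th1) (@th2) (qjet l). have l3 : jxx jt q + jyy jt q = 8 / rad ^+ 2 * (m1 (qd l q) - 1).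
  have -> : 8 / rad ^+ 2 * (m1 (qd l q) - 1) = 4 / rad ^+ 2 * (2 * (m1 (qd l q) - 1)) by move: (rad ^- 2) (m1 _) => a b; ring.
  rewrite -th_lap//.
  change (th2 (qd l q) * (2 * (q.1 - Re l) / rad ^+ 2) * (2 * (q.1 - Re l) / rad ^+ 2) + th1 (qd l q) * (2 / rad ^+ 2) +
   (th2 (qd l q) * (2 * (q.2 - Im l) / rad ^+ 2) * (2 * (q.2 - Im l) / rad ^+ 2) + th1 (qd l q) * (2 / rad ^+ 2)) =
   4 / rad ^+ 2 * (((q.1 - Re l) ^+ 2 + (q.2 - Im l) ^+ 2) / rad ^+ 2 * th2 (qd l q) + th1 (qd l q))).
  by move: (th2 _) (th1 _) (q.1 - _) (q.2 - _) => u u' a b; field; rewrite gt_eqF.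
 have eD : dlogQ q = 8 / rad ^+ 2 * (m1 (qd l q) - 1) by rewrite -Eq. rewrite DE (dens_lap H (cplx q)) eD.
 have l4 : jxx (jmul (jcst (- m%:R)) jt) q + jyy (jmul (jcst (- m%:R)) jt) q = - (m%:R * (8 / rad ^+ 2 * (m1 (qd l q) - 1))).
  change (0 * j0 jt q + 0 * jx jt q + (0 * jx jt q + - m%:R * jxx jt q) + (0 * j0 jt q + 0 * jy jt q + (0 * jy jt q + - m%:R * jyy jt q)) =
   - (m%:R * (8 / rad ^+ 2 * (m1 (qd l q) - 1)))).
  by rewrite -l3 !mul0r !add0r -mulrDr mulNr.
 exact (lap_sum (j0 (lnjet H 1) q) (jx (lnjet H 1) q) (jy (lnjet H 1) q) l1 l2 l4).
have [j Cj [E1 E2]] := jet_glue pV loc.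
by exists j; split=> // p q0; rewrite E1 /V gt_eqF.
Unshelve. all: by end_near.
Qed.

Lemma bm_Dens : bm Dens.
Proof.
have [j [Cj _ E2]] := potential; have [[_ _ _ bxx byy] _ _] := C2p_bm tau Cj.
have := bmB (bmZ (-1) (bmD bxx byy)) (bmZ m%:R (bm_dlogQ tau)); congr bm; apply/funext => p.
by rewrite E2; ring.
Qed.

Lemma J_Dens : J Dens = 4 * pi * m%:R.
Proof.
have [j [Cj _ E2]] := potential; have C1 : C2p (jcst 1) by split=> [p|//]; exact: jcst_ok.
have := green tau Cj C1; rewrite /=.
have -> : (fun p => (jxx j p + jyy j p) * 1) = (fun p => (-1) * Dens p - m%:R * dlogQ p) by apply/funext => p; rewrite mulr1 E2 mulN1r.
have -> : (fun p => j0 j p * (0 + 0)) = (fun p => 0 * (1 : R)) by apply/funext => p; rewrite addr0 mulr0 mul0r.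
rewrite (JZ tau 0 (bm_cst 1)) mul0r (JB tau (bmZ _ bm_Dens) (bmZ _ (bm_dlogQ tau))).
rewrite (JZ tau _ bm_Dens) (JZ tau _ (bm_dlogQ tau)) J_dlogQ; lra.
Qed.

(** The C^2 part is integrated by [green] and m logQ by [logQ_test]. The two [dlogQ] terms cancel,
    [Dens] cancels against exp u, and 4 pi m h(0) remains. *)
Lemma liouville_solution : exists2 u : C -> R, solution w1 w2 (4 * pi * m%:R) u &
 forall z, ~ L z -> u z = ln (density f z).
Proof.
have [j [Cj E1 E2]] := potential; have [[b0 _ _ _ _] _ _] := C2p_bm tau Cj; have [_ pj] := Cj.
have mP := par_meas tau.
pose U p := j0 j p + m%:R * logQ p.
pose u z := U (Re z, Im z).
have uE p : u (cplx p) = U p by case: p.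
have mU : meas2 (U : RR -> R).
 by apply: measurable_funD; [exact: b0.1|apply: measurable_funM => //; exact: logQ_meas].
have iU : mu2.-integrable P (EFin \o U).
 have h := integrableD mP (bm_int tau b0) (integrableZl mP m%:R (logQ_integrable tau)).
 by apply: eq_integrable h => // p _.
have UE p : 0 < Q p -> U p = ln (density f (cplx p)) by move=> q0; rewrite /U E1// subrK.
have nL p : 0 < Q p -> ~ L (cplx p) by move=> q0 /Q_eq0_L /eqP e; move: q0; rewrite e ltxx.
have [_ [M hM]] := b0.
have bE : bm (fun p => expR (U p)).
 split; first exact: (measurableT_comp (@measurable_expR R) mU).
 exists (expR (M + m%:R * (3 / 2))) => p; rewrite ger0_norm ?expR_ge0// ler_expR lerD//.
  exact: le_trans (ler_norm _) (hM p).
 rewrite ler_wpM2l// /logQ; have := Q_ge0 tau p; rewrite le_eqVlt => /orP[/eqP <-|q0].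
  rewrite /th /m1 min_l// ln0// add0r; lra.
 apply: le_trans (th_le0 q0) _; lra.
have ED p : 0 < Q p -> expR (U p) = Dens p.
 by move=> q0; rewrite UE// lnK ?posrE ?df//; [rewrite /Dens gt_eqF|exact: nL].
exists u; last first.
 move=> z Lz; have E : z = cplx (Re z, Im z) by case: (z).
 rewrite {2}E /u UE// lt_neqAle Q_ge0 andbT eq_sym; apply/negP => /Q_eq0_L; rewrite -E; exact: Lz.
split.
- move=> z l Ll; rewrite /u; have E : (Re (z + l), Im (z + l)) = pshift (Re l, Im l) (Re z, Im z).
  by case: (z) (l) => [a b] [c d].
 have Ll' : L (cplx (Re l, Im l)) by case: (l) Ll. by rewrite E /U /logQ pj// Q_per.
- by apply: eq_integrable iU => // p _; rewrite /= uE.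
- by apply: eq_integrable (bm_int tau bE) => // p _; rewrite /= uE.
move=> h ph sh; have [k Ck [Ek El]] := test_jet ph sh.
have [[k0 _ _ kxx kyy] _ _] := C2p_bm tau Ck; have bL := bmD kxx kyy.
pose Lk p := jxx k p + jyy k p.
pose A p := j0 j p * Lk p + expR (U p) * j0 k p.
have bA : bm A by apply: bmD; exact: bmM.
pose B p := m%:R * (logQ p * Lk p).
have iB : mu2.-integrable P (EFin \o B).
 by have := integrableZl mP m%:R (logQ_int bL); apply: eq_integrable.
have -> : (\int[mu2]_(p in P) (u (cplx p) * laplacian (h \o @cplx R) p + expR (u (cplx p)) * h (cplx p))%:E =
  \int[mu2]_(p in P) ((A p + B p)%R)%:E)%E.
 apply: eq_integral => p _; rewrite uE El; congr EFin. have -> : h (cplx p) = j0 k p by rewrite Ek.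
 by rewrite /A /B /U -/(Lk p); ring.
have iAB : mu2.-integrable P (fun p => (A p + B p)%:E).
 by have := integrableD mP (bm_int tau bA) iB; apply: eq_integrable.
rewrite -[LHS]fineK; last exact: (integrable_fin_num mP iAB).
congr EFin; change (\int[mu2]_(p in P) (A p + B p) = 4 * pi * m%:R * h 0).
rewrite RintegralD//; last exact: (bm_int tau bA).
have -> : \int[mu2]_(p in P) B p = m%:R * J (fun p => logQ p * Lk p).
 by rewrite /B RintegralZl//; exact: logQ_int.
rewrite -/(J A) (logQ_test tau Ck).
have -> : J A = J (fun p => j0 j p * Lk p) + J (fun p => expR (U p) * j0 k p) by apply: (JD tau); exact: bmM.
have -> : J (fun p => expR (U p) * j0 k p) = J (fun p => Dens p * j0 k p).
 apply: J_ae; [exact: (bmM bE k0).1|exact: (bmM bm_Dens k0).1|]. by move=> p q0; rewrite ED.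
rewrite (green tau Cj Ck).
have -> : J (fun p => (jxx j p + jyy j p) * j0 k p) = - J (fun p => Dens p * j0 k p) - m%:R * J (fun p => dlogQ p * j0 k p).
 have bD := bmM bm_Dens k0; have bq := bmM (bm_dlogQ tau) k0.
 rewrite -mulN1r -(JZ tau _ bD) -(JZ tau _ bq) -(JB tau (bmZ _ bD) (bmZ _ bq)); congr J; apply/funext => p.
 by rewrite E2; ring.
have -> : j0 k (0, 0) = h 0 by rewrite Ek /=.
by ring.
Qed.

Lemma solution_mass (n : nat) (u : C -> R) : solution w1 w2 (4 * pi * n%:R) u ->
 (forall z, ~ L z -> u z = ln (density f z)) -> m = n.
Proof.
move=> [_ _ ie hs] hu; have mP := par_meas tau.
have := hs (fun=> 1) (fun _ _ _ => erefl).
have l0 p : laplacian ((fun=> 1 : R) \o @cplx R) p = 0.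
 rewrite /laplacian /dx /dy. have e v : (fun p : R * R => 'D_v ((fun=> 1 : R) \o @cplx R) p) = (fun=> 0).
  by apply/funext => q; exact: derive_cst.
 by rewrite !e !derive_cst addr0.
have sm : smooth ((fun=> 1 : R) \o @cplx R).
 have gen (c : R) (i : nat) : class_C i (fun _ : R * R => c).
  have d0 v (c' : R) : (fun p : R * R => 'D_v (fun _ : R * R => c') p) = (fun=> 0) by apply/funext => q; exact: derive_cst.
  elim: i c => [|i ih] c /=; first by split=> //; exact: cst_continuous. split; first exact: cst_continuous.
  by split; try (move=> p; exact: derivable_cst); rewrite /dx /dy d0; exact: ih.
 by move=> i; exact: gen.
move=> /(_ sm); rewrite mulr1.
have -> : (\int[mu2]_(p in P) (u (cplx p) * laplacian ((fun=> 1 : R) \o @cplx R) p + expR (u (cplx p)) * 1)%:E =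
  \int[mu2]_(p in P) (Dens p)%:E)%E.
 transitivity (\int[mu2]_(p in P) (expR (u (cplx p)))%:E)%E.
  by apply: eq_integral => p _; rewrite l0 mulr0 add0r mulr1.
 apply: ae_eq_integral => //.
 - by have /integrableP[] := ie.
 - by apply/measurable_EFinP; apply: measurable_funS bm_Dens.1.
 have := ae_Q tau; apply: filterS => p q0 Pp; congr EFin; have qp := q0 Pp.
 have nL : ~ L (cplx p) by move=> /Q_eq0_L /eqP e; move: qp; rewrite e ltxx.
 by rewrite hu// lnK ?posrE ?df// /Dens gt_eqF.
rewrite -[LHS]fineK; last exact: (integrable_fin_num mP (bm_int tau bm_Dens)).
move=> [] /esym; rewrite -/(Rintegral _ _ _) -/(J Dens) J_Dens => /(mulfI _) -/(_ _)/eqP.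
rewrite eqr_nat => E; apply/esym/eqP; apply: E.
by rewrite mulf_neq0// gt_eqF// pi_gt0.
Qed.
End LiouvilleEquation.

(** * From functions with default values to maps into the sphere *)

Section Completion.
Implicit Types (z w a b c : C) (F G : C -> C) (s : sphere R).

(* [s] is the value at [z] of the extension of [F] to a holomorphic map to the sphere. *)
Definition sval F z s : Prop := if s is Some c
 then exists g, [/\ holo g z, g z = c & nearp z (fun w => F w = g w)]
 else exists g, [/\ holo g z, g z = 0 & nearp z (fun w => F w = (g w)^-1 /\ F w != 0)].

Lemma sval_ex F z k : ord F z k -> exists s, sval F z s.
Proof.
case: k => n o; first by have [g hg E] := ord_reg (isT : 0 <= n%:Z) o; exists (Some (g z)), g.
have [g [hg g0 E]] := ordV o; exists None, (fun w => (w - z) ^+ n.+1 * g w); split.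
- by apply: holoM hg; apply: holoX; exact: holoB (holo_id z) (holo_cst z z).
- by rewrite subrr expr0n mul0r.
have e w : (F w)^-1 = (w - z) ^ (- Negz n) * g w -> F w = ((w - z) ^+ n.+1 * g w)^-1 by move=> h; rewrite -[LHS]invrK h NegzE opprK.
by apply: nearpS2 (nearp_and E (ord_neq0 o)) (nearpT z (fun w => I)) => w [/e h h0] _.
Qed.

Lemma sval_uniq F z s s' : sval F z s -> sval F z s' -> s = s'.
Proof.
have aux c : sval F z (Some c) -> sval F z None -> False.
 move=> [g [hg gc E]] [h [hh h0 E']]. have : h z * g z = 1.
  apply: (@ccts_eq_at (fun w => h w * g w) (fun=> 1)); [exact: holo_cts (holoM hh hg)|exact: holo_cts (holo_cst 1 z)|].
  apply: nearpS (nearp_and E E') => w [e1 [e2 e3]]; rewrite -e1 e2 mulfV//. by move: e3; rewrite e2 invr_eq0.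
 by rewrite h0 mul0r => /eqP; rewrite eq_sym oner_eq0.
case: s s' => [c|] [c'|] //; [|by move=> a b; case: (aux c)|by move=> a b; case: (aux c')].
move=> [g [hg <- E]] [h [hh <- E']]; congr Some; apply: ccts_eq_at (holo_cts hg) (holo_cts hh) _.
by apply: nearpS (nearp_and E E') => w [<- <-].
Qed.

Lemma sval_ext F G z s : nearp z (fun w => F w = G w) -> sval F z s -> sval G z s.
Proof.
by move=> E; case: s => [c|] [g [a b c']]; exists g; split=> //; apply: nearpS (nearp_and E c') => w [<-].
Qed.

Lemma sval_shift F z a s : sval F (z + a) s -> sval (fun w => F (w + a)) z s.
Proof.
case: s => [c|] [g [h e /nearp_shift E]]; exists (fun w => g (w + a)); split=> //; exact: holo_shift.
Qed.

Lemma sval_opp_arg F z s : sval F (- z) s -> sval (fun w => F (- w)) z s.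
Proof.
case: s => [c|] [g [h e /nearp_opp E]]; exists (fun w => g (- w)); split=> //; exact: holo_opp_arg.
Qed.

Lemma sval_opp F z s : sval F z s -> sval (fun w => - F w) z (sph_opp s).
Proof.
case: s => [c|] [g [h e E]]; exists (fun w => - g w); split=> /=; try exact: holoN.
- by rewrite e.
- by apply: nearpS E => w ->.
- by rewrite e oppr0.
by apply: nearpS E => w [-> h0]; rewrite oppr_eq0 invrN.
Qed.

Lemma sval_inv F z s : sval F z s -> nearp z (fun w => F w != 0) -> sval (fun w => (F w)^-1) z (sph_inv s).
Proof.
move=> + n0; case: s => [c|] [g [h e E]] /=; last first.
 by exists g; split=> //; apply: nearpS E => w [-> _]; rewrite invrK.
have [c0|c0] := eqVneq c 0; last first.
 by exists (fun w => (g w)^-1); split; [apply: holoV; rewrite ?e|rewrite e|apply: nearpS E => w ->].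
by exists g; split=> //; [rewrite e|apply: nearpS (nearp_and E n0) => w [-> h0]; rewrite invr_eq0].
Qed.

(** At isolated points, where F may carry a default value, the limit in the sphere is taken instead.
    By [sval_uniq], functional equations of F valid off isolated points hold for f everywhere. *)
Lemma completion F : (forall z, exists k, ord F z k) -> exists f : C -> sphere R,
 [/\ meromorphic f, forall z, sval F z (f z) & forall z, nearp z (fun w => f w = Some (F w))].
Proof.
move=> ho; have /choice[f hf] : forall z, exists s, sval F z s by move=> z; have [k /sval_ex] := ho z.
have fS w c : sval F w (Some c) -> f w = Some c by exact: sval_uniq (hf w).
have near_some z c : f z = Some c -> exists2 g, holo g z & nearc z (fun w => f w = Some (g w)) /\ nearp z (fun w => F w = g w).
 move=> E; have := hf z; rewrite E => -[g [hg gz Eg]]; exists g => //; split=> //.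
 apply: nearcS2 (nearp_open Eg) (holo_near hg) => w h1 h2; have [->|wz] := eqVneq w z; first by rewrite E gz.
 by apply: fS; exists g; split=> //; apply: nearc_p; exact: h1.
have near_none z : f z = None -> exists2 g, holo g z & [/\ g z = 0, nearp z (fun w => F w != 0 /\ F w = (g w)^-1) &
  nearp z (fun w => f w = Some (F w))].
 move=> E; have := hf z; rewrite E => -[g [hg gz Eg]]; exists g => //; split=> //.
  by apply: nearpS Eg => w [].
 apply: nearpS2 (nearp_open Eg) (nearc_p (holo_near hg)) => w h1 h2; have [Fw Fw0] := nearc_at h1.
 have gw : g w != 0 by rewrite -invr_eq0 -Fw.
 apply: fS; exists (fun w => (g w)^-1); split; [exact: holoV|by rewrite Fw|].
 by apply: nearc_p; apply: nearcS h1 => v [].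
have fF z : nearp z (fun w => f w = Some (F w)).
 case E : (f z) => [c|]; last by have [g _ []] := near_none z E.
 by have [g _ [h1 h2]] := near_some z c E; apply: nearpS2 (nearc_p h1) h2 => w -> ->.
exists f; split=> //; split.
 move=> z; case E : (f z) => [c|]; [left|right]; apply/holomorphic_atP.
  have [g hg [h1 _]] := near_some z c E; split; first by apply: nearcS h1 => w ->.
  by apply: holo_ext hg; apply: nearcS h1 => w h; rewrite /fin h.
 have [g hg [gz h1 h2]] := near_none z E. have h3 : nearc z (fun w => (@sph_inv R \o f) w = Some (g w)).
  apply: nearcS2 h1 h2 => w a b; have [->|wz] := eqVneq w z; first by rewrite /= E gz.
  by have [a0 aE] := a wz; rewrite /= (b wz) /= (negbTE a0) aE invrK.
 split; first by apply: nearcS h3 => w ->. by apply: holo_ext hg; apply: nearcS h3 => w h; rewrite /fin h.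
by have [w _ h] := nearp_ex (fF 0); exists w; rewrite h.
Qed.
End Completion.

(** * The square root S on a double cover of C/L' *)

Section SquareRoot.
Implicit Types (y z w l a b c : C).
Variables (w1 w2 : C) (tau : 0 < Im (w2 / w1)).
Local Notation L' := (lattice w1 (2 * w2)).
Local Notation X := (Xw w1 w2).
Local Notation h := (w1 / 2).
Local Notation h' := (w1 / 2 + w2).
Local Notation v1 := (- (2 * w2)).
Local Notation M := (lattice v1 (2 * w1)).
Local Notation Y := (Xw v1 w1).
Local Notation k := (Y h).

(** The results on X are applied to the basis -2 w2, w1 in place of w1, w2: the doubled period is
    then 2 w1 and w1 becomes a half period. The minus sign keeps the orientation. *)
Lemma tauS : 0 < Im (w1 / v1).
Proof.
have w10 := w1_neq0 tau; have w20 : w2 != 0 by apply/eqP => e; move: tau; rewrite e mul0r ltxx.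
have -> : w1 / v1 = (- 2^-1 : R)%:C * (w2 / w1)^-1.
 by rewrite rmorphN fmorphV rmorph_nat; field; rewrite w20 w10.
move: tau; case: (w2 / w1) => a b /= b0.
have n0 : 0 < a ^+ 2 + b ^+ 2 by rewrite ltr_wpDl ?sqr_ge0// exprn_gt0.
by rewrite mul0r addr0 mulNr mulrN opprK mulr_gt0 ?invr_gt0// divr_gt0.
Qed.
Local Notation tS := tauS.

Lemma lat_swap z : lattice v1 w1 z <-> L' z.
Proof.
split=> -[m [n ->]]; first by exists n, (- m); rewrite rmorphN /=; ring.
by exists (- n), m; rewrite rmorphN /=; ring.
Qed.
Lemma M_sub z : M z -> L' z.
Proof. by move=> hz; apply/lat_swap/lat_double; left. Qed.
Lemma M_w1 : M (2 * w1). Proof. exact: lat_w2. Qed.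
Lemma M_w2 : M (2 * w2). Proof. by have /latN := lat_w1 v1 (2 * w1); rewrite opprK. Qed.
Lemma M2 l : L' l -> M (2 * l).
Proof. by move=> [m [n ->]]; exists (- n - n), m; rewrite rmorphB rmorphN /=; ring. Qed.
Lemma notM_w1 : ~ M w1. Proof. exact: (half_w2 tS).2. Qed.

Lemma hL : ~ L' h. Proof. exact: (half_w1 tau).2. Qed.
Lemma h'L : ~ L' h'. Proof. exact: (half_w3 tau).2. Qed.

Lemma Y_shift z : ~ L' z -> Y z * Y (z + w1) = k ^+ 2.
Proof.
move=> Lz; have s v : ~ L' v -> ~ lattice v1 w1 v by move=> a /lat_swap.
rewrite (Xw_shift tS (s _ Lz)) -(Xw_shift tS (s _ hL)) expr2; congr (_ * _).
have -> : h + w1 = - h + 2 * w1 by field.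
by rewrite (Xw_per tS _ M_w1) (Xw_even tS).
Qed.
Lemma Y_neq0 z : ~ L' z -> Y z != 0.
Proof. by move=> Lz; apply: (Xw_neq0 tS) => /lat_swap. Qed.
Lemma k_neq0 : k != 0. Proof. exact: Y_neq0 hL. Qed.

Lemma Y_h'_w1 : Y (h' + w1) = Y h'.
Proof.
have -> : h' + w1 = - h' + (2 * w1 + 2 * w2) by field.
by rewrite (Xw_per tS) ?(Xw_even tS)//; exact: latD M_w1 M_w2.
Qed.

(** Translation by w1 sends h to -h and h' to -h' modulo M, so Y^2 = k^2 at both points. Y h' = k
    would put h' at h or -h modulo M. *)
Lemma Y_h' : Y h' = - k.
Proof.
have /eqP := Y_shift h'L; rewrite Y_h'_w1 -expr2 eqf_sqr => /orP[/eqP e|/eqP//].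
have nM v : ~ L' v -> ~ M v by move=> a /M_sub.
have [] := Xw_eq tS (nM _ h'L) (nM _ hL) e.
 have -> : h' - h = w2 by ring. have := (half_w1 tS).2; have -> : v1 / 2 = - w2 by field. by rewrite latNE.
have -> : h' + h = - (v1 / 2 + w1) + 2 * w1 by field.
by rewrite latDr ?latNE; [move/(half_w3 tS).2|exact: M_w1].
Qed.

Lemma Y_eq_at g z : ~ L' g -> L' (2 * g) -> Y (g + w1) = Y g -> ~ L' z -> Y z = Y g <-> L' (z - g).
Proof.
move=> Lg L2 gw Lz; have nM v : ~ L' v -> ~ M v by move=> a /M_sub.
split=> [/(Xw_eq tS (nM _ Lz) (nM _ Lg))[/M_sub//|/M_sub hz]|].
 by have -> : z - g = z + g - 2 * g by [ring]; exact: latB.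
move=> /lat_swap/lat_double[hz|hz].
 by rewrite -[z](subrKC g) (Xw_per tS).
have e : z = (g + w1) + (z - g - w1) by ring.
by rewrite -gw {1}e (Xw_per tS _ hz).
Qed.

Lemma L2h : L' (2 * h). Proof. exact: (half_w1 tau).1. Qed.
Lemma L2h' : L' (2 * h'). Proof. exact: (half_w3 tau).1. Qed.
Lemma Y_h_w1 : Y (h + w1) = k.
Proof.
have -> : h + w1 = - h + 2 * w1 by field.
by rewrite (Xw_per tS _ M_w1) (Xw_even tS).
Qed.

Lemma Y_k z : ~ L' z -> Y z = k <-> L' (z - h).
Proof. exact: Y_eq_at hL L2h Y_h_w1. Qed.
Lemma Y_Nk z : ~ L' z -> Y z = - k <-> L' (z - h').
Proof. by rewrite -Y_h'; exact: Y_eq_at h'L L2h' Y_h'_w1. Qed.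

(** Translation by w1 acts on Y as Y -> k^2/Y, whose fixed points k and -k are the values at h and
    h'. In the coordinate with zero k and pole -k this involution is S -> -S. S has simple zeros at
    h + L' and simple poles at h' + L', so S^2 is a multiple of (X - X h)/(X - X h'). *)
Definition sqroot w := (Y w - k) * (Y w - - k)^-1.
Local Notation S := sqroot.

Lemma k_neqN : k != - k.
Proof. by apply/eqP => /eqP; rewrite -subr_eq0 opprK -mulr2n mulrn_eq0 /= (negbTE k_neq0). Qed.

Lemma notM2 g l : L' (2 * g) -> ~ M (2 * g) -> L' (l - g) -> ~ M (2 * l).
Proof.
move=> _ Mg /M2 a b; apply: Mg; have -> : 2 * g = 2 * l - 2 * (l - g) by ring.
exact: latB.
Qed.
Lemma notM2h : ~ M (2 * h).
Proof. by have -> : 2 * h = w1 by [field]; exact: notM_w1. Qed.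
Lemma notM2h' : ~ M (2 * h').
Proof.
have -> : 2 * h' = w1 + 2 * w2 by field.
by rewrite latDr; [exact: notM_w1|exact: M_w2].
Qed.
Lemma off_half g z : ~ L' g -> L' (z - g) -> ~ L' z.
Proof. by move=> Lg a b; apply: Lg; have -> : g = z - (z - g) by [ring]; exact: latB. Qed.

Lemma sqroot_zero z : L' (z - h) -> ord S z 1.
Proof.
move=> Lz; have nz := off_half hL Lz; have yk := (Y_k nz).2 Lz.
have nM : ~ M z by move=> /M_sub.
have o1 := XwB_ord1 tS nM (notM2 L2h notM2h Lz); rewrite yk in o1.
have o2 : ord (fun w => Y w - - k) z 0 by apply: (XwB_ord0 tS nM); rewrite yk k_neqN.
by have := ordM o1 (ordV o2); rewrite oppr0 addr0.
Qed.

Lemma sqroot_pole z : L' (z - h') -> ord S z (- 1).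
Proof.
move=> Lz; have nz := off_half h'L Lz; have yk := (Y_Nk nz).2 Lz.
have nM : ~ M z by move=> /M_sub.
have o1 := XwB_ord1 tS nM (notM2 L2h' notM2h' Lz); rewrite yk in o1.
have o2 : ord (fun w => Y w - k) z 0 by apply: (XwB_ord0 tS nM); rewrite yk eq_sym k_neqN.
by have := ordM o2 (ordV o1); rewrite add0r.
Qed.

Lemma sqroot_ord0 z : ~ L' (z - h) -> ~ L' (z - h') -> ord S z 0.
Proof.
move=> n1 n2; have [Mz|Mz] := pselect (M z).
 have := ordM (XwB_ord tS k Mz) (ordV (XwB_ord tS (- k) Mz)). by rewrite subrr.
have [yk yNk] : Y z != k /\ Y z != - k.
 have [Lz|Lz] := pselect (L' z).
  have [//|hz] := (lat_double v1 w1 z).1 ((lat_swap z).2 Lz).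
  have -> : Y z = 0 by rewrite -[z](subrKC w1) (Xw_per tS)// (Xw_w2 v1 w1). by rewrite !(eq_sym 0) oppr_eq0 k_neq0.
 by split; apply/eqP; [move/(Y_k Lz)|move/(Y_Nk Lz)].
by have := ordM (XwB_ord0 tS Mz yk) (ordV (XwB_ord0 tS Mz yNk)); rewrite oppr0 addr0.
Qed.

Lemma sqroot_holo z : ~ L' z -> ~ L' (z - h') -> holo S z.
Proof.
move=> Lz Lz'; have hY : holo Y z by apply: (Xw_holo tS) => /M_sub.
apply: holoM (holoB hY (holo_cst _ z)) (holoV (holoB hY (holo_cst _ z)) _).
by rewrite subr_eq0; apply/eqP => /(Y_Nk Lz).
Qed.

Lemma sqroot_ex z : exists o, ord S z o.
Proof.
have [/sqroot_zero|n1] := pselect (L' (z - h)); first by exists 1.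
have [/sqroot_pole|n2] := pselect (L' (z - h')); first by exists (- 1).
by exists 0; exact: sqroot_ord0.
Qed.
Lemma sqroot_even z : S (- z) = S z. Proof. by rewrite /S (Xw_even tS). Qed.
Lemma sqroot_2w2 z : S (z + 2 * w2) = S z. Proof. by rewrite /S (Xw_per tS _ M_w2). Qed.

Lemma near_off z a : nearp z (fun w => ~ L' (w - a)).
Proof.
by have := nearp_shift (lat_near (tau_double tau) (z - a)); apply.
Qed.

Lemma sqroot_w1 z : nearp z (fun w => S (w + w1) = - S w).
Proof.
apply: nearpS2 (lat_near (tau_double tau) z) (near_off z h') => w Lw Lw'.
have y0 := Y_neq0 Lw; have yk : Y w != - k by apply/eqP => /(Y_Nk Lw).
have k0 := k_neq0; have E : Y (w + w1) = k ^+ 2 / Y w by rewrite -(Y_shift Lw) mulrAC mulfV ?mul1r.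
rewrite /S E; move: yk; rewrite -subr_eq0 opprK; move: (Y w) k y0 k0 => y c y0 c0 yc; field.
have -> : c ^+ 2 + c * y = c * (y + c) by ring.
by rewrite y0 yc mulf_neq0.
Qed.

(** Translation by w2 exchanges the zeros and the poles of S, so the product has order 0 everywhere;
    under w1 the two sign changes cancel. *)
Lemma sqroot_mul : exists2 s0, s0 != 0 & forall z, nearp z (fun w => S w * S (w + w2) = s0).
Proof.
have o0 z : ord (fun w => S w * S (w + w2)) z 0.
 have sh o : ord S (z + w2) o -> ord (fun w => S (w + w2)) z o by exact: ord_shift.
 have [z1|n1] := pselect (L' (z - h)).
  have /sqroot_pole/sh o : L' (z + w2 - h') by have -> : z + w2 - h' = z - h by ring.
  by have := ordM (sqroot_zero z1) o; rewrite subrr.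
 have [z2|n2] := pselect (L' (z - h')).
  have /sqroot_zero/sh o : L' (z + w2 - h).
   by have -> : z + w2 - h = z - h' + 2 * w2 by [ring]; apply: latD => //; exact: lat_w2.
  by have := ordM (sqroot_pole z2) o; rewrite addrC subrr.
 have /sh o : ord S (z + w2) 0.
  apply: sqroot_ord0.
   have -> : z + w2 - h = z - h' + 2 * w2 by ring. by rewrite latDr//; exact: lat_w2.
  by have -> : z + w2 - h' = z - h by ring.
 by have := ordM (sqroot_ord0 n1 n2) o; rewrite addr0.
have [||c hc] := @liouville_nper _ _ (tau_double tau) (fun w => S w * S (w + w2)) (fun z => ord_reg (lexx 0) (o0 z)).
- move=> z; have n2 := nearp_shift (sqroot_w1 (z + w2)).
 by apply: nearpS2 (sqroot_w1 z) n2 => w -> e; rewrite -addrA (addrC w1) addrA e mulrNN.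
- by move=> z; apply: nearpT => w; rewrite -[w + _ + _]addrA (addrC _ w2) addrA !sqroot_2w2.
exists c => //; apply/eqP => c0.
by apply: (nearp_false _ (hc 0) (ord_neq0 (o0 0))) => w ->; rewrite c0 eqxx.
Qed.
Lemma X_h z : ~ L' z -> X z = X h -> L' (z - h).
Proof. by move=> Lz; apply: (Xw_eq_half tau (half_w1 tau)). Qed.
Lemma X_h' z : ~ L' z -> X z = X h' -> L' (z - h').
Proof. by move=> Lz; apply: (Xw_eq_half tau (half_w3 tau)). Qed.
Lemma X_at g z : L' (z - g) -> X z = X g.
Proof. by move=> Lz; rewrite -[z](subrKC g) (Xw_per tau). Qed.
Lemma X_hh' : X h != X h'.
Proof. by rewrite (Xw_w1 tau) (Xw_w3 tau); exact: a13_neq. Qed.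

Lemma sqroot_sqr : exists kap, forall z, nearp z (fun w => S w ^+ 2 * (X w - X h') = kap * (X w - X h)).
Proof.
pose G w := S w ^+ 2 * ((X w - X h') * (X w - X h)^-1).
have o0 z : ord G z 0.
 have [Lz|Lz] := pselect (L' z).
  have n1 g : ~ L' g -> ~ L' (z - g) by move=> Lg /off_half; apply.
  have oS := ordX 2 (sqroot_ord0 (n1 _ hL) (n1 _ h'L)).
  exact (ordM oS (ordM (XwB_ord tau (X h') Lz) (ordV (XwB_ord tau (X h) Lz)))).
 have [z1|n1] := pselect (L' (z - h)).
  have e := X_at z1; have oS := ordX 2 (sqroot_zero z1).
  have o1 : ord (fun w => X w - X h') z 0 by apply: (XwB_ord0 tau Lz); rewrite e X_hh'.
  exact (ordM oS (ordM o1 (ordV (XwB_half tau (half_w1 tau) z1)))).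
 have [z2|n2] := pselect (L' (z - h')).
  have e := X_at z2; have oS := ordX 2 (sqroot_pole z2).
  have o1 : ord (fun w => X w - X h) z 0 by apply: (XwB_ord0 tau Lz); rewrite e eq_sym X_hh'.
  exact (ordM oS (ordM (XwB_half tau (half_w3 tau) z2) (ordV o1))).
 have o1 : ord (fun w => X w - X h) z 0 by apply: (XwB_ord0 tau Lz); apply/eqP => /(X_h Lz).
 have o2 : ord (fun w => X w - X h') z 0 by apply: (XwB_ord0 tau Lz); apply/eqP => /(X_h' Lz).
 exact (ordM (ordX 2 (sqroot_ord0 n1 n2)) (ordM o2 (ordV o1))).
have [||c hc] := @liouville_nper _ _ (tau_double tau) G (fun z => ord_reg (lexx 0) (o0 z)).
- move=> z; apply: nearpS (sqroot_w1 z) => w e; rewrite /G e sqrrN.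
 by rewrite (Xw_per tau w (lat_w1 w1 (2 * w2))).
- by move=> z; apply: nearpT => w; rewrite /G sqroot_2w2 (Xw_per tau w (lat_w2 w1 (2 * w2))).
exists c => z; have [e o1] := wpB_ex_ord (tau_double tau) (wp L' (2 * w2 / 2) + X h) z.
rewrite -XwBE in o1; apply: nearpS2 (hc z) (ord_neq0 o1) => w <- n0.
by rewrite /G -!mulrA mulVf// mulr1.
Qed.
End SquareRoot.

(** * The Klein four-group as monodromy *)

Section TypeOne.
Implicit Types (z w : C) (s : sphere R).

Lemma sph_oppK s : sph_opp (sph_opp s) = s.
Proof. by case: s => [b|] //=; rewrite opprK. Qed.
Lemma sph_opp_inv s : sph_opp (sph_inv s) = sph_inv (sph_opp s).
Proof. by case: s => [b|] /=; [rewrite oppr_eq0; case: eqP => //= _; rewrite invrN|rewrite oppr0]. Qed.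

Definition klein (p : 'Z_2 * 'Z_2) s : sphere R :=
 let t := if p.2 == 0 then s else sph_inv s in if p.1 == 0 then t else sph_opp t.

(** Representatives of determinant 1: the identity, diag(i, -i) for s -> -s, i times the swap for s
    -> 1/s, and the rotation with rows (0, -1), (1, 0) for s -> -1/s. *)
Lemma klein_PSU2 p : PSU2 (klein p).
Proof.
pose m (a b c d : C) : 'M[C]_2 := \matrix_(i, j) (if i == 0 then (if j == 0 then a else b) else (if j == 0 then c else d)).
have i2 : ('i%C : C) * 'i%C = -1 by rewrite -expr2 sqr_i.
have ci : Num.conj ('i%C : C) = - 'i%C by rewrite /Num.conj /= /conjc /=; apply/eqP; rewrite eq_complex /= oppr0 !eqxx.
have c0 : Num.conj (0 : C) = 0 by exact: rmorph0.
have c1 : Num.conj (1 : C) = 1 by exact: rmorph1.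
have i0 : ('i%C : C) != 0 by apply/eqP => e; move: i2; rewrite e mul0r => /eqP; rewrite eq_sym oppr_eq0 oner_eq0.
have su a b c d : a * d - b * c = 1 -> a * Num.conj a + b * Num.conj b = 1 -> c * Num.conj c + d * Num.conj d = 1 ->
  a * Num.conj c + b * Num.conj d = 0 -> c * Num.conj a + d * Num.conj b = 0 -> SU2 (m a b c d).
 move=> hd h1 h2 h3 h4; split.
  apply/matrixP => i j; rewrite !mxE !big_ord_recl big_ord0 addr0 !mxE /=.
  by case: i => [[|[|]]] // i1; case: j => [[|[|]]] // j1; rewrite /= ?h1 ?h2 ?h3 ?h4.
 by rewrite (expand_det_row _ 0) !big_ord_recl big_ord0 addr0 /cofactor !det_mx11 !mxE /= expr0 mul1r expr1 mulN1r mulrN.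
rewrite /PSU2; case: p => [[[|[|]]] // p1 [[|[|]]] // p2]; rewrite /klein /=.
- exists (m 1 0 0 1); first by apply: su; rewrite ?c0 ?c1; ring.
 apply/funext => -[b|]; rewrite /mobius !mxE /=; last by rewrite eqxx.
 by rewrite mul0r add0r oner_eq0 mul1r addr0 divr1.
- exists (m 0 'i%C 'i%C 0).
  by apply: su; rewrite ?c0 ?ci ?mulrN ?i2 ?mulr0 ?mul0r ?addr0 ?add0r ?oppr0 ?opprK ?sub0r ?opprK// i2 opprK.
 apply/funext => -[b|]; rewrite /mobius !mxE /=; last by rewrite (negbTE i0) mul0r.
 rewrite addr0 mul0r add0r mulf_eq0 (negbTE i0) /=; case: eqP => // /eqP b0; congr Some; field. by rewrite b0 i0.
- exists (m 'i%C 0 0 (- 'i%C)).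
  have cNi : Num.conj (- 'i%C : C) = 'i%C by rewrite /Num.conj /= /conjc /=; apply/eqP; rewrite eq_complex /= oppr0 opprK !eqxx.
  by apply: su; rewrite ?c0 ?cNi ?ci; ring: i2.
 apply/funext => -[b|]; rewrite /mobius !mxE /=; last by rewrite eqxx.
 by rewrite mul0r add0r oppr_eq0 (negbTE i0) addr0; congr Some; field.
exists (m 0 (-1) 1 0); first by apply: su; rewrite ?rmorphN ?c0 ?c1; ring.
apply/funext => -[b|]; rewrite /mobius !mxE /=; last by rewrite oner_eq0 mul0r oppr0.
rewrite mul1r addr0 mul0r add0r; case: eqP => // /eqP b0; congr Some; field.
exact: b0.
Qed.

Lemma kleinD p q s : klein (p + q) s = klein p (klein q s).
Proof.
case: p => [[[|[|]]] // p1 [[|[|]]] // p2]; case: q => [[[|[|]]] // q1 [[|[|]]] // q2];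
 by rewrite /klein /= ?sph_opp_inv ?sph_invK ?sph_oppK.
Qed.

Lemma klein_inj : injective klein.
Proof.
have n1 : (-1 : C) == 1 = false by rewrite eq_sym -subr_eq0 opprK -(natrD _ 1 1) pnatr_eq0.
move=> p q /(congr1 (fun k => (isSome (k (Some 0)), odflt 0 (k (Some 1)) == 1))).
case: p => [[[|[|]]] // p1 [[|[|]]] // p2]; case: q => [[[|[|]]] // q1 [[|[|]]] // q2];
 rewrite /klein /= ?eqxx ?oner_eq0 /= ?invr1 ?eqxx ?n1 // => _; congr pair; exact: val_inj.
Qed.

(** The class of a period modulo 2 determines its transformation. Surjectivity of f is what makes T
    unique in f(z + w) = T (f z), so that the monodromy contains nothing else. *)
Lemma type_I_normalized (w1 w2 : C) (f : C -> sphere R) : normalized w1 w2 f -> (forall s, exists z, f z = s) ->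
 type_I (lattice w1 w2) f.
Proof.
move=> [n1 n2] sf.
have kl (m n : int) z : f (z + (m%:~R * w1 + n%:~R * w2)) = klein ((m%:~R : 'Z_2), (n%:~R : 'Z_2)) (f z).
 pose T (m n : int) := forall z, f (z + (m%:~R * w1 + n%:~R * w2)) = klein ((m%:~R : 'Z_2), (n%:~R : 'Z_2)) (f z).
 have comb m1 n1' m2 n2' : T m1 n1' -> T m2 n2' -> T (m1 + m2) (n1' + n2').
  move=> a b v; have -> : v + ((m1 + m2)%:~R * w1 + (n1' + n2')%:~R * w2) =
    v + (m2%:~R * w1 + n2'%:~R * w2) + (m1%:~R * w1 + n1'%:~R * w2) by rewrite !intrD; ring.
  by rewrite a b -kleinD !intrD.
 have t1 : T 1 0 by move=> v; rewrite mul1r mul0r addr0 n1.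
 have t2 : T 0 1 by move=> v; rewrite mul1r mul0r add0r n2. have t0 : T 0 0 by move=> v; rewrite !mul0r !addr0.
 have neg (m' n' : int) : T m' n' -> T (- m') (- n').
  move: m' n' => {}m {}n a v; have := a (v + ((- m)%:~R * w1 + (- n)%:~R * w2)).
  have -> : v + ((- m)%:~R * w1 + (- n)%:~R * w2) + (m%:~R * w1 + n%:~R * w2) = v by rewrite !rmorphN /=; ring.
  move=> ->; rewrite -kleinD.
  have -> : ((((- m)%:~R : 'Z_2), ((- n)%:~R : 'Z_2)) + ((m%:~R : 'Z_2), (n%:~R : 'Z_2))) = 0 :> 'Z_2 * 'Z_2.
   by congr pair; rewrite /= rmorphN /= addNr.
  by [].
 have nn (m' n' : int) (k : nat) : T m' n' -> T (m' * k) (n' * k).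
  by move=> a; elim: k => [|k ih]; [rewrite !mulr0|rewrite -addn1 PoszD !mulrDr !mulr1; exact: comb].
 have all (m' : int) : T m' 0 /\ T 0 m'.
  case: m' => k; first by have := nn _ _ k t1; have := nn _ _ k t2; rewrite !mul1r !mul0r.
  rewrite NegzE; have := neg _ _ (nn _ _ k.+1 t1); have := neg _ _ (nn _ _ k.+1 t2).
  by rewrite !mul1r !mul0r !oppr0.
 by have := comb _ _ _ _ (all m).1 (all n).2; rewrite addr0 add0r; apply.
exists klein; split; [exact: klein_inj| |by move=> a b; apply/funext => s; exact: kleinD].
apply/seteqP; split=> [_ [p _ <-]|T [_ [w [m [n ->]] hT]]].
 split; first exact: klein_PSU2.
 exists ((val p.1)%:R * w1 + (val p.2)%:R * w2); first by exists (Posz (val p.1)), (Posz (val p.2)).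
 move=> z; have := kl (Posz (val p.1)) (Posz (val p.2)) z; rewrite -!pmulrn => ->; congr (klein _ _).
 by case: p => a b /=; rewrite !natr_Zp.
exists (m%:~R, n%:~R) => //; apply/funext => s; have [z <-] := sf s.
by rewrite -hT kl.
Qed.
End TypeOne.

(** * Orders and derivatives of finite products *)

Lemma ord_prod (I : Type) (r : seq I) (H : I -> C -> C) (x : C) (o : I -> int) :
 (forall i, ord (H i) x (o i)) -> ord (fun w => \prod_(i <- r) H i w) x (\sum_(i <- r) o i).
Proof.
move=> h; elim: r => [|i r ih].
 rewrite big_nil; apply: ord_ext (holo_ord (holo_cst 1 x) (oner_neq0 _)). by apply: nearpT => w; rewrite big_nil.
rewrite big_cons; apply: ord_ext (ordM (h i) ih).
by apply: nearpT => w; rewrite big_cons.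
Qed.

Lemma cdiff_prodB (I : Type) (r : seq I) (y : I -> C) (X : C -> C) (x d : C) :
 cdiff X x d -> (forall i, X x != y i) ->
 cdiff (fun w => \prod_(i <- r) (X w - y i)) x (\prod_(i <- r) (X x - y i) * (d * \sum_(i <- r) (X x - y i)^-1)).
Proof.
move=> dX ny; elim: r => [|i r ih].
 rewrite !big_nil !mulr0; apply: cdiff_ext (cdiff_cst 1 x); apply: nearcT => w; by rewrite big_nil.
rewrite !big_cons; have := cdiffM (cdiffB dX (cdiff_cst (y i) x)) ih; rewrite subr0.
have yi : X x - y i != 0 by rewrite subr_eq0.
have -> : d * \prod_(j <- r) (X x - y j) + (X x - y i) * (\prod_(j <- r) (X x - y j) * (d * \sum_(j <- r) (X x - y j)^-1)) =
  (X x - y i) * \prod_(j <- r) (X x - y j) * (d * ((X x - y i)^-1 + \sum_(j <- r) (X x - y j)^-1)).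
 by move: (\prod_(j <- r) _) (\sum_(j <- r) _) yi; move: (X x - y i) => a p s a0; field.
by apply: cdiff_ext; apply: nearcT => w; rewrite big_cons.
Qed.

Lemma wsum_eval (K : fieldType) (I : finType) (x w : I -> K) (v : K) : (forall i, v != x i) ->
 (wsum x w).[v] = (rprod x).[v] * \sum_i w i * (v - x i)^-1.
Proof.
move=> h; rewrite /wsum horner_sum mulr_sumr; apply: eq_bigr => i _.
have vi : v - x i != 0 by rewrite subr_eq0.
rewrite hornerZ -(rprodE x i) hornerM hornerXsubC; move: ((rprod' x i).[v]) vi; move: (v - x i) => a p a0.
by field.
Qed.
Lemma int_count (n : nat) : 0 + (- 2 - 1 + (0 + - 2 * n%:Z - (- 2) *+ (2 * n + 2))) = (2 * n + 1)%N%:Z :> int.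
Proof. by rewrite -mulr_natr natz; lia. Qed.

(** * From a solution of the polynomial system to a developing map *)

Section Converse.
Implicit Types (x y w l a b c : C).
Variables (w1 w2 : C) (tau : 0 < Im (w2 / w1)).
Local Notation L := (lattice w1 w2).
Local Notation L' := (lattice w1 (2 * w2)).
Local Notation X := (Xw w1 w2).
Local Notation h := (w1 / 2).
Local Notation h' := (w1 / 2 + w2).
Local Notation S := (sqroot w1 w2).
Local Notation mu := (X h * X h').
Local Notation dX := (cderiv X).
Variables (n : nat) (z zt : 'I_n -> C).
Hypothesis sys : polynomial_system mu (fun j : 'I_n => (X h' ^+ j.+1 - X h ^+ j.+1) / 2) z zt.

Let LL v : ~ L v -> ~ L' v.
Proof. by move=> a b; apply: a; apply/lat_double; left. Qed.
Lemma not_L_h : ~ L h. Proof. exact: (half1 tau).2. Qed.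
Lemma not_L_h' : ~ L h'. Proof. by rewrite latDr; [exact: not_L_h|exact: lat_w2]. Qed.
Lemma mu0 : mu != 0.
Proof. by rewrite mulf_neq0// (Xw_neq0 tau)//; [exact: not_L_h|exact: not_L_h']. Qed.

Lemma zzt i : z i * zt i = mu. Proof. exact: (sys i).2. Qed.
Lemma z0 i : z i != 0. Proof. by apply/eqP => e; have := mu0; rewrite -(zzt i) e mul0r eqxx. Qed.
Lemma zt0 i : zt i != 0. Proof. by apply/eqP => e; have := mu0; rewrite -(zzt i) e mulr0 eqxx. Qed.

Let ab (b : bool) := if b then X h else X h'.
Let zz (b : bool) := if b then z else zt.
Local Notation x := (sroot ab zz).
Local Notation wt := (@sweight C n).
Local Notation I := (bool * 'I_n.+1)%type.

Let xt i : x (true, lift ord0 i) = z i. Proof. by rewrite /sroot /= liftK. Qed.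
Let xf i : x (false, lift ord0 i) = zt i. Proof. by rewrite /sroot /= liftK. Qed.
Let xt0 : x (true, ord0) = X h. Proof. by rewrite /sroot /= unlift_none. Qed.
Let xf0 : x (false, ord0) = X h'. Proof. by rewrite /sroot /= unlift_none. Qed.
Lemma two0 : (2 : C) != 0. Proof. by rewrite pnatr_eq0. Qed.

Lemma moments j : (j <= n)%N -> \sum_(p : I) wt p * x p ^+ j = 0.
Proof.
case: j => [_|j jn]; rewrite (sroot_powers ab zz two0) /=; first by rewrite !expr0 subrr mul0r subrr addr0.
by have [-> _] := sys (Ordinal jn); rewrite /=; field.
Qed.

Lemma x_neq0 p : x p != 0.
Proof.
case: p => b i; rewrite /sroot /=; case: (unlift ord0 i) => [j|]; case: b; rewrite /ab /zz /=.
- exact: z0.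
- exact: zt0.
- by apply: (Xw_neq0 tau); exact: not_L_h.
by apply: (Xw_neq0 tau); exact: not_L_h'.
Qed.

Lemma x_inv (b : bool) i : (x (b, i))^-1 = x (~~ b, i) / mu.
Proof.
have e : x (b, i) * x (~~ b, i) = mu.
 rewrite /sroot /=; case: (unlift ord0 i) => [j|]; case: b; rewrite /ab /zz /= ?zzt//.
 - by rewrite mulrC zzt. by rewrite mulrC.
rewrite -e; have := x_neq0 (b, i); have := x_neq0 (~~ b, i); move: (x _) (x _) => a c a0 c0; field.
by rewrite a0 c0.
Qed.

(** The involution x -> mu/x of the roots changes the sign of the weights, so the inverse moments
    are multiples of the moments of order at most n. *)
Lemma inv_moments j : (j < n)%N -> \sum_(p : I) wt p * (x p)^-1 ^+ j.+1 = 0.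
Proof.
move=> jn; have inv2 : involutive (fun p : I => (~~ p.1, p.2)) by move=> [b i] /=; rewrite negbK.
rewrite (reindex_inj (inv_inj inv2)) /=.
transitivity (\sum_(p : I) - (mu ^- j.+1) * (wt p * x p ^+ j.+1)); last by rewrite -mulr_sumr moments ?mulr0.
apply: eq_bigr => -[b i] _ /=; rewrite x_inv negbK expr_div_n.
have -> : wt (~~ b, i) = - wt (b, i) by rewrite /sweight /=; case: b => /=; rewrite ?mulN1r ?mul1r ?opprK.
by move: (mu ^- _) (_ ^+ _) (wt _) => u v t; ring.
Qed.

(** The inverse moments make [wsum] divisible by 'X^n, and the moments bound its size by n + 1. *)
Lemma wsum_monomial : exists kap, wsum x wt = kap *: 'X^n.
Proof.
have [q E] := wsum_low x_neq0 inv_moments.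
have := wsum_size moments; rewrite card_sroot E.
have -> : (2 * n + 2 - n.+1 = n.+1)%N by lia.
have [->|q0] := eqVneq q 0; first by exists 0; rewrite mulr0 scale0r.
rewrite size_monicM ?monicXn// size_polyXn /= => sq.
have /size1_polyC -> : (size q <= 1)%N by move: sq; rewrite -addn1 leq_add2l.
by exists q`_0; rewrite mulrC mul_polyC.
Qed.

Let A w := \prod_(i <- index_enum 'I_n) (X w - z i).
Let B w := \prod_(i <- index_enum 'I_n) (X w - zt i).
Let Rp w := \prod_(p <- index_enum I) (X w - x p).

Lemma RpE w : Rp w = (rprod x).[X w].
Proof. by rewrite /Rp /rprod horner_prod; apply: eq_bigr => p _; rewrite hornerXsubC. Qed.

Variable lam : C.
Hypothesis lam0 : lam != 0.
Let F w := lam * (S w * (A w * (B w)^-1)).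

Lemma XB_ex y v : exists k, ord (fun w => X w - y) v k.
Proof. by rewrite (XwBE w1 w2); exact: (wpB_ex_ord (tau_double tau)). Qed.

Lemma prod_ex (J : finType) (y : J -> C) v : exists k, ord (fun w => \prod_(i <- index_enum J) (X w - y i)) v k.
Proof.
have /choice[e he] : forall i, exists k, ord (fun w => X w - y i) v k by move=> i; exact: XB_ex.
by exists (\sum_(i <- index_enum J) e i); exact: ord_prod.
Qed.

Lemma F_ord v (a b c : int) : ord S v a -> ord A v b -> ord B v c -> ord F v (a + (b - c)).
Proof.
by move=> oS oA oB; have := ordM (holo_ord (holo_cst lam v) lam0) (ordM oS (ordM oA (ordV oB))); rewrite add0r.
Qed.

Lemma F_ex v : exists k, ord F v k.
Proof.
have [a oS] := sqroot_ex tau v; have [b oA] := prod_ex z v; have [c oB] := prod_ex zt v.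
by eexists; exact: F_ord oS oA oB.
Qed.

Definition generic w := [/\ ~ L w, ~ L' (w - h), ~ L' (w - h'), forall p, X w != x p & S w != 0].

Lemma near_generic v : nearp v generic.
Proof.
have [a oS] := sqroot_ex tau v; have [b oR] := prod_ex x v.
have n1 := nearp_and (lat_near tau v) (nearp_and (near_off tau v h) (near_off tau v h')).
apply: nearpS2 n1 (nearp_and (ord_neq0 oS) (ord_neq0 oR)) => w [a1 [a2 a3]] [s0 r0]; split=> // p.
by rewrite -subr_eq0; have := prodf_seq_neq0 (index_enum I) xpredT (fun p => X w - x p); rewrite r0 => /esym/allP/(_ p); rewrite mem_index_enum; apply.
Qed.
Lemma gen_z w i : generic w -> X w - z i != 0.
Proof. by move=> [_ _ _ hx _]; rewrite subr_eq0 -xt. Qed.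
Lemma gen_zt w i : generic w -> X w - zt i != 0.
Proof. by move=> [_ _ _ hx _]; rewrite subr_eq0 -xf. Qed.
Lemma gen_h w : generic w -> X w - X h != 0.
Proof. by move=> [_ _ _ hx _]; rewrite subr_eq0 -xt0. Qed.
Lemma gen_h' w : generic w -> X w - X h' != 0.
Proof. by move=> [_ _ _ hx _]; rewrite subr_eq0 -xf0. Qed.
Lemma gen_A w : generic w -> A w != 0.
Proof. by move=> g; rewrite /A prodf_seq_neq0; apply/allP => i _; exact: gen_z. Qed.
Lemma gen_B w : generic w -> B w != 0.
Proof. by move=> g; rewrite /B prodf_seq_neq0; apply/allP => i _; exact: gen_zt. Qed.

Lemma dS v : nearp v (fun w => cdiff S w (S w * (dX w * (2^-1 * (X w - X h)^-1 - 2^-1 * (X w - X h')^-1)))).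
Proof.
have [kap hk] := sqroot_sqr tau.
apply: nearpS2 (near_generic v) (nearp_open (hk v)) => w g E.
have [Lw n1 n2 hx s0] := g; have a0 := gen_h g; have b0 := gen_h' g.
have hS := cdiff_ex (holoW (sqroot_holo tau (LL Lw) n2)); have hX := cdiff_ex (holoW (Xw_holo tau (LL Lw))).
have d1 := cdiffM (cdiffX 2 hS) (cdiffB hX (cdiff_cst (X h') w)).
have d2 := cdiffM (cdiff_cst kap w) (cdiffB hX (cdiff_cst (X h) w)).
have e1 := cdiff_uniq (cdiff_ext E d1) d2.
have e0 := nearc_at E.
suff -> : S w * (dX w * (2^-1 * (X w - X h)^-1 - 2^-1 * (X w - X h')^-1)) = cderiv S w by [].
move: e1 e0; rewrite /= !subr0 mul0r add0r expr1; move: a0 b0 s0.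
move: (cderiv S w) (S w) (X w - X h) (X w - X h') (dX w) => s' s a b d a0 b0 s0 e1 e0.
have ek : kap = s ^+ 2 * b / a by rewrite e0 mulfK.
rewrite ek in e1; have : s' = (s ^+ 2 * b / a * d - s ^+ 2 * d) / (2 * s * b).
 rewrite -e1; field; by rewrite b0 s0.
by move=> ->; field; rewrite a0 b0 s0.
Qed.

Section Wsum.
Variable kap : C.
Hypothesis kE : wsum x wt = kap *: 'X^n.

(** The logarithmic derivative of F is X' times the sum of weight/(X - x) over all roots, the halves
    coming from the square root S. By [wsum_eval] this sum is wsum/rprod at X, and [kE] makes the
    numerator a monomial. *)
Lemma dF v : nearp v (fun w => cdiff F w (F w * (dX w * (kap * X w ^+ n * (Rp w)^-1)))).
Proof.
apply: nearpS2 (near_generic v) (dS v) => w g sd; have [Lw n1 n2 hx s0] := g.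
have hX := cdiff_ex (holoW (Xw_holo tau (LL Lw))).
have A0 := gen_A g; have B0 := gen_B g.
have nz i : X w != z i by rewrite -subr_eq0 gen_z.
have nzt i : X w != zt i by rewrite -subr_eq0 gen_zt.
have dA := cdiff_prodB (index_enum 'I_n) hX nz.
have dB := cdiff_prodB (index_enum 'I_n) hX nzt.
have D := cdiffM (cdiff_cst lam w) (cdiffM sd (cdiffM dA (cdiffV B0 dB))).
have R0 : Rp w != 0 by rewrite /Rp prodf_seq_neq0; apply/allP => p _; rewrite /= subr_eq0 hx.
have W : kap * X w ^+ n * (Rp w)^-1 = (2^-1 * (X w - X h)^-1 + \sum_(i <- index_enum 'I_n) (X w - z i)^-1) +
  (- (2^-1 * (X w - X h')^-1) + - \sum_(i <- index_enum 'I_n) (X w - zt i)^-1).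
 have := wsum_eval wt hx; rewrite kE hornerZ hornerXn -RpE => ->. rewrite mulrAC mulfV// mul1r big_sroot.
 pose add := fun u v : C => u + v; refine (congr2 add (congr2 add _ _) (congr2 add _ _)).
 - by rewrite /sweight /sroot /= unlift_none /= mul1r.
 - by apply: eq_bigr => i _; rewrite /sweight /sroot /= liftK /= !mul1r.
 - by rewrite /sweight /sroot /= unlift_none /= mulN1r mulNr.
 by rewrite -sumrN; apply: eq_bigr => i _; rewrite /sweight /sroot /= liftK /= mulr1 mulN1r.
have -> : F w * (dX w * (kap * X w ^+ n * (Rp w)^-1)) =
  0 * (S w * (A w * (B w)^-1)) + lam * (S w * (dX w * (2^-1 * (X w - X h)^-1 - 2^-1 * (X w - X h')^-1)) * (A w * (B w)^-1) +
   S w * (A w * (dX w * \sum_(i <- index_enum 'I_n) (X w - z i)^-1) * (B w)^-1 +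
    A w * (- (B w * (dX w * \sum_(i <- index_enum 'I_n) (X w - zt i)^-1)) / B w ^+ 2))); last exact D.
rewrite W /F; move: B0; move: (A w) (B w) (S w) (dX w) (X w - X h)^-1 (X w - X h')^-1 (\sum_(i <- _) _) (\sum_(i <- _) _) => *.
by field.
Qed.

Lemma F_w1 v : nearp v (fun w => F (w + w1) = - F w).
Proof.
apply: nearpS (sqroot_w1 tau v) => w e; rewrite /F e /A /B (Xw_per tau w (lat_w1 w1 (2 * w2))); ring.
Qed.
Lemma F_even w : F (- w) = F w.
Proof. by rewrite /F /A /B (sqroot_even tau) (Xw_even tau). Qed.

(** F is even and changes sign under w1 = 2h, so it is odd about h and its order there cannot be 0.
    Thus F is nonconstant before the roots are known to be distinct, which gives [kap0]. *)
Lemma F_odd_h : exists2 k, k != 0 & ord F h k.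
Proof.
have [k o] := F_ex h; exists k => //; apply/eqP => k0.
have hs : nearp h (fun w => F (h + h - w) = -1 * F w).
 apply: nearpS (nearp_opp (F_w1 (- h))) => w e. have -> : h + h - w = - w + w1 by field. by rewrite e F_even mulN1r.
have := ord_parity o hs; rewrite k0 expr0z => /eqP.
by rewrite eq_sym -subr_eq0 opprK -(natrD _ 1 1) pnatr_eq0.
Qed.

Lemma kap0 : kap != 0.
Proof.
have [k k0 o] := F_odd_h; apply/eqP => e; have od := ord_deriv o k0.
apply: nearp_false (dF h) (ord_neq0 od) => w /cdiff_cderiv ->.
by rewrite e !mul0r !mulr0 eqxx.
Qed.

(** If two roots coincided, every term of [wsum] would vanish at the common value x, whereas kap x^n
    is nonzero. Distinctness of the roots is a consequence of the system. *)
Lemma x_inj : injective x.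
Proof.
move=> p q E; apply/eqP/negPn/negP => pq; have : (wsum x wt).[x p] = 0.
 rewrite /wsum horner_sum big1// => i _; rewrite hornerZ /rprod' horner_prod. have [ip|ip] := eqVneq i p.
  by rewrite (bigD1 q) /= ?ip 1?eq_sym// hornerXsubC -E subrr mul0r mulr0.
 by rewrite (bigD1 p) 1?eq_sym//= hornerXsubC subrr mul0r mulr0.
by rewrite kE hornerZ hornerXn => /eqP; rewrite mulf_eq0 (negbTE kap0) /= expf_eq0 (negbTE (x_neq0 p)) andbF.
Qed.

(** Off L the only ramification points of X are w1/2 and w1/2 + w2 modulo L', where e is 2;
    elsewhere e is 1. *)
Lemma X_orders v : ~ L v -> exists e : int, [/\ ord dX v (e - 1),
 forall y, ord (fun w => X w - y) v (if X v == y then e else 0) & e = 1 \/ (X v = X h \/ X v = X h')].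
Proof.
move=> Lv; have Lv' := LL Lv; have off y : X v != y -> ord (fun w => X w - y) v 0 := fun hy => XwB_ord0 tau Lv' hy.
have fin (e : int) : e != 0 -> ord (fun w => X w - X v) v e -> e = 1 \/ (X v = X h \/ X v = X h') ->
  exists e : int, [/\ ord dX v (e - 1), forall y, ord (fun w => X w - y) v (if X v == y then e else 0) &
  e = 1 \/ (X v = X h \/ X v = X h')].
 move=> e0 o hc; exists e; split=> //; first exact (dX_ord tau o e0).
 by move=> y; case: eqP => [<-|/eqP] //; exact: off.
have [L2|L2] := pselect (L' (2 * v)); last by apply: (fin 1) => //; [exact (XwB_ord1 tau Lv' L2)|left].
apply: (fin 2) => //; first by apply: (XwB_half tau) => //; rewrite subrr; exact: lat0.
right; case: (half_cases (conj L2 Lv' : half w1 (2 * w2) v)) => hc.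
- by left; apply: (X_at tau).
- by case: Lv; apply/lat_double; right; move: hc; have -> : 2 * w2 / 2 = w2 by field.
right; rewrite -(Xw_even tau h'); apply: (X_at tau); move: hc.
by have -> : (- w1 - 2 * w2) / 2 = - h' by field.
Qed.

(** By [x_inj] at most one root equals X v, so only one of S, A and B contributes to the order k of
    F: k is 0 off the roots and 1 or -1 at them. By [dF] the derivative has order k + (e - 1), minus
    e at a root, that is 0 unless v is a simple pole. *)
Lemma main_orders v : ~ L v -> exists2 e : int, ord F v e & e = -1 \/ ord (cderiv F) v 0.
Proof.
move=> Lv; have [e [oX oB hc]] := X_orders Lv.
pose sg (J : finType) (y : J -> C) : int := \sum_(i <- index_enum J) (if X v == y i then e else 0).
have sg0 (J : finType) (y : J -> C) : (forall i, X v != y i) -> sg J y = 0.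
 by move=> hy; rewrite /sg big1// => i _; rewrite (negbTE (hy i)).
have sg1 (J : finType) (y : J -> C) j : X v = y j -> (forall i, i != j -> X v != y i) -> sg J y = e.
 move=> yj hy; rewrite /sg (bigD1 j)//= {1}yj eqxx big1 ?addr0// => i ij; by rewrite (negbTE (hy i ij)).
have oA : ord A v (sg _ z) by apply: ord_prod => i; exact: oB.
have oBB : ord B v (sg _ zt) by apply: ord_prod => i; exact: oB.
have oR : ord Rp v (sg _ x) by apply: ord_prod => p; exact: oB.
have oXn : ord (fun w => X w ^+ n) v 0.
 by have := ordX n (Xw_neq0_ord tau Lv); rewrite mul0r.
have dfin k : ord F v k -> ord (cderiv F) v (k + (e - 1 - sg _ x)).
 move=> oF; have := ordM oF (ordM oX (ordM (ordM (holo_ord (holo_cst kap v) kap0) oXn) (ordV oR))).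
 rewrite !add0r addrA => o; have := ord_ext _ o; rewrite -addrA; apply.
 by apply: nearpS (dF v) => w /cdiff_cderiv ->.
have [[p hp]|np] := pselect (exists p, X v = x p); last first.
 have nx p : X v != x p by apply/eqP => hp; apply: np; exists p. have e1 : e = 1.
  by case: hc => // -[hc|hc]; [have := nx (true, ord0); rewrite xt0|have := nx (false, ord0); rewrite xf0]; rewrite hc eqxx.
 have oS : ord S v 0.
  apply: (sqroot_ord0 tau) => /(X_at tau) hv; [have := nx (true, ord0); rewrite xt0|have := nx (false, ord0); rewrite xf0];
   by rewrite hv eqxx.
 have oF := F_ord oS oA oBB; rewrite !sg0 in oF; [|by move=> i; rewrite -xf|by move=> i; rewrite -xt].
 exists 0; first exact: oF. by right; have := dfin 0 oF; rewrite sg0// e1.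
have ux q : q != p -> X v != x q.
 by apply: contraNN => /eqP hq; apply/eqP/x_inj; rewrite -hq.
have sx : sg _ x = e by apply: (sg1 _ _ p).
have dfin1 k : ord F v k -> ord (cderiv F) v (k - 1).
 by move=> /dfin; rewrite sx addrAC subrr sub0r.
have nz i : (true, lift ord0 i) != p -> X v != z i by move=> /ux; rewrite xt.
have nzt i : (false, lift ord0 i) != p -> X v != zt i by move=> /ux; rewrite xf.
have nh : (true, ord0) != p -> ~ L' (v - h).
 by move=> /ux; rewrite xt0 => /eqP a /(X_at tau) b; apply: a.
have nh' : (false, ord0) != p -> ~ L' (v - h').
 by move=> /ux; rewrite xf0 => /eqP a /(X_at tau) b; apply: a.
have neq (b b' : bool) (i i' : 'I_n.+1) : b != b' -> (b, i) != (b', i') by move=> bb; apply: contra bb => /eqP[-> _].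
have neq2 (b : bool) (i i' : 'I_n.+1) : i != i' -> (b, i) != (b, i') by move=> ii; apply: contra ii => /eqP[->].
have e1 : (true, ord0) != p -> (false, ord0) != p -> e = 1.
 move=> /ux; rewrite xt0 => /eqP a /ux; rewrite xf0 => /eqP b; by case: hc => // -[].
move: hp nz nzt nh nh' e1 ux sx; case: p => b i; case: (unliftP ord0 i) => [j ->|->]; case: b => hp nz nzt nh nh' e1 ux sx.
- have oS := sqroot_ord0 tau (nh (neq2 _ _ _ (neq_lift ord0 j))) (nh' (neq false true _ _ isT)).
 have sA : sg _ z = e.
  apply: (sg1 _ _ j); [by rewrite -xt|move=> i' ij; apply: nz; apply: neq2]. by rewrite (inj_eq lift_inj).
 have sB : sg _ zt = 0 by apply: sg0 => i'; exact: nzt (neq false true _ _ isT).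
 have := F_ord oS oA oBB; rewrite sA sB (e1 (neq2 _ _ _ (neq_lift ord0 j)) (neq false true _ _ isT)) => oF.
 by exists 1 => //; right; exact: dfin1 oF.
- have oS := sqroot_ord0 tau (nh (neq true false _ _ isT)) (nh' (neq2 _ _ _ (neq_lift ord0 j))).
 have sB : sg _ zt = e.
  apply: (sg1 _ _ j); [by rewrite -xf|move=> i' ij; apply: nzt; apply: neq2]. by rewrite (inj_eq lift_inj).
 have sA : sg _ z = 0 by apply: sg0 => i'; exact: nz (neq true false _ _ isT).
 have := F_ord oS oA oBB; rewrite sA sB (e1 (neq true false _ _ isT) (neq2 _ _ _ (neq_lift ord0 j))) => oF.
 by exists (-1) => //; left.
- have Lh : L' (v - h) by apply: (X_h tau (LL Lv)); rewrite hp xt0.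
 have sA : sg _ z = 0 by apply: sg0 => i'; apply: nz; apply: neq2; rewrite eq_sym neq_lift.
 have sB : sg _ zt = 0 by apply: sg0 => i'; exact: nzt (neq false true _ _ isT).
 have := F_ord (sqroot_zero tau Lh) oA oBB; rewrite sA sB => oF. by exists 1 => //; right; exact: dfin1 oF.
have Lh : L' (v - h') by apply: (X_h' tau (LL Lv)); rewrite hp xf0.
have sA : sg _ z = 0 by apply: sg0 => i'; exact: nz (neq true false _ _ isT).
have sB : sg _ zt = 0 by apply: sg0 => i'; apply: nzt; apply: neq2; rewrite eq_sym neq_lift.
have := F_ord (sqroot_pole tau Lh) oA oBB; rewrite sA sB => oF.
by exists (-1) => //; left.
Qed.

Lemma orders_at0 : ord F 0 0 /\ ord (cderiv F) 0 (2 * n + 1)%N%:Z.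
Proof.
have l0 : L' 0 by exact: lat0.
have oS : ord S 0 0.
 apply: (sqroot_ord0 tau); rewrite sub0r latNE; [exact: (hL tau)|exact: (h'L tau)].
have oA : ord A 0 (\sum_(i <- index_enum 'I_n) (- 2)) by apply: ord_prod => i; exact (XwB_ord tau (z i) l0).
have oB : ord B 0 (\sum_(i <- index_enum 'I_n) (- 2)) by apply: ord_prod => i; exact (XwB_ord tau (zt i) l0).
have oR : ord Rp 0 (\sum_(p <- index_enum I) (- 2)) by apply: ord_prod => i; exact (XwB_ord tau (x i) l0).
have oF := F_ord oS oA oB; rewrite subrr addr0 in oF; split=> //.
have oX : ord dX 0 (- 2 - 1) by apply: (dX_ord tau (XwB_ord tau 0 l0)).
have := ordM oF (ordM oX (ordM (ordM (holo_ord (holo_cst kap 0) kap0) (ordX n (Xw_ord tau l0))) (ordV oR))).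
have -> : 0 + (- 2 - 1 + (0 + - 2 * n%:Z - \sum_(p <- index_enum I) (- 2))) = (2 * n + 1)%N%:Z :> int.
 by rewrite sumr_const card_sroot; exact: int_count.
by apply: ord_ext; apply: nearpS (dF 0) => w /cdiff_cderiv ->.
Qed.

Variable s0 : C.
Hypothesis hs0 : forall v, nearp v (fun w => S w * S (w + w2) = s0).
Hypothesis lamE : lam ^+ 2 * s0 * \prod_(i <- index_enum 'I_n) (z i / zt i) = 1.

(** Since X(w + w2) = mu/X(w) and z_i zt_i = mu, the shift exchanges A and B up to constants and
    powers of X, while S becomes s0/S. The hypothesis [lamE] says that the remaining constant is
    1. *)
Lemma F_w2 v : nearp v (fun w => F (w + w2) = (F w)^-1).
Proof.
apply: nearpS2 (near_generic v) (hs0 v) => w g hs; have [Lw n1 n2 hx sn0] := g.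
have A0 := gen_A g; have B0 := gen_B g; have X0 := Xw_neq0 tau Lw.
have Xs : X (w + w2) = mu / X w.
 have e : X w * X (w + w2) = mu by rewrite (Xw_shift tau Lw) -(Xw_shift tau not_L_h).
 by rewrite -e mulrAC mulfV// mul1r.
pose Pt := \prod_(i <- index_enum 'I_n) (- zt i / X w); pose r := \prod_(i <- index_enum 'I_n) (z i / zt i).
have Pt0 : Pt != 0.
 by rewrite prodf_seq_neq0; apply/allP => i _; rewrite /= mulf_neq0 ?invr_neq0 ?oppr_eq0 ?zt0.
have EA : A (w + w2) = r * Pt * B w.
 rewrite /A /r /Pt /B -!big_split; apply: eq_bigr => i _ /=; rewrite Xs -(zzt i).
 by have := zt0 i; move: X0; move: (X w) (z i) (zt i) => a b c a0 c0; field; rewrite a0 c0.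
have EB : B (w + w2) = Pt * A w.
 rewrite /A /Pt /B -!big_split; apply: eq_bigr => i _ /=; rewrite Xs -(zzt i).
 by move: X0; move: (X w) (z i) (zt i) => a b c a0; field.
have := lamE; rewrite -hs -/r /F EA EB; move: A0 B0 sn0 Pt0 lam0; clear EA EB.
move: (A w) (B w) (S w) (S (w + w2)) Pt r lam => a b s s' t q k a0 b0 s1 t0 k0 E.
have -> : k * (s' * (q * t * b * (t * a)^-1)) = (k ^+ 2 * (s * s') * q) * (k * (s * (a * b^-1)))^-1.
 by field; rewrite a0 b0 s1 t0 k0.
by rewrite E mul1r.
Qed.
Lemma F_neq0 v : nearp v (fun w => F w != 0).
Proof. by have [k o] := F_ex v; exact: ord_neq0 o. Qed.

Lemma F_2w1 v : nearp v (fun w => F (w + 2 * w1) = F w).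
Proof.
apply: nearpS2 (F_w1 v) (nearp_shift (F_w1 (v + w1))) => w e1 e2.
have -> : w + 2 * w1 = w + w1 + w1 by ring.
by rewrite e2 e1 opprK.
Qed.

Lemma F_2w2 v : nearp v (fun w => F (w + 2 * w2) = F w).
Proof.
apply: nearpS2 (F_w2 v) (nearp_shift (F_w2 (v + w2))) => w e1 e2.
have -> : w + 2 * w2 = w + w2 + w2 by ring.
by rewrite e2 e1 invrK.
Qed.

(** If c were omitted, 1/(F - c) would be regular with periods 2 w1 and 2 w2, hence constant, and so
    would F; but F changes sign under w1 and is not zero. *)
Lemma F_omits_none (f : C -> sphere R) c : (forall v, sval F v (f v)) -> exists v, f v = Some c.
Proof.
move=> sf; apply: contrapT => nx; have nc v : f v <> Some c by move=> e; apply: nx; exists v.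
have t2 : 0 < Im ((2 * w2) / (2 * w1)).
 by have -> : 2 * w2 / (2 * w1) = w2 / w1 by field; rewrite (w1_neq0 tau).
have rG v : reg (fun w => (F w - c)^-1) v.
 have := sf v; case E : (f v) => [b|] [g [hg gv Eg]].
  exists (fun w => (g w - c)^-1); last by apply: nearpS Eg => w ->.
  apply: holoV (holoB hg (holo_cst c v)) _; rewrite gv subr_eq0; apply/eqP => bc. by apply: (nc v); rewrite E bc.
 exists (fun w => g w * (1 - c * g w)^-1).
  apply: holoM hg (holoV (holoB (holo_cst 1 v) (holoM (holo_cst c v) hg)) _). by rewrite gv mulr0 subr0 oner_neq0.
 apply: nearpS Eg => w [-> n0]; have g0 : g w != 0 by rewrite -invr_eq0.
 have -> : (g w)^-1 - c = (1 - c * g w) / g w by field. by rewrite invf_div.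
have [||d hd] := @liouville_nper _ _ t2 (fun w => (F w - c)^-1) rG.
- by move=> v; apply: nearpS (F_2w1 v) => w ->.
- by move=> v; apply: nearpS (F_2w2 v) => w ->.
have hF v : nearp v (fun w => F w = c + d^-1).
 by apply: nearpS (hd v) => w <-; rewrite invrK subrKC.
apply: nearp_false (nearp_and (hF 0) (nearp_shift (hF (0 + w1)))) (nearp_and (F_w1 0) (F_neq0 0)) => w [e1 e2] [e3 /eqP].
apply; move: e3; rewrite e2 e1 => /eqP; rewrite -subr_eq0 opprK -mulr2n mulrn_eq0 /= => /eqP //.
Qed.

Lemma converse_of_scale : exists (u : C -> R) (f : C -> sphere R) (p : 'I_n -> C),
 [/\ solution w1 w2 (4 * pi * (2 * n + 1)%:R) u, developing_map L u f, type_I L f, even_map f &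
  simple_zeros_poles w1 w2 f p /\ forall i, z i = X (p i) /\ zt i = X (p i + w2)].
Proof.
have [f [mf sf nf]] := completion F_ex.
have n1 v : f (v + w1) = sph_opp (f v).
 apply: (sval_uniq (sval_shift (sf (v + w1)))); apply: sval_ext (sval_opp (sf v)). by apply: nearpS (F_w1 v) => w ->.
have n2 v : f (v + w2) = sph_inv (f v).
 apply: (sval_uniq (sval_shift (sf (v + w2)))); apply: sval_ext (sval_inv (sf v) (F_neq0 v)).
 by apply: nearpS (F_w2 v) => w ->.
have ev v : f (- v) = f v.
 have := sval_opp_arg (sf (- v)).
 by move=> hv; apply: (sval_uniq _ (sf v)); apply: sval_ext hv; apply: nearpT => w; exact: F_even.
have finF v : nearp v (fun w => F w = fin f w) by apply: nearpS (nf v) => w; rewrite /fin => ->.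
have dfinF v : nearp v (fun w => cderiv F w = cderiv (fin f) w).
 apply: nearpS2 (nearp_open (finF v)) (dF v) => w E d.
 by rewrite (cdiff_cderiv d); apply/esym/cdiff_cderiv; exact: cdiff_ext E d.
have per := density_normalized mf (conj n1 n2).
have some_pos (v b : C) : ~ L v -> f v = Some b -> 0 < density f v.
 move=> Lv E; have [e oF he] := main_orders Lv. have [[E' hF _]|[]] := sph_local v mf; last by rewrite E.
 have od : ord (cderiv (fin f)) v 0.
  case: he => [e1|o]; last exact: ord_ext (dfinF v) o. have oF' := ord_ext (finF v) oF; rewrite e1 in oF'.
  have := ordge_ord_le ((ordge0 (fin f) v).2 (holo_reg hF)) oF'; by [].
 have d0 := holo_ord0_neq0 (holo_deriv hF) od. have t0 : 0 < 1 + nm (fin f v) ^+ 2 by rewrite ltr_wpDr ?sqr_ge0.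
 by rewrite (density_someE E') divr_gt0 ?mulr_gt0 ?exprn_gt0 ?nm_gt0.
have df : forall v, ~ L v -> 0 < density f v.
 move=> v Lv; case E : (f v) => [b|]; first exact: some_pos E.
 rewrite -(per v w2 (lat_w2 w1 w2)); apply: (@some_pos _ 0); last by rewrite n2 E. by rewrite latDr//; exact: lat_w2.
have [oF0 od0] := orders_at0.
have f0 : f 0 <> None.
 move=> E; have := sf 0; rewrite E => -[g [hg g0 Eg]].
 have oV := ordV oF0; have r : nearp 0 (fun w => (F w)^-1 = g w) by apply: nearpS Eg => w [-> _]; rewrite invrK.
 have := ordge_ord_le (holo_ordge1 hg g0) (ord_ext r oV); by [].
have om := ord_ext (dfinF 0) od0.
have [u su hu] := liouville_solution tau mf (fun v l _ Ll => per v l Ll) df f0 om.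
have value v : ~ L v -> (forall i, X v != zt i) -> X v != X h' -> A v = 0 \/ S v = 0 -> f v = Some 0.
 move=> Lv hz hh' h0; have Lv' := LL Lv; have hX := Xw_holo tau Lv'.
 have nh' : ~ L' (v - h') by move=> /(X_at tau) e; move: hh'; rewrite e eqxx.
 have hP (y : 'I_n -> C) : holo (fun w => \prod_(i <- index_enum 'I_n) (X w - y i)) v.
  elim: (index_enum _) => [|i r ih].
   by apply: holo_ext (holo_cst 1 v); apply: nearcT => w; rewrite big_nil.
  by apply: holo_ext (holoM (holoB hX (holo_cst (y i) v)) ih); apply: nearcT => w; rewrite big_cons.
 have B0 : B v != 0 by rewrite /B prodf_seq_neq0; apply/allP => i _; rewrite /= subr_eq0.
 apply: (sval_uniq (sf v)); exists F; split; last exact: nearpT.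
  exact: holoM (holo_cst lam v) (holoM (sqroot_holo tau Lv' nh') (holoM (hP z) (holoV (hP zt) B0))).
 by rewrite /F; case: h0 => ->; rewrite ?(mul0r, mulr0).
have /choice[p hp] : forall i, exists v, ~ L' v /\ X v = z i by move=> i; have [v a b] := Xw_surj tau (z i); exists v.
have Lp i : ~ L (p i).
 move=> /lat_double[|Lw]; first exact: (hp i).1. have := z0 i; rewrite -(hp i).2 (X_at tau Lw) Xw_w2 eqxx; by [].
have fp i : f (p i) = Some 0.
 apply: (value _ (Lp i)).
 - by move=> j; rewrite (hp i).2 -xt -xf; apply/eqP => /x_inj.
 - by rewrite (hp i).2 -xt -xf0; apply/eqP => /x_inj.
 left; apply/eqP; rewrite /A prodf_seq_eq0; apply/hasP; exists i; first exact: mem_index_enum.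
 by rewrite /= (hp i).2 subrr.
have fh : f h = Some 0.
 apply: (value _ not_L_h).
 - by move=> j; rewrite -xt0 -xf; apply/eqP => /x_inj.
 - exact: X_hh' tau. right; by rewrite /sqroot subrr mul0r.
have zero v : ~ L v -> f v = Some 0 -> simple_zero f v by exact: (simple_zero_of mf df).
have pole v : ~ L v -> f v = Some 0 -> simple_pole f (v + w2).
 move=> Lv E; apply: (simple_pole_of mf df); last by rewrite n2 E /= eqxx. by rewrite latDr//; exact: lat_w2.
have LpN i : ~ L (- p i) by rewrite latNE.
exists u, f, p; split=> //.
- by split=> // v Lv; split; [exact: df|exact: hu].
- apply: (type_I_normalized (conj n1 n2)) => -[b|]; first exact: F_omits_none sf.
 by exists (h + w2); rewrite n2 fh /= eqxx.
split; last first.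
 move=> i; rewrite (hp i).2; split=> //; have e : X (p i) * X (p i + w2) = mu by rewrite (Xw_shift tau (Lp i)) -(Xw_shift tau not_L_h).
 by apply: (mulfI (z0 i)); rewrite zzt -e (hp i).2.
split.
- exact: zero not_L_h fh.
- by move=> i; split; apply: zero; rewrite ?ev.
- exact: pole not_L_h fh.
by move=> i; split; apply: pole; rewrite ?ev.
Qed.
End Wsum.
End Converse.
Lemma converse (w1 w2 : C) (n : nat) (z zt : 'I_n -> C) :
 0 < Im (w2 / w1) ->
 polynomial_system (Xw w1 w2 (w1 / 2) * Xw w1 w2 (w1 / 2 + w2))
  (fun j : 'I_n => (Xw w1 w2 (w1 / 2 + w2) ^+ j.+1 - Xw w1 w2 (w1 / 2) ^+ j.+1) / 2) z zt ->
 exists (u : C -> R) (f : C -> sphere R) (p : 'I_n -> C),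
 [/\ solution w1 w2 (4 * pi * (2 * n + 1)%:R) u, developing_map (lattice w1 w2) u f,
  type_I (lattice w1 w2) f, even_map f &
  simple_zeros_poles w1 w2 f p /\ forall i, z i = Xw w1 w2 (p i) /\ zt i = Xw w1 w2 (p i + w2)].
Proof.
move=> tau sys; have [kap kE] := wsum_monomial tau sys; have [s0 s00 hs0] := sqroot_mul tau.
pose P := \prod_(i <- index_enum 'I_n) (z i / zt i).
have P0 : P != 0.
 by rewrite prodf_seq_neq0; apply/allP => i _; rewrite /= mulf_neq0 ?invr_neq0 ?(z0 tau sys) ?(zt0 tau sys).
have q0 : s0 * P != 0 by rewrite mulf_neq0.
(* The scale lam demanded by [lamE]; the two square roots correspond to f and -f. *)
have E : sqrtC ((s0 * P)^-1) ^+ 2 * s0 * P = 1 by rewrite sqrtCK -mulrA mulVf.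
have lam0 : sqrtC ((s0 * P)^-1) != 0 by rewrite sqrtC_eq0 invr_eq0.
exact (converse_of_scale tau sys lam0 kE hs0 E).
Qed.

(** * Normalized developing maps of a given solution *)

Section NormalizedSolution.
Implicit Types (f : C -> sphere R) (u : C -> R).
Variables (w1 w2 : C) (tau : 0 < Im (w2 / w1)).
Local Notation L := (lattice w1 w2).

(* Tested against the constant 1, the equation computes the order of f' at 0. *)
Lemma normalized_order f u (n : nat) : solution w1 w2 (4 * pi * n%:R) u -> developing_map L u f ->
 normalized w1 w2 f -> ord (cderiv (fin f)) 0 n%:Z.
Proof.
move=> su [mf hu] nf; have df v : ~ L v -> 0 < density f v by move=> /hu [].
have [f0 _] := fin_at0 tau mf nf df; have [m om] := dfin_ord0_ex tau mf nf df.
have nn : f 0 <> None by rewrite f0.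
have pd : forall z l, ~ L z -> L l -> density f (z + l) = density f z.
 by move=> z l _ Ll; exact: density_normalized mf nf z l Ll.
have hd : forall v, ~ L v -> u v = ln (density f v) by move=> v /hu [].
by rewrite -(solution_mass tau mf pd df nn om su hd).
Qed.

Lemma developing_map_inv f u : developing_map L u f -> normalized w1 w2 f ->
 developing_map L u (@sph_inv R \o f) /\ normalized w1 w2 (@sph_inv R \o f).
Proof.
move=> [mf hu] [n1 n2]; split; last first.
 split=> z /=; last by rewrite n2. rewrite n1; case: (f z) => [b|]/=; last by rewrite oppr0.
 by rewrite oppr_eq0; case: (b == 0) => //=; rewrite invrN.
split=> [|z Lz]; last by rewrite density_inv//; exact: hu.
apply: (meromorphic_inv mf); have [_ [z fz]] := mf.
have [e|e] := pselect (f z = Some 0); last by exists z.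
by exists (z + w2); rewrite n2 e /= eqxx.
Qed.

Lemma solution_even f u (n : nat) : solution w1 w2 (4 * pi * n%:R) u -> developing_map L u f ->
 even_map f -> even_map u.
Proof.
move=> [pu _ _ _] [mf hu] ev z; have [Lz|Lz] := pselect (L z).
 have up y : L y -> u y = u 0 by move=> Ly; rewrite -[y in LHS]add0r pu. by rewrite !up// latNE.
have Lz' : ~ L (- z) by rewrite latNE.
by rewrite (hu _ Lz).2 (hu _ Lz').2 density_opp_arg.
Qed.

(** Evenness and the period w1 give f(w1/2) = f(-w1/2) = -f(w1/2), and only 0 and infinity are fixed
    by the sign change. *)
Lemma even_half_period f : normalized w1 w2 f -> even_map f -> f (w1 / 2) = Some 0 \/ f (w1 / 2) = None.
Proof.
move=> [n1 _] ev; have := n1 (- (w1 / 2)); have -> : - (w1 / 2) + w1 = w1 / 2 by field.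
rewrite ev; case: (f (w1 / 2)) => [b|]/=; last by right.
by move=> [/eqP]; rewrite -subr_eq0 opprK -mulr2n mulrn_eq0 /= => /eqP ->; left.
Qed.
End NormalizedSolution.
End Plane.

Theorem theorem0p4 (R : realType) (n : nat) :
  exists (mu : R[i] -> R[i] -> R[i] -> R[i] -> R[i])
         (c : R[i] -> R[i] -> R[i] -> R[i] -> 'I_n -> R[i]),
  forall w1 w2 : R[i], 0 < complex.Im (w2 / w1) ->
  let L := lattice w1 w2 in
  let rho : R := 4 * pi * (2 * n + 1)%:R in
  let w1' := w1 in
  let w2' := 2 * w2 in
  let w3' := - w1' - w2' in
  let L' := lattice w1' w2' in
  let e1 := wp L' (w1' / 2) in
  let e2 := wp L' (w2' / 2) in
  let e3 := wp L' (w3' / 2) in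
  let mu0 := mu e1 e3 (g2 L') (g3 L') in
  let c0 := c e1 e3 (g2 L') (g3 L') in
  (forall (u : R[i] -> R) (f : R[i] -> sphere R),
     solution w1 w2 rho u ->
     developing_map L u f -> type_I L f -> normalized w1 w2 f ->
     let g := zero_at_half_period w1 f in
     (* (1) *)
     (even_map u /\ even_map f) /\
     (* (2) *)
     ((exists p : 'I_n -> R[i], divisor_data w1 w2 g p) /\
      (forall p p' : 'I_n -> R[i],
         divisor_data w1 w2 g p -> divisor_data w1 w2 g p' ->
         exists s : {perm 'I_n}, forall i,
           L' (p' i - p (s i)) \/ L' (p' i + p (s i)))) /\
     (* (3) *)
     (forall p : 'I_n -> R[i], divisor_data w1 w2 g p ->
        polynomial_system mu0 c0
          (fun i => wp L' (p i) - e2) (fun i => wp L' (p i + w2) - e2))) /\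
  (* (4) *)
  (forall z zt : 'I_n -> R[i], polynomial_system mu0 c0 z zt ->
     exists (u : R[i] -> R) (f : R[i] -> sphere R) (p : 'I_n -> R[i]),
       solution w1 w2 rho u /\ developing_map L u f /\ type_I L f /\
       even_map f /\ simple_zeros_poles w1 w2 f p /\
       (forall i, z i = wp L' (p i) - e2 /\ zt i = wp L' (p i + w2) - e2)).
Proof.
(* As e1 + e2 + e3 = 0, X takes the values 2 e1 + e3 at w1/2 and 2 e3 + e1 at w1/2 + w2; mu is their
   product. The C_j express the vanishing of the weighted power sums, in which these two values have
   weights 1/2 and -1/2; the index j of 'I_n stands for the exponent j + 1. *)
exists (fun e1 e3 _ _ => (2 * e1 + e3) * (2 * e3 + e1)),
 (fun e1 e3 _ _ (j : 'I_n) => ((2 * e3 + e1) ^+ j.+1 - (2 * e1 + e3) ^+ j.+1) / 2).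
move=> w1 w2 tau L rho w1' w2' w3' L' e1 e2 e3 mu0 c0.
have a1E : Xw w1 w2 (w1 / 2) = 2 * e1 + e3 by exact: Xw_w1.
have a3E : Xw w1 w2 (w1 / 2 + w2) = 2 * e3 + e1 by exact: Xw_w3.
have muE : mu0 = Xw w1 w2 (w1 / 2) * Xw w1 w2 (w1 / 2 + w2) by rewrite a1E a3E.
have cE : c0 = fun j : 'I_n => (Xw w1 w2 (w1 / 2 + w2) ^+ j.+1 - Xw w1 w2 (w1 / 2) ^+ j.+1) / 2.
 by rewrite a1E a3E.
rewrite muE cE; split=> [u f su du _ nf g|z zt sys]; last first.
 have [u [f [p [su du tf ef [hp hz]]]]] := converse tau sys.
 by exists u, f, p; exact (conj su (conj du (conj tf (conj ef (conj hp hz))))).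
have of_ := normalized_order tau su du nf.
have ef : even_map f by exact: (normalized_even tau du.1 nf (fun z Lz => (du.2 z Lz).1) of_).
have [dg ng g1] : [/\ developing_map L u g, normalized w1 w2 g & g (w1 / 2) = Some 0].
 have [di ni] := developing_map_inv du nf.
 by rewrite /g /zero_at_half_period; have [E|E] := even_half_period nf ef; rewrite E /=; split=> //=; rewrite E.
have og := normalized_order tau su dg ng.
have pg z : ~ L z -> 0 < density g z by move=> /dg.2 [].
split; first by split=> //; exact: solution_even su du ef.
split; first split.
- exact: (divisor_exists tau dg.1 ng pg og g1).
- by move=> p p' hp hp'; exact: (divisor_unique ng hp hp').
by move=> p hp; exact: (divisor_powers tau dg.1 ng pg og g1 hp).
Qed.
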